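(* Assume that $Y_K(T)$ is a free $\mathcal{R}$-module of rank $r_T\ge1$, that for every $F\in\Omega(\mathcal{K}/K)$ the module $H^1_\Sigma(\mathcal{O}_{F,S(F)},T^*(1))$ is $O$-free and $H^0_\Sigma(F,T^*(1))=0$, that $\mathcal{K}$ contains $E(\mathfrak{n})$ for all $\mathfrak{n}\in\mathcal{N}$, and that $E\supseteq K(1)$. Then for every $\mathfrak{n}\in\mathcal{N}$ and every prime $\mathfrak{q}\mid\mathfrak{n}$ one has $$\varphi_\mathfrak{q}^\mathfrak{n}=\rho_\mathfrak{q}\circ\varphi_\mathfrak{q}^{\rm fs}+P_\mathfrak{q}({\rm Fr}_\mathfrak{q}^{-1})\cdot v_\mathfrak{q}\quad\text{in }\ \mathrm{Hom}_R\big(H^1_\Sigma(\mathcal{O}_{K,S_\mathfrak{n}},\mathcal{A}^*(1)),R\otimes I_\mathfrak{n}/I_\mathfrak{n}^2\big).$$ Here $\rho_\mathfrak{q}\circ\varphi^{\rm fs}_\mathfrak{q}$ is the composite $H^1_\Sigma(\mathcal{O}_{K,S_\mathfrak{n}},\mathcal{A}^*(1))\xrightarrow{\varphi_\mathfrak{q}^{\rm fs}}R\otimes G_\mathfrak{q}\xrightarrow{\rho_\mathfrak{q},\sim}R\otimes I_\mathfrak{q}/I_\mathfrak{q}^2\subset R\otimes I_\mathfrak{n}/I_\mathfrak{n}^2$, and $P_\mathfrak{q}({\rm Fr}_\mathfrak{q}^{-1})$ is regarded as an element of $\mathfrak{r}\otimes I_{\mathfrak{n}/\mathfrak{q}}/I_{\mathfrak{n}/\mathfrak{q}}^2\subset\mathfrak{r}\otimes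 I_\mathfrak{n}/I_\mathfrak{n}^2$.
   Context: Setting. For a module $X$ over a commutative ring $B$, $X^*=\mathrm{Hom}_B(X,B)$. $K$ is a number field with absolute Galois group $G_K$, $p$ an odd prime, $O$ the ring of integers of a finite extension $Q$ of $\mathbb{Q}_p$, $\mathcal{Q}$ a finite dimensional semisimple commutative $Q$-algebra, $\mathcal{R}$ a Gorenstein $O$-order in $\mathcal{Q}$ (an $O$-order that is a one-dimensional Gorenstein ring). $T$ is a free $\mathcal{R}$-module of finite rank with a continuous $\mathcal{R}$-linear $G_K$-action ramified at only finitely many places; $T^*(1)=\mathrm{Hom}_\mathcal{R}(T,\mathcal{R}\otimes_{\mathbb{Z}_p}\mathbb{Z}_p(1))$. $S$ is a finite set of places of $K$ containing all archimedean places ($S_\infty(K)$), all $p$-adic places and all places where $T$ ramifies. $\mathcal{K}/K$ is an abelian pro-$p$-extension in which all archimedean places split completely, $\Omega(\mathcal{K}/K)$ the set of finite extensions of $K$ in $\mathcal{K}$; $S(F)=S\cup\{\text{places ramifying in }F/K\}$. $\Sigma$ is a fixed finite set of places of $K$ disjoint from $S$ and unramified in $\mathcal{K}$. $Y_K(T):=\bigoplus_{v\in S_\infty(K)}H^0(K_v,T)$, of $\mathcal{R}$-rank $r_T$. Cohomology. $R\Gamma(\mathcal{O}_{F,U},N)$ is the continuous cochain complex of the Galois group over $F$ of the maximal extension unramified outside $U$; $R\Gamma_f(F_w,N)=R\Gamma(F_w^{\rm ur}/F_w,N)$; $R\Gamma_{/f}(F_w,N)$ is the cone of inflation $R\Gamma_f\to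 R\Gamma$; $R\Gamma_\Sigma(\mathcal{O}_{F,U},N)$ is the mapping fibre of localization $R\Gamma(\mathcal{O}_{F,U},N)\to\bigoplus_{w\in\Sigma_F}R\Gamma_f(F_w,N)$; $H^i_*$ is the corresponding cohomology; $H^0_\Sigma(F,\cdot)=\ker(H^0(F,\cdot)\to\bigoplus_{w\in\Sigma_F}H^0(F_w,\cdot))$. Finite coefficients. Fix $0\ne M\in O$; $\mathfrak{r}=\mathcal{R}/M\mathcal{R}$; $\overline M$ is the smallest power of $p$ divisible by $M$. Fix $E\in\Omega(\mathcal{K}/K)$ unramified outside $S$ over $K$; $\Gamma=\mathrm{Gal}(E/K)$, $A=T/MT$, $R=\mathfrak{r}[\Gamma]$, $\mathcal{A}=\mathfrak{r}[\Gamma]\otimes_\mathfrak{r}A$ with $\sigma\in G_K$ acting by $a\otimes t\mapsto a\bar\sigma^{-1}\otimes\sigma t$, $\mathcal{A}^*(1)=\mathrm{Hom}_R(\mathcal{A},R(1))$, $R(1)=R\otimes_{\mathbb Z_p}\mathbb Z_p(1)$. $K(1)$ is the maximal $p$-extension of $K$ in its Hilbert class field, $E_M=E(\mu_{\overline M},(\mathcal{O}_K^\times)^{1/\overline M})K(1)$. $\mathcal{P}$ (assumed non-empty) is the set of primes $\mathfrak{q}\notin S\cup\Sigma$ splitting completely in $E_M$ with $\mathcal{A}/({\rm Fr}_\mathfrak{q}-1)\mathcal{A}\simeq R$; $\mathcal{N}$ is the set of square-free products of primes in $\mathcal{P}$, $S_\mathfrak{n}=S\cup\{\mathfrak{q}\mid\mathfrak{n}\}$.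 $K(\mathfrak{q})$ is the maximal $p$-extension of $K$ in the ray class field modulo $\mathfrak{q}$, $K(\mathfrak{n})$ the composite of the $K(\mathfrak{q})$, $\mathfrak{q}\mid\mathfrak{n}$, $E(\mathfrak{n})=E\cdot K(\mathfrak{n})$, $G_\mathfrak{q}=\mathrm{Gal}(K(\mathfrak{q})_\mathfrak{q}/K_\mathfrak{q})$, $\mathcal{H}_\mathfrak{n}=\mathrm{Gal}(E(\mathfrak{n})/E)\simeq\prod_{\mathfrak{q}\mid\mathfrak{n}}G_\mathfrak{q}$. $I_\mathfrak{n}$ is the augmentation ideal of $\mathbb{Z}[\mathcal{H}_\mathfrak{n}]$, $I_\mathfrak{q}$ that of $\mathbb{Z}[G_\mathfrak{q}]$; $\rho_\mathfrak{q}:G_\mathfrak{q}\simeq I_\mathfrak{q}/I_\mathfrak{q}^2$, $\sigma\mapsto\sigma-1$. Unlabelled tensor products are over $\mathbb{Z}$. Local maps. For $\mathfrak{q}\in\mathcal{P}$, $P_\mathfrak{q}(x)=\det(1-{\rm Fr}_\mathfrak{q}^{-1}x\mid T)\in\mathcal{R}[x]$, which satisfies $P_\mathfrak{q}(1)\equiv0$ mod $M$; since $\mathfrak{q}$ splits completely in $E$, one may regard ${\rm Fr}_\mathfrak{q}\in\mathcal{H}_{\mathfrak{n}/\mathfrak{q}}$ for $\mathfrak{q}\mid\mathfrak{n}$. $Q_\mathfrak{q}(x)\in\mathfrak{r}[x]$ is the unique polynomial with $(x-1)Q_\mathfrak{q}(x)\equiv P_\mathfrak{q}(x)$ mod $M$;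 $Q_\mathfrak{q}({\rm Fr}_\mathfrak{q})$ induces $\mathcal{A}/({\rm Fr}_\mathfrak{q}-1)\mathcal{A}\xrightarrow{\sim}\mathcal{A}^{{\rm Fr}_\mathfrak{q}=1}$. The cup product $H^i(K_\mathfrak{q},\mathcal{A}^*(1))\times H^{2-i}(K_\mathfrak{q},\mathcal{A})\to H^2(K_\mathfrak{q},R(1))\simeq R$ induces the local duality isomorphisms. Fix an isomorphism $(\mathcal{A}^{{\rm Fr}_\mathfrak{q}=1})^*\simeq R$, and hence $H^2(K_\mathfrak{q},\mathcal{A}^*(1))\simeq(\mathcal{A}^{{\rm Fr}_\mathfrak{q}=1})^*\simeq R$. $v_\mathfrak{q}:H^1(K,\mathcal{A}^*(1))\to R$ is localization to $H^1_{/f}(K_\mathfrak{q},\mathcal{A}^*(1))$ followed by $H^1_{/f}(K_\mathfrak{q},\mathcal{A}^*(1))\simeq H^1_f(K_\mathfrak{q},\mathcal{A})^*\simeq(\mathcal{A}/({\rm Fr}_\mathfrak{q}-1)\mathcal{A})^*\simeq(\mathcal{A}^{{\rm Fr}_\mathfrak{q}=1})^*\simeq R$ (local duality; evaluation of cocycles at ${\rm Fr}_\mathfrak{q}$; dual of $-Q_\mathfrak{q}({\rm Fr}_\mathfrak{q})^{-1}$; fixed isomorphism). The finite-singular comparison map $H^1_f(K_\mathfrak{q},\mathcal{A}^*(1))\xrightarrow{\sim}H^1_{/f}(K_\mathfrak{q},\mathcal{A}^*(1))\otimes G_\mathfrak{q}$ is the composite of $H^1_f\simeq\mathcal{A}^*(1)/({\rm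 Fr}_\mathfrak{q}-1)$ (evaluation at ${\rm Fr}_\mathfrak{q}$), $Q_\mathfrak{q}({\rm Fr}_\mathfrak{q}^{-1}):\mathcal{A}^*(1)/({\rm Fr}_\mathfrak{q}-1)\simeq\mathcal{A}^*(1)^{{\rm Fr}_\mathfrak{q}=1}$ and the inverse of $H^1_{/f}\otimes G_\mathfrak{q}=\mathrm{Hom}(G_\mathfrak{q},\mathcal{A}^*(1)^{{\rm Fr}_\mathfrak{q}=1})\otimes G_\mathfrak{q}\simeq\mathcal{A}^*(1)^{{\rm Fr}_\mathfrak{q}=1}$, $f\otimes\sigma\mapsto f(\sigma)$. One has $H^1(K_\mathfrak{q},\mathcal{A}^*(1))=H^1_f\oplus H^1_{\rm tr}$ with $H^1_{\rm tr}=H^1(G_\mathfrak{q},\mathcal{A}^*(1)^{G_{K(\mathfrak{q})_\mathfrak{q}}})$; $\varphi^{\rm fs}_\mathfrak{q}:H^1(K,\mathcal{A}^*(1))\to R\otimes G_\mathfrak{q}$ is localization, projection to $H^1_f$ along $H^1_{\rm tr}$, the finite-singular map, then the isomorphism $H^1_{/f}\simeq R$ used for $v_\mathfrak{q}$. Bockstein map. Let $\mathcal{D}_\mathfrak{q}=\mathrm{Gal}(E(\mathfrak{n})_\mathfrak{q}/K_\mathfrak{q})\subset\mathcal{H}_\mathfrak{n}$ and $\mathcal{J}_\mathfrak{q}$ the augmentation ideal of $\mathbb{Z}[\mathcal{D}_\mathfrak{q}]$. $\varphi_\mathfrak{q}^\mathfrak{n}$ is localization $H^1_\Sigma(\mathcal{O}_{K,S_\mathfrak{n}},\mathcal{A}^*(1))\to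 H^1(K_\mathfrak{q},\mathcal{A}^*(1))$ followed by $$H^1(K_\mathfrak{q},\mathcal{A}^*(1))\xrightarrow{\delta}H^2(K_\mathfrak{q},\mathcal{A}^*(1)\otimes\mathcal{J}_\mathfrak{q})\to H^2(K_\mathfrak{q},\mathcal{A}^*(1)\otimes\mathcal{J}_\mathfrak{q}/\mathcal{J}_\mathfrak{q}^2)=H^2(K_\mathfrak{q},\mathcal{A}^*(1))\otimes\mathcal{J}_\mathfrak{q}/\mathcal{J}_\mathfrak{q}^2\simeq R\otimes\mathcal{J}_\mathfrak{q}/\mathcal{J}_\mathfrak{q}^2\to R\otimes I_\mathfrak{n}/I_\mathfrak{n}^2,$$ where $\delta$ is the connecting map of $0\to\mathcal{A}^*(1)\otimes\mathcal{J}_\mathfrak{q}\to\mathcal{A}^*(1)\otimes\mathbb{Z}[\mathcal{D}_\mathfrak{q}]\to\mathcal{A}^*(1)\to0$ ($\sigma\in G_{K_\mathfrak{q}}$ acting on $\mathbb{Z}[\mathcal{D}_\mathfrak{q}]$ as multiplication by $\bar\sigma^{-1}$, as in the convention for induced modules). *)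

(* Defs.v *)
From HB Require Import structures.
From mathcomp Require Import all_boot all_order all_algebra all_fingroup all_field.
From mathcomp Require Import all_classical generic_quotient ring_quotient.

Set Implicit Arguments.
Unset Strict Implicit.
Unset Printing Implicit Defensive.

Import Order.TTheory GRing.Theory Num.Theory.
Local Open Scope classical_set_scope.
Local Open Scope quotient_scope.
Local Open Scope ring_scope.

Record subm (R : pzRingType) (V : lmodType R) := Subm {
  subm_set :> V -> Prop;
  subm_0 : subm_set 0;
  subm_lin : forall a x y, subm_set x -> subm_set y -> subm_set (a *: x + y) }.

Section Submodule.
Context {R : pzRingType} {V : lmodType R} (S : subm V).

Definition subm_pred : {pred V} := fun x => `[< S x >].

Lemma subm_predP x : reflect (S x) (x \in subm_pred).
Proof. exact: asboolP. Qed.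

Fact subm_pred_closed : submod_closed subm_pred.
Proof.
split; first exact/subm_predP/subm_0.
by move=> a x y /subm_predP Sx /subm_predP Sy; apply/subm_predP/subm_lin.
Qed.
HB.instance Definition _ := GRing.isSubmodClosed.Build R V subm_pred subm_pred_closed.

Record submod := Submod { submod_val : V; submod_valP : submod_val \in subm_pred }.
HB.instance Definition _ := [isSub for submod_val].
HB.instance Definition _ := [Choice of submod by <:].
HB.instance Definition _ := [SubChoice_isSubLmodule of submod by <:].

Definition quotm := Quotient.quot subm_pred.
HB.instance Definition _ := GRing.Zmodule.on quotm.
HB.instance Definition _ := EqQuotient.on quotm.

Lemma quotm_eqP x y : \pi_quotm x = \pi_quotm y <-> S (x - y).
Proof.
have h := Quotient.idealrBE subm_pred x y.
by split=> [/eqP|/subm_predP]; [rewrite -h => /subm_predP | rewrite h => /eqP].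
Qed.

Fact quotm_piD x y : \pi_quotm (x + y) = \pi_quotm x + \pi_quotm y.
Proof. exact: (Quotient.pi_add subm_pred). Qed.

Definition quotm_scale (a : R) (x : quotm) : quotm := \pi_quotm (a *: repr x).

Lemma quotm_scale_pi a x : quotm_scale a (\pi_quotm x) = \pi_quotm (a *: x).
Proof.
apply/quotm_eqP; rewrite -scalerBr.
have h : S (repr (\pi_quotm x) - x) by apply/quotm_eqP; rewrite reprK.
by have := subm_lin a h (subm_0 S); rewrite addr0.
Qed.

Lemma quotm_ind (P : quotm -> Prop) : (forall x, P (\pi_quotm x)) -> forall v, P v.
Proof. by move=> h v; have := h (repr v); rewrite reprK. Qed.

Fact quotm_scaleA a b v : quotm_scale a (quotm_scale b v) = quotm_scale (a * b) v.
Proof. by elim/quotm_ind: v => v; rewrite !quotm_scale_pi scalerA. Qed.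
Fact quotm_scale1 : left_id 1 quotm_scale.
Proof. by elim/quotm_ind => v; rewrite quotm_scale_pi scale1r. Qed.
Fact quotm_scaleDr : right_distributive quotm_scale +%R.
Proof.
move=> a; elim/quotm_ind => u; elim/quotm_ind => v.
by rewrite -quotm_piD !quotm_scale_pi -quotm_piD scalerDr.
Qed.
Fact quotm_scaleDl v : {morph quotm_scale^~ v : a b / a + b}.
Proof.
by move=> a b; elim/quotm_ind: v => v; rewrite !quotm_scale_pi scalerDl quotm_piD.
Qed.
HB.instance Definition _ := GRing.Zmodule_isLmodule.Build R quotm
  quotm_scaleA quotm_scale1 quotm_scaleDr quotm_scaleDl.

End Submodule.

Section Subquotient.
Context {R : pzRingType} {V : lmodType R}.

Fact subm_preim_0 (Z B : subm V) : B (val (0 : submod Z)).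
Proof. by rewrite raddf0; apply: subm_0. Qed.
Fact subm_preim_lin (Z B : subm V) a (x y : submod Z) :
  B (val x) -> B (val y) -> B (val (a *: x + y)).
Proof. by move=> ? ?; rewrite linearP; apply: subm_lin. Qed.
Definition subm_preim (Z B : subm V) : subm (submod Z) :=
  @Subm R (submod Z) (fun x => B (val x)) (subm_preim_0 Z B) (@subm_preim_lin Z B).

(* The module [Z / (Z `&` B)]. *)
Definition subquot (Z B : subm V) := quotm (subm_preim Z B).
HB.instance Definition _ Z B := GRing.Lmodule.on (subquot Z B).

(* The class of [x]; it is meaningful for [x] in [Z], and is 0 otherwise. *)
Definition cls (Z B : subm V) (x : V) : subquot Z B :=
  \pi_(quotm (subm_preim Z B)) (insubd (0 : submod Z) x).
Definition rep (Z B : subm V) (c : subquot Z B) : V :=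
  val (repr (c : quotm (subm_preim Z B))).

End Subquotient.

Section Dual.
Context {R : comPzRingType}.

Definition is_linear (V W : lmodType R) (f : V -> W) : Prop :=
  forall a x y, f (a *: x + y) = a *: f x + f y.

Fact is_linear_0 (V W : lmodType R) : is_linear (0 : V -> W).
Proof. by move=> a x y; rewrite /GRing.zero /= scaler0 addr0. Qed.
Fact is_linear_lin (V W : lmodType R) b (f g : V -> W) :
  is_linear f -> is_linear g -> is_linear (b *: f + g).
Proof.
move=> hf hg a x y.
change (b *: f (a *: x + y) + g (a *: x + y) = a *: (b *: f x + g x) + (b *: f y + g y)).
by rewrite hf hg !scalerDr !scalerA (mulrC b a) addrACA.
Qed.

Definition dual (V : lmodType R) : lmodType R :=
  submod (Subm (@is_linear_0 V R^o) (@is_linear_lin V R^o)).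

Definition free_of_rank (V : lmodType R) (r : nat) : Prop :=
  exists f : {linear 'rV[R]_r -> V}, bijective f.

(* [V] is free as a module over the subring [O] of [R]. *)
Definition free_over (O : set R) (V : lmodType R) : Prop :=
  exists B : set V,
    (forall v, exists2 s : seq (R * V),
        (forall x, x \in s -> O x.1 /\ B x.2) & v = \sum_(x <- s) x.1 *: x.2) /\
    (forall (s : seq V) (c : V -> R),
        uniq s -> (forall x, x \in s -> B x /\ O (c x)) ->
        \sum_(x <- s) c x *: x = 0 -> forall x, x \in s -> c x = 0).

End Dual.

Section HomGroup.
Context {R : pzRingType} (G : zmodType) (V : lmodType R).

Definition is_additive (f : G -> V) : Prop := forall x y, f (x + y) = f x + f y.
Fact is_additive_0 : is_additive 0.
Proof. by move=> x y; rewrite /GRing.zero /= addr0. Qed.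
Fact is_additive_lin a f g : is_additive f -> is_additive g -> is_additive (a *: f + g).
Proof.
move=> hf hg x y.
change (a *: f (x + y) + g (x + y) = (a *: f x + g x) + (a *: f y + g y)).
by rewrite hf hg scalerDr addrACA.
Qed.

Definition homZ : lmodType R := submod (Subm is_additive_0 is_additive_lin).
End HomGroup.

(* The tensor product over [Z].  An element is represented by a list of pure
   tensors; two lists are identified when every biadditive map to an abelian
   group takes the same value on them. *)
Section Tensor.

Definition biadditive (U V W : zmodType) (f : U -> V -> W) : Prop :=
  (forall u u' v, f (u + u') v = f u v + f u' v) /\
  (forall u v v', f u (v + v') = f u v + f u v').

Definition teval (U V W : zmodType) (f : U -> V -> W) (s : seq (U * V)) : W :=
  \sum_(x <- s) f x.1 x.2.

Context (U V : zmodType).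

Definition tens_eq (s t : seq (U * V)) : bool :=
  `[< forall (W : zmodType) (f : U -> V -> W), biadditive f -> teval f s = teval f t >].

Fact tens_eq_refl : reflexive tens_eq.
Proof. by move=> s; apply/asboolP. Qed.
Fact tens_eq_sym : symmetric tens_eq.
Proof. by move=> s t; apply/asboolP/asboolP => h W f hf; rewrite h. Qed.
Fact tens_eq_trans : transitive tens_eq.
Proof.
by move=> t s u /asboolP h1 /asboolP h2; apply/asboolP=> W f hf; rewrite h1 ?h2.
Qed.
Canonical tens_equiv := EquivRel tens_eq tens_eq_refl tens_eq_sym tens_eq_trans.

Definition tens := {eq_quot tens_equiv}.
HB.instance Definition _ := Choice.on tens.
HB.instance Definition _ := EqQuotient.on tens.

Definition tmk (u : U) (v : V) : tens := \pi_tens [:: (u, v)].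

(* The additive extension of a biadditive map [f]. *)
Definition tlift (W : zmodType) (f : U -> V -> W) (x : tens) : W := teval f (repr x).

Lemma tens_eqP s t : \pi_tens s = \pi_tens t <->
  forall (W : zmodType) (f : U -> V -> W), biadditive f -> teval f s = teval f t.
Proof.
split; first by move/eqmodP => /asboolP.
by move=> h; apply/eqmodP/asboolP.
Qed.

Lemma tlift_pi (W : zmodType) (f : U -> V -> W) s :
  biadditive f -> tlift f (\pi_tens s) = teval f s.
Proof. by move=> hf; apply: (tens_eqP _ _).1 hf; rewrite reprK. Qed.

Definition tzero : tens := \pi_tens [::].
Definition tadd (x y : tens) : tens := \pi_tens (repr x ++ repr y).
Definition topp (x : tens) : tens := \pi_tens [seq (- z.1, z.2) | z <- repr x].

Lemma teval_cat (W : zmodType) (f : U -> V -> W) s t :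
  teval f (s ++ t) = teval f s + teval f t.
Proof. exact: big_cat. Qed.

Lemma biadditive0l (W : zmodType) (f : U -> V -> W) v : biadditive f -> f 0 v = 0.
Proof. by move=> [h _]; apply: (addrI (f 0 v)); rewrite -h !addr0. Qed.

Lemma teval_opp (W : zmodType) (f : U -> V -> W) s : biadditive f ->
  teval f [seq (- z.1, z.2) | z <- s] = - teval f s.
Proof.
move=> hf; rewrite /teval big_map -sumrN; apply: eq_bigr => x _ /=.
by apply/eqP; rewrite -subr_eq0 opprK -hf.1 addNr biadditive0l.
Qed.

Lemma tadd_pi s t : tadd (\pi_tens s) (\pi_tens t) = \pi_tens (s ++ t).
Proof.
apply/tens_eqP => W f hf; rewrite !teval_cat.
by rewrite -!(tlift_pi _ hf) !reprK.
Qed.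

Lemma topp_pi s : topp (\pi_tens s) = \pi_tens [seq (- z.1, z.2) | z <- s].
Proof.
by apply/tens_eqP => W f hf; rewrite !teval_opp // -!(tlift_pi _ hf) !reprK.
Qed.

Lemma tens_ind (P : tens -> Prop) : (forall s, P (\pi_tens s)) -> forall x, P x.
Proof. by move=> h x; have := h (repr x); rewrite reprK. Qed.

Fact taddA : associative tadd.
Proof.
elim/tens_ind => x; elim/tens_ind => y; elim/tens_ind => z.
by rewrite !tadd_pi catA.
Qed.
Fact taddC : commutative tadd.
Proof.
elim/tens_ind => x; elim/tens_ind => y; rewrite !tadd_pi; apply/tens_eqP => W f hf.
by rewrite !teval_cat addrC.
Qed.
Fact tadd0 : left_id tzero tadd.
Proof. by elim/tens_ind => x; rewrite tadd_pi. Qed.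
Fact taddN : left_inverse tzero topp tadd.
Proof.
elim/tens_ind => x; rewrite topp_pi tadd_pi; apply/tens_eqP => W f hf.
by rewrite teval_cat teval_opp // addNr /teval big_nil.
Qed.
HB.instance Definition _ := GRing.isZmodule.Build tens taddA taddC tadd0 taddN.

Lemma tlift_additive (W : zmodType) (f : U -> V -> W) x y :
  biadditive f -> tlift f (x + y) = tlift f x + tlift f y.
Proof.
move=> hf; have -> : x + y = \pi_tens (repr x ++ repr y) by [].
by rewrite tlift_pi // teval_cat.
Qed.

Lemma tmk_biadditive : biadditive tmk.
Proof.
by split=> [u u' v|u v v']; apply: etrans _ (esym (tadd_pi _ _));
  apply/tens_eqP => W f hf; rewrite teval_cat /teval !big_seq1 /= ?hf.1 ?hf.2.
Qed.

End Tensor.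

Section TensorLmodule.
Context {R : pzRingType} (U : lmodType R) (V : zmodType).
Implicit Types x y : tens U V.

Definition tscale (a : R) x : tens U V :=
  \pi_(tens U V) [seq (a *: z.1, z.2) | z <- repr x].

Lemma biadditive_scale (W : zmodType) (f : U -> V -> W) a :
  biadditive f -> biadditive (fun u v => f (a *: u) v).
Proof. by move=> [h1 h2]; split=> *; rewrite ?scalerDr ?h1 ?h2. Qed.

Lemma tscale_pi a s : tscale a (\pi_(tens U V) s) = \pi_(tens U V) [seq (a *: z.1, z.2) | z <- s].
Proof.
apply/tens_eqP => W f hf; rewrite /teval !big_map /=.
have h : \pi_(tens U V) (repr (\pi_(tens U V) s)) = \pi_(tens U V) s by rewrite reprK.
exact: (tens_eqP _ _).1 h _ _ (biadditive_scale a hf).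
Qed.

Fact tscaleA a b x : tscale a (tscale b x) = tscale (a * b) x.
Proof.
elim/tens_ind: x => x; rewrite !tscale_pi -map_comp; congr (\pi_(tens U V) _).
by apply: eq_map => z /=; rewrite scalerA.
Qed.
Fact tscale1 : left_id 1 tscale.
Proof.
elim/tens_ind => x; rewrite tscale_pi; congr (\pi_(tens U V) _).
by rewrite -[RHS]map_id; apply: eq_map => -[u v] /=; rewrite scale1r.
Qed.
Fact tscaleDr : right_distributive tscale +%R.
Proof.
move=> a; elim/tens_ind => x; elim/tens_ind => y.
have hD s t : \pi_(tens U V) s + \pi_(tens U V) t = \pi_(tens U V) (s ++ t) by exact: tadd_pi.
by rewrite hD !tscale_pi hD map_cat.
Qed.
Fact tscaleDl x : {morph tscale^~ x : a b / a + b}.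
Proof.
move=> a b; elim/tens_ind: x => x; rewrite !tscale_pi; apply: etrans _ (esym (tadd_pi _ _)).
apply/tens_eqP => W f hf; rewrite teval_cat /teval !big_map -big_split /=.
by apply: eq_bigr => z _; rewrite scalerDl hf.1.
Qed.
HB.instance Definition _ := GRing.Zmodule_isLmodule.Build R (tens U V)
  tscaleA tscale1 tscaleDr tscaleDl.

Lemma tlift_scale (W : lmodType R) (f : U -> V -> W) a x : biadditive f ->
  (forall u v, f (a *: u) v = a *: f u v) -> tlift f (a *: x) = a *: tlift f x.
Proof.
move=> hf hZ; have -> : a *: x = \pi_(tens U V) [seq (a *: z.1, z.2) | z <- repr x] by [].
rewrite tlift_pi // /tlift /teval big_map scaler_sumr.
by apply: eq_bigr => z _; rewrite hZ.
Qed.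
End TensorLmodule.

(* [id_U (x) g] *)
Definition tmapr (U V W : zmodType) (g : V -> W) : tens U V -> tens U W :=
  tlift (fun u v => tmk u (g v)).
(* [f (x) id_V] *)
Definition tmapl (U U' V : zmodType) (f : U -> U') : tens U V -> tens U' V :=
  tlift (fun u v => tmk (f u) v).

(* All the Galois groups whose group rings occur below are finite and abelian;
   they are written additively. *)
Section GroupRing.
Context (r : comPzRingType) (G : finZmodType).
Local Notation rG := {ffun G -> r^o}.

Definition gring : Type := rG.
HB.instance Definition _ := GRing.Lmodule.copy gring rG.
Implicit Types f g h : gring.

Definition gdelta (s : G) : gring := [ffun x => (x == s)%:R : r^o].
Definition gmul f g : gring := [ffun x => \sum_y (f y : r) * (g (x - y) : r) : r^o].
Definition gaug f : r := \sum_x (f x : r).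

Fact gmulC : commutative gmul.
Proof.
move=> f g; apply/ffunP => x; rewrite !ffunE.
rewrite (reindex_inj (inv_inj (subKr x))) /=.
by apply: eq_bigr => y _; rewrite subKr mulrC.
Qed.
Fact gmulA : associative gmul.
Proof.
move=> f g h; apply/ffunP => x; rewrite !ffunE.
under eq_bigr => y _ do rewrite ffunE mulr_sumr.
under [RHS]eq_bigr => y _ do rewrite ffunE mulr_suml.
rewrite [RHS]exchange_big /=; apply: eq_bigr => y _.
rewrite [RHS](reindex_inj (addrI y)) /=; apply: eq_bigr => z _.
by rewrite mulrA (addrC y z) addrK opprD addrA addrAC.
Qed.
Fact gmul1 : left_id (gdelta 0) gmul.
Proof.
move=> f; apply/ffunP => x; rewrite !ffunE (bigD1 0) //= big1 => [|y /negPf y0].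
  by rewrite ffunE eqxx mul1r subr0 addr0.
by rewrite ffunE y0 mul0r.
Qed.
Fact gmulDl : left_distributive gmul +%R.
Proof.
move=> f g h; apply/ffunP => x; rewrite !ffunE -big_split /=.
by apply: eq_bigr => y _; rewrite ffunE mulrDl.
Qed.
HB.instance Definition _ := GRing.Zmodule_isComPzRing.Build gring
  gmulA gmulC gmul1 gmulDl.

Lemma gscaleAl (a : r) f g : a *: (f * g) = (a *: f) * g.
Proof.
apply/ffunP => x; rewrite !ffunE /= [LHS]mulr_sumr.
by apply: eq_bigr => y _; rewrite !ffunE mulrA.
Qed.

Lemma gaugD (a : r) f g : gaug (a *: f + g) = a * gaug f + gaug g.
Proof.
by rewrite /gaug mulr_sumr -big_split /=; apply: eq_bigr => x _; rewrite !ffunE.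
Qed.

Lemma gaug_delta s f : gaug (gdelta s * f) = gaug f.
Proof.
rewrite /gaug (reindex_inj (addrI s)) /=; apply: eq_bigr => x _.
rewrite ffunE (bigD1 s) //= big1 => [|y /negPf ys]; last by rewrite ffunE ys mul0r.
by rewrite ffunE eqxx mul1r addr0 addrAC subrr add0r.
Qed.

End GroupRing.

Section AugmentationIdeal.
Context (G : finZmodType).
Local Notation ZG := (gring int G).

Fact aug_0 : gaug (0 : ZG) = 0.
Proof. by rewrite /gaug big1 // => x _; rewrite ffunE. Qed.
Fact aug_lin a (x y : ZG) : gaug x = 0 -> gaug y = 0 -> gaug (a *: x + y) = 0.
Proof. by move=> hx hy; rewrite gaugD hx hy mulr0 addr0. Qed.

Definition augideal : subm ZG :=
  @Subm _ ZG [set x : ZG | gaug x = 0] aug_0 aug_lin.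

Definition augsq_set : set ZG := [set x | exists2 s : seq (ZG * ZG),
  (forall y, y \in s -> augideal y.1 /\ augideal y.2) & x = \sum_(y <- s) y.1 * y.2].

Fact augsq_0 : augsq_set 0.
Proof. by exists [::]; rewrite ?big_nil. Qed.
Fact augsq_lin a (x y : ZG) : augsq_set x -> augsq_set y -> augsq_set (a *: x + y).
Proof.
move=> [s hs ->] [t ht ->]; exists ([seq (a *: z.1, z.2) | z <- s] ++ t).
  move=> z; rewrite mem_cat => /orP[|/ht //].
  move=> /mapP[w /hs[h1 h2] ->]; split=> //=.
  by have := subm_lin a h1 (subm_0 augideal); rewrite addr0.
rewrite big_cat big_map; congr (_ + _); rewrite scaler_sumr /=.
by apply: eq_bigr => z _; rewrite gscaleAl.
Qed.
Definition augsq : subm ZG := Subm augsq_0 augsq_lin.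

(* [I / I^2] for the augmentation ideal [I] of [Z[G]] *)
Definition augquot : lmodType int := subquot augideal augsq.
Definition augcls (x : ZG) : augquot := cls augideal augsq x.

Definition rho_aug (g : G) : augquot := augcls (gdelta int g - gdelta int 0).

Fact gact_proof (g : G) (x : submod augideal) :
  gdelta int g * val x \in subm_pred augideal.
Proof. by apply/subm_predP; rewrite /= gaug_delta; exact: elimT (subm_predP augideal _) (valP x). Qed.
Definition gact (g : G) (x : submod augideal) : submod augideal := Submod (gact_proof g x).

Lemma gactD g (x y : submod augideal) : gact g (x + y) = gact g x + gact g y.
Proof. by apply/val_inj; rewrite /= mulrDr. Qed.

(* The inverse of the isomorphism from [r (x) I] to the augmentation ideal of
   [r[G]]: an element [f] of the latter is the sum over [g] of [f g *: (g - 1)]. *)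
Definition to_aug (r : comPzRingType) (f : gring r G) : tens r^o (submod augideal) :=
  \sum_g tmk (f g) (insubd (0 : submod augideal) (gdelta int g - gdelta int 0)).

End AugmentationIdeal.

(* The maps on group rings and on [I / I^2] induced by a map of groups *)
Definition gpush (G H : finZmodType) (f : G -> H) (x : gring int G) : gring int H :=
  \sum_g (x g : int) *: gdelta int (f g).
Definition augpush (G H : finZmodType) (f : G -> H) (x : augquot G) : augquot H :=
  augcls (gpush f (rep x)).

Section Gorenstein.
Context (A : comNzRingType).

Definition is_ideal (I : set A) : Prop :=
  I 0 /\ forall a x y, I x -> I y -> I (a * x + y).
Definition is_prime (P : set A) : Prop :=
  [/\ is_ideal P, ~ P 1 & forall x y, P (x * y) -> P x \/ P y].
Definition is_maximal (P : set A) : Prop :=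
  [/\ is_ideal P, ~ P 1 & forall I, is_ideal I -> P `<=` I -> ~ I 1 -> I = P].

Definition noetherian : Prop := forall I, is_ideal I ->
  exists s : seq A, forall x, I x <-> exists c : A -> A, x = \sum_(y <- s) c y * y.

Definition krull_dim_1 : Prop :=
  (exists P0 P1, [/\ is_prime P0, is_prime P1 & P0 `<` P1]) /\
  ~ (exists P0 P1 P2, [/\ is_prime P0, is_prime P1, is_prime P2, P0 `<` P1 & P1 `<` P2]).

Definition is_localization (P : set A) (L : comNzRingType) (l : {rmorphism A -> L}) : Prop :=
  [/\ forall s, ~ P s -> exists t, l s * t = 1,
      forall x, exists a s, ~ P s /\ x * l s = l a &
      forall a, l a = 0 -> exists2 s, ~ P s & s * a = 0].

Definition injective_module (I : lmodType A) : Prop :=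
  forall (M N : lmodType A) (i : {linear M -> N}) (f : {linear M -> I}),
    injective i -> exists g : {linear N -> I}, forall x, g (i x) = f x.

Inductive injdim_le : lmodType A -> nat -> Prop :=
| injdim0 (M : lmodType A) n : injective_module M -> injdim_le M n
| injdimS (M I C : lmodType A) (f : {linear M -> I}) (g : {linear I -> C}) n :
    injective_module I -> injective f -> (forall y, exists x, g x = y) ->
    (forall x, g x = 0 <-> exists m, x = f m) ->
    injdim_le C n -> injdim_le M n.+1.
End Gorenstein.

Definition gorenstein (A : comNzRingType) : Prop :=
  noetherian A /\ forall (P : set A) (L : comNzRingType) (l : {rmorphism A -> L}),
    is_maximal P -> is_localization P l -> exists n, injdim_le L^o n.

Definition semisimple (F : fieldType) (B : falgType F) : Prop :=
  let ideal (U : {vspace B}) := forall a u, u \in U -> a * u \in U in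
  forall U, ideal U -> exists V, [/\ ideal V, (U + V)%VS = fullv & (U :&: V)%VS = 0%VS].

(* The ring of p-adic integers, as the limit of the [Z / p ^ n] *)
Section Padic.
Context (p : nat) (p_pr : prime p).

Definition padic_seq : pred (nat -> nat) :=
  fun f => `[< forall n, f n = (f n.+1 %% p ^ n)%N >].

Record padicZ := PadicZ { padic_val : nat -> nat; padic_valP : padic_seq padic_val }.
HB.instance Definition _ := [isSub for padic_val].
HB.instance Definition _ := [Choice of padicZ by <:].

Let p_gt0 n : (0 < p ^ n)%N. Proof. by rewrite expn_gt0 prime_gt0. Qed.

Lemma padicE (x : padicZ) n : padic_val x n = (padic_val x n.+1 %% p ^ n)%N.
Proof. by case: x => f /= /asboolP. Qed.

Lemma padic_mod (x : padicZ) n : (padic_val x n %% p ^ n = padic_val x n)%N.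
Proof. by rewrite padicE modn_mod. Qed.

Lemma padic_le (x : padicZ) n m : (padic_val x (n + m) %% p ^ n = padic_val x n)%N.
Proof.
elim: m => [|m IH]; first by rewrite addn0 padic_mod.
rewrite -IH (padicE x (n + m)) modn_dvdm ?addnS //.
by rewrite expnD dvdn_mulr.
Qed.

Fact padic_mk_proof (f : nat -> nat) :
  (forall n, (f n.+1 = f n %[mod p ^ n])%N) -> padic_seq (fun n => (f n %% p ^ n)%N).
Proof.
by move=> h; apply/asboolP => n; rewrite modn_dvdm ?h // expnS dvdn_mull.
Qed.
Definition padic_mk f h := PadicZ (@padic_mk_proof f h).

Lemma padicS (x : padicZ) n : (padic_val x n.+1 = padic_val x n %[mod p ^ n])%N.
Proof. by rewrite -padicE padic_mod. Qed.

Fact padic_cst_proof (m : nat) n : ((fun _ : nat => m) n.+1 = m %[mod p ^ n])%N.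
Proof. by []. Qed.
Definition padic_cst m := padic_mk (padic_cst_proof m).

Fact padic_add_proof (x y : padicZ) n :
  (padic_val x n.+1 + padic_val y n.+1 = padic_val x n + padic_val y n %[mod p ^ n])%N.
Proof. by rewrite -modnDm !padicS modnDm. Qed.
Definition padic_add x y := padic_mk (padic_add_proof x y).

Fact padic_mul_proof (x y : padicZ) n :
  (padic_val x n.+1 * padic_val y n.+1 = padic_val x n * padic_val y n %[mod p ^ n])%N.
Proof. by rewrite -modnMm !padicS modnMm. Qed.
Definition padic_mul x y := padic_mk (padic_mul_proof x y).

Fact padic_opp_proof (x : padicZ) n :
  ((p ^ n.+1 - 1) * padic_val x n.+1 = (p ^ n - 1) * padic_val x n %[mod p ^ n])%N.
Proof.
apply/eqP; rewrite -(eqn_modDr (padic_val x n.+1)).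
rewrite -[X in ((_ + X) %% _)%N == _]mul1n -mulnDl subnK //.
rewrite -[X in _ == X]modnDmr padicS modnDmr.
rewrite -[X in _ == ((_ + X) %% _)%N]mul1n -mulnDl subnK //.
by rewrite expnSr -mulnA !modnMr.
Qed.
Definition padic_opp x := padic_mk (padic_opp_proof x).

Lemma padic_ext (x y : padicZ) :
  (forall n, (padic_val x n = padic_val y n %[mod p ^ n])%N) -> x = y.
Proof.
move=> h; apply/val_inj/funext => n /=.
by rewrite -[LHS]padic_mod -[RHS]padic_mod h.
Qed.

Fact padic_addA : associative padic_add.
Proof. by move=> x y z; apply: padic_ext => n; rewrite /= !(modn_mod, modnDml, modnDmr) addnA. Qed.
Fact padic_addC : commutative padic_add.
Proof. by move=> x y; apply: padic_ext => n; rewrite /= addnC. Qed.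
Fact padic_add0 : left_id (padic_cst 0) padic_add.
Proof. by move=> x; apply: padic_ext => n; rewrite /= !(modn_mod, modnDml). Qed.
Fact padic_addN : left_inverse (padic_cst 0) padic_opp padic_add.
Proof.
move=> x; apply: padic_ext => n; rewrite /= !(modn_mod, modnDml).
by rewrite -[X in ((_ + X) %% _)%N]mul1n -mulnDl subnK // modnMr mod0n.
Qed.
HB.instance Definition _ := GRing.isZmodule.Build padicZ
  padic_addA padic_addC padic_add0 padic_addN.

Fact padic_mulA : associative padic_mul.
Proof. by move=> x y z; apply: padic_ext => n; rewrite /= !(modn_mod, modnMml, modnMmr) mulnA. Qed.
Fact padic_mulC : commutative padic_mul.
Proof. by move=> x y; apply: padic_ext => n; rewrite /= mulnC. Qed.
Fact padic_mul1 : left_id (padic_cst 1) padic_mul.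
Proof. by move=> x; apply: padic_ext => n; rewrite /= !(modn_mod, modnMml) mul1n. Qed.
Fact padic_mulDl : left_distributive padic_mul padic_add.
Proof.
move=> x y z; apply: padic_ext => n.
by rewrite /= !(modn_mod, modnMml, modnMmr, modnDml, modnDmr) mulnDl.
Qed.
Fact padic_1neq0 : padic_cst 1 != padic_cst 0.
Proof.
apply/eqP => /(congr1 (fun x => padic_val x 1)) /=.
by rewrite expn1 mod0n modn_small ?prime_gt1.
Qed.
HB.instance Definition _ := GRing.Zmodule_isComNzRing.Build padicZ
  padic_mulA padic_mulC padic_mul1 padic_mulDl padic_1neq0.

Definition padic_unit : pred padicZ := fun x => `[< exists y, y * x = 1 >].
Definition padic_inv (x : padicZ) : padicZ :=
  if pselect (exists y, y * x = 1) is left h then projT1 (cid h) else x.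

Fact padic_mulV : {in padic_unit, left_inverse 1 padic_inv *%R}.
Proof.
move=> x /asboolP h; rewrite /padic_inv; case: pselect => // h'.
by case: cid.
Qed.
Fact padic_unitP x y : y * x = 1 -> padic_unit x.
Proof. by move=> h; apply/asboolP; exists y. Qed.
Fact padic_inv_out : {in [predC padic_unit], padic_inv =1 id}.
Proof.
move=> x; rewrite inE => hx; rewrite /padic_inv; case: pselect => // h.
by case/negP: hx; apply/asboolP.
Qed.
HB.instance Definition _ := GRing.ComNzRing_hasMulInverse.Build padicZ
  padic_mulV padic_unitP padic_inv_out.

Lemma padic_neq0 (x : padicZ) : x != 0 ->
  exists n, forall m, ~~ (p ^ n %| padic_val x (n + m))%N.
Proof.
move=> x0; suff [n hn] : exists n, padic_val x n != 0%N.
  by exists n => m; rewrite /dvdn padic_le.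
apply: contrapT => h; move/eqP: x0; apply; apply: padic_ext => n /=.
rewrite modn_mod mod0n; case: (eqVneq (padic_val x n) 0%N) => [-> |hn].
  by rewrite mod0n.
by case: h; exists n.
Qed.

Fact padic_idomain : GRing.integral_domain_axiom padicZ.
Proof.
move=> x y xy0; apply: contraT; rewrite negb_or => /andP[x0 y0].
have [n hn] := padic_neq0 x0; have [m hm] := padic_neq0 y0.
have hN := hn m; have hM := hm n; rewrite addnC in hM.
have a0 : (0 < padic_val x (n + m))%N by rewrite lt0n; apply: contraNneq hN => ->.
have b0 : (0 < padic_val y (n + m))%N by rewrite lt0n; apply: contraNneq hM => ->.
have : (p ^ (n + m) %| padic_val x (n + m) * padic_val y (n + m))%N.
  have := congr1 (fun z => padic_val z (n + m)) xy0.
  by rewrite /= mod0n /dvdn => ->.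
rewrite pfactor_dvdn ?muln_gt0 ?a0 // lognM //.
rewrite pfactor_dvdn // -ltnNge in hN; rewrite pfactor_dvdn // -ltnNge in hM.
by rewrite leqNgt (_ : (_ < _)%N) // -addnS leq_add // ltnW.
Qed.
HB.instance Definition _ := GRing.ComUnitRing_isIntegral.Build padicZ padic_idomain.

Definition padicQ : fieldType := {fraction padicZ}.

(* The ring of integers of a finite extension [Q] of [padicQ] *)
Definition padic_integers (Q : fieldExtType padicQ) : set Q :=
  [set x | integralOver (fun z : padicZ => (tofrac z : padicQ)%:A : Q) x].

End Padic.

(* [algC] serves as the algebraic closure of every number field; number fields
   and their extensions are subfields of [algC]. *)
Definition is_autom (f : algC -> algC) : Prop :=
  [/\ f 1 = 1, {morph f : x y / x + y}, {morph f : x y / x * y} & bijective f].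

Record gal := Gal { gal_fun :> algC -> algC; gal_funP : `[< is_autom gal_fun >] }.
HB.instance Definition _ := [isSub for gal_fun].
HB.instance Definition _ := [Choice of gal by <:].

Fact gal_id_proof : `[< is_autom id >].
Proof. by apply/asboolP; split=> //; exists id. Qed.
Definition gal_id := Gal gal_id_proof.

Fact gal_comp_proof (s t : gal) : `[< is_autom (s \o t) >].
Proof.
have /asboolP[s1 sD sM sB] := gal_funP s; have /asboolP[t1 tD tM tB] := gal_funP t.
apply/asboolP; split=> /=; first by rewrite t1 s1.
- by move=> x y /=; rewrite tD sD.
- by move=> x y /=; rewrite tM sM.
- exact: bij_comp.
Qed.
Definition gal_comp s t := Gal (gal_comp_proof s t).

Fact gal_inv_ex (s : gal) : exists t : gal, cancel s t /\ cancel t s.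
Proof.
have /asboolP[s1 sD sM [t st ts]] := gal_funP s.
suff tP : `[< is_autom t >] by exists (Gal tP).
apply/asboolP; split; first by rewrite -s1 st.
- by move=> x y; apply: (can_inj st); rewrite sD !ts.
- by move=> x y; apply: (can_inj st); rewrite sM !ts.
- by exists s.
Qed.
Definition gal_inv s : gal := projT1 (cid (gal_inv_ex s)).

Fact gal_compA : associative gal_comp. Proof. by move=> s t u; apply/val_inj. Qed.
Fact gal_comp1 : left_id gal_id gal_comp. Proof. by move=> s; apply/val_inj. Qed.
Fact gal_comp1r : right_id gal_id gal_comp. Proof. by move=> s; apply/val_inj. Qed.
Fact gal_compV : left_inverse gal_id gal_inv gal_comp.
Proof.
move=> s; apply/val_inj/funext => x /=; rewrite /gal_inv.
by case: cid => t [/= h _]; rewrite h.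
Qed.
Fact gal_compVr : right_inverse gal_id gal_inv gal_comp.
Proof.
move=> s; apply/val_inj/funext => x /=; rewrite /gal_inv.
by case: cid => t [/= _ h]; rewrite h.
Qed.
HB.instance Definition _ := isGroup.Build gal
  gal_compA gal_comp1 gal_comp1r gal_compV gal_compVr.

(* A module on which only a subgroup [D] of [gal], fixed by the context, need act
   as a group: the values of [gm_act] outside [D] are irrelevant. *)
Record gmod (R : comPzRingType) := Gmod {
  gm_mod :> lmodType R;
  gm_act : gal -> gm_mod -> gm_mod;
  gm_lin : forall s, is_linear (gm_act s) }.
Arguments gm_act {R} N s x : rename.

Section GmodTheory.
Context {R : comPzRingType} (N : gmod R) (s : gal).
Lemma gm_act0 : gm_act N s 0 = 0.
Proof.
have := gm_lin s 1 (0 : N) 0; rewrite !scale1r addr0 => h.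
by apply: (addrI (gm_act N s 0)); rewrite -h addr0.
Qed.
Lemma gm_actD x y : gm_act N s (x + y) = gm_act N s x + gm_act N s y.
Proof. by have := gm_lin s 1 x y; rewrite !scale1r. Qed.
Lemma gm_actZ a x : gm_act N s (a *: x) = a *: gm_act N s x.
Proof. by have := gm_lin s a x 0; rewrite gm_act0 !addr0. Qed.

Fact fixed_lin a x y : gm_act N s x = x -> gm_act N s y = y ->
  gm_act N s (a *: x + y) = a *: x + y.
Proof. by move=> hx hy; rewrite gm_lin hx hy. Qed.
(* [N ^ {s = 1}] *)
Definition fixed : lmodType R :=
  submod (@Subm R N (fun x => gm_act N s x = x) gm_act0 fixed_lin).
End GmodTheory.

Section Constructions.
Context {R : comPzRingType}.

Fact mx_act_lin d (a : gal -> 'M[R]_d) s : is_linear (fun v : 'cV[R]_d => a s *m v).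
Proof. by move=> c x y; rewrite mulmxDr -scalemxAr. Qed.
(* [R^d], with [s] acting through the matrix [a s] *)
Definition mx_gmod d (a : gal -> 'M[R]_d) : gmod R := Gmod (mx_act_lin a).

Fact twist_lin (c : gal -> R) s : is_linear (fun x : R^o => c s * x : R^o).
Proof.
move=> a x y; rewrite mulrDr; congr (_ + _).
by change (c s * (a * x) = a * (c s * x)); rewrite mulrCA.
Qed.
(* [R], with the Galois group acting through the character [c] *)
Definition twist (c : gal -> R) : gmod R := Gmod (twist_lin c).

Section TwistedDual.
Context (N : gmod R) (c : gal -> R).

Fact dual_act_proof s (f : dual N) :
  (fun x : N => gm_act (twist c) s (val f (gm_act N (s^-1)%g x)) : R^o)
    \in subm_pred (Subm (@is_linear_0 R N R^o) (@is_linear_lin R N R^o)).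
Proof.
apply/subm_predP => a x y /=; have /subm_predP hf := valP f.
by rewrite gm_lin hf -[RHS](twist_lin c s).
Qed.
Definition dual_act s (f : dual N) : dual N := Submod (dual_act_proof s f).

Fact dual_act_lin s : is_linear (dual_act s).
Proof.
move=> a f g; apply/val_inj/funext => x /=.
exact: (twist_lin c s a (val f _) (val g _)).
Qed.
(* [Hom_R(N, R(c))], where [R(c)] is [twist c] *)
Definition twisted_dual : gmod R := Gmod dual_act_lin.
End TwistedDual.

Section TensorGmod.
Context (N : gmod R) (X : zmodType) (e : gal -> X -> X).
Context (eD : forall s x y, e s (x + y) = e s x + e s y).

Definition tens_act s : tens N X -> tens N X :=
  tlift (fun b x => tmk (gm_act N s b) (e s x)).

Lemma tens_act_biadditive s : biadditive (fun b x => tmk (gm_act N s b) (e s x)).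
Proof.
have [h1 h2] := tmk_biadditive (GRing.Lmodule.sort N) X.
by split=> *; rewrite ?gm_actD ?eD ?h1 ?h2.
Qed.

Lemma tmkZ (a : R) (b : N) (x : X) : tmk (a *: b) x = a *: (tmk b x : tens N X).
Proof. by rewrite [RHS]tscale_pi. Qed.

Fact tens_act_lin s : is_linear (tens_act s).
Proof.
move=> a x y; rewrite /tens_act tlift_additive; last exact: tens_act_biadditive.
congr (_ + _); apply: tlift_scale; first exact: tens_act_biadditive.
by move=> u v; rewrite gm_actZ tmkZ.
Qed.
(* [N (x) X], with [s] acting on [X] through the additive map [e s] *)
Definition tens_gmod : gmod R := Gmod tens_act_lin.
End TensorGmod.
End Constructions.

Section Cohomology.
Context (p : nat) {R : comPzRingType}.
Implicit Types (N : gmod R) (D I : set gal).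

Definition fixes (L : seq algC) (h : gal) : Prop := forall x, x \in L -> h x = x.

(* Continuity of cochains on [D], for the Krull topology on [D] and the p-adic
   topology on the coefficients (which is discrete on p-power torsion modules). *)
Definition cont1 D (N : zmodType) (f : gal -> N) : Prop :=
  forall n s, D s -> exists L, forall h, D h -> fixes L h ->
    exists y, f (s * h)%g - f s = y *+ (p ^ n).
Definition cont2 D (N : zmodType) (f : gal -> gal -> N) : Prop :=
  forall n s t, D s -> D t -> exists L, forall h k, D h -> D k -> fixes L h -> fixes L k ->
    exists y, f (s * h)%g (t * k)%g - f s t = y *+ (p ^ n).

Definition cob1 N (f : gal -> N) (s t : gal) : N :=
  gm_act N s (f t) - f (s * t)%g + f s.
Definition cob2 N (f : gal -> gal -> N) (s t u : gal) : N :=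
  gm_act N s (f t u) - f (s * t)%g u + f s (t * u)%g - f s t.

(* Cochains of [D] are functions on the whole of [gal] of which only the values
   on [D] matter: the coboundaries below contain all the functions vanishing on
   [D].  Hence a cochain of [D] is its own restriction to a subgroup of [D]. *)

(* 1-cocycles on [D] inflated from the quotient of [D] by a subgroup [I]
   acting trivially on [N] *)
Definition is_Z1 N D I (f : gal -> N) : Prop :=
  [/\ cont1 D f, forall s t, D s -> D t -> cob1 f s t = 0 & forall s, I s -> f s = 0].
Definition is_B1 N D (f : gal -> N) : Prop :=
  exists n, forall s, D s -> f s = gm_act N s n - n.
Definition is_Z2 N D (f : gal -> gal -> N) : Prop :=
  cont2 D f /\ forall s t u, D s -> D t -> D u -> cob2 f s t u = 0.
Definition is_B2 N D (f : gal -> gal -> N) : Prop :=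
  exists2 g : gal -> N, cont1 D g & forall s t, D s -> D t -> f s t = cob1 g s t.

Lemma fixes_cat L L' h : fixes (L ++ L') h -> fixes L h /\ fixes L' h.
Proof. by move=> H; split=> x xL; apply: H; rewrite mem_cat xL ?orbT. Qed.

Lemma lin_diff (V : lmodType R) a (u u' v v' y z : V) m :
  u - u' = y *+ m -> v - v' = z *+ m ->
  (a *: u + v) - (a *: u' + v') = (a *: y + z) *+ m.
Proof.
by move=> h1 h2; rewrite mulrnDl scalerMnr -h1 -h2 scalerBr opprD addrACA.
Qed.

Lemma cob1_lin N a (f g : gal -> N) s t :
  cob1 (a *: f + g) s t = a *: cob1 f s t + cob1 g s t.
Proof.
rewrite /cob1.
change (gm_act N s (a *: f t + g t) - (a *: f (s * t)%g + g (s * t)%g) + (a *: f s + g s)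
  = a *: (gm_act N s (f t) - f (s * t)%g + f s) + (gm_act N s (g t) - g (s * t)%g + g s)).
by rewrite gm_lin opprD !scalerDr scalerN [X in X + _]addrACA [LHS]addrACA.
Qed.

Lemma cob2_lin N a (f g : gal -> gal -> N) s t u :
  cob2 (a *: f + g) s t u = a *: cob2 f s t u + cob2 g s t u.
Proof.
rewrite /cob2.
change (gm_act N s (a *: f t u + g t u) - (a *: f (s * t)%g u + g (s * t)%g u)
    + (a *: f s (t * u)%g + g s (t * u)%g) - (a *: f s t + g s t)
  = a *: (gm_act N s (f t u) - f (s * t)%g u + f s (t * u)%g - f s t)
    + (gm_act N s (g t u) - g (s * t)%g u + g s (t * u)%g - g s t)).
rewrite gm_lin !opprD !scalerDr !scalerN.
by rewrite [X in X + _ + _]addrACA [X in X + _]addrACA [LHS]addrACA.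
Qed.

Lemma cont1_lin D (V : lmodType R) a (f g : gal -> V) :
  cont1 D f -> cont1 D g -> cont1 D (a *: f + g).
Proof.
move=> hf hg n s Ds; have [L hL] := hf n s Ds; have [L' hL'] := hg n s Ds.
exists (L ++ L') => h Dh /fixes_cat[/(hL _ Dh)[y hy] /(hL' _ Dh)[z hz]].
by exists (a *: y + z); apply: lin_diff.
Qed.

Lemma cont2_lin D (V : lmodType R) a (f g : gal -> gal -> V) :
  cont2 D f -> cont2 D g -> cont2 D (a *: f + g).
Proof.
move=> hf hg n s t Ds Dt; have [L hL] := hf n s t Ds Dt; have [L' hL'] := hg n s t Ds Dt.
exists (L ++ L') => h k Dh Dk /fixes_cat[h1 h2] /fixes_cat[k1 k2].
have [y hy] := hL _ _ Dh Dk h1 k1; have [z hz] := hL' _ _ Dh Dk h2 k2.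
by exists (a *: y + z); apply: lin_diff.
Qed.

Lemma cont1_cst D (V : zmodType) (v : V) : cont1 D (fun=> v).
Proof. by move=> n s _; exists [::] => h _ _; exists 0; rewrite mul0rn subrr. Qed.

Section Groups.
Context (N : gmod R) (D I : set gal).

Fact is_Z1_0 : is_Z1 D I (0 : gal -> N).
Proof.
split=> //; first exact: cont1_cst.
by move=> s t _ _; rewrite /cob1 /GRing.zero /= gm_act0 subrr addr0.
Qed.
Fact is_Z1_lin a (f g : gal -> N) : is_Z1 D I f -> is_Z1 D I g -> is_Z1 D I (a *: f + g).
Proof.
move=> [f1 f2 f3] [g1 g2 g3]; split; first exact: cont1_lin.
  by move=> s t Ds Dt; rewrite cob1_lin f2 // g2 // scaler0 addr0.
move=> s Is; change (a *: f s + g s = 0).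
by rewrite f3 // g3 // scaler0 addr0.
Qed.
Definition Z1 : subm (gal -> N) := Subm is_Z1_0 is_Z1_lin.

Fact is_B1_0 : is_B1 D (0 : gal -> N).
Proof. by exists 0 => s _; rewrite gm_act0 subrr. Qed.
Fact is_B1_lin a (f g : gal -> N) : is_B1 D f -> is_B1 D g -> is_B1 D (a *: f + g).
Proof.
move=> [m hm] [n hn]; exists (a *: m + n) => s Ds.
change (a *: f s + g s = gm_act N s (a *: m + n) - (a *: m + n)).
by rewrite hm // hn // gm_lin opprD scalerBr addrACA.
Qed.
Definition B1 : subm (gal -> N) := Subm is_B1_0 is_B1_lin.

Fact is_Z2_0 : is_Z2 D (0 : gal -> gal -> N).
Proof.
split; first by move=> n s t _ _; exists [::] => *; exists 0; rewrite mul0rn subrr.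
by move=> s t u _ _ _; rewrite /cob2 /GRing.zero /= gm_act0 subrr add0r subrr.
Qed.
Fact is_Z2_lin a (f g : gal -> gal -> N) : is_Z2 D f -> is_Z2 D g -> is_Z2 D (a *: f + g).
Proof.
move=> [f1 f2] [g1 g2]; split; first exact: cont2_lin.
by move=> s t u Ds Dt Du; rewrite cob2_lin f2 // g2 // scaler0 addr0.
Qed.
Definition Z2 : subm (gal -> gal -> N) := Subm is_Z2_0 is_Z2_lin.

Fact is_B2_0 : is_B2 D (0 : gal -> gal -> N).
Proof.
exists 0; first exact: cont1_cst.
by move=> s t _ _; rewrite /cob1 /GRing.zero /= gm_act0 subrr addr0.
Qed.
Fact is_B2_lin a (f g : gal -> gal -> N) : is_B2 D f -> is_B2 D g -> is_B2 D (a *: f + g).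
Proof.
move=> [x x1 hx] [y y1 hy]; exists (a *: x + y); first exact: cont1_lin.
by move=> s t Ds Dt; rewrite cob1_lin -hx // -hy.
Qed.
Definition B2 : subm (gal -> gal -> N) := Subm is_B2_0 is_B2_lin.
End Groups.

Definition H1 N D : lmodType R := subquot (Z1 N D set0) (B1 N D).
Definition H2 N D : lmodType R := subquot (Z2 N D) (B2 N D).
Definition cls1 N D (f : gal -> N) : H1 N D := cls (Z1 N D set0) (B1 N D) f.
Definition cls2 N D (f : gal -> gal -> N) : H2 N D := cls (Z2 N D) (B2 N D) f.
Definition rep1 N D (c : H1 N D) : gal -> N := rep c.
Definition rep2 N D (c : H2 N D) : gal -> gal -> N := rep c.

Definition res1 N D D' (c : H1 N D) : H1 N D' := cls1 D' (rep1 c).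

(* [c] is the image of [x] under the connecting map of a short exact sequence
   0 -> N' -> N -> N'' -> 0 with maps [i] and [j] *)
Definition connecting D (N' N N'' : gmod R) (i : N' -> N) (j : N -> N'')
    (x : H1 N'' D) (c : H2 N' D) : Prop :=
  exists (z : gal -> N'') (zt : gal -> N) (y : gal -> gal -> N'),
    [/\ Z1 N'' D set0 z /\ cls1 D z = x,
        cont1 D zt /\ (forall s, D s -> j (zt s) = z s),
        Z2 N' D y /\ cls2 D y = c &
        forall s t, D s -> D t -> i (y s t) = cob1 zt s t].

(* The first cohomology of the mapping fibre of localization from the cochains
   of [G / J] to the sum over [v] in [V] of the cochains of [D v / I v], where
   [I v] is contained in [J]: a cocycle is a 1-cocycle [x.1] of [G / J]
   with, for each [v] in [V], an element [x.2 v] of [N] trivializing the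
   restriction of [x.1] to [D v]. *)
Section MappingFibre.
Context (N : gmod R) (G J : set gal) (P : Type) (V : set P) (D : P -> set gal).
Local Notation C := ((gal -> N) * (P -> N))%type.

Definition is_ZS (x : C) : Prop :=
  is_Z1 G J x.1 /\
  (forall v, V v -> forall s, D v s -> x.1 s = gm_act N s (x.2 v) - x.2 v).
Definition is_BS (x : C) : Prop :=
  exists n, (forall s, G s -> x.1 s = gm_act N s n - n) /\ (forall v, V v -> x.2 v = n).

Fact is_ZS_0 : is_ZS 0.
Proof.
by split; [exact: is_Z1_0 | move=> v _ s _; rewrite /GRing.zero /= gm_act0 subrr].
Qed.
Fact is_ZS_lin a (x y : C) : is_ZS x -> is_ZS y -> is_ZS (a *: x + y).
Proof.
move=> [x1 x2] [y1 y2]; split; first exact: is_Z1_lin.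
move=> v Vv s Ds; change (a *: x.1 s + y.1 s =
  gm_act N s (a *: x.2 v + y.2 v) - (a *: x.2 v + y.2 v)).
by rewrite (x2 v) // (y2 v) // gm_lin opprD scalerBr addrACA.
Qed.
Fact is_BS_0 : is_BS 0.
Proof. by exists 0; split=> // s _; rewrite gm_act0 subrr. Qed.
Fact is_BS_lin a (x y : C) : is_BS x -> is_BS y -> is_BS (a *: x + y).
Proof.
move=> [m [m1 m2]] [n [n1 n2]]; exists (a *: m + n); split=> [s Gs|v Vv].
  change (a *: x.1 s + y.1 s = gm_act N s (a *: m + n) - (a *: m + n)).
  by rewrite m1 // n1 // gm_lin opprD scalerBr addrACA.
by change (a *: x.2 v + y.2 v = a *: m + n); rewrite m2 // n2.
Qed.
Definition fibre_H1 : lmodType R := subquot (Subm is_ZS_0 is_ZS_lin) (Subm is_BS_0 is_BS_lin).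
Definition fibre_to_H1 (x : fibre_H1) : H1 N G := cls1 G (rep x).1.
End MappingFibre.

End Cohomology.

Definition is_subfield (L : set algC) : Prop :=
  [/\ L 1, forall x y, L x -> L y -> L (x - y), forall x y, L x -> L y -> L (x * y) &
      forall x, L x -> L x^-1].

Definition degree (K L : set algC) (n : nat) : Prop :=
  exists b : 'I_n -> algC, (forall i, L (b i)) /\
    forall x, L x -> exists! c : {ffun 'I_n -> algC},
      (forall i, K (c i)) /\ x = \sum_i c i * b i.

Definition finite_ext (K L : set algC) : Prop :=
  [/\ is_subfield L, K `<=` L & exists n, degree K L n].

Definition number_field (K : set algC) : Prop := finite_ext [set x : algC | x \in Crat] K.

Definition field_gen (S : set algC) : set algC :=
  [set x | forall L, is_subfield L -> S `<=` L -> L x].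

Definition galf (K : set algC) : set gal := [set s | forall x, K x -> s x = x].

Definition galois_ext (K L : set algC) : Prop :=
  [/\ is_subfield L, K `<=` L & forall s x, galf K s -> L x -> L (s x)].
Definition abelian_ext (K L : set algC) : Prop :=
  galois_ext K L /\ forall s t x, galf K s -> galf K t -> L x -> s (t x) = t (s x).

Definition max_pext (p : nat) (K H : set algC) : set algC :=
  [set x | exists L, [/\ finite_ext K L, galois_ext K L, exists k, degree K L (p ^ k)%N,
    L `<=` H & L x]].

(* The finite places of a field are the nonzero primes of its ring of integers. *)
Definition integers (F : set algC) : set algC := [set x | F x /\ x \in Aint].

Definition prime_of (F P : set algC) : Prop :=
  [/\ P `<=` integers F, exists2 x, P x & x <> 0,
      forall x y, P x -> P y -> P (x - y),
      forall a x, integers F a -> P x -> P (a * x) &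
      ~ P 1 /\ forall x y, integers F x -> integers F y -> P (x * y) -> P x \/ P y].

(* A place of the field of algebraic numbers.  The decomposition group of [W] in
   [galf K] is the absolute Galois group of the completion of [K] at the place
   [W `&` K], for the embedding of algebraic closures given by [W]. *)
Definition place (W : set algC) : Prop := prime_of setT W.

Definition decomp (K W : set algC) : set gal :=
  [set s | galf K s /\ forall x, W (s x) <-> W x].
Definition inertia (K W : set algC) : set gal :=
  [set s | decomp K W s /\ forall x, x \in Aint -> W (s x - x)].

Definition residue_card (K v : set algC) (n : nat) : Prop :=
  exists r : 'I_n -> algC, (forall i, integers K (r i)) /\
    forall x, integers K x -> exists! i, v (x - r i).

(* Frobenius elements are arithmetic ones. *)
Definition is_frob (K W : set algC) (s : gal) : Prop :=
  decomp K W s /\ exists2 n, residue_card K (W `&` K) n &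
    forall x, x \in Aint -> W (s x - x ^+ n).

Definition unramified (K L v : set algC) : Prop :=
  forall W, place W -> W `&` K = v -> inertia K W `<=` galf L.
(* for a Galois extension [L] of [K] *)
Definition splits_completely (K L v : set algC) : Prop :=
  forall W, place W -> W `&` K = v -> decomp K W `<=` galf L.

(* An element [g] of [gal] gives an archimedean place of [K]: the absolute value
   of [g x]; its decomposition group is generated by the conjugate by [g] of the
   complex conjugation, if this fixes [K]. *)
Definition arch_decomp (K : set algC) (g : gal) : set gal :=
  [set s | galf K s /\ ((forall x, s x = x) \/ (forall x, g (s x) = (g x)^* ))].
Definition same_arch_place (K : set algC) (g h : gal) : Prop :=
  (forall x, K x -> g x = h x) \/ (forall x, K x -> g x = (h x)^* ).
Definition arch_splits (K L : set algC) : Prop :=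
  forall g, arch_decomp K g `<=` galf L.

Definition hilbert_class_field (K : set algC) : set algC :=
  [set x | exists L, [/\ finite_ext K L, abelian_ext K L, L x, arch_splits K L &
    forall v, prime_of K v -> unramified K L v]].

Definition ideal_mul (I J : set algC) : set algC :=
  [set x | exists2 s : seq (algC * algC),
    (forall y, y \in s -> I y.1 /\ J y.2) & x = \sum_(y <- s) y.1 * y.2].

(* [L] is the ray class field of [K] modulo [q]: it is abelian over [K],
   unramified outside [q], and the product of the Frobenius elements at
   [v_1, ..., v_k], all different from [q], is trivial on [L] if and only if
   the ideal [v_1 ... v_k] has a generator congruent to 1 modulo [q]. *)
Definition ray_class_field (K q L : set algC) : Prop :=
  [/\ finite_ext K L, abelian_ext K L,
      forall v, prime_of K v -> v <> q -> unramified K L v &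
      forall s : seq (set algC * gal),
        (forall x, x \in s -> [/\ prime_of K x.1, x.1 <> q &
           exists W, [/\ place W, W `&` K = x.1 & is_frob K W x.2]]) ->
        galf L (foldr (fun x g => x.2 * g)%g 1%g s) <->
        exists a, [/\ integers K a, q (a - 1) &
          foldr ideal_mul (integers K) [seq x.1 | x <- s] = [set a * b | b in integers K]]].

(* The maximal extension of [F] unramified outside the places above [U] *)
Definition max_unr (K F : set algC) (U : set (set algC)) : set algC :=
  [set x | forall W, place W -> ~ U (W `&` K) -> forall s, inertia F W s -> s x = x].

(* [c] is the p-adic cyclotomic character of [galf K], with values in [A] *)
Definition is_cyclotomic (p : nat) (A : comNzRingType) (K : set algC) (c : gal -> A) : Prop :=
  forall s n, galf K s -> exists a : nat,
    (forall z : algC, z ^+ (p ^ n) = 1 -> s z = z ^+ a) /\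
    exists y, c s = a%:R + y *+ (p ^ n).

(* [f] identifies the quotient of [D] by [H] with the abelian group [G]. *)
Definition is_quotient (D H : set gal) (G : zmodType) (f : gal -> G) : Prop :=
  [/\ forall s t, D s -> D t -> f (s * t)%g = f s + f t,
      forall g, exists2 s, D s & f s = g & forall s, D s -> (f s = 0 <-> H s)].

(* [emb] identifies [A] with an order over the ring of integers of [Q] in [B]. *)
Definition is_order (p : nat) (p_pr : prime p) (Q : fieldExtType (padicQ p_pr))
    (B : falgType Q) (A : comNzRingType) (emb : {rmorphism A -> B}) : Prop :=
  [/\ injective emb, forall o, padic_integers o -> exists x, emb x = o%:A,
      exists s : seq A, forall x, exists2 c : A -> Q,
        (forall y, padic_integers (c y)) & emb x = \sum_(y <- s) c y *: emb y &
      forall z, exists s : seq (Q * A), z = \sum_(x <- s) x.1 *: emb x.2].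

Record setting := Setting {
  s_p : nat;
  s_prime : prime s_p;
  s_odd : odd s_p;

  s_Q : fieldExtType (padicQ s_prime);
  s_QA : falgType s_Q;
  s_QA_comm : commutative (@GRing.mul s_QA);
  s_QA_semisimple : semisimple s_QA;
  s_R : comNzRingType;
  s_emb : {rmorphism s_R -> s_QA};
  s_order : is_order s_emb;
  s_dim : krull_dim_1 s_R;
  s_gorenstein : gorenstein s_R;

  s_K : set algC;
  s_number_field : number_field s_K;

  (* the free module [T], in coordinates *)
  s_rank : nat;
  s_rho : gal -> 'M[s_R]_s_rank;
  s_rho1 : s_rho 1%g = 1%:M;
  s_rhoM : forall s t, galf s_K s -> galf s_K t -> s_rho (s * t)%g = s_rho s *m s_rho t;
  s_rho_cont : cont1 s_p (galf s_K) s_rho;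
  s_chi : gal -> s_R;
  s_chi_cyclotomic : is_cyclotomic s_p s_K s_chi;

  (* the finite places in the set [S], which also contains all the archimedean places *)
  s_S : set (set algC);
  s_S_finite : finite_set s_S;
  s_S_prime : forall v, s_S v -> prime_of s_K v;
  s_S_p : forall v, prime_of s_K v -> v s_p%:R -> s_S v;
  s_S_ram : forall v, prime_of s_K v -> ~ s_S v ->
    forall W, place W -> W `&` s_K = v -> forall s, inertia s_K W s -> s_rho s = 1%:M;

  s_KK : set algC;
  s_KK_abelian : abelian_ext s_K s_KK;
  s_KK_prop : forall F, finite_ext s_K F -> F `<=` s_KK -> exists k, degree s_K F (s_p ^ k)%N;
  s_KK_arch : arch_splits s_K s_KK;

  s_Sigma : set (set algC);
  s_Sigma_finite : finite_set s_Sigma;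
  s_Sigma_prime : forall v, s_Sigma v -> prime_of s_K v;
  s_Sigma_S : s_Sigma `&` s_S = set0;
  s_Sigma_unr : forall v, s_Sigma v -> unramified s_K s_KK v;

  (* a place of the algebraic closure above every finite place of every finite
     extension of [K], and an embedding for every archimedean place of [K] *)
  s_above : set algC -> set algC -> set algC;
  s_aboveP : forall F v, finite_ext s_K F -> prime_of F v ->
    place (s_above F v) /\ s_above F v `&` F = v;
  s_narch : nat;
  s_arch : 'I_s_narch -> gal;
  s_archP : forall g, exists! i, same_arch_place s_K (s_arch i) g }.

Section Setting.
Context (X : setting).
Local Notation p := (s_p X).
Local Notation K := (s_K X).
Local Notation RR := (s_R X).

Definition T_mod : gmod RR := mx_gmod (@s_rho X).
(* [T^*(1)]: the module Z_p(1) is free of rank one, with action through the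
   cyclotomic character. *)
Definition Tdual1 : gmod RR := twisted_dual T_mod (@s_chi X).

Definition O_in_R : set RR := [set x | exists2 o, padic_integers o & s_emb X x = o%:A].

Definition Omega : set (set algC) := [set F | finite_ext K F /\ F `<=` s_KK X].

Definition S_of (F : set algC) : set (set algC) :=
  [set v | prime_of K v /\ (s_S X v \/ ~ unramified K F v)].

Definition Sigma_above (F : set algC) : set (set algC) :=
  [set w | prime_of F w /\ s_Sigma X (w `&` K)].

Definition H1Sigma (R : comPzRingType) (N : gmod R) (F : set algC) (U : set (set algC)) :
    lmodType R :=
  fibre_H1 p N (galf F) (galf (max_unr K F U)) (Sigma_above F)
    (fun w => decomp F (s_above X F w)).

Definition H0Sigma (R : comPzRingType) (N : gmod R) (F : set algC) : set N :=
  [set n | (forall s, galf F s -> gm_act N s n = n) /\ (forall w, Sigma_above F w -> n = 0)].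

Definition is_YK (y : 'I_(s_narch X) -> T_mod) : Prop :=
  forall i s, arch_decomp K (s_arch i) s -> gm_act T_mod s (y i) = y i.
Fact is_YK_0 : is_YK 0.
Proof. by move=> i s _; exact: gm_act0. Qed.
Fact is_YK_lin a y z : is_YK y -> is_YK z -> is_YK (a *: y + z).
Proof. by move=> hy hz i s Ds; apply: fixed_lin; [apply: hy | apply: hz]. Qed.
Definition YK : lmodType RR := submod (Subm is_YK_0 is_YK_lin).

Definition K1 : set algC := max_pext p K (hilbert_class_field K).

End Setting.
Arguments O_in_R X _ : clear implicits.
Arguments H0Sigma X {R} N F _.

Record coefficients (X : setting) := Coefficients {
  c_M : s_R X;
  c_M0 : s_Q X;
  c_M_emb : s_emb X c_M = c_M0%:A;
  c_M_int : padic_integers c_M0;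
  c_M_neq0 : c_M0 != 0;
  c_Mbar : nat;
  c_Mbar_pow : exists k, c_Mbar = (s_p X ^ k)%N;
  c_Mbar_dvd : padic_integers (c_Mbar%:R / c_M0);
  c_Mbar_min : forall k, padic_integers ((s_p X ^ k)%:R / c_M0) -> (c_Mbar <= s_p X ^ k)%N;

  (* [c_r] is the quotient of [s_R] by the ideal generated by [M]. *)
  c_r : comPzRingType;
  c_pi : {rmorphism s_R X -> c_r};
  c_pi_surj : forall y, exists x, c_pi x = y;
  c_pi_ker : forall x, c_pi x = 0 <-> exists y, x = c_M * y;

  c_E : set algC;
  c_E_Omega : Omega X c_E;
  c_E_unr : forall v, prime_of (s_K X) v -> ~ s_S X v -> unramified (s_K X) c_E v;
  c_Gamma : finZmodType;
  c_resE : gal -> c_Gamma;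
  c_resEP : is_quotient (galf (s_K X)) (galf c_E) c_resE;

  c_ray : set algC -> set algC;
  c_rayP : forall q, prime_of (s_K X) q -> ray_class_field (s_K X) q (c_ray q) }.

Section Coefficients.
Context (X : setting) (Y : coefficients X).
Local Notation p := (s_p X).
Local Notation K := (s_K X).

Definition RGam : comPzRingType := gring (c_r Y) (c_Gamma Y).
Definition r_to_R (c : c_r Y) : RGam := (c *: gdelta (c_r Y) 0 : gring (c_r Y) (c_Gamma Y)).
Definition RR_to_R (x : s_R X) : RGam := r_to_R (c_pi Y x).

(* [r[Gamma] (x) T / M T] *)
Definition A_mod : gmod RGam :=
  mx_gmod (fun s => (gdelta (c_r Y) (- c_resE Y s) : RGam) *: map_mx RR_to_R (s_rho X s)).
Definition R1 : gmod RGam := twist (RR_to_R \o s_chi X).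
Definition A_dual1 : gmod RGam := twisted_dual A_mod (RR_to_R \o s_chi X).

Definition units_roots : set algC :=
  [set x | let u := x ^+ c_Mbar Y in
    [/\ integers K u, integers K u^-1 & u != 0]].

Definition E_M : set algC :=
  field_gen (c_E Y `|` [set x | x ^+ c_Mbar Y = 1] `|` units_roots `|` K1 X).

Definition primes_P : set (set algC) :=
  [set q | [/\ prime_of K q, ~ s_S X q, ~ s_Sigma X q, splits_completely K E_M q &
    exists s (f : {linear A_mod -> RGam^o}),
      [/\ is_frob K (s_above X K q) s, forall y, exists x, f x = y &
          forall x, f x = 0 <-> exists y, x = gm_act A_mod s y - y]]].

(* A square-free product of primes in [primes_P] is given by the set of its prime divisors. *)
Definition squarefree_N : set (set (set algC)) :=
  [set n | finite_set n /\ n `<=` primes_P].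

Definition K_ray (q : set algC) : set algC := max_pext p K (c_ray Y q).
Definition K_n (n : set (set algC)) : set algC := field_gen (K `|` \bigcup_(q in n) K_ray q).
Definition E_n (n : set (set algC)) : set algC := field_gen (c_E Y `|` K_n n).

End Coefficients.

Definition D_at (X : setting) (q : set algC) : set gal :=
  decomp (s_K X) (s_above X (s_K X) q).
Definition I_at (X : setting) (q : set algC) : set gal :=
  inertia (s_K X) (s_above X (s_K X) q).

(* det(1 - s^-1 x | T) *)
Definition P_poly (X : setting) (s : gal) : {poly s_R X} :=
  \det (1%:M - 'X *: map_mx polyC (s_rho X s^-1%g)).

Record local_data (X : setting) (Y : coefficients X) (n : set (set algC)) (q : set algC) :=
  LocalData {
  l_Fr : gal;
  l_FrP : is_frob (s_K X) (s_above X (s_K X) q) l_Fr;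

  (* a lift of the polynomial [Q_q] *)
  l_Q : {poly s_R X};
  l_QP : forall i, exists y, (('X - 1) * l_Q - P_poly X l_Fr)`_i = c_M Y * y;

  (* An arbitrary isomorphism, such as the invariant map of local class field
     theory.  The maps [v_q], [phi^fs_q] and [phi^n_q] all depend linearly on it. *)
  l_inv : {linear H2 (s_p X) (R1 Y) (D_at X q) -> (RGam Y)^o};
  l_inv_bij : bijective l_inv;
  l_theta : {linear dual (fixed (A_mod Y) l_Fr) -> (RGam Y)^o};
  l_theta_bij : bijective l_theta;

  (* Gal(K(q)_q / K_q) *)
  l_Gq : finZmodType;
  l_resGq : gal -> l_Gq;
  l_resGqP : is_quotient (D_at X q) (galf (K_ray Y q)) l_resGq;
  (* Gal(E(n)_q / K_q) *)
  l_Dq : finZmodType;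
  l_resDq : gal -> l_Dq;
  l_resDqP : is_quotient (D_at X q) (galf (E_n Y n)) l_resDq;
  (* Gal(E(n) / E) *)
  l_Hn : finZmodType;
  l_resHn : gal -> l_Hn;
  l_resHnP : is_quotient (galf (c_E Y)) (galf (E_n Y n)) l_resHn;
  (* Gal(E(n/q) / E) *)
  l_Hnq : finZmodType;
  l_resHnq : gal -> l_Hnq;
  l_resHnqP : is_quotient (galf (c_E Y)) (galf (E_n Y (n `\ q))) l_resHnq;

  (* The inclusions in [l_Hn].  Those of [l_Gq] and [l_Hnq] come from the
     decomposition of [l_Hn] as a product: their images are trivial on
     E(n/q) and on K(q), respectively. *)
  l_inclDq : l_Dq -> l_Hn;
  l_inclDqP : forall s, D_at X q s -> l_inclDq (l_resDq s) = l_resHn s;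
  l_inclGq : l_Gq -> l_Hn;
  l_inclGqP : forall g, exists s t, [/\ galf (E_n Y (n `\ q)) s, l_resHn s = l_inclGq g,
    D_at X q t, l_resGq t = g & forall x, K_ray Y q x -> s x = t x];
  l_inclHnq : l_Hnq -> l_Hn;
  l_inclHnqP : forall h, exists s,
    [/\ galf (c_E Y) s, galf (K_ray Y q) s, l_resHnq s = h & l_resHn s = l_inclHnq h] }.

Section Local.
Context (X : setting) (Y : coefficients X) (n : set (set algC)) (q : set algC).
Context (L : local_data Y n q).
Local Notation p := (s_p X).
Local Notation K := (s_K X).
Local Notation R := (RGam Y).
Local Notation A := (A_mod Y).
Local Notation B := (A_dual1 Y).
Local Notation D := (D_at X q).
Local Notation Fr := (l_Fr L).
Local Notation AFr := (fixed A Fr).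
Local Notation BFr := (fixed B Fr).

Definition Q_act (N : gmod R) (s : gal) (x : N) : N :=
  \sum_(i < size (l_Q L)) RR_to_R Y (l_Q L)`_i *: iter i (gm_act N s) x.

(* Cup products with values in H^2(K_q, R(1)), induced by the evaluation of
   [B = A^*(1)] on [A] *)
Definition cup11 (x : H1 p B D) (c : H1 p A D) : H2 p (R1 Y) D :=
  cls2 p D (fun s t => val (rep1 x s) (gm_act A s (rep1 c t)) : R1 Y).
Definition cup20 (x : H2 p B D) (a : AFr) : H2 p (R1 Y) D :=
  cls2 p D (fun s t => val (rep2 x s t) (val a) : R1 Y).

(* H^2(K_q, A^*(1)) -> (A^{Fr = 1})^* -> R *)
Definition H2_dual (x : H2 p B D) : dual AFr := insubd 0 (fun a => l_inv L (cup20 x a)).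
Definition H2_to_R (x : H2 p B D) : R := l_theta L (H2_dual x).

(* [v] is the composite H^1(K_q, A^*(1)) -> H^1_{/f}(K_q, A^*(1)) -> R: the
   value on [a] of the form attached to [x] is the cup product of [x] with an
   unramified class whose value at [Fr] is the image of [a] under [- Q_q(Fr)^-1]. *)
Definition is_v_loc (v : H1 p B D -> R) : Prop :=
  forall x, exists l : dual AFr, v x = l_theta L l /\
    forall a : AFr, exists c : gal -> A,
      [/\ Z1 p A D (I_at X q) c, - Q_act Fr (c Fr) = val a &
          val l a = l_inv L (cup11 x (cls1 p D c))].

Definition v_q (v : H1 p B D -> R) (x : H1 p B (galf K)) : R := v (res1 D x).

(* The map from [H^1_{/f} = Hom(G_q, A^*(1)^{Fr = 1})] to H^1(K_q, A^*(1)) given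
   by inflation; it is a section of the projection to [H^1_{/f}]. *)
Definition infl_Gq (h : homZ (l_Gq L) BFr) : H1 p B D :=
  cls1 p D (fun s => val (val h (l_resGq L s))).

(* [phi] is the map phi^fs_q, where [v] is as in [is_v_loc]: [x] is the sum of
   an unramified class [f] and of a transverse class [t], and [y] is the image of
   [f] under the finite-singular comparison map. *)
Definition is_phi_fs (v : H1 p B D -> R) (phi : H1 p B (galf K) -> tens R^o (l_Gq L)) : Prop :=
  forall x, exists (f t : gal -> B) (y : tens (homZ (l_Gq L) BFr) (l_Gq L)),
    [/\ Z1 p B D (I_at X q) f, Z1 p B D (D `&` galf (K_ray Y q)) t,
        res1 D x = cls1 p D f + cls1 p D t,
        tlift (fun h g => val (val h g)) y = Q_act (Fr^-1)%g (f Fr) &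
        phi x = tmapl (fun h => v (infl_Gq h)) y].

(* The Bockstein map.  An element [s] acts on Z[D_q] as multiplication by the
   inverse of its image; it acts trivially on [J / J^2]. *)
Local Notation J := (submod (augideal (l_Dq L))).

Fact gring_actD s (x y : gring int (l_Dq L)) :
  gdelta int (- l_resDq L s) * (x + y) =
  gdelta int (- l_resDq L s) * x + gdelta int (- l_resDq L s) * y.
Proof. exact: mulrDr. Qed.
Fact J_actD s (x y : J) :
  gact (- l_resDq L s) (x + y) = gact (- l_resDq L s) x + gact (- l_resDq L s) y.
Proof. exact: gactD. Qed.

Definition B_ZD : gmod R := tens_gmod B gring_actD.
Definition B_J : gmod R := tens_gmod B J_actD.
Definition B_JJ2 : gmod R :=
  @tens_gmod R B (augquot (l_Dq L)) (fun _ => id) (fun _ _ _ => erefl).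

Definition J_to_ZD : B_J -> B_ZD := tmapr (fun j : J => val j).
Definition ZD_to_B : B_ZD -> B := tlift (fun (b : B) (d : gring int (l_Dq L)) => b *~ gaug d).
Definition J_to_JJ2 (c : H2 p B_J D) : H2 p B_JJ2 D :=
  cls2 p D (fun s t => tmapr (fun j : J => augcls (val j)) (rep2 c s t) : B_JJ2).

(* H^2(K_q, B) (x) J / J^2 = H^2(K_q, B (x) J / J^2) *)
Definition H2_tens (y : tens (H2 p B D) (augquot (l_Dq L))) : H2 p B_JJ2 D :=
  tlift (fun c j => cls2 p D (fun s t => tmk (rep2 c s t) j : B_JJ2)) y.

Local Notation H1Sn := (H1Sigma X B K (s_S X `|` n)).

Definition is_bockstein (phi : H1Sn -> tens R^o (augquot (l_Hn L))) : Prop :=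
  forall x, exists (c : H2 p B_J D) (y : tens (H2 p B D) (augquot (l_Dq L))),
    [/\ connecting J_to_ZD ZD_to_B (res1 D (fibre_to_H1 x)) c,
        H2_tens y = J_to_JJ2 c &
        phi x = tmapr (augpush (@l_inclDq _ _ _ _ L)) (tmapl H2_to_R y)].

Definition rho_q (y : tens R^o (l_Gq L)) : tens R^o (augquot (l_Hn L)) :=
  tmapr (augpush (@l_inclGq _ _ _ _ L)) (tmapr (@rho_aug (l_Gq L)) y).

(* P_q(Fr^-1) in r[H_{n/q}]; its augmentation is [P_q(1) = 0]. *)
Definition P_Fr : gring (c_r Y) (l_Hnq L) :=
  \sum_(i < size (P_poly X Fr)) c_pi Y (P_poly X Fr)`_i *: gdelta (c_r Y) (- l_resHnq L Fr) ^+ i.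
Definition P_Fr_aug : tens (c_r Y)^o (augquot (l_Hn L)) :=
  tmapr (augpush (@l_inclHnq _ _ _ _ L)) (tmapr (fun j => augcls (val j)) (to_aug P_Fr)).
Definition mul_P_Fr (v : R) : tens R^o (augquot (l_Hn L)) :=
  v *: tmapl (fun c => r_to_R c : R^o) P_Fr_aug.

End Local.

(* Main.v *)
(* Homomorphisms T from H_n to R separate the points of R (x) I_n / I_n^2, because
   the ring of integers of Q is a valuation ring; so it is enough to compare both
   sides after pairing with T.  Let a0 generate A^(Fr = 1).  Evaluated at a0 and
   paired with T, the Bockstein map sends a class x to minus the cup product of
   the restriction of T to the decomposition group with x(a0), in H^2(K_q, R(1)).
   Write T = w + u with w factoring through G_q and u unramified, and x = f + t
   with f unramified and t transverse.  The product of two unramified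
   homomorphisms vanishes, as H^2 of the profinite integers does on torsion
   modules.  The product of w with t(a0) vanishes because the pro-p part of tame
   inertia is cyclic: the product is then symmetric, while cup products are
   antisymmetric and p is odd.  The product of w with f(a0) is the finite-singular
   term, and that of u with t(a0) is the term P_q(Fr^-1) v_q, in view of
   P_q'(1) = Q_q(1) modulo M.  The extension K(q) / K is totally ramified at q
   because the subfield fixed by inertia lies in K(1), on which the decomposition
   group acts trivially as E contains K(1). *)
From HB Require Import structures.
From mathcomp Require Import all_boot all_order all_algebra all_fingroup all_field all_solvable.
From mathcomp Require Import all_classical generic_quotient.
From mathcomp Require Import ring.
Require Import Defs.
Set Implicit Arguments.
Unset Strict Implicit.
Unset Printing Implicit Defensive.
Import Order.TTheory GRing.Theory Num.Theory.
Local Open Scope classical_set_scope.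
Local Open Scope ring_scope.

(** * Automorphisms and Galois correspondence for subfields of algC *)

(** The maps [v], [phi_fs] and [phi] are characterised by relations, each through auxiliary cocycles
    that vary with the argument. They become comparable once everything is expressed by a single
    unramified cocycle [cc] with [- Q_q(Fr) (cc Fr) = a0]: then [eta * v x] is the invariant of the
    cup product of [x] with [cc], for a cancellable scalar [eta] that accounts for the arbitrary
    isomorphism [theta]. So the identity is proved after multiplication by [eta], with explicit
    2-cocycles, most of them products of two homomorphisms on [D]. The minus sign in the Bockstein
    map comes from the action by inverses on Z[D_q], and it is matched by the sign in
    [- Q_q(Fr)^-1]. The remaining weight lies in the arithmetic of [D]. A place is a prime ideal in
    the ring of all algebraic integers and [gal] is a bare group; accordingly limits of
    automorphisms are taken along ultrafilters, valuations are compared by a divisibility relation,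
    and residue fields are represented by roots of unity of order [N ^ n - 1]. *)

Fact gal_zmod_morphism (s : gal) : zmod_morphism s.
Proof.
have /asboolP[s1 sD sM _] := gal_funP s.
have s0 : s 0 = 0 by apply: (addrI (s 0)); rewrite -sD !addr0.
have sN y : s (- y) = - s y.
  by apply: (addrI (s y)); rewrite -sD !subrr.
by move=> x y; rewrite sD sN.
Qed.
HB.instance Definition _ (s : gal) := GRing.isZmodMorphism.Build algC algC s (gal_zmod_morphism s).
Fact gal_monoid_morphism (s : gal) : monoid_morphism s.
Proof. by have /asboolP[s1 sD sM _] := gal_funP s. Qed.
HB.instance Definition _ (s : gal) := GRing.isMonoidMorphism.Build algC algC s (gal_monoid_morphism s).

Lemma gal_mulE (s t : gal) x : (s * t)%g x = s (t x). Proof. by []. Qed.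
Lemma gal_oneE x : (1%g : gal) x = x. Proof. by []. Qed.
Lemma gal_invK (s : gal) : cancel s (s^-1)%g.
Proof. by move=> x; rewrite -gal_mulE mulVg. Qed.
Lemma gal_invVK (s : gal) : cancel (s^-1)%g s.
Proof. by move=> x; rewrite -gal_mulE mulgV. Qed.
Lemma gal_of_rmorphism (nu : {rmorphism algC -> algC}) : exists s : gal, forall x, s x = nu x.
Proof.
suff h : `[< is_autom nu >] by exists (Gal h).
apply/asboolP; split; rewrite ?rmorph1 //; first exact: rmorphD.
  exact: rmorphM.
by exists (algC_invaut nu); [exact: algC_autK | exact: algC_invautK].
Qed.

Lemma gal_Aint (s : gal) x : (s x \in Aint) = (x \in Aint).
Proof. exact: Aint_aut. Qed.

(** The minimal polynomial over the rationals is fixed by every automorphism, so its roots contain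
    the orbit. Finiteness of orbits is what makes limits of automorphisms exist. *)
Lemma gal_orbit (x : algC) : exists r : seq algC, forall g : gal, g x \in r.
Proof.
have [r Dr] := closed_field_poly_normal (minCpoly x).
exists r => g; have [p [Dp monp] dvp] := minCpolyP x.
have : root (minCpoly x) (g x).
  have E : map_poly g (minCpoly x) = minCpoly x.
    by rewrite Dp -map_poly_comp; apply: eq_map_poly => a /=; rewrite fmorph_rat.
  by rewrite -E fmorph_root root_minCpoly.
rewrite Dr (monicP (minCpoly_monic x)) scale1r root_prod_XsubC.
by [].
Qed.

(** Bridge to finite Galois theory: the splitting field of the product of the minimal polynomials of
    [s] embeds in [algC] with an image containing [s]. Questions on finitely many algebraic numbers
    are moved to such a [Q]. *)
Lemma normal_field (s : seq algC) : exists (Q : splittingFieldType rat) (i : {rmorphism Q -> algC}),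
  forall x, x \in s -> exists y, i y = x.
Proof.
pose mp (x : algC) := projT1 (minCpolyP x).
have mpE x : minCpoly x = map_poly ratr (mp x) by case: (projT2 (minCpolyP x)) => -[].
pose P := \prod_(x <- s) mp x.
have [r Dr] := closed_field_poly_normal (map_poly (ratr : rat -> algC) P).
have P0 : P != 0.
  rewrite prodf_seq_neq0; apply/allP => x _ /=.
  by have := monic_neq0 (minCpoly_monic x); rewrite mpE map_poly_eq0.
have [Qs [QsC [s1 Ds1 gen]]] := num_field_exists r.
have lc : lead_coef (map_poly (ratr : rat -> algC) P) != 0.
  by rewrite lead_coef_eq0 map_poly_eq0.
have ax : SplittingField.axiom Qs.
  exists (map_poly (in_alg Qs) P); first by apply/polyOverP => i; rewrite coef_map /= memvZ ?mem1v.
  exists s1 => //.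
  have h : map_poly QsC (map_poly (in_alg Qs) P) = map_poly ratr P.
    rewrite -map_poly_comp; apply: eq_map_poly => a /=.
    by rewrite rmorphZ_num rmorph1 mulr1.
  have e : map_poly QsC (\prod_(z <- s1) ('X - z%:P)) = \prod_(z <- r) ('X - z%:P).
    by rewrite rmorph_prod -Ds1 big_map; apply: eq_bigr => y _; rewrite /= map_polyXsubC.
  by rewrite -(eqp_map QsC) h e Dr eqp_scale.
pose Qm := FieldExt_isSplittingField.Build rat Qs ax.
pose Q : splittingFieldType rat := HB.pack Qs Qm.
exists Q, QsC => x xs.
have : x \in r.
  have : root (map_poly (ratr : rat -> algC) P) x.
    rewrite /root rmorph_prod horner_prod prodf_seq_eq0; apply/hasP; exists x => //=.
    by rewrite -mpE; exact: root_minCpoly.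
  by rewrite Dr rootZ // root_prod_XsubC.
by rewrite -Ds1 => /mapP[y _ ->]; exists y.
Qed.

Lemma ultra_fin (T : Type) (U : set_system T) (V : eqType) (f : T -> V) (r : seq V) :
  UltraFilter U -> (forall t, f t \in r) -> exists y, U [set t | f t = y].
Proof.
move=> UU fr; apply: contrapT => h.
suff : U [set t | f t \notin r].
  move=> /(@filter_ex _ U _)[t]; rewrite /= fr //.
have {}h y : U [set t | f t <> y].
  by have [|//] := in_ultra_setVsetC [set t | f t = y] UU => hy; case: h; exists y.
elim: r {fr} => [|y r IH]; first by apply: filterS filterT => t.
apply: filterS (filterI (h y) IH) => t [/= h1 h2].
by rewrite inE negb_or h2 andbT; apply/eqP.
Qed.

(** Compactness of the Galois group. Orbits being finite, each [g t x] is constant on a member of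
    [U]; the limits of the [g t] and of their inverses are inverse to each other. *)
Lemma ultra_gal (T : Type) (U : set_system T) (g : T -> gal) :
  UltraFilter U -> exists s : gal, forall x, U [set t | g t x = s x].
Proof.
move=> UU.
have h (k : T -> gal) x : exists y, U [set t | k t x = y].
  by have [r hr] := gal_orbit x; apply: (@ultra_fin _ _ _ _ r).
have [s hs] := choice (h g).
have [s' hs'] := choice (h (fun t => (g t)^-1%g)).
have E (P : Prop) : U [set t | P] -> P.
  by move=> /(@filter_ex _ U _)[].
suff H : `[< is_autom s >] by exists (Gal H).
apply/asboolP; split.
- by apply: E; apply: filterS (hs 1) => t /= <-; rewrite rmorph1.
- move=> x y; apply: E.
  by apply: filterS (filterI (hs (x + y)) (filterI (hs x) (hs y))) => t [/= <- [<- <-]]; rewrite rmorphD.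
- move=> x y; apply: E.
  by apply: filterS (filterI (hs (x * y)) (filterI (hs x) (hs y))) => t [/= <- [<- <-]]; rewrite rmorphM.
exists s' => x; apply: E.
  by apply: filterS (filterI (hs x) (hs' (s x))) => t [/= h1 <-]; rewrite -h1 gal_invK.
by apply: filterS (filterI (hs' x) (hs (s' x))) => t [/= h1 <-]; rewrite -h1 gal_invVK.
Qed.

Lemma subfield_Crat F x : is_subfield F -> x \in Crat -> F x.
Proof.
move=> [F1 FB FM FV] /CratP[a ->].
have F0 : F 0 by rewrite -(subrr 1); apply: FB.
have FN y : F y -> F (- y) by move=> Fy; rewrite -sub0r; apply: FB.
have FD y z : F y -> F z -> F (y + z).
  by move=> Fy Fz; rewrite -(opprK z); apply: FB => //; apply: FN.
have Fn (m : nat) : F m%:R.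
  by elim: m => [|m IH] //; rewrite -natr1; apply: FD.
have Fz (m : int) : F m%:~R.
  by case: m => m; [exact: Fn | rewrite NegzE mulrNz; apply: FN; exact: Fn].
by rewrite /ratr; apply: FM => //; apply: FV.
Qed.

Lemma subfield0 F : is_subfield F -> F 0.
Proof. by move=> hF; apply: subfield_Crat => //; rewrite rpred0. Qed.
Lemma subfieldD F x y : is_subfield F -> F x -> F y -> F (x + y).
Proof.
move=> hF Fx Fy; have [_ FB _ _] := hF; rewrite -(opprK y).
by apply: (FB) => //; rewrite -sub0r; apply: (FB) => //; exact: subfield0.
Qed.
Lemma subfield_sum F (I : Type) (r : seq I) (P : pred I) (f : I -> algC) :
  is_subfield F -> (forall j, P j -> F (f j)) -> F (\sum_(j <- r | P j) f j).
Proof.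
move=> hF h; elim/big_ind: _ => //; first exact: subfield0.
by move=> x y; apply: subfieldD.
Qed.

(** Finiteness over the rationals, in a form that passes to all subsets without a choice of
    basis. *)
Definition num_gen (F : set algC) : Prop := exists s : seq algC, forall x, F x -> x \in Crat_span s.

Lemma Crat_span_sum s (I : Type) (r : seq I) (c f : I -> algC) :
  (forall j, c j \in Crat) -> (forall j, f j \in s) -> \sum_(j <- r) c j * f j \in Crat_span s.
Proof.
by move=> hc hf; apply: rpred_sum => j _; apply: Crat_spanM => //; apply: mem_Crat_span.
Qed.

Lemma number_field_num_gen K : number_field K -> num_gen K.
Proof.
move=> [_ _ [n [b [_ h]]]]; exists (codom b) => x /h[c [[cQ ->] _]].
by apply: Crat_span_sum => j; [exact: cQ | exact: codom_f].
Qed.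

Lemma Crat_span_mul s t x y : x \in Crat_span s -> y \in Crat_span t ->
  x * y \in Crat_span [seq u * v | u <- s, v <- t].
Proof.
move=> /Crat_spanP[a ->] /Crat_spanP[b ->]; rewrite mulr_suml; apply: rpred_sum => j _.
rewrite mulr_sumr; apply: rpred_sum => k _; rewrite mulrACA -rmorphM.
by apply: Crat_spanZ; apply: mem_Crat_span; apply/allpairsP; exists (s`_j, t`_k); rewrite !mem_nth.
Qed.

Lemma finite_ext_num_gen K F : num_gen K -> finite_ext K F -> num_gen F.
Proof.
move=> [s hs] [_ _ [n [b [_ h]]]].
exists [seq u * v | u <- s, v <- codom b] => x /h[c [[cK ->] _]].
apply: rpred_sum => j _; apply: Crat_span_mul; first exact/hs/cK.
by apply: mem_Crat_span; exact: codom_f.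
Qed.

Lemma num_gen_sub F F' : num_gen F -> F' `<=` F -> num_gen F'.
Proof. by move=> [s hs] h; exists s => x /h/hs. Qed.

Section Bridge.
Context (Q : splittingFieldType rat) (i : {rmorphism Q -> algC}).

Lemma imageE s x : (forall y, y \in s -> exists z, i z = y) -> x \in Crat_span s ->
  exists z, i z = x.
Proof.
move=> h /Crat_spanP[a ->].
have /choice[f hf] : forall j : 'I_(size s), exists z, i z = s`_j.
  by move=> j; apply: h; apply: mem_nth.
exists (\sum_j a j *: f j); rewrite rmorph_sum; apply: eq_bigr => j _.
by rewrite rmorphZ_num hf.
Qed.

(** Among the subspaces contained in [P] take one of largest dimension: any vector of [P] outside it
    could be adjoined. *)
Lemma vspace_of (P : Q -> Prop) : P 0 -> (forall a x y, P x -> P y -> P (a *: x + y)) ->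
  exists V : {vspace Q}, forall y, y \in V <-> P y.
Proof.
move=> P0 Plin.
pose good (n : nat) := `[< exists V : {vspace Q}, \dim V = n /\ forall y, y \in V -> P y >].
have g0 : exists n, good n.
  exists 0%N; apply/asboolP; exists 0%VS; split; first exact: dimv0.
  by move=> y; rewrite memv0 => /eqP ->.
have gb n : good n -> (n <= \dim {:Q})%N.
  by move=> /asboolP[V [<- _]]; apply: dimvS; apply: subvf.
case: (ex_maxnP g0 gb) => n /asboolP[V [dV VP]] maxn.
exists V => y; split; first exact: VP.
move=> Py; apply: contraPT (leqnn n) => yV.
have := maxn (\dim (V + <[y]>)); rewrite leqNgt => h hn; apply/negP: hn.
have dd : \dim (V + <[y]>) = n.+1.
  rewrite dimv_disjoint_sum ?dV ?dim_vline.
    by case: eqP yV => [->|]; rewrite ?mem0v ?addn1.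
  apply/eqP; rewrite -subv0; apply/subvP => z /memv_capP[zV /vlineP[c zc]].
  case: (eqVneq c 0) => [c0|c0]; first by rewrite zc c0 scale0r mem0v.
  case/negP: yV; have -> : y = c^-1 *: z by rewrite zc scalerA mulVf ?scale1r.
  exact: memvZ.
have /h : good (\dim (V + <[y]>)).
  apply/asboolP; exists (V + <[y]>)%VS; split=> // z /memv_addP[u uV [w /vlineP[c ->] ->]].
  by rewrite addrC; apply: Plin => //; exact: VP.
by rewrite dd ltnSn.
Qed.

Lemma subfield_of F : is_subfield F -> exists FF : {subfield Q}, forall y, y \in FF <-> F (i y).
Proof.
move=> hF; have [F1 FB FM FV] := hF.
have [|a x y Fx Fy|V hV] := @vspace_of (fun y => F (i y)).
- by rewrite rmorph0; exact: subfield0.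
- rewrite rmorphD rmorphZ_num; apply: subfieldD => //; apply: FM => //.
  by apply: subfield_Crat => //; apply: Crat_rat.
have hA : is_aspace V.
  rewrite /is_aspace has_algid1 /=; last by apply/hV; rewrite rmorph1.
  by apply/prodvP => u v /hV Fu /hV Fv; apply/hV; rewrite rmorphM; apply: FM.
by exists (ASpace hA).
Qed.

Lemma ext_gal (phi : {rmorphism Q -> Q}) :
  exists g : gal, forall y, g (i y) = i (phi y).
Proof.
have [nu hnu] := extend_algC_subfield_aut i phi.
by have [g hg] := gal_of_rmorphism nu; exists g => y; rewrite hg -hnu.
Qed.

Lemma res_gal (K : set algC) (KK : {subfield Q}) (g : gal) :
  (forall y, y \in KK <-> K (i y)) -> galf K g ->
  exists2 phi : gal_of {:Q}%AS, phi \in ('Gal({:Q} / KK))%g & forall y, i (phi y) = g (i y).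
Proof.
move=> hK Kg; have [nu hnu] := restrict_aut_to_normal_num_field i g.
have kA : kAut KK {:Q} (linfun nu).
  rewrite kAutE subvf andbT; apply/kHomP; split=> [x y _ _|x xK]; first by rewrite !lfunE rmorphM.
  by rewrite lfunE /=; apply: (fmorph_inj i); rewrite hnu; apply: Kg; apply/hK.
have [phi h1 h2] := kAut_to_gal kA; exists phi => // y.
by rewrite -h2 ?memvf // lfunE hnu.
Qed.

Lemma galois_full (KK : {subfield Q}) : galois KK {:Q}.
Proof.
rewrite /galois subvf normalFieldf andbT /=.
by apply/separableP=> u _; apply: pcharf0_separable => r; rewrite pchar_lalg pchar_num.
Qed.

Context (K F : set algC) (KK FF : {subfield Q}).
Context (sfK : is_subfield K) (hK : forall y, y \in KK <-> K (i y)) (hF : forall y, y \in FF <-> F (i y)).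
Context (KF : K `<=` F) (imF : forall x, F x -> exists y, i y = x).

Lemma sub_KF : (KK <= FF)%VS.
Proof. by apply/subvP => y /hK/KF/hF. Qed.

Lemma degree_dim n : degree K F n <-> n = \dim_KK FF.
Proof.
rewrite -dim_aspaceOver ?sub_KF //.
have memV (y : Q) : (y \in vspaceOver KK FF) = (y \in FF) by rewrite mem_aspaceOver ?sub_KF.
have iZ (a : subvs_of KK) (y : fieldOver KK) : i (a *: y) = i (vsval a) * i y by rewrite -rmorphM.
have iK (a : subvs_of KK) : K (i (vsval a)) by apply/hK/subvsP.
split=> [[b [bF h]]|->].
  have /choice[c hc] j : exists y : fieldOver KK, i y = b j by have [y hy] := imF (bF j); exists y.
  suff : basis_of (vspaceOver KK FF) [tuple c j | j < n] by move/size_basis.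
  rewrite /basis_of eqEsubv andbC; apply/and3P; split.
  - apply/freeP => k; rewrite (eq_bigr (fun j => k j *: c j)) => [k0 j|j _]; last first.
      by rewrite -tnth_nth tnth_mktuple.
    have [|c0 [_ u]] := h 0; first by rewrite -(rmorph0 i); apply/hF; exact: mem0v.
    have /(congr1 (fun f : {ffun 'I_n -> algC} => f j)) :
        [ffun j => i (vsval (k j))] = 0 :> {ffun 'I_n -> algC}.
      rewrite -(u [ffun j => i (vsval (k j))]); last first.
        split=> [l|]; first by rewrite ffunE.
        under eq_bigr => l _ do rewrite ffunE -hc -iZ.
        by rewrite -rmorph_sum k0 rmorph0.
      apply: u; split=> [l|]; first by rewrite ffunE; exact: subfield0.
      by rewrite big1 // => l _; rewrite ffunE mul0r.
    by rewrite !ffunE -(rmorph0 i) => /fmorph_inj h0; apply: val_inj.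
  - apply/span_subvP => y /mapP[j _ ->]; rewrite memV; apply/hF; rewrite hc; exact: bF.
  apply/subvP => y; rewrite memV => /hF/h[a [[aK ya] _]].
  have /choice[a' ha'] j : exists y : subvs_of KK, i (vsval y) = a j.
    have [z hz] := imF (KF (aK j)).
    have zK : z \in KK by apply/hK; rewrite hz.
    by exists (Subvs zK).
  have -> : y = \sum_j (a' j *: (c j : fieldOver KK)).
    apply: (fmorph_inj i); rewrite ya rmorph_sum; apply: eq_bigr => j _.
    by rewrite iZ ha' hc.
  apply: memv_suml => j _; apply: memvZ; apply: memv_span.
  by apply/mapP; exists j; rewrite ?mem_enum.
set V := vspaceOver KK FF; pose bV := vbasis V.
exists (fun j => i bV`_j); split=> [j|x /[dup] Fx /imF[y yx]].
  by apply/hF; rewrite -memV; apply: vbasis_mem; rewrite mem_nth ?size_tuple.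
have yV : y \in V by rewrite memV; apply/hF; rewrite yx.
exists [ffun j => i (vsval (coord bV j y))]; split.
  split=> [j|]; first by rewrite ffunE.
  rewrite -yx {1}(coord_vbasis yV) rmorph_sum; apply: eq_bigr => j _.
  by rewrite ffunE -iZ.
move=> a [aK xa]; apply/ffunP => j; rewrite ffunE.
have /choice[a' ha'] l : exists y : subvs_of KK, i (vsval y) = a l.
  have [z hz] := imF (KF (aK l)).
  have zK : z \in KK by apply/hK; rewrite hz.
  by exists (Subvs zK).
have -> : y = \sum_l (a' l *: (bV`_l : fieldOver KK)).
  apply: (fmorph_inj i); rewrite yx xa rmorph_sum; apply: eq_bigr => l _.
  by rewrite iZ ha'.
by rewrite coord_sum_free ?ha' //; exact: basis_free (vbasisP V).
Qed.
End Bridge.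

Lemma galois_of (Q : splittingFieldType rat) (i : {rmorphism Q -> algC}) K F (KK FF : {subfield Q}) :
  (forall y, y \in KK <-> K (i y)) -> (forall y, y \in FF <-> F (i y)) ->
  galois_ext K F -> (forall x, F x -> exists y, i y = x) -> (forall x, K x -> exists y, i y = x) ->
  galois KK FF.
Proof.
move=> hK hF [_ KF stF] imF imK; have sKF : (KK <= FF)%VS by apply/subvP => y /hK/KF/hF.
rewrite /galois sKF /=; apply/andP; split.
  by apply/separableP=> u _; apply: pcharf0_separable => r; rewrite pchar_lalg pchar_num.
apply/forall_inP => phi; rewrite inE kAutfE => /kAHomP fixK.
have [g hg] := ext_gal i phi.
have Kg : galf K g.
  by move=> x /[dup] Kx /imK[y yx]; rewrite -yx hg; congr (i _); apply: fixK; apply/hK; rewrite yx.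
rewrite eqEdim limg_dim_eq ?leqnn ?andbT; last first.
  by apply/eqP; rewrite -subv0 (eqP (AEnd_lker0 _)) capv0.
by apply/subvP => _ /memv_imgP[y /hF Fy ->]; apply/hF; rewrite -hg; apply: stF.
Qed.

(** The finite Galois correspondence suffices: [x] and a spanning family of [K] lie in one normal
    field, and every automorphism of that field extends to [algC]. *)
Lemma fixed_in K x : is_subfield K -> num_gen K -> (forall g : gal, galf K g -> g x = x) -> K x.
Proof.
move=> sfK [s hs] hx; have [Q [i im]] := normal_field (x :: s).
have imK z : K z -> exists y, i y = z.
  by move=> /hs; apply: imageE => y ys; apply: im; rewrite inE ys orbT.
have [y yx] := im x (mem_head _ _).
have [KK hK] := subfield_of i sfK; rewrite -yx; apply/hK.
rewrite -(galois_fixedField (galois_full KK)); apply/fixedFieldP; first exact: memvf.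
move=> phi phiG; have [g hg] := ext_gal i phi.
apply: (fmorph_inj i); rewrite -hg yx; apply: hx => z /[dup] Kz /imK[w wz].
by rewrite -wz hg; congr (i _); apply: (fixed_gal (subvf _) phiG); apply/hK; rewrite wz.
Qed.

Lemma gal_of_exp (Q : splittingFieldType rat) (i : {rmorphism Q -> algC}) (FF : {subfield Q})
    (u : gal_of FF) (g : gal) n y :
  (forall y, y \in FF -> i (u y) = g (i y)) -> y \in FF ->
  i ((u ^+ n)%g y) = (g ^+ n)%g (i y).
Proof.
move=> h; elim: n y => [|n IH] y yF; first by rewrite !expg0 galois.gal_id.
by rewrite expgS galM // IH ?memv_gal // h // expgSr.
Qed.

Lemma galois_degree_exp K F n (s : gal) x : is_subfield K -> num_gen F -> galois_ext K F ->
  degree K F n -> galf K s -> F x -> (s ^+ n)%g x = x.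
Proof.
move=> sfK [r hr] galF dF Ks Fx; have [sfF KF _] := galF.
have [Q [i im]] := normal_field r.
have imF z : F z -> exists y, i y = z by move=> /hr; apply: imageE.
have imK z : K z -> exists y, i y = z by move=> /KF/imF.
have [KK hK] := subfield_of i sfK; have [FF hF] := subfield_of i sfF.
have galKF := galois_of hK hF galF imF imK.
have [phi phiG hphi] := res_gal hK Ks.
have sKF := sub_KF hK hF KF.
have /kAut_to_gal[u uG hu] : kAut KK FF phi.
  apply: (@normalField_kAut _ _ KK FF {:Q}%AS); rewrite ?sKF ?subvf //.
    by case/and3P: galKF.
  by rewrite -gal_kAut ?subvf.
have [y yx] := imF _ Fx; have yF : y \in FF by apply/hF; rewrite yx.
rewrite -yx -(gal_of_exp (u := u)) //; last by move=> z zF; rewrite -hu.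
suff -> : (u ^+ n)%g = 1%g by rewrite galois.gal_id.
rewrite (degree_dim sfK hK hF KF imF) in dF; rewrite dF galois_dim //.
by apply/eqP; rewrite -order_dvdn order_dvdG.
Qed.

(** By Cauchy's theorem every prime divisor of the order of the Galois group is the order of some
    element, and this order divides a power of [p]. *)
Lemma pext_degree p K F : prime p -> is_subfield K -> num_gen F -> galois_ext K F ->
  (forall s, galf K s -> exists k, forall x, F x -> (s ^+ (p ^ k))%g x = x) ->
  exists k, degree K F (p ^ k)%N.
Proof.
move=> p_pr sfK [r hr] galF hp; have [sfF KF _] := galF.
have [Q [i im]] := normal_field r.
have imF z : F z -> exists y, i y = z by move=> /hr; apply: imageE.
have imK z : K z -> exists y, i y = z by move=> /KF/imF.
have [KK hK] := subfield_of i sfK; have [FF hF] := subfield_of i sfF.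
have galKF := galois_of hK hF galF imF imK.
have sKF := sub_KF hK hF KF.
suff : p.-nat #|'Gal(FF / KK)%g|.
  move=> /p_natP[k hk]; exists k; apply/(degree_dim sfK hK hF KF imF).
  by rewrite galois_dim.
apply/pnatP => [|q q_pr]; first exact: cardG_gt0.
move=> /(Cauchy q_pr)[u uG uq]; rewrite -uq.
have [g hg] := ext_gal i u.
have Kg : galf K g.
  move=> x /[dup] Kx /imK[y yx]; rewrite -yx hg; congr (i _).
  by apply: (fixed_gal sKF uG); apply/hK; rewrite yx.
have [k hk] := hp g Kg.
have : (u ^+ (p ^ k))%g = 1%g.
  apply/eqP/gal_eqP => y yF; apply: (fmorph_inj i); rewrite galois.gal_id.
  by rewrite (gal_of_exp (g := g)) //; apply: hk; apply/hF.
move=> /eqP; rewrite -order_dvdn uq Euclid_dvdX // => /andP[+ _].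
by rewrite dvdn_prime2 // => /eqP ->; rewrite inE.
Qed.

(** * Places and their conjugates *)

Section Place.
Context (W : set algC) (pW : place W).

Lemma place_Aint x : W x -> x \in Aint.
Proof. by case: pW => [h _ _ _ _] /h[]. Qed.
Lemma placeB x y : W x -> W y -> W (x - y).
Proof. by case: pW => [_ _ h _ _]; apply: h. Qed.
Lemma place0 : W 0.
Proof. by case: pW => [_ [x Wx _] h _ _]; rewrite -(subrr x); apply: h. Qed.
Lemma placeN x : W x -> W (- x).
Proof. by move=> h; rewrite -sub0r; apply: placeB => //; apply: place0. Qed.
Lemma placeD x y : W x -> W y -> W (x + y).
Proof. by move=> h1 h2; rewrite -(opprK y); apply: placeB => //; apply: placeN. Qed.
Lemma placeM a x : a \in Aint -> W x -> W (a * x).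
Proof. by case: pW => [_ _ _ h _] aA; apply: h. Qed.
Lemma place1 : ~ W 1.
Proof. by case: pW => [_ _ _ _ []]. Qed.
Lemma place_prime x y : x \in Aint -> y \in Aint -> W (x * y) -> W x \/ W y.
Proof. by case: pW => [_ _ _ _ [_ h]] xA yA; apply: h. Qed.
Lemma placeX x n : x \in Aint -> W (x ^+ n) -> W x.
Proof.
move=> xA; elim: n => [|n IH]; first by rewrite expr0 => /place1.
by rewrite exprS => /(place_prime xA (rpredX n xA))[].
Qed.
Lemma place_sum (I : Type) (r : seq I) (P : pred I) (f : I -> algC) :
  (forall j, P j -> W (f j)) -> W (\sum_(j <- r | P j) f j).
Proof. by move=> h; elim/big_ind: _ => //; [exact: place0 | exact: placeD]. Qed.
Lemma place_prod (I : eqType) (r : seq I) (f : I -> algC) :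
  (forall j, j \in r -> f j \in Aint) -> W (\prod_(j <- r) f j) -> exists2 j, j \in r & W (f j).
Proof.
elim: r => [|x r IH] h; first by rewrite big_nil => /place1.
rewrite big_cons => /place_prime[||/=|].
- exact/h/mem_head.
- by rewrite big_seq rpred_prod // => j jr; apply: h; rewrite inE jr orbT.
- by exists x; rewrite ?mem_head.
move=> /IH[j jr|j jr Wj]; first by apply: h; rewrite inE jr orbT.
by exists j; rewrite // inE jr orbT.
Qed.
Lemma place_sub x y z : W (x - y) -> W (y - z) -> W (x - z).
Proof. by move=> h1 h2; rewrite -(subrKA y); apply: placeD. Qed.
Lemma place_sym x y : W (x - y) -> W (y - x).
Proof. by move=> /placeN; rewrite opprB. Qed.
Lemma place_subM x y x' y' : x \in Aint -> y' \in Aint ->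
  W (x - x') -> W (y - y') -> W (x * y - x' * y').
Proof.
move=> xA yA h1 h2; have -> : x * y - x' * y' = x * (y - y') + y' * (x - x').
  by rewrite !mulrBr (mulrC y') [y' * x']mulrC addrA subrK.
by apply: placeD; apply: placeM.
Qed.
Lemma place_subX x y n : x \in Aint -> y \in Aint -> W (x - y) -> W (x ^+ n - y ^+ n).
Proof.
move=> xA yA h; elim: n => [|n IH]; first by rewrite !expr0 subrr; exact: place0.
by rewrite !exprS; apply: place_subM => //; apply: rpredX.
Qed.

(** Gauss's lemma modulo [W]: if [a] and [b] are the least indices of coefficients outside [W], the
    coefficient of index [a + b] of the product is congruent to the product of these two. *)
Lemma place_gauss (p q : {poly algC}) : p \is a polyOver Aint -> q \is a polyOver Aint ->
  (forall j, W (p * q)`_j) -> (forall j, W p`_j) \/ (forall j, W q`_j).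
Proof.
move=> /polyOverP pA /polyOverP qA h.
have [|/existsNP hp] := pselect (forall j, W p`_j); first by left.
have [|/existsNP hq] := pselect (forall j, W q`_j); first by right.
have ex r : (exists x, ~ W (r : {poly algC})`_x) -> exists m, ~ W r`_m /\ forall j, (j < m)%N -> W r`_j.
  move=> [x hx]; pose P m := `[< ~ W r`_m >].
  have eP : exists m, P m by exists x; apply/asboolP.
  case: (ex_minnP eP) => m /asboolP hm min; exists m; split=> // j jm.
  by apply: contrapT => /asboolP/min; rewrite leqNgt jm.
have [a [ha mina]] := ex _ hp; have [b [hb minb]] := ex _ hq; exfalso.
suff : W (p`_a * q`_b) by move=> /place_prime[].
have lab : (a < (a + b).+1)%N by rewrite ltnS leq_addr.
have := h (a + b)%N; rewrite coefM (bigD1 (Ordinal lab)) //= addKn => hs.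
rewrite -(addrK (\sum_(i < (a + b).+1 | i != Ordinal lab) p`_i * q`_(a + b - i)) (p`_a * q`_b)).
apply: placeB => //; apply: place_sum => j jab.
have [ja|] := ltnP j a; first by rewrite mulrC; apply: placeM => //; apply: mina.
rewrite leq_eqVlt => /orP[/eqP aj|aj].
  by case/eqP: jab; apply: val_inj.
apply: placeM => //; apply: minb; rewrite ltn_subLR ?ltn_add2r //.
by rewrite -ltnS.
Qed.

Lemma place_gauss_prod (I : eqType) (r : seq I) (f : I -> {poly algC}) :
  (forall x, x \in r -> f x \is a polyOver Aint) ->
  (forall j, W (\prod_(x <- r) f x)`_j) -> exists2 x, x \in r & forall j, W (f x)`_j.
Proof.
elim: r => [|x r IH] h; first by rewrite big_nil => /(_ 0%N); rewrite coef1 => /place1.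
rewrite big_cons => /place_gauss[||/=|].
- exact/h/mem_head.
- by rewrite big_seq rpred_prod // => j jr; apply: h; rewrite inE jr orbT.
- by exists x; rewrite ?mem_head.
move=> /IH[j jr|j jr Wj]; first by apply: h; rewrite inE jr orbT.
by exists j; rewrite // inE jr orbT.
Qed.

End Place.

(** The conjugates of the tuple [s] are listed without repetition, so that [galf K] permutes the
    list and symmetric expressions in its members lie in [K]. *)
Lemma gal_tuples (K : set algC) (s : seq algC) : exists l : seq (seq algC),
  uniq l /\ forall t, (t \in l) <-> exists2 g, galf K g & t = [seq gal_fun g x | x <- s].
Proof.
have [l hl] : exists l : seq (seq algC), forall g : gal, [seq g x | x <- s] \in l.
  elim: s => [|x s [l IH]]; first by exists [:: [::]] => g; rewrite mem_head.
  have [r hr] := gal_orbit x; exists [seq y :: t | y <- r, t <- l] => g /=.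
  by apply/allpairsP; exists (g x, [seq g y | y <- s]); split=> //=.
exists (undup [seq t <- l | `[< exists2 g, galf K g & t = [seq gal_fun g x | x <- s] >]]).
split; first exact: undup_uniq.
move=> t; rewrite mem_undup mem_filter; split; first by case/andP=> /asboolP.
by move=> /[dup] [[g Kg ->] h]; rewrite hl andbT; apply/asboolP; exists g.
Qed.

Lemma galf1 K : galf K 1%g. Proof. by []. Qed.
Lemma galf_mul K (s t : gal) : galf K s -> galf K t -> galf K (s * t)%g.
Proof. by move=> hs ht x Kx; rewrite gal_mulE ht ?hs. Qed.
Lemma galf_inv K (s : gal) : galf K s -> galf K (s^-1)%g.
Proof. by move=> hs x Kx; rewrite -{1}(hs x) // gal_invK. Qed.
Lemma galf_exp K (s : gal) n : galf K s -> galf K (s ^+ n)%g.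
Proof. by move=> hs; elim: n => [|n IH]; rewrite ?expg0 // expgS; apply: galf_mul. Qed.

(** Regard [s] as the coefficients of a polynomial. The product of its conjugates has coefficients
    in [K] and in [W], hence in [W'], and by Gauss's lemma some conjugate has all its coefficients
    in [W']. Thus one [g] serves all of [s], where the norm of an element would handle only that
    element. *)
Lemma place_finite_conj K W W' (s : seq algC) : is_subfield K -> num_gen K ->
  place W -> place W' -> W `&` K `<=` W' -> (forall x, x \in s -> W x) ->
  exists2 g, galf K g & forall x, x \in s -> W' (gal_fun g x).
Proof.
move=> sfK gK pW pW' WK sW.
have [l [ul hl]] := gal_tuples K s.
pose P := \prod_(t <- l) Poly t.
have polyA t : t \in l -> Poly t \is a polyOver Aint.
  move=> /hl[g _ ->]; apply/polyOverP => j; rewrite coef_Poly.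
  have [js|js] := ltnP j (size s); last by rewrite nth_default ?size_map ?rpred0.
  by rewrite (nth_map 0) // gal_Aint; apply: (place_Aint pW); apply/sW/mem_nth.
have sl : s \in l.
  by apply/hl; exists 1%g => //; rewrite -[LHS]map_id; apply: eq_map.
have PK j : K P`_j.
  apply: fixed_in => // h Kh.
  suff E : map_poly h P = P by rewrite -[in RHS]E coef_map.
  have E t : map_poly h (Poly t) = Poly [seq h x | x <- t].
    apply/polyP => k; rewrite coef_map /= !coef_Poly.
    have [kt|kt] := ltnP k (size t); first by rewrite (nth_map 0).
    by rewrite !nth_default ?size_map // rmorph0.
  rewrite rmorph_prod /= (eq_bigr (fun t => Poly [seq h x | x <- t])) => [|t _]; last exact: E.
  rewrite -(big_map (map h) predT Poly); apply: perm_big; apply: uniq_perm => //.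
    by rewrite map_inj_uniq //; apply: inj_map; exact: fmorph_inj.
  move=> t; apply/mapP/idP => [[u /hl[g Kg ->] ->]|/hl[g Kg ->]].
    apply/hl; exists (h * g)%g; first exact: galf_mul.
    by rewrite -map_comp.
  exists [seq gal_fun (h^-1 * g)%g x | x <- s].
    by apply/hl; exists (h^-1 * g)%g => //; apply: galf_mul => //; apply: galf_inv.
  by rewrite -map_comp; apply: eq_map => x /=; rewrite gal_invVK.
have PW j : W P`_j.
  have remA : \prod_(t <- rem s l) Poly t \is a polyOver Aint.
    by rewrite big_seq rpred_prod // => t /mem_rem; exact: polyA.
  rewrite /P (perm_big _ (perm_to_rem sl)) big_cons coefM.
  apply: (place_sum pW) => k _; rewrite mulrC; apply: (placeM pW); first exact: (polyOverP remA).
  rewrite coef_Poly; have [ks|ks] := ltnP k (size s); first exact/sW/mem_nth.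
  by rewrite nth_default //; exact: place0.
have [t tl tW] := place_gauss_prod pW' polyA (fun j => WK _ (conj (PW j) (PK j))).
move/hl: tl tW => [g Kg ->] hW; exists g => // x xs.
have := hW (index x s); rewrite coef_Poly (nth_map 0) ?index_mem // nth_index //.
Qed.

(** Incomparability of primes with the same contraction. Let [x] be in [W'] and not in [W]. In an
    equation [f = g * 'X + c] of [x] modulo [W], the integer [c] lies in [W'], hence in [W]; so
    [g.[x] * x] lies in [W] and [x] satisfies the shorter equation [g]. The descent ends with 1 in
    [W]. *)
Lemma place_maximal W W' : place W -> place W' -> W `<=` W' ->
  W' `&` [set x : algC | x \in Crat] `<=` W -> W' `<=` W.
Proof.
move=> pW pW' WW' WQ x W'x; apply: contrapT => nWx.
have xA := place_Aint pW' W'x.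
suff H n : forall f : {poly int}, f \is monic -> size f = n.+1 ->
    W (map_poly intr f).[x] -> False.
  have [f [_ monf] fx] : exists2 f : {poly int}, (map_poly intr f = minCpoly x /\ f \is monic) &
      (map_poly intr f).[x] = 0.
    have /polyOverP hA : minCpoly x \is a polyOver Num.int by [].
    have [f hf] : exists f : {poly int}, map_poly intr f = minCpoly x.
      exists (map_poly Num.floor (minCpoly x)); rewrite -map_poly_comp_id0 ?floor0 //.
      by rewrite map_poly_id // => y /(nthP 0)[k _ <-] /=; rewrite floorK.
    exists f; last by rewrite hf; apply/eqP; exact: root_minCpoly.
    split=> //; have := minCpoly_monic x; rewrite -hf !monicE lead_coef_map_inj //; last exact: intr_inj.
    by rewrite -(rmorph1 intr) => /eqP/intr_inj ->.
  case sf : (size f) => [|m].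
    by move/eqP: sf; rewrite size_poly_eq0 (negPf (monic_neq0 monf)).
  by apply: (H m f) => //; rewrite fx; exact: place0.
elim: n => [|n IH] f monf sf Wf.
  have fc := size1_polyC (eq_leq sf).
  apply: (place1 pW); have : f`_0 = 1 by have /monicP := monf; rewrite /lead_coef sf.
  by move: Wf; rewrite fc map_polyC hornerC /= coefC /= => h e; rewrite e in h.
have [c [g fE]] : exists c (g : {poly int}), f = g * 'X + c%:P.
  by elim/poly_ind: {IH monf sf Wf} f => [|g c _]; [exists 0, 0; rewrite mul0r addr0 | exists c, g].
have g0 : g != 0.
  by apply/eqP => g0; move: sf; rewrite fE g0 mul0r add0r size_polyC; case: (c != 0).
have sg : size g = n.+1.
  by move: sf; rewrite fE size_MXaddC (negPf g0) /= => -[].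
have mong : g \is monic.
  have : lead_coef f = 1 by apply/monicP.
  rewrite fE lead_coefDl ?lead_coefMX ?monicE => [->//|].
  by rewrite size_mulX // sg size_polyC; case: (c != 0).
apply: (IH g mong sg).
move: Wf; rewrite fE rmorphD rmorphM /= map_polyX map_polyC hornerD hornerMX hornerC /= => Wf.
have gA : (map_poly intr g).[x] \in Aint.
  by apply: rpred_horner => //; apply/polyOverP => k; rewrite coef_map Aint_int.
have Wc : W (c%:~R : algC).
  apply: WQ; split; last exact: rpred_int.
  have -> : c%:~R = ((map_poly intr g).[x] * x + c%:~R) - (map_poly intr g).[x] * x :> algC.
    by rewrite addrAC subrr add0r.
  by apply: (placeB pW'); [apply: WW' | apply: (placeM pW')].
have : W ((map_poly intr g).[x] * x).
  by rewrite -(addrK (c%:~R : algC) (_ * x)); apply: placeB.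
by case/(place_prime pW gA xA).
Qed.

(** [place_finite_conj] treats each finite list; the automorphisms it gives have a limit along an
    ultrafilter which contains, for each [s], the set of lists containing [s]. The limit maps [W]
    into [W'], and incomparability gives equality. *)
Lemma place_conj K W W' : is_subfield K -> num_gen K -> place W -> place W' ->
  W `&` K = W' `&` K ->
  exists2 g : gal, galf K g & forall x, W x <-> W' (gal_fun g x).
Proof.
move=> sfK gK pW pW' WK.
have /choice[g hg] (t : seq algC) : exists g : gal, galf K g /\ forall x, x \in t -> W x -> W' (gal_fun g x).
  have [||g Kg h] := @place_finite_conj K W W' [seq x <- t | `[< W x >]] sfK gK pW pW'.
  - by rewrite WK => x [].
  - by move=> x; rewrite mem_filter => /andP[/asboolP].
  by exists g; split=> // x xt Wx; apply: h; rewrite mem_filter xt andbT; apply/asboolP.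
pose F : set_system (seq algC) := [set A : set (seq algC) | exists s : seq algC, forall t : seq algC, {subset s <= t} -> A t].
have PF : ProperFilter F.
  split; first by move=> [s /(_ s)]; apply.
  split; first by exists [::].
    by move=> A B [s hs] [t ht]; exists (s ++ t) => u hu; split; [apply: hs | apply: ht] => x xs;
      apply: hu; rewrite mem_cat xs ?orbT.
  by move=> A B AB [s hs]; exists s => t /hs/AB.
have [U [UU FU]] := ultraFilterLemma PF.
have [s hs] := ultra_gal g UU.
have Ks : galf K s.
  move=> x Kx; have [t /= <-] := filter_ex (hs x); exact: (hg t).1.
exists s => // x.
have Wsub y : W y -> W' (gal_fun s y).
  move=> Wy; have : U [set t : seq algC | y \in t].
    by apply: FU; exists [:: y] => t /(_ y); apply; rewrite mem_head.
  by move=> /(filterI (hs y))/filter_ex[t [/= <- yt]]; apply: (hg t).2.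
split; first exact: Wsub.
have pW'' : place [set x | W' (gal_fun s x)].
  split=> [y /(place_Aint pW')|||a y aA /= Wy|].
  - by rewrite gal_Aint.
  - case: pW' => _ [y Wy y0] _ _ _; exists ((s^-1)%g y); first by rewrite /= gal_invVK.
    by move=> h; apply: y0; rewrite -[y](gal_invVK s) h rmorph0.
  - by move=> y z /= h1 h2; rewrite rmorphB; apply: placeB.
  - by rewrite /= rmorphM; apply: placeM => //; rewrite gal_Aint; case: aA.
  split=> /=; first by rewrite rmorph1; exact: place1.
  by move=> y z [_ yA] [_ zA] /=; rewrite rmorphM; apply: place_prime; rewrite ?gal_Aint.
apply: (place_maximal pW pW'' Wsub).
move=> y [/= W'y yQ]; have Ky : K y by apply: subfield_Crat.
move: W'y; rewrite (Ks y Ky) => W'y.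
by have [] : (W `&` K) y by rewrite WK.
Qed.

(** * Frobenius elements and the structure of decomposition groups *)

Lemma gal_exp_fix (s : gal) n m x : (s ^+ n)%g x = x -> (s ^+ (n * m))%g x = x.
Proof. by move=> h; elim: m => [|m IH]; rewrite ?muln0 ?expg0 // mulnS expgD gal_mulE IH. Qed.

Lemma gal_period (s : gal) (L : seq algC) : exists2 n, (0 < n)%N & fixes L (s ^+ n)%g.
Proof.
have per x : exists2 n, (0 < n)%N & (s ^+ n)%g x = x.
  have [r hr] := gal_orbit x.
  have : ~~ uniq [seq (s ^+ k)%g x | k <- iota 0 (size r).+1].
    apply/negP => u; suff : ((size r).+1 <= size r)%N by rewrite ltnn.
    rewrite -{1}(size_iota 0 (size r).+1) -(size_map (fun k => (s ^+ k)%g x)).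
    by apply: uniq_leq_size => // _ /mapP[k _ ->].
  move=> /(uniqPn 0)[a [b [ab]]]; rewrite size_map size_iota => bl.
  have al := ltn_trans ab bl.
  rewrite !(nth_map 0%N) ?size_iota // !nth_iota // !add0n => E.
  exists (b - a)%N; rewrite ?subn_gt0 //.
  apply: (fmorph_inj (s ^+ a)%g) => /=.
  by rewrite -[LHS]gal_mulE -expgD subnKC // ltnW.
elim: L => [|x L [n n0 hn]]; first by exists 1%N.
have [m m0 hm] := per x; exists (n * m)%N; first by rewrite muln_gt0 n0.
move=> y; rewrite inE => /orP[/eqP ->|yL]; first by rewrite mulnC; apply: gal_exp_fix.
by apply: gal_exp_fix; apply: hn.
Qed.

Section Frobenius.
Context (K W : set algC) (sfK : is_subfield K) (pW : place W) (Fr : gal) (N : nat).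
Local Notation D := (decomp K W).
Local Notation I := (inertia K W).
Context (DFr : D Fr) (hN : residue_card K (W `&` K) N).
Context (hFr : forall x, x \in Aint -> W (Fr x - x ^+ N)).

Lemma decompP s x : D s -> W (s x) <-> W x. Proof. by case. Qed.
Lemma decomp_galf s : D s -> galf K s. Proof. by case. Qed.
Lemma decomp1 : D 1%g. Proof. by []. Qed.
Lemma decomp_mul s t : D s -> D t -> D (s * t)%g.
Proof.
move=> [Ks Ws] [Kt Wt]; split; first exact: galf_mul.
by move=> x; rewrite gal_mulE Ws Wt.
Qed.
Lemma decomp_inv s : D s -> D (s^-1)%g.
Proof.
move=> [Ks Ws]; split; first exact: galf_inv.
by move=> x; rewrite -Ws gal_invVK.
Qed.
Lemma decomp_exp s n : D s -> D (s ^+ n)%g.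
Proof. by move=> Ds; elim: n => [|n IH]; [rewrite expg0; exact: decomp1 | rewrite expgS; exact: decomp_mul]. Qed.
Lemma inertia_decomp s : I s -> D s. Proof. by case. Qed.

Lemma inertia_mul s t : I s -> I t -> I (s * t)%g.
Proof.
move=> [Ds Is] [Dt It]; split; first exact: decomp_mul.
move=> x xA; rewrite gal_mulE; apply: (place_sub pW) (It x xA).
by apply: Is; rewrite gal_Aint.
Qed.
Lemma inertia1 : I 1%g.
Proof. by split; [exact: decomp1 | move=> x _; rewrite gal_oneE subrr; exact: place0]. Qed.
Lemma inertia_inv s : I s -> I (s^-1)%g.
Proof.
move=> [Ds Is]; split; first exact: decomp_inv.
move=> x xA; apply/(decompP _ Ds); rewrite rmorphB /= gal_invVK; apply: (place_sym pW); exact: Is.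
Qed.
Lemma inertia_exp s n : I s -> I (s ^+ n)%g.
Proof. by move=> Is; elim: n => [|n IH]; [rewrite expg0; exact: inertia1 | rewrite expgS; exact: inertia_mul]. Qed.

Lemma residue_card_gt1 : (1 < N)%N.
Proof.
have [r [rK hr]] := hN.
have [a [ha _]] : exists! i, (W `&` K) (0 - r i).
  by apply: hr; split; [exact: subfield0 | exact: rpred0].
have [b [hb _]] : exists! i, (W `&` K) (1 - r i).
  by apply: hr; split; [case: sfK | exact: rpred1].
rewrite ltnNge; apply/negP => N1.
have ab : a = b by apply: val_inj; case: a b {ha hb} => [[|a] ha] [[|b] hb] //=; move: (leq_trans ha N1) (leq_trans hb N1).
apply: (place1 pW); rewrite -(subr0 1); apply: (place_sub pW hb.1).
by apply: (place_sym pW); rewrite -ab; case: ha.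
Qed.

(** Adding 1 permutes the [N] residue classes, and the sum over all classes of the change is [N]. *)
Lemma residue_card_mem : W N%:R.
Proof.
have [r [rK hr]] := hN.
have rA j : r j \in Aint by case: (rK j).
have /choice[f hf] (j : 'I_N) : exists k, W (r j + 1 - r k).
  have [|k [[hk _] _]] := hr (r j + 1); last by exists k.
  by split; [apply: subfieldD => //; [case: (rK j) | case: sfK] | rewrite rpredD ?rpred1].
have finj : injective f.
  move=> j k jk; have h : W (r j - r k).
    have := placeB pW (hf j) (hf k); rewrite jk.
    by rewrite opprB addrA subrK opprD addrACA subrr addr0.
  have [|l [_ u]] := hr (r j); first exact: rK.
  have <- : l = j by apply: u; rewrite subrr; split; [exact: place0 | exact: subfield0].
  apply: u; split=> //; case: sfK => _ FB _ _.
  by apply: FB; [case: (rK j) | case: (rK k)].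
have : W (\sum_j (r j + 1 - r (f j))) by apply: (place_sum pW).
rewrite sumrB big_split /= [X in _ - X](_ : _ = \sum_j r j).
  by rewrite addrAC subrr add0r sumr_const card_ord.
by symmetry; apply: (reindex_inj finj).
Qed.

Lemma expN_pred_mem n : (0 < n)%N -> ~ W (N ^ n).-1%:R.
Proof.
move=> n0 h; apply: (place1 pW).
have -> : 1 = (N ^ n)%:R - (N ^ n).-1%:R :> algC.
  by rewrite -natrB ?leq_pred // -subn1 subKn // expn_gt0 (ltnW residue_card_gt1).
apply: (placeB pW) => //; rewrite natrX -(prednK n0) exprS mulrC.
by apply: (placeM pW); [rewrite rpredX ?rpred_nat | exact: residue_card_mem].
Qed.

Lemma expN_pred_gt0 n : (0 < n)%N -> (0 < (N ^ n).-1)%N.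
Proof.
move=> n0; rewrite -subn1 subn_gt0 -(exp1n n) ltn_exp2r //; exact: residue_card_gt1.
Qed.

(** Roots of unity of order prime to the residue characteristic stay distinct modulo [W]: for
    [z = w / w'] different from 1 the sum of the first [m] powers vanishes, whereas for [z]
    congruent to 1 it is congruent to [m]. *)
Lemma unity_root_inj m (w w' : algC) : (0 < m)%N -> ~ W m%:R -> w ^+ m = 1 -> w' ^+ m = 1 ->
  W (w - w') -> w = w'.
Proof.
move=> m0 hm w1 w'1 h.
have Ax (z : algC) : z ^+ m = 1 -> z \in Aint.
  by move=> z1; apply: (Aint_unity_root m0); rewrite unity_rootE z1.
pose z := w * w' ^+ m.-1.
have wE : w = z * w' by rewrite /z -mulrA -exprSr prednK // w'1 mulr1.
have z1 : z ^+ m = 1 by rewrite exprMn w1 -exprM mulnC exprM w'1 expr1n mulr1.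
have hz : W (z - 1).
  have -> : z - 1 = w' ^+ m.-1 * (w - w').
    by rewrite mulrBr -exprSr prednK // w'1 /z mulrC.
  by apply: (placeM pW) => //; apply: rpredX; apply: Ax.
suff z11 : z = 1 by rewrite wE z11 mul1r.
apply: contrapT => /eqP z11; apply: hm.
have S0 : \sum_(k < m) z ^+ k = 0.
  by apply: (mulfI (x := z - 1)); rewrite ?subr_eq0 // -subrX1 z1 subrr mulr0.
have -> : m%:R = - \sum_(k < m) (z ^+ k - 1 ^+ k) :> algC.
  rewrite sumrB S0 sub0r opprK (eq_bigr (fun=> 1)) => [|k _]; last by rewrite expr1n.
  by rewrite sumr_const card_ord.
apply: (placeN pW); apply: (place_sum pW) => k _.
by apply: (place_subX pW) => //; exact: Ax.
Qed.

Lemma polyOver_Aint_factor (f : {poly algC}) x : f \is a polyOver Aint -> x \in Aint ->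
  exists2 g : {poly algC}, g \is a polyOver Aint & f = g * ('X - x%:P) + (f.[x])%:P.
Proof.
move=> fA xA; elim/poly_ind: f fA => [|f c IH] fA.
  by exists 0; rewrite ?rpred0 // mul0r horner0 addr0.
have {}fA : f \is a polyOver Aint.
  apply/polyOverP => j; have := polyOverP fA j.+1.
  by rewrite coefD coefMX coefC addr0.
have [g gA fE] := IH fA.
exists (g * 'X + (f.[x])%:P).
  by rewrite rpredD ?rpredM ?polyOverX // polyOverC rpred_horner.
rewrite hornerMXaddC polyCD polyCM {1}fE; set t := (f.[x])%:P; set u := x%:P.
ring.
Qed.

(** Division by ['X - x%:P] leaves the remainder [f.[x]], which lies in [W]; the other roots are not
    congruent to [x], so they remain roots of the quotient modulo [W]. *)
Lemma place_root_count (f : {poly algC}) (rs : seq algC) : f \is a polyOver Aint -> f \is monic ->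
  (forall x, x \in rs -> x \in Aint /\ W f.[x]) ->
  pairwise (fun x y => `[< ~ W (x - y) >]) rs -> (size rs < size f)%N.
Proof.
elim: rs f => [|x rs IH] f fA fm hf; first by rewrite size_poly_gt0 monic_neq0.
rewrite pairwise_cons => /andP[/allP hx hrs].
have [xA Wx] := hf x (mem_head _ _).
have sf1 : (1 < size f)%N.
  rewrite ltnNge; apply/negP => sf; apply: (place1 pW); move: Wx.
  have : f`_0 = 1.
    have /monicP := fm; rewrite /lead_coef.
    have : size f != 0%N by rewrite size_poly_eq0 monic_neq0.
    by case: (size f) sf => [|[]].
  by rewrite (size1_polyC sf) hornerC coefC /= => ->.
have [g gA fE] := polyOver_Aint_factor fA xA.
have g0 : g != 0.
  by apply: contraTneq sf1 => g0; rewrite fE g0 mul0r add0r size_polyC; case: eqP.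
have sgX : size (g * ('X - x%:P)) = (size g).+1.
  by rewrite size_Mmonic ?monicXsubC // size_XsubC addn2.
have sC : (size (f.[x])%:P < size (g * ('X - x%:P))%R)%N.
  by rewrite sgX size_polyC ltnS; apply: leq_trans (leq_b1 _) _; rewrite size_poly_gt0.
have sg : size g = (size f).-1 by rewrite {1}fE size_polyDl // sgX.
have gm : g \is monic.
  by have := fm; rewrite !monicE {1}fE lead_coefDl // lead_coefM lead_coefXsubC mulr1.
rewrite -(prednK (ltnW sf1)) ltnS -sg; apply: IH => // y yrs.
have [yA Wy] := hf y (mem_behead (s := x :: rs) yrs); split=> //.
have : W (g.[y] * (y - x)).
  have -> : g.[y] * (y - x) = f.[y] - f.[x].
    by rewrite {1}fE hornerD hornerM hornerXsubC hornerC addrK.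
  exact: placeB.
move=> h; have [||//|/(place_sym pW) h'] := place_prime pW _ _ h.
- exact: rpred_horner.
- exact: rpredB.
by have /asboolP := hx y yrs.
Qed.

Lemma frob_unity_root n (w : algC) : (0 < n)%N -> w ^+ (N ^ n).-1 = 1 -> Fr w = w ^+ N.
Proof.
move=> n0 w1; apply: (unity_root_inj (expN_pred_gt0 n0) (expN_pred_mem n0)).
- by rewrite -rmorphXn w1 rmorph1.
- by rewrite -exprM mulnC exprM w1 expr1n.
by apply: hFr; apply: (Aint_unity_root (expN_pred_gt0 n0)); rewrite unity_rootE w1.
Qed.

Lemma frobX_unity_root n (w : algC) j : (0 < n)%N -> w ^+ (N ^ n).-1 = 1 ->
  (Fr ^+ j)%g w = w ^+ (N ^ j).
Proof.
move=> n0 w1; elim: j => [|j IH]; first by rewrite expg0 expn0 expr1.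
by rewrite expgS gal_mulE IH rmorphXn /= (frob_unity_root n0 w1) -exprM expnS.
Qed.

Lemma unity_root_expN n (w : algC) : w ^+ (N ^ n).-1 = 1 -> w ^+ (N ^ n) = w.
Proof.
move=> w1; have /prednK <- : (0 < N ^ n)%N by rewrite expn_gt0 (ltnW residue_card_gt1).
by rewrite exprS w1 mulr1.
Qed.

(* An element fixed by the Frobenius is congruent to an element of [K], as the
   polynomial X^N - X has at most N roots modulo [W]. *)
Lemma frob_fixed_residue c : c \in Aint -> Fr c = c -> exists2 y, W (c - y) & K y.
Proof.
move=> cA Fc; apply: contrapT => hc; have [r [rK hr]] := hN.
have rA j : r j \in Aint by case: (rK j).
have sXN : size ('X^N - 'X : {poly algC}) = N.+1.
  by rewrite size_polyDl size_polyXn // size_polyN size_polyX ltnS residue_card_gt1.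
have : (size (c :: codom r) < size ('X^N - 'X : {poly algC})%R)%N.
  apply: place_root_count.
  - by rewrite rpredB ?rpredX ?polyOverX.
  - by rewrite monicE lead_coefDl ?lead_coefXn // size_polyN size_polyX size_polyXn ltnS residue_card_gt1.
  - move=> x; rewrite hornerD hornerXn hornerN hornerX inE => xr.
    have [xA Fx] : x \in Aint /\ Fr x = x.
      case/orP: xr => [/eqP ->|/codomP[j ->]] //; split=> //.
      by apply: (decomp_galf DFr); case: (rK j).
    by split=> //; apply: (place_sym pW); rewrite -{1}Fx; exact: hFr.
  rewrite pairwise_cons; apply/andP; split.
    apply/allP => _ /codomP[j ->]; apply/asboolP => h; apply: hc.
    by exists (r j) => //; case: (rK j).
  rewrite codomE pairwise_map; have := enum_uniq 'I_N; rewrite uniq_pairwise.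
  apply: sub_pairwise => a b /eqP ab; apply/asboolP => h; apply: ab.
  have [|l [_ u]] := hr (r a); first exact: rK.
  have <- : l = a by apply: u; rewrite subrr; split; [exact: place0 | exact: subfield0].
  apply: u; split=> //; case: sfK => _ FB _ _.
  by apply: FB; [case: (rK a) | case: (rK b)].
by rewrite /= size_codom card_ord sXN ltnn.
Qed.

(** The polynomial [g] whose roots are the Frobenius orbit of a primitive root [z] is fixed by [Fr],
    so its coefficients are congruent to elements of [K] and [s] moves them only within [W]. Hence
    [s z] is congruent to some member of the orbit, and [unity_root_inj] turns the congruence into
    an equality. *)
Lemma decomp_unity_root n s : (0 < n)%N -> D s -> exists2 j, (j < n)%N &
  forall w : algC, w ^+ (N ^ n).-1 = 1 -> s w = w ^+ (N ^ j).
Proof.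
move=> n0 Ds; have m0 := expN_pred_gt0 n0.
have [z pz] := C_prim_root_exists m0.
have z1 := prim_expr_order pz.
have zA : z \in Aint by exact: Aint_prim_root pz.
pose g := \prod_(j < n) ('X - (z ^+ (N ^ j))%:P).
have gA : g \is a polyOver Aint.
  by apply: rpred_prod => j _; rewrite polyOverXsubC rpredX.
have Fg : map_poly Fr g = g.
  rewrite rmorph_prod /=.
  rewrite (eq_bigr (fun j : 'I_n => 'X - (z ^+ (N ^ j.+1))%:P)) => [|j _]; last first.
    by rewrite map_polyXsubC rmorphXn /= (frob_unity_root n0 z1) -exprM expnS.
  rewrite /g; case: (n) n0 z1 => // m _ z1.
  rewrite [RHS]big_ord_recl big_ord_recr /= expn0 expr1 (unity_root_expN z1) mulrC.
  by congr (_ * _).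
have gs j : W (s g`_j - g`_j).
  have gjA : g`_j \in Aint by exact: (polyOverP gA).
  have [y Wy Ky] : exists2 y, W (g`_j - y) & K y.
    by apply: frob_fixed_residue; rewrite // -{2}Fg coef_map.
  apply: (place_sub pW (y := y)); last exact: (place_sym pW).
  by rewrite -(decomp_galf Ds Ky) -rmorphB; apply/(decompP _ Ds).
have : W (g.[s z]).
  have -> : g.[s z] = - ((map_poly s g).[s z] - g.[s z]).
    rewrite horner_map opprB [_.[z]](_ : _ = 0) ?rmorph0 ?subr0 //.
    apply/eqP; rewrite horner_prod prodf_seq_eq0; apply/hasP; exists (Ordinal n0).
      by rewrite mem_index_enum.
    by rewrite /= hornerXsubC expn0 expr1 subrr.
  rewrite -hornerN -hornerD; apply: (placeN pW); rewrite horner_coef; apply: (place_sum pW) => k _.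
  rewrite mulrC coefD coefN coef_map; apply: (placeM pW); last exact: gs.
  by apply: rpredX; rewrite gal_Aint.
rewrite horner_prod => /(place_prod pW)[j _|j _].
  by rewrite hornerXsubC rpredB ?rpredX ?gal_Aint.
rewrite hornerXsubC => Wj; exists j => // w w1.
have [k ->] := prim_rootP pz w1.
rewrite rmorphXn /= -!exprM mulnC exprM; congr (_ ^+ _).
apply: (unity_root_inj m0 (expN_pred_mem n0)) Wj.
  by rewrite -rmorphXn /= z1 rmorph1.
by rewrite -exprM mulnC exprM z1 expr1n.
Qed.

(** If [Fr ^+ n] fixes [x], then [x ^+ (N ^ n)] is congruent to [x], so [x] lies in [W] or is
    congruent to a root of unity of order dividing [(N ^ n).-1]. These roots thus represent all
    nonzero residues. *)
Lemma inertia_unity_root s : D s ->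
  (forall n (w : algC), (0 < n)%N -> w ^+ (N ^ n).-1 = 1 -> s w = w) -> I s.
Proof.
move=> Ds hs; split=> // x xA.
have [n n0 hn] := gal_period Fr [:: x]; have {}hn := hn x (mem_head _ _).
have FX k : W ((Fr ^+ k)%g x - x ^+ (N ^ k)).
  elim: k => [|k IH]; first by rewrite expg0 gal_oneE expn0 expr1 subrr; exact: place0.
  rewrite expgS gal_mulE; apply: (place_sub pW (y := Fr (x ^+ (N ^ k)))).
    by rewrite -rmorphB; apply/(decompP _ DFr).
  by rewrite rmorphXn /= expnS exprM; apply: place_subX; rewrite ?gal_Aint ?rpredX //; exact: hFr.
have := FX n; rewrite hn => /(place_sym pW) h.
have m0 := expN_pred_gt0 n0.
have : W (x * (x ^+ (N ^ n).-1 - 1)).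
  by rewrite mulrBr mulr1 -exprS prednK // expn_gt0 (ltnW residue_card_gt1).
case/(place_prime pW xA) => [|Wx|]; first by rewrite rpredB ?rpredX ?rpred1.
  by apply: (placeB pW) => //; apply/(decompP _ Ds).
have [z pz] := C_prim_root_exists m0.
have zA : z \in Aint by exact: Aint_prim_root pz.
have -> : x ^+ (N ^ n).-1 - 1 = \prod_(k < (N ^ n).-1) (x - z ^+ k).
  have := congr1 (horner^~ x) (factor_Xn_sub_1 pz).
  rewrite /= horner_prod hornerD hornerXn hornerN hornerC => <-.
  by rewrite big_mkord; apply: eq_bigr => k _; rewrite hornerXsubC.
case/(place_prod pW) => [k _|k _ Wk]; first by rewrite rpredB ?rpredX.
have e : s (z ^+ k) = z ^+ k.
  by apply: (hs n) => //; rewrite -exprM mulnC exprM (prim_expr_order pz) expr1n.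
apply: (place_sub pW (y := z ^+ k)); last exact: (place_sym pW).
by rewrite -{1}e -rmorphB; apply/(decompP _ Ds).
Qed.

End Frobenius.

Section FrobeniusStructure.
Context (K W : set algC) (sfK : is_subfield K) (pW : place W) (Fr : gal) (N : nat).
Local Notation D := (decomp K W).
Local Notation I := (inertia K W).
Context (DFr : D Fr) (hN : residue_card K (W `&` K) N).
Context (hFr : forall x, x \in Aint -> W (Fr x - x ^+ N)).

Lemma decomp_deg n s : (0 < n)%N -> D s -> exists2 j, (j < n)%N &
  forall w : algC, w ^+ (N ^ n).-1 = 1 -> s w = (Fr ^+ j)%g w.
Proof.
move=> n0 Ds; have [j jn hj] := decomp_unity_root sfK pW DFr hN hFr n0 Ds.
exists j => // w w1; rewrite hj //.
by rewrite (frobX_unity_root sfK pW hN hFr _ n0 w1).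
Qed.

(* [gamma] is the power of the Frobenius element, with exponent in the profinite
   completion of the integers, acting on the residue field as [s] does. *)
Lemma decomp_split s : D s -> exists gamma, [/\ D gamma, I (gamma^-1 * s)%g &
  forall n (L : seq algC), (0 < n)%N -> exists j, fixes L (gamma^-1 * Fr ^+ j)%g /\
    forall w : algC, w ^+ (N ^ n).-1 = 1 -> s w = (Fr ^+ j)%g w].
Proof.
move=> Ds.
(* Factorials, so that the exponent found at stage [m] is right for every positive [n <= m]. *)
have /choice[e he] (m : nat) : exists j, forall w : algC,
    w ^+ (N ^ m`!).-1 = 1 -> s w = (Fr ^+ j)%g w.
  by have [j _ hj] := decomp_deg (fact_gt0 m) Ds; exists j.
have hes m n (w : algC) : (0 < n <= m)%N -> w ^+ (N ^ n).-1 = 1 -> s w = (Fr ^+ e m)%g w.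
  move=> nm w1; apply: he; have /dvdnP[c ->] := dvdn_fact nm.
  have /dvdnP[c' ->] : ((N ^ n).-1 %| (N ^ (c * n)).-1)%N.
    by rewrite mulnC expnM; exact: dvdn_pred_predX.
  by rewrite mulnC exprM w1 expr1n.
pose F : set_system nat := [set A : set nat | exists m0, forall m, (m0 <= m)%N -> A m].
have PF : ProperFilter F.
  split; first by move=> [m /(_ m (leqnn m))].
  split; first by exists 0%N.
    move=> A B [a ha] [b hb]; exists (maxn a b) => m; rewrite geq_max => /andP[am bm].
    by split; [apply: ha | apply: hb].
  by move=> A B AB [m hm]; exists m => k /hm/AB.
have [U [UU FU]] := ultraFilterLemma PF.
have [gamma hg] := ultra_gal (fun m => Fr ^+ e m)%g UU.
have DX m : D (Fr ^+ e m)%g by exact: decomp_exp.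
have Dg : D gamma.
  split; first by move=> x Kx; have [m <-] := filter_ex (hg x); exact: (decomp_galf (DX m)).
  by move=> x; have [m <-] := filter_ex (hg x); exact: (decompP _ (DX m)).
have Uge m0 : U [set m | (m0 <= m)%N] by apply: FU; exists m0.
exists gamma; split=> //.
  apply: (inertia_unity_root sfK pW DFr hN hFr); first exact: decomp_mul (decomp_inv Dg) Ds.
  move=> n w n0 w1; rewrite gal_mulE.
  have [m [/= nm mw]] := filter_ex (filterI (Uge n) (hg w)).
  by rewrite (hes m n) ?n0 // mw gal_invK.
move=> n L n0.
have [m [/= nm mL]] : exists m, (n <= m)%N /\ forall x, x \in L -> (Fr ^+ e m)%g x = gamma x.
  suff /filter_ex[m [h1 h2]] : U [set m | (n <= m)%N /\ forall x, x \in L -> (Fr ^+ e m)%g x = gamma x].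
    by exists m.
  elim: L => [|x L IH]; first by apply: filterS (Uge n).
  apply: filterS (filterI (hg x) IH) => m [/= hx [nm hL]]; split=> // y.
  by rewrite inE => /orP[/eqP ->|/hL].
exists (e m); split; first by move=> x /mL h; rewrite gal_mulE h gal_invK.
by move=> w w1; apply: (hes m n) => //; rewrite n0.
Qed.

(** Density of the powers of [Fr] in [D] modulo inertia, without topology: [h] is the error made on
    approximating [gamma] by a power of [Fr] that agrees with it on [L]. *)
Lemma decomp_struct n (L : seq algC) s : (0 < n)%N -> D s ->
  exists j h i, [/\ s = (Fr ^+ j * h * i)%g, D h, fixes L h, I i &
    forall w : algC, w ^+ (N ^ n).-1 = 1 -> s w = (Fr ^+ j)%g w].
Proof.
move=> n0 Ds; have [gamma [Dg Ig /(_ n L n0)[j [hj hw]]]] := decomp_split Ds.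
exists j, (Fr ^- j * gamma)%g, (gamma^-1 * s)%g; split=> //.
- by rewrite !mulgA mulgV mul1g mulgV mul1g.
- exact: decomp_mul (decomp_inv (decomp_exp _ DFr)) Dg.
by move=> x xL; rewrite -{1}(hj x xL) -gal_mulE !mulgA mulgK mulVg.
Qed.

(* An unramified homomorphism is determined by its value on the Frobenius. *)
Lemma decomp_ind (P : gal -> Prop) (L : seq algC) :
  (forall j, P (Fr ^+ j)%g) ->
  (forall s h, D s -> D h -> fixes L h -> P s -> P (s * h)%g) ->
  (forall s i, D s -> I i -> P s -> P (s * i)%g) ->
  forall s, D s -> P s.
Proof.
move=> h1 h2 h3 s /(decomp_struct L (ltn0Sn 0))[j [h [i [-> Dh Lh Ii _]]]].
have Dj := decomp_exp j DFr.
by apply: h3 => //; [exact: decomp_mul | apply: h2].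
Qed.

(** The degree map from [D] to Z/n, read off from the action on a primitive root of unity of order
    [(N ^ n).-1], on which the first [n] powers of [Fr] differ. *)
Lemma frob_deg n : (0 < n)%N -> exists (d : gal -> nat) (L : seq algC),
  [/\ forall s j, D s -> (forall w : algC, w ^+ (N ^ n).-1 = 1 -> s w = (Fr ^+ j)%g w) -> d s = (j %% n)%N,
      forall s t, D s -> D t -> (d s + d t = d (s * t)%g %[mod n])%N,
      forall s, D s -> forall w : algC, w ^+ (N ^ n).-1 = 1 -> s w = (Fr ^+ d s)%g w &
      forall s h, D s -> D h -> fixes L h -> d (s * h)%g = d s].
Proof.
move=> n0; have m0 := expN_pred_gt0 sfK pW hN n0.
have [z pz] := C_prim_root_exists m0; have z1 := prim_expr_order pz.
have FrX j : (Fr ^+ j)%g z = z ^+ (N ^ j) by exact: (frobX_unity_root sfK pW hN hFr j n0 z1).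
have N1 := residue_card_gt1 sfK pW hN.
have FrXn j : (Fr ^+ j)%g z = (Fr ^+ (j %% n))%g z.
  rewrite {1}(divn_eq j n) addnC expgD gal_mulE; congr (gal_fun _ _).
  rewrite mulnC; apply: gal_exp_fix; rewrite FrX.
  by apply: (unity_root_expN sfK pW hN z1).
have inj j k : (j < n)%N -> (k < n)%N -> (Fr ^+ j)%g z = (Fr ^+ k)%g z -> j = k.
  wlog jk : j k / (j <= k)%N.
    by move=> H jn kn e; case: (leqP j k) => [/H|/ltnW/H h]; [apply | apply/esym/h].
  move=> jn kn; have := kn; rewrite -[k](subnKC jk) expgD gal_mulE => kn' /fmorph_inj e.
  have {e} : z ^+ 1 = z ^+ (N ^ (k - j)) by rewrite -FrX expr1.
  case: (posnP (k - j)) => [-> //|kj] /eqP; first by rewrite addn0.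
  rewrite (eq_prim_root_expr pz) => h; exfalso.
  have lt : (N ^ (k - j) < (N ^ n).-1)%N.
    apply: (@leq_ltn_trans (N ^ n.-1)); first by rewrite leq_exp2l // -ltnS prednK // (leq_ltn_trans (leq_subr _ _) kn).
    have n2 : (1 < n)%N by apply: leq_ltn_trans kn; apply: leq_trans kj (leq_subr _ _).
    rewrite -ltnS prednK ?expn_gt0 ?(ltnW N1) // -{2}(prednK n0) expnS.
    apply: (@leq_trans (2 * N ^ n.-1)); last by rewrite leq_mul2r N1 orbT.
    rewrite mul2n -addnn -addn2 leq_add2l.
    apply: (@leq_trans (N ^ 1)); first by rewrite expn1.
    by rewrite leq_exp2l // -ltnS prednK.
  have gt1 : (1 < N ^ (k - j))%N by rewrite -(exp1n (k - j)) ltn_exp2r.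
  by move: h; rewrite /eqn !modn_small ?(ltn_trans gt1) // => /eqP e; rewrite -e ltnn in gt1.
have /choice[d hd] s : exists j, D s -> (j < n)%N /\
    forall w : algC, w ^+ (N ^ n).-1 = 1 -> s w = (Fr ^+ j)%g w.
  have [Ds|nDs] := pselect (D s); last by exists 0%N.
  by have [j jn hj] := decomp_deg n0 Ds; exists j.
have d1 s j : D s -> (forall w : algC, w ^+ (N ^ n).-1 = 1 -> s w = (Fr ^+ j)%g w) -> d s = (j %% n)%N.
  move=> Ds h; have [dn hds] := hd s Ds; apply: inj; rewrite ?ltn_mod //.
  by rewrite -FrXn -h // hds.
exists d, [:: z]; split=> // [s t Ds Dt|s Ds|s h Ds Dh Lh].
- have [dn hds] := hd s Ds; have [dn' hdt] := hd t Dt.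
  rewrite (d1 (s * t)%g (d s + d t)%N) ?modn_mod //; first exact: decomp_mul.
  move=> w w1; rewrite gal_mulE hdt // hds; last by rewrite -rmorphXn w1 rmorph1.
  by rewrite -gal_mulE -expgD.
- by have [] := hd s Ds.
have [dn hds] := hd s Ds; apply/esym; have [dn' hdt] := hd _ (decomp_mul Ds Dh).
apply: inj => //; rewrite -hds // -hdt // gal_mulE Lh //; exact: mem_head.
Qed.

(* H^2 of the profinite completion of the integers vanishes on torsion modules. *)
Lemma unramified_coboundary (V : zmodType) (P : nat) (phi : gal -> gal -> V) (L : seq algC) :
  (0 < P)%N -> (forall v : V, v *+ P = 0) ->
  (forall s t u, D s -> D t -> D u ->
     phi t u - phi (s * t)%g u + phi s (t * u)%g - phi s t = 0) ->
  (forall s t g, D s -> D t -> D g -> I g \/ fixes L g ->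
     phi (s * g)%g t = phi s t /\ phi s (t * g)%g = phi s t) ->
  (forall s, D s -> phi s 1%g = 0 /\ phi 1%g s = 0) ->
  exists (g : gal -> V) (L' : seq algC),
    (forall s h, D s -> D h -> fixes L' h -> g (s * h)%g = g s) /\
    forall s t, D s -> D t -> phi s t = g t - g (s * t)%g + g s.
Proof.
move=> P0 VP coc inv nrm; have [n n0 hn] := gal_period Fr L.
have DX j := decomp_exp j DFr.
pose f i j := phi (Fr ^+ i)%g (Fr ^+ j)%g.
have fn1 i j k : f (i + n * k)%N j = f i j.
  elim: k => [|k IH]; first by rewrite muln0 addn0.
  rewrite mulnS addnCA addnC -IH /f expgD; apply: (inv _ _ _ _ _ _ _).1 => //.
  by right.
have fn2 i j k : f i (j + n * k)%N = f i j.
  elim: k => [|k IH]; first by rewrite muln0 addn0.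
  rewrite mulnS addnCA addnC -IH /f expgD; apply: (inv _ _ _ _ _ _ _).2 => //.
  by right.
(* On powers of [Fr] the cocycle relation makes [f] the coboundary of minus its partial sums. These
   are additive along multiples of [n], so the torsion of [V] makes [G] periodic of period [n * P],
   and it extends to [D] through the degree map. *)
pose G j := - \sum_(i < j) f i 1%N.
have GS j : G j.+1 = G j - f j 1%N by rewrite /G big_ord_recr opprD.
have GE i j : G j - G (i + j)%N + G i = f i j.
  elim: j => [|j IH].
    by rewrite addn0 subrK /G big_ord0 oppr0 /f expg0 (nrm _ (DX i)).1.
  have h : f i j.+1 = f i j - f j 1%N + f (i + j)%N 1%N.
    have := coc _ _ _ (DX i) (DX j) (DX 1%N); rewrite -!expgD addn1 => /eqP.
    rewrite subr_eq0 => /eqP e; rewrite /f -e -(addrA _ (- _)) (addrC (- phi (Fr ^+ j)%g _)).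
    by rewrite -[X in _ = _ + X]opprB addrAC subrr add0r.
  by rewrite addnS !GS h -IH opprB (AC (2*2*1) (1*4*5*2*3)).
have f0 i : f 0%N i = 0 by rewrite /f expg0 (nrm _ (DX i)).2.
have Gn j k : G (j + n * k)%N = G j + G (n * k)%N.
  have /eqP := GE (n * k)%N j; rewrite -[(n * k)%N]add0n fn1 f0 add0n.
  by rewrite addrAC subr_eq0 (addnC (n * k)%N) => /eqP.
have GnP k : G (n * k)%N = G n *+ k.
  elim: k => [|k IH]; first by rewrite muln0 /G big_ord0 oppr0.
  by rewrite mulnS Gn IH mulrS.
have GP j k : G (j + n * P * k)%N = G j by rewrite -mulnA Gn GnP mulrnA VP mul0rn addr0.
have nP0 : (0 < n * P)%N by rewrite muln_gt0 n0.
have [d [L' [d1 d2 d3 d4]]] := frob_deg nP0.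
exists (fun s => G (d s)), L'; split=> [s h Ds Dh Lh|s t Ds Dt]; first by rewrite d4.
have Gmod j : G (j %% (n * P))%N = G j by rewrite [in RHS](divn_eq j (n * P)) addnC (mulnC (j %/ _)%N) GP.
rewrite -(Gmod (d (s * t)%g)) -d2 // Gmod GE.
have red s' : D s' -> exists j, [/\ d s' = (j %% (n * P))%N,
    forall t', D t' -> phi s' t' = phi (Fr ^+ j)%g t' & forall t', D t' -> phi t' s' = phi t' (Fr ^+ j)%g].
  move=> Ds'; have [j [h [i [-> Dh Lh Ii hj]]]] := decomp_struct L nP0 Ds'.
  have Di := inertia_decomp Ii; have Djh := decomp_mul (DX j) Dh.
  exists j; split=> [|t' Dt'|t' Dt'].
  - by apply: d1 => //; exact: decomp_mul.
  - rewrite (inv _ _ _ Djh Dt' Di _).1; last by left.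
    by rewrite (inv _ _ _ (DX j) Dt' Dh _).1 //; right.
  - rewrite (inv _ _ _ Dt' Djh Di _).2; last by left.
    by rewrite (inv _ _ _ Dt' (DX j) Dh _).2 //; right.
have [j [-> hj1 _]] := red s Ds; have [k [-> _ hk2]] := red t Dt.
rewrite hj1 // hk2 // -/(f j k).
rewrite {1}(divn_eq j (n * P)) {1}(divn_eq k (n * P)) addnC (addnC (k %/ _ * _)%N).
by rewrite (mulnC (j %/ _)%N) (mulnC (k %/ _)%N) -!mulnA fn1 fn2.
Qed.

End FrobeniusStructure.

(** * Valuation rings of places *)

Lemma minCpoly_int (x : algC) : x \in Aint ->
  exists2 f : {poly int}, f \is monic & map_poly intr f = minCpoly x.
Proof.
move=> xA; have /polyOverP hA : minCpoly x \is a polyOver Num.int by [].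
have hf : map_poly intr (map_poly Num.floor (minCpoly x)) = minCpoly x.
  rewrite -map_poly_comp_id0 ?floor0 //.
  by rewrite map_poly_id // => y /(nthP 0)[k _ <-] /=; rewrite floorK.
exists (map_poly Num.floor (minCpoly x)) => //.
have := minCpoly_monic x; rewrite -{1}hf !monicE lead_coef_map_inj //; last exact: intr_inj.
by rewrite -(rmorph1 intr) => /eqP/intr_inj ->.
Qed.

Lemma Aint_integral (x : algC) : x \in Aint <-> integralOver (intr : int -> algC) x.
Proof.
split=> [/minCpoly_int[f fm ff]|[f fm fx]].
  by exists f => //; rewrite ff; exact: root_minCpoly.
apply: root_monic_Aint fx _ _; first exact: monic_map.
by apply/polyOverP => j; rewrite coef_map /=; exact: intr_int.
Qed.

Lemma Aint_integrally_closed (p : {poly algC}) x :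
  p \is monic -> p \is a polyOver Aint -> root p x -> x \in Aint.
Proof.
move=> pm /polyOverP pA px; apply/Aint_integral.
apply: (integral_root_monic pm px); apply/integral_poly => j; exact/Aint_integral.
Qed.

Section Seidenberg.
Context (F : fieldType) (A W : F -> Prop).
Context (A1 : A 1) (AB : forall x y, A x -> A y -> A (x - y)) (AM : forall x y, A x -> A y -> A (x * y)).
Context (A_closed : forall (p : {poly F}) x, p \is monic -> (forall j, A p`_j) -> root p x -> A x).

Let A0 : A 0. Proof. by rewrite -(subrr 1); exact: AB. Qed.
Let AD x y : A x -> A y -> A (x + y).
Proof. by move=> hx hy; rewrite -(opprK y); apply: (AB) => //; rewrite -sub0r; exact: AB. Qed.
Let AX x n : A x -> A (x ^+ n).
Proof. by move=> hx; elim: n => [|n IH]; rewrite ?expr0 ?exprS //; exact: AM. Qed.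

(** Multiplied by a power of [c], the equation becomes monic in [c * z]. The coefficients are listed
    from the leading one down and evaluated by Horner's scheme, so that the next Horner value
    [c * z + d] can play the role of leading coefficient in a shorter equation. *)
Lemma horner_integral (z c : F) (s : seq F) : A c -> (forall x, x \in s -> A x) -> s != [::] ->
  foldl (fun y a => y * z + a) c s = 0 -> A (c * z).
Proof.
move=> cA sA s0 h; have [->|c0] := eqVneq c 0; first by rewrite mul0r; exact: A0.
suff [p [pm pA pE]] : exists p : {poly F}, [/\ p \is monic, forall j, A p`_j &
    c * p.[c * z] = c ^+ (size s) * foldl (fun y a => y * z + a) c s].
  apply: (A_closed pm pA); rewrite /root; apply/eqP/(mulfI c0).
  by rewrite pE h !mulr0.
elim/last_ind: {s0 h} s sA => [|s a IH] sA.
  exists 1; rewrite monic1 hornerC /= expr0 mul1r mulr1; split=> // j.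
  by rewrite coef1; case: (j == 0)%N; [exact: A1 | exact: A0].
have aA : A a by apply: sA; rewrite mem_rcons mem_head.
have [|p [pm pA pE]] := IH; first by move=> x xs; apply: sA; rewrite mem_rcons inE xs orbT.
exists (p * 'X + (c ^+ size s * a)%:P); split.
- rewrite monicE lead_coefDl ?lead_coefMX //.
  rewrite size_polyC size_mulX ?monic_neq0 // ltnS.
  by apply: leq_trans (leq_b1 _) _; rewrite size_poly_gt0 monic_neq0.
- move=> j; rewrite coefD coefMX coefC; apply: AD; case: (j == 0)%N => //; try exact: A0.
  by apply: AM => //; exact: AX.
rewrite hornerMXaddC size_rcons foldl_rcons mulrDr (mulrA c p.[c * z]) pE exprS; ring.
Qed.

Context (W0 : W 0) (WB : forall x y, W x -> W y -> W (x - y)).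

(* Seidenberg's lemma: a root of a polynomial with coefficients in the integrally
   closed ring [A], not all in the ideal [W], is in A_W or is the inverse of an
   element of A_W. *)
Lemma val_ring_horner (z c : F) (s : seq F) : A c -> (forall x, x \in s -> A x) ->
  foldl (fun y a => y * z + a) c s = 0 -> (exists2 x, x \in c :: s & ~ W x) ->
  (exists a b, [/\ A a, A b, ~ W b & z * b = a]) \/ (exists a b, [/\ A a, A b, ~ W b & z^-1 * b = a]).
Proof.
elim: s c => [|d s IH] c cA sA h [x xs nW].
  by exfalso; apply: nW; move: xs; rewrite inE => /eqP ->; rewrite (h : c = 0); exact: W0.
have czA : A (c * z) by apply: horner_integral h.
have dA : A d by apply: sA; exact: mem_head.
have sA' y : y \in s -> A y by move=> ys; apply: sA; rewrite inE ys orbT.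
have eA : A (c * z + d) by exact: AD.
(* If the equation with leading coefficient [c * z + d] still has a coefficient outside [W],
   induction applies. Otherwise only [c] and [d] can be outside [W]. If [c] is, [z = c * z / c]; if
   not, [d] is, so [c * z] is outside [W] and [z^-1 = c / (c * z)]. *)
have [H|H] := pselect (exists2 x, x \in c * z + d :: s & ~ W x); first exact: (IH (c * z + d)).
have Ws y : y \in c * z + d :: s -> W y by move=> ys; apply: contrapT => nWy; apply: H; exists y.
have [Wc|nWc] := pselect (W c); last by left; exists (c * z), c; split=> //; rewrite mulrC.
have nWd : ~ W d.
  move=> Wd; apply: nW; move: xs; rewrite !inE => /or3P[/eqP ->|/eqP ->|xs] //.
  by apply: Ws; rewrite inE xs orbT.
have nWcz : ~ W (c * z).
  move=> Wcz; apply: nWd; rewrite -(addrK (c * z) d); apply: (WB) _ Wcz.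
  by rewrite addrC; apply: Ws; exact: mem_head.
right; exists c, (c * z); split=> //.
have z0 : z != 0 by apply/eqP => z0; apply: nWcz; rewrite z0 mulr0; exact: W0.
by rewrite mulrCA mulVf ?mulr1.
Qed.
End Seidenberg.

Lemma cross_expr (R : idomainType) (u v a b c d : R) n : v != 0 ->
  u ^+ n * d = v ^+ n * c -> u * b = v * a -> b ^+ n * c = d * a ^+ n.
Proof.
move=> v0 e e'; apply: (mulfI (expf_neq0 n v0)).
transitivity (b ^+ n * (u ^+ n * d)); first by rewrite e; ring.
transitivity ((u * b) ^+ n * d); first by rewrite exprMn; ring.
by rewrite e' exprMn; ring.
Qed.

Section Valuation.
Context (W : set algC) (pW : place W) (N : nat) (N0 : (0 < N)%N) (WN : W N%:R).

Lemma place_int : exists2 l : nat, (1 < l)%N /\ W l%:R &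
  forall c : int, W c%:~R -> (l %| c)%Z.
Proof.
pose P n := (0 < n)%N && `[< W n%:R >].
have eP : exists n, P n by exists N; rewrite /P N0; apply/asboolP.
case: (ex_minnP eP) => l /andP[l0 /asboolP Wl] minl.
exists l => [|c Wc]; first split=> //.
  rewrite ltn_neqAle l0 andbT; apply/eqP => l1.
  by apply: (place1 pW); rewrite -l1 in Wl.
have lA : (l%:R : algC) \in Aint by exact: rpred_nat.
have h : W (c %% l)%Z%:~R.
  rewrite /modz rmorphB rmorphM /=; apply: (placeB pW) => //.
  by apply: (placeM pW) => //; exact: Aint_int.
have l0' : (l%:Z != 0)%R by rewrite eqz_nat -lt0n.
have := modz_ge0 c l0'; have := ltz_pmod c (l0 : 0 < l%:Z).
case E : (c %% l)%Z h => [r|//] h; rewrite ltz_nat => rl _.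
case: (posnP r) => [r0|r0]; first by apply/dvdz_mod0P; rewrite E r0.
have : P r by rewrite /P r0; apply/asboolP.
by move=> /minl; rewrite leqNgt rl.
Qed.

Definition val_ring (z : algC) : Prop := exists a b, [/\ a \in Aint, b \in Aint, ~ W b & z * b = a].

Lemma Aint_closed (p : {poly algC}) x : p \is monic -> (forall j, p`_j \in Aint) -> root p x -> x \in Aint.
Proof. by move=> pm pA; apply: Aint_integrally_closed pm _; apply/polyOverP. Qed.

Lemma int_hornerE (f : {poly int}) (z : algC) :
  foldl (fun y a => y * z + a) 0 (rev [seq c%:~R | c <- f]) = (map_poly intr f).[z].
Proof.
rewrite foldl_rev /horner.
rewrite [polyseq (map_poly _ _)](_ : _ = [seq c%:~R | c <- f]); last first.
  apply: (@eq_from_nth _ 0); first by rewrite size_map (size_map_inj_poly (@intr_inj algC) (mulr0z 1)).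
  rewrite (size_map_inj_poly (@intr_inj algC) (mulr0z 1)) => k kf.
  by rewrite coef_map (nth_map 0).
by elim: [seq _ | _ <- _] => //= b s ->.
Qed.

Lemma Aint_multiple (z : algC) : exists2 c : int, c != 0 & c%:~R * z \in Aint.
Proof.
have [p [Dp pm] _] := minCpolyP z.
have [q [a a0 pE]] := rat_poly_scale p.
have q0 : q != 0.
  by apply: contraNneq (monic_neq0 pm) => q0; rewrite pE q0 rmorph0 scaler0.
have qz : (map_poly intr q : {poly algC}).[z] = 0.
  have : (minCpoly z).[z] = 0 by apply/eqP; exact: root_minCpoly.
  rewrite Dp pE map_polyZ hornerZ => /eqP; rewrite mulf_eq0 fmorph_eq0 invr_eq0 intr_eq0 (negPf a0) /=.
  by move=> /eqP <-; congr (_.[z]); rewrite -map_poly_comp; apply: eq_map_poly => b /=; rewrite ratr_int.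
have := int_hornerE q z; rewrite qz.
have : all [in Aint] (rev [seq c%:~R : algC | c <- q]).
  by apply/allP => x; rewrite mem_rev => /mapP[c _ ->]; exact: Aint_int.
have lq : last 0 q = lead_coef q by rewrite /lead_coef nth_last.
have lq0 : lead_coef q != 0 by rewrite lead_coef_eq0.
case/lastP: (polyseq q) lq => [/= e|s c]; first by rewrite -e eqxx in lq0.
rewrite last_rcons map_rcons rev_rcons /= => -> /andP[cA sA]; rewrite mul0r add0r.
have [->|s0] := eqVneq (rev [seq c%:~R : algC | c <- s]) [::].
  by move=> /= /eqP; rewrite intr_eq0 (negPf lq0).
move=> h; exists (lead_coef q) => //; apply: (@horner_integral _ (fun x => x \in Aint) _ _ _ _ _ _ _ _ _ _ h) => //.
- by move=> *; exact: rpredB.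
- by move=> *; exact: rpredM.
- exact: Aint_closed.
exact/allP.
Qed.

(** A primitive integral equation of [z] has a coefficient outside [W], for otherwise the least
    positive integer [l] in [W] would divide its content. *)
Lemma val_ringP (z : algC) : val_ring z \/ val_ring z^-1.
Proof.
have [l [l1 _] hl] := place_int.
have [p [Dp _] _] := minCpolyP z.
have [q [a a0 pE]] := rat_poly_scale p.
have p0 : p != 0.
  by have := monic_neq0 (minCpoly_monic z); rewrite Dp map_poly_eq0.
have q0 : q != 0 by apply: contraNneq p0 => q0; rewrite pE q0 rmorph0 scaler0.
pose f := zprimitive q.
have fz : (map_poly intr f : {poly algC}).[z] = 0.
  have : (map_poly intr q : {poly algC}).[z] = 0.
    have : (minCpoly z).[z] = 0 by apply/eqP; exact: root_minCpoly.
    rewrite Dp pE map_polyZ hornerZ => /eqP; rewrite mulf_eq0 fmorph_eq0 invr_eq0 intr_eq0 (negPf a0) /=.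
    by move=> /eqP <-; congr (_.[z]); rewrite -map_poly_comp; apply: eq_map_poly => b /=; rewrite ratr_int.
  rewrite (zpolyEprim q) map_polyZ hornerZ => /eqP.
  by rewrite mulf_eq0 intr_eq0 zcontents_eq0 (negPf q0) => /eqP.
have cf : zcontents f = 1 by rewrite zcontents_primitive (negPf q0).
clearbody f.
have [j nWj] : exists j, ~ W (f`_j)%:~R.
  apply: contrapT => /forallNP h.
  have : (l %| zcontents f)%Z.
    rewrite dvdz_contents; apply/polyOverP => j; apply: hl; apply: contrapT; exact: h.
  rewrite cf dvdz1 absz_nat => /eqP l1'.
  by rewrite l1' in l1.
have sf : size f != 0%N.
  by rewrite size_poly_eq0; apply: contra_notN nWj => /eqP ->; rewrite coef0; exact: place0.
pose cs := rev [seq c%:~R | c <- f] : seq algC.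
have E : foldl (fun y a => y * z + a) 0 cs = 0 by rewrite /cs int_hornerE.
have csA x : x \in cs -> x \in Aint by rewrite mem_rev => /mapP[c _ ->]; exact: Aint_int.
have wcs : (f`_j)%:~R \in cs.
  rewrite mem_rev; apply: map_f; apply: mem_nth; rewrite ltnNge; apply/negP => h.
  by apply: nWj; rewrite nth_default //; exact: place0.
apply: (@val_ring_horner _ (fun x => x \in Aint) W _ _ _ _ _ _ z 0 cs) => //.
- by move=> *; exact: rpredB.
- by move=> *; exact: rpredM.
- exact: Aint_closed.
- exact: place0.
- by move=> *; exact: placeB.
by exists (f`_j)%:~R; rewrite // inE wcs orbT.
Qed.

(** Equality of valuations: [x / y] is a unit of the valuation ring, written without division. The
    value group enters only through this relation. *)
Definition val_eq (x y : algC) : Prop :=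
  exists a b, [/\ a \in Aint, b \in Aint, ~ W a, ~ W b & x * b = y * a].

Lemma nplaceM a b : a \in Aint -> b \in Aint -> ~ W a -> ~ W b -> ~ W (a * b).
Proof. by move=> aA bA ha hb /(place_prime pW aA bA)[]. Qed.
Lemma nplaceX a n : a \in Aint -> ~ W a -> ~ W (a ^+ n).
Proof. by move=> aA ha /(placeX pW aA). Qed.
Lemma nplace_neq0 a : ~ W a -> a != 0.
Proof. by move=> ha; apply/eqP => a0; apply: ha; rewrite a0; exact: place0. Qed.
Lemma nplace1 : ~ W 1. Proof. exact: place1 pW. Qed.

Lemma val_eq_refl x : val_eq x x.
Proof. by exists 1, 1; rewrite rpred1; split=> //; exact: nplace1. Qed.
Lemma val_eq_sym x y : val_eq x y -> val_eq y x.
Proof. by move=> [a [b [aA bA ha hb h]]]; exists b, a; split. Qed.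
Lemma val_eq_trans x y z : val_eq x y -> val_eq y z -> val_eq x z.
Proof.
move=> [a [b [aA bA ha hb h]]] [c [d [cA dA hc hd h']]].
exists (a * c), (b * d); split; rewrite ?rpredM //; try exact: nplaceM.
by rewrite mulrA h mulrAC h' mulrAC mulrA.
Qed.
Lemma val_eqM x y x' y' : val_eq x y -> val_eq x' y' -> val_eq (x * x') (y * y').
Proof.
move=> [a [b [aA bA ha hb h]]] [c [d [cA dA hc hd h']]].
exists (a * c), (b * d); split; rewrite ?rpredM //; try exact: nplaceM.
by rewrite mulrACA h h' mulrACA.
Qed.
Lemma val_eqX x y n : val_eq x y -> val_eq (x ^+ n) (y ^+ n).
Proof.
by move=> h; elim: n => [|n IH]; rewrite ?expr0 ?exprS; [exact: val_eq_refl | exact: val_eqM].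
Qed.
Lemma val_eq_cancel x y z : z != 0 -> val_eq (x * z) (y * z) -> val_eq x y.
Proof.
move=> z0 [a [b [aA bA ha hb h]]]; exists a, b; split=> //.
by apply: (mulIf z0); rewrite mulrAC h mulrAC.
Qed.
Lemma val_eq_Aint x y : x \in Aint -> val_eq x y -> ~ W y -> y \in Aint -> ~ W x.
Proof.
move=> xA [a [b [aA bA ha hb h]]] hy yA Wx; apply: (nplaceM yA aA hy ha).
by rewrite -h mulrC; apply: (placeM pW).
Qed.

(** The value group is torsion-free: [x / y] or its inverse lies in the valuation ring, and a
    non-unit of that ring has no power that is a unit. *)
Lemma val_eq_root x y n : (0 < n)%N -> x != 0 -> y != 0 -> val_eq (x ^+ n) (y ^+ n) -> val_eq x y.
Proof.
move=> n0 x0 y0 h.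
have H u v : u != 0 -> v != 0 -> val_eq (u ^+ n) (v ^+ n) -> val_ring (u / v) -> val_eq u v.
  move=> u0 v0 [c [d [cA dA hc hd e]]] [a [b [aA bA hb ab]]].
  have e' : u * b = v * a by rewrite -ab mulrA (mulrC v) divfK.
  exists a, b; split=> // Wa; apply: (nplaceM (rpredX n bA) cA (nplaceX bA hb) hc) => //.
  rewrite (cross_expr v0 e e').
  by apply: (placeM pW) => //; rewrite -(prednK n0) exprSr; apply: (placeM pW) => //; exact: rpredX.
case: (val_ringP (x / y)) => hv; first exact: H.
by rewrite invf_div in hv; apply/val_eq_sym/H => //; exact: val_eq_sym.
Qed.

Lemma nplace_nat_int (m : int) (l : nat) : W l%:R -> (forall c : int, W c%:~R -> (l %| c)%Z) ->
  (1 < l)%N -> m != 0 -> exists k, val_eq m%:~R (l%:R ^+ k).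
Proof.
move=> Wl hl l1 m0.
have [n le_n] := ubnP `|m|%N; elim: n => // n IH in m m0 le_n *.
have [Wm|nWm] := pselect (W m%:~R); last first.
  by exists 0%N, m%:~R, 1; rewrite Aint_int rpred1; split=> //; [exact: nplace1 | rewrite expr0 mulr1 mul1r].
have /dvdzP[c mE] := hl _ Wm; have c0 : c != 0 by apply: contraNneq m0 => c0; rewrite mE c0 mul0r.
have [|k hk] := IH c c0.
  rewrite mE abszM absz_nat ltnS in le_n; apply: leq_trans le_n.
  by rewrite ltn_Pmulr ?absz_gt0.
exists k.+1; rewrite mE rmorphM exprSr; exact: val_eqM hk (val_eq_refl _).
Qed.

(** The least valuation must occur twice: otherwise, after division by the term [m] of least
    valuation, the remaining terms lie in the maximal ideal and cannot add up to -1. *)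
Lemma val_sum0 (s : seq algC) : s != [::] -> (forall x, x \in s -> x != 0) -> \sum_(x <- s) x = 0 ->
  exists i j, [/\ (i < j)%N, (j < size s)%N & val_eq s`_i s`_j].
Proof.
move=> s0 hs hsum.
have [m ms mmin] : exists2 m, m \in s & forall x, x \in s -> val_ring (x / m).
  elim: s s0 hs {hsum} => // x s IH _ hs.
  have x0 := hs x (mem_head _ _).
  have vx : val_ring (x / x).
    by exists 1, 1; rewrite rpred1 divff // mulr1; split=> //; exact: nplace1.
  case: (eqVneq s [::]) => [->|s0]; first by exists x; rewrite ?mem_head // => y; rewrite inE => /eqP ->.
  have [|m ms hm] := IH s0; first by move=> y ys; apply: hs; rewrite inE ys orbT.
  have m0 : m != 0 by apply: hs; rewrite inE ms orbT.
  case: (val_ringP (x / m)) => h.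
    by exists m; [rewrite inE ms orbT | move=> y; rewrite inE => /orP[/eqP ->|/hm]].
  exists x; [exact: mem_head | move=> y; rewrite inE => /orP[/eqP ->//|/hm]].
  move: h; rewrite invf_div => -[a [b [aA bA hb e]]] [c [d [cA dA hd e']]].
  exists (c * a), (d * b); split; rewrite ?rpredM //; first exact: nplaceM.
  by rewrite -e -e' [RHS]mulrACA; congr (_ * _); rewrite -mulrA mulKf.
apply: contrapT => hno.
have m0 := hs m ms.
pose i := index m s; have il : (i < size s)%N by rewrite index_mem.
have mE : s`_i = m by exact: nth_index.
have strict x : x \in rem m s -> exists a b, [/\ W a, b \in Aint, ~ W b & x / m * b = a].
  move=> xr; have xs := mem_rem xr; have [a [b [aA bA hb e]]] := mmin x xs.
  exists a, b; split=> //; apply: contrapT => ha; apply: hno.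
  have ve : val_eq x m.
    by exists a, b; split=> //; rewrite -e mulrA (mulrC m) divfK.
  have [j [ij jl jx]] : exists j, [/\ j != i, (j < size s)%N & s`_j = x].
    move: xr; rewrite remE mem_cat => /orP[/(nthP 0)[k]|/(nthP 0)[k]].
      rewrite size_takel; last exact: ltnW.
      move=> ki; rewrite nth_take // => <-; exists k; split=> //; last exact: ltn_trans il.
      by rewrite neq_ltn ki.
    rewrite size_drop nth_drop => kl <-; exists (i.+1 + k)%N; split=> //.
      by rewrite neq_ltn addSn ltnS leq_addr orbT.
    by rewrite -ltn_subRL.
  move: ij; rewrite neq_ltn => /orP[ji|ij].
    by exists j, i; split=> //; rewrite mE jx.
  by exists i, j; split=> //; rewrite mE jx; apply: val_eq_sym.
have [a [b [Wa bA hb e]]] : exists a b, [/\ W a, b \in Aint, ~ W b & (\sum_(x <- rem m s) x) / m * b = a].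
  elim: (rem m s) strict => [|x r IH] h.
    exists 0, 1; rewrite big_nil mul0r mul0r rpred1; split=> //; [exact: place0 | exact: nplace1].
  have [a [b [Wa bA hb e]]] := h x (mem_head _ _).
  have [|c [d [Wc dA hd e']]] := IH; first by move=> y yr; apply: h; rewrite inE yr orbT.
  exists (d * a + b * c), (b * d); split; rewrite ?rpredM //.
  - by apply: (placeD pW); apply: (placeM pW).
  - exact: nplaceM.
  by rewrite big_cons !mulrDl mulrA e (mulrC b d) mulrA e' mulrC (mulrC b).
apply: hb; move: hsum; rewrite (perm_big _ (perm_to_rem ms)) big_cons /= => /eqP.
rewrite addrC addr_eq0 => /eqP h; move: e; rewrite h mulNr divff // mulN1r => e.
by rewrite -(opprK b) e; apply: (placeN pW).
Qed.

(** Two terms of the integral equation of [x] have the same valuation, and its nonzero coefficients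
    have valuations of powers of [l]. So the valuation of [x] is a rational multiple of that of [l]:
    the value group has rank one. *)
Lemma val_eq_nat (l : nat) x : W l%:R -> (forall c : int, W c%:~R -> (l %| c)%Z) ->
  (1 < l)%N -> x \in Aint -> x != 0 -> exists n i, (0 < n)%N /\ val_eq (x ^+ n) (l%:R ^+ i).
Proof.
move=> Wl hl l1 xA x0.
have l0 : (l%:R : algC) != 0 by rewrite pnatr_eq0 -lt0n ltnW.
have lA : (l%:R : algC) \in Aint by exact: rpred_nat.
have [f fm fx] := minCpoly_int xA.
pose s := [seq (f`_k)%:~R * x ^+ k | k <- iota 0 (size f) & f`_k != 0] : seq algC.
have f0 : f != 0 by exact: monic_neq0.
have [|||i [j [ij]]] := @val_sum0 s.
- rewrite -size_eq0 size_map size_filter -lt0n -has_count; apply/hasP.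
  exists (size f).-1; first by rewrite mem_iota /= add0n prednK // size_poly_gt0.
  by rewrite -/(lead_coef f) lead_coef_eq0.
- move=> y /mapP[k]; rewrite mem_filter => /andP[k0 _] ->.
  by rewrite mulf_neq0 ?expf_neq0 // intr_eq0.
- rewrite big_map big_filter.
  have : (minCpoly x).[x] = 0 by apply/eqP; exact: root_minCpoly.
  rewrite -fx horner_coef (size_map_inj_poly (@intr_inj algC) (mulr0z 1)) => h.
  rewrite -[RHS]h -(big_mkord xpredT (fun k => (map_poly intr f)`_k * x ^+ k)) /index_iota subn0.
  rewrite [RHS](bigID (fun k => f`_k != 0)) /= [X in _ + X]big1 ?addr0.
    by apply: eq_bigr => k _; rewrite coef_map.
  by move=> k /negPn/eqP h0; rewrite coef_map /= h0 mul0r.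
rewrite size_map => js.
have is' := ltn_trans ij js.
set t := [seq k <- _ | _] in js is' *.
rewrite !(nth_map 0%N) //; set a := nth _ _ i; set b := nth _ _ j.
have ab : (a < b)%N.
  have st : sorted ltn t by apply: sorted_filter (iota_ltn_sorted _ _); exact: ltn_trans.
  by apply: (sorted_ltn_nth ltn_trans 0%N st).
have fa : f`_a != 0 by have := mem_nth 0%N is'; rewrite mem_filter => /andP[].
have fb : f`_b != 0 by have := mem_nth 0%N js; rewrite mem_filter => /andP[].
have [c hc] := nplace_nat_int Wl hl l1 fa; have [d hd] := nplace_nat_int Wl hl l1 fb.
move=> h.
have {}h : val_eq (l%:R ^+ c) (l%:R ^+ d * x ^+ (b - a)).
  apply: (val_eq_cancel (expf_neq0 a x0)); rewrite -mulrA -exprD subnK; last exact: ltnW.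
  apply: val_eq_trans (val_eqM (val_eq_sym hc) (val_eq_refl _)) _.
  exact: val_eq_trans h (val_eqM hd (val_eq_refl _)).
have n0 : (0 < b - a)%N by rewrite subn_gt0.
have [dc|cd] := leqP d c.
  exists (b - a)%N, (c - d)%N; split=> //.
  apply: (val_eq_cancel (expf_neq0 d l0)); rewrite -exprD subnK // mulrC; exact: val_eq_sym.
(* A negative valuation is impossible for an algebraic integer: a positive power of [l] times a
   power of [x] would be a unit. *)
exfalso.
have {}h : val_eq (l%:R ^+ (d - c) * x ^+ (b - a)) 1.
  apply: (val_eq_cancel (expf_neq0 c l0)); rewrite mul1r mulrAC -exprD subnK; last exact: ltnW.
  exact: val_eq_sym.
have WA : W (l%:R ^+ (d - c) * x ^+ (b - a)).
  rewrite mulrC; apply: (placeM pW); first exact: rpredX.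
  have dc0 : (0 < d - c)%N by rewrite subn_gt0.
  by rewrite -(prednK dc0) exprSr; apply: (placeM pW) => //; exact: rpredX.
exact: (val_eq_Aint (place_Aint pW WA) h nplace1 (rpred1 _)).
Qed.

(** Both valuations are commensurable with that of [l]. Common factors [p] of the two exponents are
    then removed by [val_eq_root]; this condition on the exponents is what later separates the roots
    of unity of order [p]. *)
Lemma val_rank_one p x y : prime p -> x \in Aint -> y \in Aint -> W x -> W y -> x != 0 -> y != 0 ->
  exists m n, val_eq (x ^+ m) (y ^+ n) /\ ~~ ((p %| m) && (p %| n))%N.
Proof.
move=> p_pr xA yA Wx Wy x0 y0.
have [l [l1 Wl] hl] := place_int.
have [a [i [a0 hi]]] := val_eq_nat Wl hl l1 xA x0.
have [b [j [b0 hj]]] := val_eq_nat Wl hl l1 yA y0.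
have i0 : (0 < i)%N.
  rewrite lt0n; apply/eqP => i0; rewrite i0 expr0 in hi.
  apply: (val_eq_Aint (rpredX a xA) hi nplace1 (rpred1 _)).
  by rewrite -(prednK a0) exprSr; apply: (placeM pW) => //; exact: rpredX.
have h : val_eq (x ^+ (a * j)) (y ^+ (b * i)).
  apply: val_eq_trans (_ : val_eq (l%:R ^+ (i * j)) _); first by rewrite !exprM; exact: val_eqX.
  by rewrite mulnC !exprM; apply/val_eq_sym/val_eqX.
have n0 : (0 < b * i)%N by rewrite muln_gt0 b0.
move: (a * j)%N (b * i)%N h n0 => {a i b j a0 b0 hi hj i0} m n h n0.
have [k le_k] := ubnP n; elim: k => // k IH in m n h n0 le_k *.
have [/andP[/dvdnP[m' mE] /dvdnP[n' nE]]|hmn] := boolP ((p %| m) && (p %| n))%N; last by exists m, n.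
have n'0 : (0 < n')%N by move: n0; rewrite nE muln_gt0 => /andP[].
apply: (IH m' n') => //.
  by apply: (@val_eq_root _ _ p); rewrite ?prime_gt0 ?expf_neq0 // -!exprM -mE -nE.
by rewrite nE ltnS in le_k; apply: leq_trans le_k; rewrite ltn_Pmulr ?prime_gt1.
Qed.
End Valuation.

(** * Tame inertia *)

Lemma cross_sub (R : comPzRingType) (w w' a a' b b' : R) : a * b' = a' * b ->
  (w - w') * (b * b') = b * (a' - w' * b') - b' * (a - w * b).
Proof.
move=> E; have -> : b * (a' - w' * b') - b' * (a - w * b) = (w - w') * (b * b') + (a' * b - a * b') by ring.
by rewrite E subrr addr0.
Qed.

Lemma cross_val (R : comPzRingType) (x y a b c d sx sy sc sd : R) :
  x * d = y * c -> sx * sd = sy * sc -> sx * b = x * a ->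
  sy * (b * (sc * d)) = y * (a * (sd * c)).
Proof.
move=> e es e'; transitivity ((sx * sd) * b * d); first by rewrite es; ring.
transitivity ((sx * b) * (sd * d)); first by ring.
by rewrite e'; transitivity ((x * d) * (a * sd)); [ring | rewrite e; ring].
Qed.

Lemma cross_add (R : comPzRingType) (x S t a b c d : R) :
  S * b = x * a -> t * d = x * c -> (S + t) * (b * d) = x * (a * d + c * b).
Proof.
move=> e e'; transitivity ((S * b) * d + (t * d) * b); first by ring.
by rewrite e e'; ring.
Qed.

Lemma cross_addn (R : comPzRingType) (n a b c d : R) :
  a * d + c * b - (n + 1) * (b * d) = d * (a - n * b) + b * (c - d).
Proof. by ring. Qed.

Section Tame.
Context (K W : set algC) (pW : place W) (N : nat) (N0 : (0 < N)%N) (WN : W N%:R).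
Local Notation D := (decomp K W).
Local Notation I := (inertia K W).

(* [s x / x] is congruent to [w] modulo [W]. *)
Definition tame_char (s : gal) (x w : algC) : Prop :=
  exists a b, [/\ a \in Aint, b \in Aint, ~ W b, s x * b = x * a & W (a - w * b)].

Lemma inertia_congr s x : I s -> x \in Aint -> W (s x - x).
Proof. by case=> _; apply. Qed.
Lemma ndecomp s x : D s -> ~ W x -> ~ W (s x).
Proof. by move=> Ds hx /(decompP _ Ds). Qed.

Lemma tame_char_uniq s x w w' : x != 0 -> w \in Aint -> w' \in Aint ->
  tame_char s x w -> tame_char s x w' -> W (w - w').
Proof.
move=> x0 wA w'A [a [b [aA bA hb e h]]] [a' [b' [a'A b'A hb' e' h']]].
have E : a * b' = a' * b by apply: (mulfI x0); rewrite mulrA -e mulrAC e' -mulrA.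
have H : W ((w - w') * (b * b')).
  rewrite (cross_sub _ _ E).
  by apply: (placeB pW); apply: (placeM pW).
have [|||] := place_prime pW _ _ H.
- exact: rpredB.
- exact: rpredM.
- by [].
by move/(nplaceM pW bA b'A hb hb').
Qed.

Lemma tame_char_mul s t x w w' : I s -> I t -> w \in Aint -> w' \in Aint -> x != 0 ->
  tame_char s x w -> tame_char t x w' -> tame_char (s * t)%g x (w * w').
Proof.
move=> Is It wA w'A x0 [a [b [aA bA hb e h]]] [a' [b' [a'A b'A hb' e' h']]].
have Ds := inertia_decomp Is.
exists (a * s a'), (b * s b'); split; rewrite ?rpredM ?gal_Aint //.
- by apply: (nplaceM pW); rewrite ?gal_Aint //; exact: ndecomp.
- rewrite gal_mulE mulrCA -rmorphM /= mulrC e' rmorphM /= mulrAC e.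
  by rewrite mulrA.
apply: (place_sub pW (y := (w * b) * s a')).
  by rewrite -mulrBl mulrC; apply: (placeM pW); rewrite ?gal_Aint.
have -> : w * b * s a' - w * w' * (b * s b') = (w * b) * (s a' - w' * s b').
  by rewrite mulrBr; congr (_ - _); rewrite mulrACA.
apply: (placeM pW); first by rewrite rpredM.
apply: (place_sub pW (y := a')); first exact: inertia_congr.
apply: (place_sub pW (y := w' * b')) => //.
rewrite -mulrBr; apply: (placeM pW) => //; apply: (place_sym pW); exact: inertia_congr.
Qed.

Lemma tame_char1 x : x != 0 -> tame_char 1%g x 1.
Proof.
move=> x0; exists 1, 1; rewrite rpred1 !mulr1 subrr gal_oneE; split=> //; first exact: nplace1.
exact: place0.
Qed.

Lemma tame_char_exp s x w n : I s -> w \in Aint -> x != 0 ->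
  tame_char s x w -> tame_char (s ^+ n)%g x (w ^+ n).
Proof.
move=> Is wA x0 h; elim: n => [|n IH]; first by rewrite expg0 expr0; exact: tame_char1.
rewrite expgS exprS; apply: tame_char_mul; rewrite ?rpredX //; exact: inertia_exp.
Qed.

Lemma tame_charM s x y w w' : w \in Aint -> w' \in Aint ->
  tame_char s x w -> tame_char s y w' -> tame_char s (x * y) (w * w').
Proof.
move=> wA w'A [a [b [aA bA hb e h]]] [a' [b' [a'A b'A hb' e' h']]].
exists (a * a'), (b * b'); split; rewrite ?rpredM //; first exact: nplaceM.
  by rewrite rmorphM mulrACA e e' mulrACA.
have -> : a * a' - w * w' * (b * b') = a' * (a - w * b) + (w * b) * (a' - w' * b').
  by rewrite !mulrBr (mulrC a' a) (mulrC a' (w * b)) addrA subrK; congr (_ - _); rewrite mulrACA.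
by apply: (placeD pW); apply: (placeM pW); rewrite ?rpredM.
Qed.

Lemma tame_charX s x w n : w \in Aint -> tame_char s x w -> tame_char s (x ^+ n) (w ^+ n).
Proof.
move=> wA h; elim: n => [|n IH]; last by rewrite !exprS; apply: tame_charM; rewrite ?rpredX.
by exists 1, 1; rewrite rpred1 !mulr1 rmorph1 subrr; split=> //; [exact: nplace1 | exact: place0].
Qed.

(** Inertia acts trivially on residues, so [s u / u] is congruent to 1 for a unit [u], in particular
    for the unit that relates [x] and [y]. *)
Lemma tame_char_val s x y w : I s -> w \in Aint -> x != 0 ->
  val_eq W x y -> tame_char s x w -> tame_char s y w.
Proof.
move=> Is wA x0 [c [d [cA dA hc hd e]]] [a [b [aA bA hb e' h]]].
have Ds := inertia_decomp Is.
have c0 := nplace_neq0 pW hc; have d0 := nplace_neq0 pW hd.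
have sc0 : s c != 0 by rewrite fmorph_eq0.
exists (a * (s d * c)), (b * (s c * d)); split.
- by rewrite !rpredM ?gal_Aint.
- by rewrite !rpredM ?gal_Aint.
- do 2 ?apply: (nplaceM pW); rewrite ?rpredM ?gal_Aint //; exact: ndecomp.
- by apply: (cross_val e _ e'); rewrite -!rmorphM e.
have hs z : z \in Aint -> W (s z - z) by exact: inertia_congr.
have cong : W (s d * c - s c * d).
  apply: (place_sub pW (y := d * c)).
    by rewrite -mulrBl mulrC; apply: (placeM pW) => //; exact: hs.
  rewrite mulrC -mulrBl mulrC; apply: (placeM pW) => //; apply: (place_sym pW); exact: hs.
have -> : a * (s d * c) - w * (b * (s c * d)) = (s d * c) * (a - w * b) + (w * b) * (s d * c - s c * d).
  by ring.
by apply: (placeD pW); apply: (placeM pW); rewrite ?rpredM ?gal_Aint.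
Qed.

Lemma gal_iter_ratio (s : gal) x a b n : s x * b = x * a ->
  (s ^+ n)%g x * \prod_(k < n) (s ^+ k)%g b = x * \prod_(k < n) (s ^+ k)%g a.
Proof.
move=> e; elim: n => [|n IH]; first by rewrite !big_ord0 expg0 gal_oneE.
rewrite !big_ord_recr /= expgSr gal_mulE mulrCA -rmorphM e rmorphM /=.
by rewrite mulrA [X in X * _]mulrC IH mulrA.
Qed.

(** If [s x / x] were not a unit, it or its inverse would lie in the maximal ideal, although the
    product of its conjugates under the first [P] powers of [s] telescopes to 1. *)
Lemma tame_ratio s x P : I s -> x != 0 -> (0 < P)%N -> (s ^+ P)%g x = x ->
  exists a b, [/\ a \in Aint, b \in Aint, ~ W a, ~ W b & s x * b = x * a].
Proof.
move=> Is x0 P0 sP; have Ds := inertia_decomp Is.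
have H (y : algC) c d : y != 0 -> (s ^+ P)%g y = y -> s y * d = y * c -> c \in Aint -> d \in Aint -> ~ W d -> ~ W c.
  move=> y0 yP e cA dA hd Wc.
  have := gal_iter_ratio P e; rewrite yP => /(mulfI y0) E.
  have : W (\prod_(k < P) (s ^+ k)%g d).
    rewrite E -(prednK P0) big_ord_recl mulrC; apply: (placeM pW); last exact: Wc.
    by apply: rpred_prod => k _; rewrite gal_Aint.
  case/(place_prod pW) => [k _|k _]; first by rewrite gal_Aint.
  by apply: ndecomp => //; exact: decomp_exp.
case: (val_ringP pW N0 WN (s x / x)) => -[a [b [aA bA hb e]]].
  have e' : s x * b = x * a by rewrite -e mulrA [x * _]mulrC divfK.
  by exists a, b; split=> //; apply: (H x a b).
have sx0 : s x != 0 by rewrite fmorph_eq0.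
have e' : s x * a = x * b by rewrite -e invf_div mulrA [s x * _]mulrC divfK.
have e'' : s x^-1 * b = x^-1 * a.
  by rewrite fmorphV /= ![_^-1 * _]mulrC; apply/eqP; rewrite eqr_div // mulrC -e' mulrC.
have nWa : ~ W a.
  by apply: (H x^-1 a b) => //; rewrite ?invr_eq0 // fmorphV /= sP.
by exists b, a; split.
Qed.

(** The conjugates of [s x / x] under powers of [s] are congruent to it and their product is 1. Its
    residue is therefore a root of X^P - 1, which factors through the roots of unity in [algC]. *)
Lemma tame_char_exists s x P : I s -> x != 0 -> (0 < P)%N -> (s ^+ P)%g x = x ->
  exists2 w, w ^+ P = 1 & tame_char s x w.
Proof.
move=> Is x0 P0 sP; have [a [b [aA bA ha hb e]]] := tame_ratio Is x0 P0 sP.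
have := gal_iter_ratio P e; rewrite sP => /(mulfI x0) E.
have cong y : y \in Aint -> W (\prod_(k < P) (s ^+ k)%g y - y ^+ P).
  move=> yA; elim: (P) => [|n IH]; first by rewrite big_ord0 expr0 subrr; exact: place0.
  rewrite big_ord_recr exprSr /=; apply: (place_subM pW) => //.
    by apply: rpred_prod => k _; rewrite gal_Aint.
  by apply: inertia_congr => //; exact: inertia_exp.
have Wab : W (a ^+ P - b ^+ P).
  by apply: (place_sub pW) (cong b bA); apply: (place_sym pW); rewrite E; exact: cong.
have [z pz] := C_prim_root_exists P0.
have zA : z \in Aint by exact: Aint_prim_root pz.
have b0 := nplace_neq0 pW hb.
have F : a ^+ P - b ^+ P = \prod_(k < P) (a - z ^+ k * b).
  have := congr1 (horner^~ (a / b)) (factor_Xn_sub_1 pz).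
  rewrite /= horner_prod hornerD hornerXn hornerN hornerC big_mkord => h.
  transitivity (b ^+ P * ((a / b) ^+ P - 1)).
    by rewrite mulrBr mulr1 -exprMn mulrCA divff // mulr1.
  rewrite -h -{1}(card_ord P) -prodr_const -big_split /=; apply: eq_bigr => k _.
  by rewrite hornerXsubC mulrBr mulrCA divff // mulr1 (mulrC b).
rewrite F in Wab; have [k _|k _ Wk] := place_prod pW _ Wab.
  by rewrite rpredB ?rpredM ?rpredX.
exists (z ^+ k); first by rewrite -exprM mulnC exprM (prim_expr_order pz) expr1n.
by exists a, b.
Qed.

(** Each [(s ^+ k) x / x] is congruent to 1, so the sum divided by [x] is congruent to [P], which
    lies outside [W]. *)
Lemma tame_char_trace s x P : I s -> x != 0 -> ~ W P%:R -> tame_char s x 1 ->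
  \sum_(k < P) (s ^+ k)%g x != 0.
Proof.
move=> Is x0 nWP h; apply/eqP => S0.
suff [a [b [aA bA hb e Wab]]] : exists a b, [/\ a \in Aint, b \in Aint, ~ W b,
    (\sum_(k < P) (s ^+ k)%g x) * b = x * a & W (a - P%:R * b)].
  move: e; rewrite S0 mul0r => /esym/eqP; rewrite mulf_eq0 (negPf x0) => /eqP a0.
  move: Wab; rewrite a0 sub0r => /(placeN pW); rewrite opprK.
  by apply: (nplaceM pW) => //; exact: rpred_nat.
elim: (P) => [|n [a [b [aA bA hb e hab]]]].
  exists 0, 1; rewrite rpred0 rpred1 big_ord0 mul0r mulr0 sub0r oppr0.
  by split=> //; [exact: nplace1 | exact: place0].
have [c [d [cA dA hd e' hcd]]] := tame_char_exp n Is (rpred1 _) x0 h.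
rewrite expr1n mul1r in hcd.
exists (a * d + c * b), (b * d); split; rewrite ?rpredD ?rpredM //; first exact: nplaceM.
  by rewrite big_ord_recr /=; exact: cross_add.
rewrite -natr1 cross_addn.
by apply: (placeD pW); apply: (placeM pW).
Qed.

(** Produces an element that detects [s]: the sum of the conjugates of [z - s z] telescopes to 0,
    which [tame_char_trace] forbids for a trivial character. *)
Lemma tame_char_faithful s z P : I s -> ~ W P%:R -> (s ^+ P)%g z = z -> s z != z ->
  z - s z != 0 /\ ~ tame_char s (z - s z) 1.
Proof.
move=> Is nWP sP sz; have x0 : z - s z != 0 by rewrite subr_eq0 eq_sym.
split=> // /(tame_char_trace Is x0 nWP)/eqP; apply.
have E n : \sum_(k < n) (s ^+ k)%g (z - s z) = z - (s ^+ n)%g z.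
  elim: n => [|n IH]; first by rewrite big_ord0 expg0 gal_oneE subrr.
  by rewrite big_ord_recr /= IH rmorphB /= expgSr gal_mulE subrKA.
by rewrite E sP subrr.
Qed.

Lemma expr_prime_dvd (w : algC) p n : prime p -> w ^+ p = 1 -> w != 1 -> w ^+ n = 1 -> (p %| n)%N.
Proof.
move=> p_pr wp w1 wn; apply: contraT => pn; case/eqP: w1.
have cop : coprime p n by rewrite prime_coprime.
have [u [v e]] : exists u v, (u * n = v * p + 1)%N.
  have p0 := prime_gt0 p_pr; case: (posnP n) => [n0|n0].
    by rewrite n0 dvdn0 in pn.
  have [u v e _] := egcdnP p n0; exists u, v.
  by rewrite e gcdnC (eqP cop).
have : w ^+ (u * n) = w ^+ (v * p + 1) by rewrite e.
by rewrite mulnC exprM wn expr1n addn1 exprS mulnC exprM wp expr1n mulr1.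
Qed.

Lemma tame_char_int s c x w : I s -> c != 0 -> x != 0 -> w \in Aint ->
  tame_char s (c%:~R * x) w <-> tame_char s x w.
Proof.
move=> Is c0 x0 wA.
have E : s (c%:~R * x) = c%:~R * s x by rewrite rmorphM rmorph_int.
have c0' : (c%:~R : algC) != 0 by rewrite intr_eq0.
split=> -[a [b [aA bA hb e h]]]; exists a, b; split=> //.
  by apply: (mulfI c0'); rewrite !mulrA -e E.
by rewrite E -!mulrA e.
Qed.

Lemma tame_char_unit s x : I s -> x \in Aint -> ~ W x -> tame_char s x 1.
Proof.
move=> Is xA hx; exists (s x), x; split; rewrite ?gal_Aint //; first by rewrite mulrC.
by rewrite mul1r; exact: inertia_congr.
Qed.

(* Tame characters depend on the valuation only, and two elements have
   multiplicatively dependent valuations. *)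
Lemma tame_char_dependent p s t x y : prime p -> ~ W p%:R -> I s -> I t -> x != 0 -> y != 0 ->
  (s ^+ p)%g x = x -> (s ^+ p)%g y = y -> (t ^+ p)%g y = y ->
  tame_char t x 1 -> ~ tame_char s x 1 -> tame_char t y 1.
Proof.
move=> p_pr nWp Is It x0 y0 sx sy ty tx nsx; apply: contrapT => nty.
wlog [xA yA] : x y x0 y0 sx sy ty tx nsx nty / x \in Aint /\ y \in Aint.
  move=> H; have [c c0 cx] := Aint_multiple x; have [d d0 dy] := Aint_multiple y.
  have A1 : (1 : algC) \in Aint by exact: rpred1.
  have fixM (u : gal) e z : u z = z -> u (e%:~R * z) = e%:~R * z by move=> h; rewrite rmorphM rmorph_int /= h.
  apply: (H (c%:~R * x) (d%:~R * y)); rewrite ?mulf_neq0 ?intr_eq0 ?fixM //.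
  - by apply/(tame_char_int It c0 x0 A1).
  - by move/(tame_char_int Is c0 x0 A1).
  - by move/(tame_char_int It d0 y0 A1).
have Wx : W x by apply: contrapT => h; apply: nsx; exact: tame_char_unit.
have Wy : W y by apply: contrapT => h; apply: nty; exact: tame_char_unit.
have p0 := prime_gt0 p_pr.
have rA w : w ^+ p = 1 -> w \in Aint.
  by move=> w1; apply: (Aint_unity_root p0); rewrite unity_rootE w1.
have [w1 w1p h1] := tame_char_exists Is x0 p0 sx.
have [w2 w2p h2] := tame_char_exists It y0 p0 ty.
have [w3 w3p h3] := tame_char_exists Is y0 p0 sy.
have w11 : w1 != 1 by apply/eqP => e; apply: nsx; rewrite -e.
have w21 : w2 != 1 by apply/eqP => e; apply: nty; rewrite -e.
have [m [n [hmn]]] := val_rank_one pW N0 WN p_pr xA yA Wx Wy x0 y0.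
have xm0 : x ^+ m != 0 by rewrite expf_neq0.
have yn0 : y ^+ n != 0 by rewrite expf_neq0.
have rX w k : w ^+ p = 1 -> (w ^+ k) ^+ p = 1 by move=> e; rewrite -exprM mulnC exprM e expr1n.
(* The equality of valuations of [x ^+ m] and [y ^+ n] is read under [s] and then under [t]. The
   second reading makes [p] divide [n], after which the first makes it divide [m], against the
   choice of the exponents. *)
have E1 : w1 ^+ m = w3 ^+ n.
  apply: (unity_root_inj pW p0 nWp); rewrite ?rX //.
  apply: (tame_char_uniq yn0 _ _ _ (tame_charX n (rA _ w3p) h3)); rewrite ?rpredX ?rA //.
  by apply: (tame_char_val Is _ xm0 hmn); [rewrite rpredX ?rA | apply: tame_charX => //; exact: rA].
have E2 : 1 = w2 ^+ n.
  apply: (unity_root_inj pW p0 nWp); rewrite ?rX ?expr1n //.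
  have A1 : (1 : algC) \in Aint by exact: rpred1.
  apply: (tame_char_uniq yn0 A1 (rpredX n (rA _ w2p)) _ (tame_charX n (rA _ w2p) h2)).
  apply: (tame_char_val It A1 xm0 hmn).
  by rewrite -(expr1n _ m); apply: tame_charX => //; exact: rpred1.
have pn : (p %| n)%N by apply: (expr_prime_dvd p_pr w2p).
have pm : (p %| m)%N.
  apply: (expr_prime_dvd p_pr w1p w11); rewrite E1.
  by have /dvdnP[k ->] := pn; rewrite mulnC exprM w3p expr1n.
by rewrite pm pn.
Qed.
End Tame.

Lemma finZmod_card (G : finZmodType) (g : G) : g *+ #|G| = 0.
Proof.
apply: (addrI (\sum_(x : G) x)); rewrite addr0 {2}(reindex_inj (addIr g)) big_split /=.
by rewrite sumr_const.
Qed.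

Lemma finZmod_oppE (G : finZmodType) (g : G) : - g = g *+ #|G|.-1.
Proof.
apply/eqP; rewrite -subr_eq0 -opprD oppr_eq0 -mulrS prednK ?finZmod_card //.
by apply/card_gt0P; exists 0.
Qed.

Lemma torsion_split p (V : zmodType) (h : V) a : h *+ (p ^ a) = 0 -> h != 0 ->
  exists2 c, h *+ (p ^ c) != 0 & h *+ (p ^ c.+1) = 0.
Proof.
move=> ha h0; have eP : exists c, h *+ (p ^ c) == 0 by exists a; rewrite ha.
case: (ex_minnP eP) => -[|c] /eqP hc min; first by rewrite expn0 mulr1n in hc; rewrite hc eqxx in h0.
by exists c => //; apply/negP => /min; rewrite ltnn.
Qed.

Lemma prime_power_gcd p a e d : prime p -> (0 < d)%N -> (d = gcdn d (p ^ a))%N -> (d %| e)%N ->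
  forall e', gcdn e' (p ^ a) = d -> exists k, (p ^ a %| e + k * e')%N.
Proof.
move=> p_pr d0 dP /dvdnP[q ->] e' de'.
have P0 : (0 < p ^ a)%N by rewrite expn_gt0 prime_gt0.
case: (posnP e') => [e'0|e'0].
  by exists 0%N; rewrite mul0n addn0 dvdn_mull // -de' e'0 gcd0n.
have [u v huv _] := egcdnP (p ^ a) e'0; rewrite de' in huv.
exists (q * u * (p ^ a).-1)%N.
have -> : (q * d + q * u * (p ^ a).-1 * e' = q * v * (p ^ a).-1 * p ^ a + q * d * p ^ a)%N.
  set Q' := (p ^ a).-1; have E : (p ^ a = Q' + 1)%N by rewrite addn1 prednK.
  rewrite -[(q * u * Q' * e')%N]mulnA (mulnC Q') (mulnA (q * u)%N) -(mulnA q u) huv.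
  by rewrite E; ring.
by rewrite dvdn_add // dvdn_mull.
Qed.

Section TameCyclic.
Context (K W : set algC) (pW : place W) (N : nat) (N0 : (0 < N)%N) (WN : W N%:R).
Local Notation I := (inertia K W).
Context (p : nat) (p_pr : prime p) (nWp : ~ W p%:R).
Context (G : finZmodType) (f : gal -> G) (L : set algC).
Context (fM : forall s t, I s -> I t -> f (s * t)%g = f s + f t).
Context (fK : forall s, I s -> (f s = 0 <-> forall x, L x -> s x = x)).
Context (Lst : forall s x, I s -> L x -> L (s x)).
Context (f_surj : forall g, exists2 s, I s & f s = g).

Lemma tame_hom_exp (s : gal) (n : nat) : I s -> f (s ^+ n)%g = (f s : G) *+ n.
Proof.
move=> Is; elim: n => [|n IH]; last by rewrite expgS fM ?IH ?mulrS //; exact: inertia_exp.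
by apply: (addrI (f 1%g)); rewrite -fM ?mulg1 ?addr0 //; exact: inertia1.
Qed.

Lemma tame_moved (s : gal) : I s -> f s != 0 -> exists2 z, L z & s z != z.
Proof.
move=> Is /eqP h; apply: contrapT => hno; apply: h; apply/fK => // x Lx.
by apply: contrapT => /eqP hx; apply: hno; exists x.
Qed.

Lemma tame_fix (s u : gal) z (k : nat) : I s -> I u -> L z -> (f u : G) *+ k = 0 -> (u ^+ k)%g (z - s z) = z - s z.
Proof.
move=> Is Iu Lz h; have Iuk := inertia_exp pW k Iu.
have fix0 : forall x, L x -> (u ^+ k)%g x = x by apply/(fK Iuk); rewrite tame_hom_exp.
by rewrite rmorphB /= !fix0 //; exact: Lst.
Qed.

(** An [x] on which one element of order [p] has nontrivial character detects all elements of order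
    [p], by [tame_char_dependent]. So the character on [x] embeds the [p]-part of [G] in a cyclic
    group of roots of unity, and a generator is an element whose exponent has the least gcd with
    [p ^ a]. The factor [m] in the conclusion disposes of the rest of [G]. *)
Lemma tame_cyclic : exists g0 : G, forall g : G, exists n m : nat, ~~ (p %| m)%N /\ g *+ m = g0 *+ n.
Proof.
have G0 : (0 < #|G|)%N by apply/card_gt0P; exists 0.
(* Multiplication by [b], the prime-to-[p] part of the order, maps [G] onto its [p]-part. *)
have [b cop cardG] := pfactor_coprime p_pr G0; set a := logn p _ in cardG.
have pb : ~~ (p %| b)%N by rewrite -prime_coprime.
have P0 : (0 < p ^ a)%N by rewrite expn_gt0 prime_gt0.
have bP (g : G) : g *+ b *+ (p ^ a) = 0 by rewrite -mulrnA -cardG finZmod_card.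
have [allb|/existsNP[g0 /eqP hg0]] := pselect (forall g : G, g *+ b = 0).
  by exists 0 => g; exists 0%N, b; rewrite allb mul0rn.
have [c hc hcS] := torsion_split (bP g0) hg0.
have [s Is fs] := f_surj (g0 *+ b *+ (p ^ c)).
have fsp : f s *+ p = 0 by rewrite fs -mulrnA -expnSr.
have [|z Lz sz] := tame_moved Is; first by rewrite fs.
have spL y : L y -> (s ^+ p)%g y = y.
  by move: y; apply/(fK (inertia_exp pW p Is)); rewrite tame_hom_exp.
have [x0 nsx] := tame_char_faithful pW Is nWp (spL z Lz) sz.
set x := z - s z in x0 nsx.
have inj t : I t -> f t *+ (p ^ a) = 0 -> tame_char W t x 1 -> f t = 0.
  move=> It ft htx; apply/eqP; apply: contraT => ft0.
  have [d hd hdS] := torsion_split ft ft0.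
  have It' := inertia_exp pW (p ^ d) It.
  have ft' : f (t ^+ (p ^ d))%g *+ p = 0 by rewrite tame_hom_exp // -mulrnA -expnSr.
  have [|y Ly ty] := tame_moved It'; first by rewrite tame_hom_exp.
  have tpL u : L u -> ((t ^+ (p ^ d)) ^+ p)%g u = u.
    by move: u; apply/(fK (inertia_exp pW p It')); rewrite tame_hom_exp.
  have [y0 nty] := tame_char_faithful pW It' nWp (tpL y Ly) ty.
  case: nty; apply: (tame_char_dependent pW N0 WN p_pr nWp Is It' x0 y0) => //.
  - exact: tame_fix.
  - exact: tame_fix.
  - exact: tame_fix.
  by have := tame_char_exp pW (p ^ d) It (rpred1 _) x0 htx; rewrite expr1n.
have /choice[r hr] (g : G) : exists t, I t /\ f t = g *+ b by have [t It ft] := f_surj (g *+ b); exists t.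
have [zeta pz] := C_prim_root_exists P0.
have zA : zeta \in Aint by exact: Aint_prim_root pz.
have /choice[e he] (g : G) : exists k : nat, tame_char W (r g) x (zeta ^+ k).
  have [Ir fr] := hr g.
  have rx : ((r g) ^+ (p ^ a))%g x = x by apply: tame_fix => //; rewrite fr.
  have [w wP hw] := tame_char_exists pW N0 WN Ir x0 P0 rx.
  by have [k wk] := prim_rootP pz wP; exists k; rewrite -wk.
case: (arg_minnP (fun g : G => gcdn (e g) (p ^ a)) (isT : xpredT (0 : G))) => g1 _ min.
exists (g1 *+ b) => g.
set d := gcdn (e g1) (p ^ a) in min.
have d0 : (0 < d)%N by rewrite gcdn_gt0 P0 orbT.
have de : (d %| e g)%N.
  apply: dvdn_trans (dvdn_gcdl (e g) (p ^ a)).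
  have /(dvdn_pfactor _ _ p_pr)[i _ di] : (d %| p ^ a)%N by exact: dvdn_gcdr.
  have /(dvdn_pfactor _ _ p_pr)[j _ dj] : (gcdn (e g) (p ^ a) %| p ^ a)%N by exact: dvdn_gcdr.
  have := min g isT; rewrite di dj leq_exp2l ?prime_gt1 // => ij.
  exact: dvdn_exp2l.
have [|k hk] := prime_power_gcd p_pr d0 _ de (erefl : gcdn (e g1) (p ^ a) = d).
  by rewrite /d -gcdnA gcdnn.
have [Ig fg] := hr g; have [Ig1 fg1] := hr g1.
have Igk := inertia_exp pW k Ig1.
have It := inertia_mul pW Ig Igk.
have ft : f (r g * r g1 ^+ k)%g = g *+ b + g1 *+ b *+ k by rewrite fM // tame_hom_exp // fg fg1.
have : f (r g * r g1 ^+ k)%g = 0.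
  apply: inj => //; first by rewrite ft mulrnDl bP add0r -mulrnA mulnC mulrnA bP mul0rn.
  have -> : 1 = zeta ^+ e g * (zeta ^+ e g1) ^+ k.
    rewrite -exprM -exprD (mulnC _ k); have /dvdnP[q ->] := hk.
    by rewrite mulnC exprM (prim_expr_order pz) expr1n.
  have zX k' : zeta ^+ k' \in Aint by exact: rpredX.
  apply: (tame_char_mul pW Ig Igk (zX _) (rpredX k (zX _)) x0 (he g)).
  exact: (tame_char_exp pW k Ig1 (zX _) x0 (he g1)).
rewrite ft => /eqP; rewrite addr_eq0 finZmod_oppE -mulrnA => /eqP h.
by exists (k * #|G|.-1)%N, b.
Qed.
End TameCyclic.

(** * Total ramification of the ray class field *)

Lemma fixed_subfield (s : gal) : is_subfield [set x | s x = x].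
Proof.
split=> [|x y /= hx hy|x y /= hx hy|x /= hx]; first exact: rmorph1.
- by rewrite /= rmorphB /= hx hy.
- by rewrite /= rmorphM /= hx hy.
by rewrite /= fmorphV /= hx.
Qed.

Lemma field_gen_fix (S : set algC) (s : gal) : (forall x, S x -> s x = x) ->
  forall x, field_gen S x -> s x = x.
Proof. by move=> h x /(_ _ (fixed_subfield s)); apply => y; exact: h. Qed.

Lemma num_gen_fix F : num_gen F -> exists L : seq algC, forall h : gal, fixes L h -> forall x, F x -> h x = x.
Proof.
move=> [s hs]; exists s => h hh x /hs/Crat_spanP[a ->].
rewrite rmorph_sum; apply: eq_bigr => j _.
by rewrite rmorphM fmorph_rat /= hh ?mem_nth.
Qed.

Lemma gal_coprime_fix (s : gal) a b x : coprime a b -> (s ^+ a)%g x = x -> (s ^+ b)%g x = x -> s x = x.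
Proof.
move=> cop ha hb; case: (posnP a) => [a0|a0].
  by move: cop; rewrite a0 /coprime gcd0n => /eqP b1; rewrite b1 expg1 in hb.
have [u v e _] := egcdnP b a0; rewrite (eqP cop) in e.
have : (s ^+ (a * u))%g x = x by exact: gal_exp_fix.
by rewrite mulnC e addn1 expgS gal_mulE mulnC gal_exp_fix.
Qed.

Lemma coef_prod_subfield F (I : Type) (r : seq I) (P : pred I) (c : I -> algC) :
  is_subfield F -> (forall g, P g -> F (c g)) ->
  forall j, F (\prod_(g <- r | P g) ('X - (c g)%:P))`_j.
Proof.
move=> sfF hc; have [F1 FB FM _] := sfF; have F0 := subfield0 sfF.
elim/big_ind: _ => [j|p q hp hq j|g Pg j].
- by rewrite coef1; case: (j == 0)%N.
- by rewrite coefM; apply: subfield_sum => // k _; apply: FM.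
by rewrite coefB coefX coefC; apply: FB; case: (_ == _) => //; exact: hc.
Qed.

Section MaxPext.
Context (p : nat) (p_pr : prime p) (K H : set algC).
Context (sfK : is_subfield K) (gK : num_gen K) (fH : finite_ext K H) (aH : abelian_ext K H).

(** Makes the subfield and stability properties below immediate: the union that defines [max_pext]
    is the fixed field of the automorphisms whose order on [H] is prime to [p]. This fixed field is
    itself a member of the union, since [pext_degree] makes its degree a power of [p]. *)
Lemma max_pextP x : max_pext p K H x <-> H x /\ forall (s : gal) m, galf K s -> ~~ (p %| m)%N ->
  galf H (s ^+ m)%g -> s x = x.
Proof.
have gH := finite_ext_num_gen gK fH; have [galH comH] := aH.
have [sfH KH stH] := galH.
split=> [[L [fL gL [k dL] LH Lx]]|[Hx hx]].
  split=> [|s m Ks pm hm]; first exact: LH.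
  apply: (@gal_coprime_fix s (p ^ k) m); last by apply: hm; apply: LH.
    by rewrite coprimeXl // prime_coprime.
  by apply: (galois_degree_exp sfK _ gL dL) => //; exact: num_gen_sub gH LH.
pose F := [set y | H y /\ forall (s : gal) m, galf K s -> ~~ (p %| m)%N -> galf H (s ^+ m)%g -> s y = y].
have FH : F `<=` H by move=> y [].
have [H1 HB HM HV] := sfH.
have sfF : is_subfield F.
  split=> [|y z [Hy hy] [Hz hz]|y z [Hy hy] [Hz hz]|y [Hy hy]]; split.
  - by [].
  - by move=> *; exact: rmorph1.
  - exact: HB.
  - by move=> s m *; rewrite rmorphB /= (hy s m) ?(hz s m).
  - exact: HM.
  - by move=> s m *; rewrite rmorphM /= (hy s m) ?(hz s m).
  - exact: HV.
  by move=> s m *; rewrite fmorphV /= (hy s m).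
have KF : K `<=` F by move=> y Ky; split; [exact: KH | move=> s m Ks _ _; exact: Ks].
have gF : galois_ext K F.
  split=> // s y Ks [Hy hy]; split=> [|t m Kt pm hm]; first exact: stH.
  by rewrite comH // (hy t m).
have nF : num_gen F by exact: num_gen_sub gH FH.
have [n dH] : exists n, degree K H n by case: fH.
have n0 : (0 < n)%N.
  rewrite lt0n; apply/eqP => n0; case: dH => b [_ /(_ 1 H1)[c [[_ h] _]]].
  by move/eqP: h; rewrite big1 ?oner_eq0 // => j; have := ltn_ord j; rewrite {2}n0.
have [m cop nE] := pfactor_coprime p_pr n0.
have [|k dk] := pext_degree p_pr sfK nF gF.
  move=> s Ks; exists (logn p n) => y [Hy hy].
  apply: (hy _ m); first exact: galf_exp.
    by rewrite -prime_coprime.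
  by move=> z Hz; rewrite -expgM mulnC -nE; apply: (galois_degree_exp sfK gH galH dH).
by exists F; split=> //; [split=> //; exists (p ^ k)%N | exists k].
Qed.

Lemma max_pext_sub : max_pext p K H `<=` H.
Proof. by move=> x /max_pextP[]. Qed.

Lemma max_pext_subfield : is_subfield (max_pext p K H).
Proof.
have [[[H1 HB HM HV] _ _] _] := aH.
split=> [|y z /max_pextP[Hy hy] /max_pextP[Hz hz]|y z /max_pextP[Hy hy] /max_pextP[Hz hz]|y /max_pextP[Hy hy]];
  apply/max_pextP; split.
- by [].
- by move=> *; exact: rmorph1.
- exact: HB.
- by move=> s m *; rewrite rmorphB /= (hy s m) ?(hz s m).
- exact: HM.
- by move=> s m *; rewrite rmorphM /= (hy s m) ?(hz s m).
- exact: HV.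
by move=> s m *; rewrite fmorphV /= (hy s m).
Qed.

Lemma max_pext_stable (s : gal) x : galf K s -> max_pext p K H x -> max_pext p K H (s x).
Proof.
have [[_ _ stH] comH] := aH.
move=> Ks /max_pextP[Hx hx]; apply/max_pextP; split=> [|t m Kt pm hm]; first exact: stH.
by rewrite comH // (hx t m).
Qed.

Section TotalRamification.
Context (W : set algC) (pW : place W).
Local Notation D := (decomp K W).
Local Notation I := (inertia K W).
Context (unr : forall v, prime_of K v -> v <> W `&` K -> unramified K H v).
Context (arch : arch_splits K (max_pext p K H)).
Context (split1 : forall (s : gal) x, D s -> max_pext p K (hilbert_class_field K) x -> s x = x).

(* The subfield fixed by inertia is unramified everywhere, hence contained in
   the Hilbert class field. *)
Lemma inertia_fixed_hilbert x : max_pext p K H x -> (forall i : gal, I i -> i x = x) ->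
  max_pext p K (hilbert_class_field K) x.
Proof.
have gH := finite_ext_num_gen gK fH; have [galH comH] := aH.
move=> [L [fL gL [k dL] LH Lx]] Ix.
have [sfL KL stL] := gL; have [L1 LB LM LV] := sfL.
pose F := [set y | L y /\ forall i : gal, I i -> i y = y].
have FL : F `<=` L by move=> y [].
have FH : F `<=` H by move=> y /FL/LH.
have sfF : is_subfield F.
  split=> [|y z [Hy hy] [Hz hz]|y z [Hy hy] [Hz hz]|y [Hy hy]]; split.
  - by [].
  - by move=> *; exact: rmorph1.
  - exact: LB.
  - by move=> i Ii; rewrite rmorphB /= hy ?hz.
  - exact: LM.
  - by move=> i Ii; rewrite rmorphM /= hy ?hz.
  - exact: LV.
  by move=> i Ii; rewrite fmorphV /= hy.
have IK i : I i -> galf K i by case=> -[].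
have KF : K `<=` F by move=> y Ky; split; [exact: KL | move=> i /IK; apply].
have gF : galois_ext K F.
  split=> // s y Ks [Ly hy]; split=> [|i Ii]; first exact: stL.
  by rewrite (comH _ _ _ (IK i Ii) Ks (LH _ Ly)) hy.
have nL : num_gen L by exact: num_gen_sub gH LH.
have nF : num_gen F by exact: num_gen_sub nL FL.
have [|j dj] := pext_degree p_pr sfK nF gF.
  by move=> s Ks; exists k => y [Ly _]; apply: (galois_degree_exp sfK nL gL dL).
have fF : finite_ext K F by split=> //; exists (p ^ j)%N.
exists F; split=> //; first by exists j.
move=> y Fy; exists F; split=> //.
- by split=> // s t z Ks Kt Fz; apply: comH => //; exact: FH.
- move=> g s /arch hs z Fz; apply: hs.
  by exists L; split=> //; [exists k | exact: FL].
move=> v pv; have [->|hv] := pselect (v = W `&` K); last first.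
  by move=> W' pW' W'v s /(unr pv hv pW' W'v) hs z Fz; apply: hs; exact: FH.
move=> W' pW' W'K s [[Ks Ws] Is] z Fz.
have [g Kg hg] := place_conj sfK gK pW pW' (esym W'K).
have Kg' := galf_inv Kg.
have Ii : I (g^-1 * s * g)%g.
  split; last first.
    move=> u uA; apply/hg; rewrite rmorphB /= gal_invVK.
    by apply: Is; rewrite gal_Aint.
  split; first by apply: galf_mul => //; exact: galf_mul.
  by move=> u; rewrite !hg !gal_mulE gal_invVK Ws.
have [_ _ stF] := gF; have [_ /(_ _ Ii)] := stF _ _ Kg' Fz.
by rewrite !gal_mulE gal_invVK => /fmorph_inj.
Qed.

(** If [f s] avoided the image [A] of inertia, some [z] would satisfy [s z <> r g z] for all [g] in
    [A]. But the product of the ['X - (r g z)%:P] has coefficients fixed by inertia, hence in the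
    largest [p]-extension inside the Hilbert class field, hence fixed by [s]; so [s z] would be one
    of its roots. *)
Lemma total_ramification (G : finZmodType) (f : gal -> G) :
  is_quotient D (galf (max_pext p K H)) f ->
  forall s, D s -> exists2 i, I i & f s = f i.
Proof.
move=> [fM _ fK] s Ds; set Kq := max_pext p K H in fK *.
have sfKq : is_subfield Kq by exact: max_pext_subfield.
have fsub s' t : D s' -> D t -> (f s' = f t) <-> forall x, Kq x -> s' x = t x.
  move=> Ds' Dt; have Dt' := decomp_inv Dt.
  have f1 : f 1%g = 0 by apply: (addrI (f 1%g)); rewrite -fM ?mulg1 ?addr0.
  have ft : f (t^-1)%g = - f t by apply/eqP; rewrite -addr_eq0 -fM // mulVg f1.
  have := fK (t^-1 * s')%g (decomp_mul Dt' Ds'); rewrite fM // ft => h; split=> [e x Kx|e].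
    have := h.1 _ x Kx; rewrite e addNr gal_mulE => /(_ erefl) h'.
    by rewrite -[in RHS]h' gal_invVK.
  apply/eqP; rewrite -subr_eq0 addrC; apply/eqP/h => x Kx.
  by rewrite gal_mulE e // gal_invK.
apply: contrapT => hno.
pose A := [set g : G | `[< exists2 i, I i & f i = g >]]%SET.
have AP g : reflect (exists2 i, I i & f i = g) (g \in A) by rewrite inE; exact: asboolP.
have /choice[r hr] (g : G) : exists i, g \in A -> I i /\ f i = g.
  by case: (AP g) => [[i Ii fi]|h]; [exists i | exists 1%g].
have rI g : g \in A -> I (r g) by move=> /hr[].
have rD g : g \in A -> D (r g) by move=> /rI/inertia_decomp.
have /choice[y hy] (g : G) : exists x, g \in A -> Kq x /\ s x <> r g x.
  case: (boolP (g \in A)) => gA; last by exists 0.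
  apply: contrapT => /forallNP h; apply: hno; exists (r g); first exact: rI.
  apply/fsub => //; [exact: rD | move=> x Kx; apply: contrapT => hx; apply: (h x)].
  by split.
(* A primitive element for the finitely many witnesses [y g], so that a single [z] distinguishes [s]
   from every [r g]. *)
have [z [c zE] [ps psE]] := algC_PET [seq y g | g <- enum A].
have Kz : Kq z.
  rewrite zE; apply: subfield_sum => // j _.
  have : Kq [seq y g | g <- enum A]`_j.
    have jl : (j < size (enum A))%N by rewrite -(size_map y (enum A)); exact: ltn_ord.
    rewrite (nth_map 0) //.
    have : nth 0 (enum A) j \in A by rewrite -mem_enum mem_nth.
    by move=> /hy[].
  move: (_`_j) => x Kx; elim: (c j) => [|k IH]; first by rewrite mulr0n; exact: subfield0.
  by rewrite mulrS; exact: subfieldD.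
have sz g : g \in A -> s z <> r g z.
  move=> gA e; have [_ h] := hy g gA; apply: h.
  have : y g \in [seq (map_poly ratr q).[z] | q <- ps] by rewrite -psE map_f // mem_enum.
  case/mapP => q _ ->; rewrite -!horner_map /= e -!map_poly_comp; congr (_.[_]).
  by apply: eq_map_poly => a /=; rewrite !fmorph_rat.
pose P := \prod_(g in A) ('X - (r g z)%:P).
have PI i : I i -> map_poly i P = P.
  move=> Ii; have Di := inertia_decomp Ii.
  rewrite rmorph_prod /= [RHS](reindex_inj (addrI (f i))) /=.
  have EA g : (f i + g \in A) = (g \in A).
    apply/AP/AP => -[j Ij fj].
      exists (i^-1 * j)%g; first by apply: inertia_mul => //; exact: inertia_inv.
      have := fM i (i^-1 * j)%g Di (decomp_mul (decomp_inv Di) (inertia_decomp Ij)).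
      by rewrite mulgA mulgV mul1g fj => /addrI.
    exists (i * j)%g; first exact: inertia_mul.
    by rewrite fM ?fj //; exact: inertia_decomp.
  apply: eq_big => [g|g gA]; first by rewrite EA.
  rewrite map_polyXsubC; congr ('X - _%:P).
  have gA' : f i + g \in A by rewrite EA.
  apply: (fsub (i * r g)%g (r (f i + g)) _ _).1 Kz; [exact: decomp_mul (rD _ gA) | exact: rD |].
  rewrite fM //; last exact: rD.
  by rewrite (hr _ gA).2 (hr _ gA').2.
have PK j : Kq P`_j.
  by apply: coef_prod_subfield => // g /rI[[Kr _] _]; exact: max_pext_stable.
have sP : map_poly s P = P.
  apply/polyP => j; rewrite coef_map /=; apply: split1 => //.
  apply: inertia_fixed_hilbert; [exact: PK | move=> i Ii].
  by rewrite -[in RHS](PI i Ii) coef_map.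
have A0 : 0 \in A by apply/AP; exists 1%g; [exact: inertia1 | apply/fK].
have Pz : P.[z] = 0.
  rewrite /P horner_prod (bigD1 0) //= hornerXsubC.
  suff -> : r 0 z = z by rewrite subrr mul0r.
  by apply: (fK _ _).1 Kz; [exact: rD | exact: (hr 0 A0).2].
have : P.[s z] = 0 by rewrite -sP horner_map Pz rmorph0.
rewrite /P horner_prod => /eqP/prodf_eq0[g gA]; rewrite hornerXsubC subr_eq0 => /eqP.
exact: sz.
Qed.
End TotalRamification.
End MaxPext.

(** * The integers of a p-adic field form a valuation ring *)

Section CompleteDVR.
Context (R : idomainType) (pi : R).
Definition pi_cong n (x y : R) : Prop := exists z, x - y = pi ^+ n * z.
Context (complete : forall a : nat -> R, (forall n, pi_cong n (a n.+1) (a n)) ->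
  exists l, forall n, pi_cong n l (a n)).
Context (separated : forall x, (forall n, pi_cong n x 0) -> x = 0).
Context (finite_quot : forall n, exists (T : finType) (red : R -> T),
  forall x y, red x = red y -> pi_cong n x y).
Context (unit_or_dvd : forall x, (exists y, x = pi * y) \/ (exists y, x * y = 1)).
Context (pi_nunit : ~ exists y, pi * y = 1) (pi0 : pi != 0).

Section Matrices.
Context (d : nat).
Implicit Types (A B M : 'M[R]_d.+1).

Definition mx_cong n A B : Prop := exists C, A - B = pi ^+ n *: C.

Lemma mx_congP n A B : mx_cong n A B <-> forall i j, pi_cong n (A i j) (B i j).
Proof.
split=> [[C h] i j|h]; first by exists (C i j); have := congr1 (fun X : 'M_d.+1 => X i j) h; rewrite !mxE.
have /choice[f hf] (i : 'I_d.+1) : exists f, forall j, A i j - B i j = pi ^+ n * f j.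
  by have /choice[f hf] := h i; exists f.
by exists (\matrix_(i, j) f i j); apply/matrixP => i j; rewrite !mxE.
Qed.

Lemma mx_cong_trans n A B C : mx_cong n A B -> mx_cong n B C -> mx_cong n A C.
Proof. by move=> [X hX] [Y hY]; exists (X + Y); rewrite scalerDr -hX -hY subrKA. Qed.
Lemma mx_cong_sym n A B : mx_cong n A B -> mx_cong n B A.
Proof. by move=> [X hX]; exists (- X); rewrite scalerN -hX opprB. Qed.
Lemma mx_congM n A B A' B' : mx_cong n A B -> mx_cong n A' B' -> mx_cong n (A * A') (B * B').
Proof.
move=> [X hX] [Y hY]; exists (X * A' + B * Y).
by rewrite scalerDr scalerAl scalerAr -hX -hY mulrBl mulrBr subrKA.
Qed.
Lemma mx_cong_refl n A : mx_cong n A A.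
Proof. by exists 0; rewrite subrr scaler0. Qed.
Lemma mx_congX n A B k : mx_cong n A B -> mx_cong n (A ^+ k) (B ^+ k).
Proof.
by move=> h; elim: k => [|k IH]; rewrite ?expr0 ?exprS; [exact: mx_cong_refl | exact: mx_congM].
Qed.
Lemma mx_cong_eq A B : (forall n, mx_cong n A B) -> A = B.
Proof.
move=> h; apply/matrixP => i j; apply/eqP; rewrite -subr_eq0; apply/eqP/separated => n.
by have /mx_congP/(_ i j)[z hz] := h n; exists z; rewrite subr0.
Qed.

Lemma mx_complete (A : nat -> 'M[R]_d.+1) : (forall n, mx_cong n (A n.+1) (A n)) ->
  exists E, forall n, mx_cong n E (A n).
Proof.
move=> h; have /choice[f hf] (i : 'I_d.+1) : exists f, forall j n, pi_cong n (f j) (A n i j).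
  have /choice[f hf] (j : 'I_d.+1) : exists l, forall n, pi_cong n l (A n i j).
    by apply: complete => n; have /mx_congP := h n; apply.
  by exists f.
by exists (\matrix_(i, j) f i j) => n; apply/mx_congP => i j; rewrite mxE.
Qed.

(** There are finitely many matrices modulo [pi ^+ n], so the powers of [M] are eventually periodic;
    an exponent that is a multiple of the period and lies beyond the preperiod gives an
    idempotent. *)
Lemma mx_power_idem n M : exists2 a, (0 < a)%N & mx_cong n (M ^+ a * M ^+ a) (M ^+ a).
Proof.
have [T [red hred]] := finite_quot n.
pose f k : {ffun 'I_d.+1 * 'I_d.+1 -> T} := [ffun ij => red ((M ^+ k) ij.1 ij.2)].
have hf k l : f k = f l -> mx_cong n (M ^+ k) (M ^+ l).
  move=> /ffunP h; apply/mx_congP => i j; apply: hred.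
  by have := h (i, j); rewrite !ffunE.
have : ~~ uniq [seq f k | k <- iota 0 #|{ffun 'I_d.+1 * 'I_d.+1 -> T}|.+1].
  apply/negP => /card_uniqP; rewrite size_map size_iota => e.
  by have := max_card (mem [seq f k | k <- iota 0 #|{ffun 'I_d.+1 * 'I_d.+1 -> T}|.+1]); rewrite e ltnn.
move=> /(uniqPn (f 0%N))[a [b [ab]]]; rewrite size_map size_iota => bl.
have al := ltn_trans ab bl.
rewrite !(nth_map 0%N) ?size_iota // !nth_iota // !add0n => /hf h.
have step k : (a <= k)%N -> mx_cong n (M ^+ (k + (b - a))) (M ^+ k).
  move=> ak; rewrite -(subnK ak) -addnA subnKC; last exact: ltnW.
  by rewrite !exprD; apply: mx_congM; [exact: mx_cong_refl | exact: mx_cong_sym].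
have stepn k m : (a <= k)%N -> mx_cong n (M ^+ (k + (b - a) * m)) (M ^+ k).
  move=> ak; elim: m => [|m IH]; first by rewrite muln0 addn0; exact: mx_cong_refl.
  rewrite mulnS addnA addnAC; apply: mx_cong_trans IH.
  by apply: step; rewrite (leq_trans ak) ?leq_addr.
have ba : (0 < b - a)%N by rewrite subn_gt0.
exists ((b - a) * a.+1)%N; first by rewrite muln_gt0 ba.
rewrite -exprD; apply: stepn; apply: leq_trans (leqnSn a) _.
by rewrite leq_pmull.
Qed.

(* [E] is the limit of the powers of [M] with highly divisible exponents. *)
Lemma mx_idem_limit M : exists (a : nat) E, [/\ (0 < a)%N, E * E = E, E * M = M * E & mx_cong 1 E (M ^+ a)].
Proof.
have /choice[a ha] n : exists a, (0 < a)%N /\ mx_cong n (M ^+ a * M ^+ a) (M ^+ a).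
  by have [a a0 h] := mx_power_idem n M; exists a.
(* Products of exponents: each power of [M] in the sequence is a power of the preceding one, which
   is idempotent modulo [pi ^+ n], whence convergence. *)
pose b n := (\prod_(k < n.+1) a k)%N.
have b0 n : (0 < b n)%N by rewrite prodn_gt0 // => k; case: (ha k).
have pw (X : 'M[R]_d.+1) n k : (0 < k)%N -> mx_cong n (X * X) X -> mx_cong n (X ^+ k) X.
  case: k => // k _ h; elim: k => [|k IH]; first by rewrite expr1; exact: mx_cong_refl.
  rewrite exprS; apply: mx_cong_trans h; apply: mx_congM IH; exact: mx_cong_refl.
have bidem n : mx_cong n (M ^+ b n * M ^+ b n) (M ^+ b n).
  rewrite /b big_ord_recr /= mulnC exprM -exprMn_comm ?commrX //.
  by apply: mx_congX; case: (ha n).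
have bS n : mx_cong n (M ^+ b n.+1) (M ^+ b n).
  by rewrite {1}/b big_ord_recr /= -/(b n) exprM; apply: pw (bidem n); case: (ha n.+1).
have [E hE] := mx_complete bS.
exists (b 1%N), E; split=> //.
- apply: mx_cong_eq => n; apply: mx_cong_trans (mx_congM (hE n) (hE n)) _.
  by apply: mx_cong_trans (bidem n) _; apply: mx_cong_sym.
apply: mx_cong_eq => n; apply: mx_cong_trans (mx_congM (hE n) (mx_cong_refl n M)) _.
rewrite -exprSr exprS; apply: mx_congM; [exact: mx_cong_refl | exact/mx_cong_sym].
Qed.

(** As a polynomial in the scalar put in place of [pi], the determinant has value 1 at 0; at [pi] it
    is 1 plus a multiple of [pi], and such an element is a unit. *)
Lemma det_1D_pi N : exists y, \det (1 + pi *: N : 'M[R]_d.+1) * y = 1.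
Proof.
pose P := \det (1 + 'X *: map_mx polyC N : 'M[{poly R}]_d.+1).
have PE a : P.[a] = \det (1 + a *: N).
  rewrite -[LHS]/(horner_eval a P) -det_map_mx; congr (\det _).
  apply/matrixP => i j; rewrite !mxE rmorphD rmorphM rmorph_nat /= /horner_eval hornerX hornerC.
  by [].
have [y hy] : exists y, P.[pi] = 1 + pi * y.
  have [q [c PX]] : exists q c, P = q * 'X + c%:P.
    by elim/poly_ind: P {PE} => [|q c _]; [exists 0, 0; rewrite mul0r addr0 | exists q, c].
  have P0 : P.[0] = 1 by rewrite PE scale0r addr0 det1.
  exists q.[pi]; move: P0; rewrite PX !hornerMXaddC mulr0 add0r => ->.
  by rewrite addrC mulrC.
rewrite -PE hy; case: (unit_or_dvd (1 + pi * y)) => // -[z hz].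
by case: pi_nunit; exists (z - y); rewrite mulrBr -hz addrK.
Qed.
End Matrices.

Context (Q : fieldType) (io : {rmorphism R -> Q}) (io_inj : injective io).
Local Notation integral := (integralOver io).

Lemma eigen_integral d (N : 'M[R]_d.+1) (v : 'rV[Q]_d.+1) a :
  v != 0 -> v *m map_mx io N = a *: v -> integral a.
Proof.
move=> v0 h; exists (char_poly N); first exact: char_poly_monic.
by rewrite map_char_poly -eigenvalue_root_char; apply/eigenvalueP; exists v.
Qed.

(** [1 + io pi * a] is an eigenvalue of [1 + pi *: N], whose inverse has entries in [R]; its inverse
    is thus an eigenvalue of a matrix over [R], hence integral. *)
Lemma eigen_unit d (N : 'M[R]_d.+1) (v : 'rV[Q]_d.+1) a :
  v != 0 -> v *m map_mx io N = a *: v -> exists2 y, integral y & (1 + io pi * a) * y = 1.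
Proof.
move=> v0 h; have [u hu] := det_1D_pi N; set T := (1 + pi *: N) in hu.
have vT : v *m map_mx io T = (1 + io pi * a) *: v.
  rewrite /T raddfD /= map_mxZ mulmxDr -scalemxAr h scalerA scalerDl scale1r; congr (_ + _).
  by rewrite map_mx1 mulmx1.
pose Z := u *: \adj T.
have TZ : T *m Z = 1%:M by rewrite /Z -scalemxAr mul_mx_adj scale_scalar_mx mulrC hu.
have vZ : (1 + io pi * a) *: (v *m map_mx io Z) = v.
  by rewrite scalemxAl -vT -mulmxA -map_mxM TZ map_mx1 mulmx1.
have c0 : 1 + io pi * a != 0.
  by apply: contraNneq v0 => c0; rewrite -vZ c0 scale0r.
exists (1 + io pi * a)^-1; last by rewrite divff.
apply: (eigen_integral (N := Z) v0).
by rewrite -{2}vZ scalerA mulVf // scale1r.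
Qed.

(** Hensel's lemma by linear algebra. The row of powers of [x] spans an eigenspace of the companion
    matrix [M], so it is also an eigenvector of the idempotent limit [E] of powers of [M]. Its
    eigenvalue [l] under [E] is 0 or 1 and is congruent to [x ^+ a] modulo [pi]. Accordingly
    [1 - x ^+ a] or [x ^+ a] is a unit, and so is its divisor [1 - x] or [x]. *)
Lemma integral_local (x : Q) : integral x ->
  (exists2 y, integral y & x * y = 1) \/ (exists2 y, integral y & (1 - x) * y = 1).
Proof.
move=> [f fm fx]; have [d sf] : exists d, size f = d.+2.
  case sf : (size f) => [|[|d]]; last by exists d.
    by move/eqP: sf; rewrite size_poly_eq0 (negPf (monic_neq0 fm)).
  have /size1_polyC fE : (size f <= 1)%N by rewrite sf.
  move/monicP: fm; rewrite /lead_coef sf /= => f0.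
  by move: fx; rewrite fE f0 /root map_polyC hornerC /= rmorph1 oner_eq0.
pose M := \matrix_(i < d.+1, j < d.+1) if (j < d)%N then (i == j.+1 :> nat)%:R else - f`_i.
pose v : 'rV[Q]_d.+1 := \row_i x ^+ i.
have MjE (w : 'rV[Q]_d.+1) (j : 'I_d.+1) (jd : (j.+1 < d.+1)%N) :
    (w *m map_mx io M) 0 j = w 0 (Ordinal jd).
  rewrite mxE (bigD1 (Ordinal jd)) //= big1 => [|i ij].
    by rewrite !mxE -ltnS jd /= eqxx rmorph1 mulr1 addr0.
  rewrite !mxE -ltnS jd; case: eqP => [e|_]; last by rewrite rmorph0 mulr0.
  by case/eqP: ij; apply: val_inj.
have vM : v *m map_mx io M = x *: v.
  apply/rowP => j; rewrite [RHS]mxE; case: (ltnP j d) => jd.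
    by rewrite (MjE v j jd) !mxE /= exprS.
  have jE : j = d :> nat by apply/eqP; rewrite eqn_leq jd -ltnS ltn_ord.
  rewrite !mxE (eq_bigr (fun i : 'I_d.+1 => - (io f`_i * x ^+ i))) => [|i _]; last first.
    by rewrite !mxE ltnNge jd /= rmorphN mulrN mulrC.
  rewrite sumrN -exprS jE; apply/eqP; rewrite eq_sym -addr_eq0.
  have lc : (map_poly io f)`_d.+1 = 1.
    by rewrite coef_map /=; move/monicP: fm; rewrite /lead_coef sf /= => ->; rewrite rmorph1.
  move: fx; rewrite /root horner_coef size_map_inj_poly ?rmorph0 // sf big_ord_recr /= lc mul1r.
  by under eq_bigr => i _ do rewrite coef_map /=; rewrite addrC.
have v0 : v != 0.
  by apply/eqP => /rowP/(_ ord0); rewrite !mxE expr0 => /eqP; rewrite oner_eq0.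
have eig (w : 'rV[Q]_d.+1) : w *m map_mx io M = x *: w -> w = w 0 ord0 *: v.
  move=> h; apply/rowP => -[j jd]; rewrite [RHS]mxE [v _ _]mxE /=.
  elim: j jd => [|j IH] jd; first by rewrite expr0 mulr1; congr (w _ _); apply: val_inj.
  have jd' := ltnW jd; have := congr1 (fun u : 'rV_d.+1 => u 0 (Ordinal jd')) h.
  rewrite (MjE w (Ordinal jd') jd) [X in _ = X]mxE IH => e.
  by rewrite exprS mulrCA -e; congr (w _ _); exact: val_inj.
have comm (A : 'M[R]_d.+1) : A * M = M * A -> exists l, v *m map_mx io A = l *: v.
  move=> h; exists ((v *m map_mx io A) 0 ord0); apply: eig.
  by rewrite -mulmxA -map_mxM -[A *m M]/(A * M) h map_mxM mulmxA vM scalemxAl.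
have [a [E [a0 EE EM [C hC]]]] := mx_idem_limit M; rewrite expr1 in hC.
have CM : C * M = M * C.
  apply/matrixP => i j; apply: (mulfI pi0).
  have : (pi *: C) * M = M * (pi *: C).
    by rewrite -hC mulrBl mulrBr EM -exprS exprSr.
  rewrite -scalerAl -scalerAr => /matrixP/(_ i j).
  by rewrite !mxE.
have [l hl] := comm E EM; have [nu hnu] := comm C CM.
have nuI : integral nu := eigen_integral v0 hnu.
have vMa k : v *m map_mx io (M ^+ k) = x ^+ k *: v.
  elim: k => [|k IH]; first by rewrite !expr0 map_mx1 mulmx1 scale1r.
  by rewrite exprSr map_mxM mulmxA IH -scalemxAl vM scalerA exprSr.
have vinj (b c : Q) : b *: v = c *: v -> b = c.
  by move=> /rowP/(_ ord0); rewrite !mxE expr0 !mulr1.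
have lE : l = x ^+ a + io pi * nu.
  apply: vinj; rewrite -hl -(subrK (M ^+ a) E) hC map_mxD mulmxDr vMa map_mxZ -scalemxAr hnu.
  by rewrite scalerA -scalerDl addrC.
have ll : l * l = l.
  by apply: vinj; rewrite -scalerA -hl scalemxAl -hl -mulmxA -map_mxM -[E *m E]/(E * E) EE.
have xI : integral x by exists f.
have xXI k : integral (x ^+ k).
  by elim: k => [|k IH]; rewrite ?expr0 ?exprS; [exact: integral1 | exact: integral_mul].
have [l0|l0] := eqVneq l 0.
  right; have [y yI hy] := eigen_unit v0 hnu.
  exists ((\sum_(k < a) x ^+ k) * y).
    apply: integral_mul => //; elim/big_ind: _ => //; [exact: integral0 | exact: integral_add].
  have xa : x ^+ a = - (io pi * nu) by apply/eqP; rewrite -addr_eq0 -lE l0.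
  rewrite mulrA (_ : (1 - x) * _ = 1 - x ^+ a); first by rewrite xa opprK.
  by rewrite -[RHS]opprB subrX1 -mulNr opprB.
left; have l1 : l = 1 by apply: (mulfI l0); rewrite ll mulr1.
have hnu' : v *m map_mx io (- C) = (- nu) *: v by rewrite map_mxN mulmxN hnu scaleNr.
have [y yI hy] := eigen_unit v0 hnu'.
exists (x ^+ a.-1 * y); first exact: integral_mul.
rewrite mulrA -exprS prednK // (_ : x ^+ a = 1 + io pi * - nu) //.
by rewrite mulrN -l1 lE addrK.
Qed.

(** Divided by a power of [pi], the equation of [z] has a unit coefficient, and Seidenberg's lemma
    applies with [W] the set of non-units among the integral elements. That [W] is closed under
    subtraction is [integral_local]. *)
Lemma valuation_ring (z : Q) (F : {poly R}) : F != 0 -> root (map_poly io F) z ->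
  integral z \/ integral z^-1.
Proof.
move=> F0 Fz.
have [F' [F'z [j hj]]] : exists F' : {poly R}, root (map_poly io F') z /\ exists j y, F'`_j * y = 1.
  (* Separatedness, applied to a nonzero coefficient, bounds the powers of [pi] that divide [F]. *)
  pose P n := `[< exists G : {poly R}, F = pi ^+ n *: G >].
  have [m hm] : exists m, forall n, P n -> (n <= m)%N.
    have [j Fj] : exists j, F`_j != 0.
      apply: contrapT => /forallNP h; move/eqP: F0; apply; apply/polyP => j; rewrite coef0.
      by apply: contrapT => /eqP; exact: h.
    have [m hm] : exists m, ~ pi_cong m F`_j 0.
      by apply/existsNP => h; move/eqP: Fj; apply; exact: separated.
    exists m => n /asboolP[G FG]; rewrite leqNgt; apply/negP => mn; apply: hm.
    exists (pi ^+ (n - m) * G`_j); rewrite subr0 mulrA -exprD subnKC; last exact: ltnW.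
    by rewrite {1}FG coefZ.
  have P0 : exists n, P n by exists 0%N; apply/asboolP; exists F; rewrite expr0 scale1r.
  case: (ex_maxnP P0 hm) => n /asboolP[G FG] maxn.
  exists G; split.
    move: Fz; rewrite FG map_polyZ rootZ // rmorphXn expf_neq0 //.
    by rewrite -(rmorph0 io) (inj_eq io_inj).
  apply: contrapT => hno.
  have /choice[c hc] j : exists y, G`_j = pi * y.
    case: (unit_or_dvd G`_j) => // -[y hy]; by case: hno; exists j, y.
  have /maxn : P n.+1; last by rewrite ltnn.
  apply/asboolP; exists (\poly_(j < size G) c j); rewrite exprSr -scalerA FG; congr (_ *: _).
  apply/polyP => j; rewrite coefZ coef_poly; case: ltnP => jG; first exact: hc.
  by rewrite mulr0 nth_default.
have := F'z; rewrite /root => /eqP; rewrite -[LHS]/(horner_rec (map_poly io F') z).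
rewrite [polyseq (map_poly io F')](_ : _ = [seq io c | c <- F']); last first.
  apply: (@eq_from_nth _ 0); first by rewrite size_map size_map_inj_poly ?rmorph0.
  rewrite size_map_inj_poly ?rmorph0 // => k kf.
  by rewrite coef_map (nth_map 0).
set cs := [seq _ | _ <- _] => hE.
have E : foldl (fun y a => y * z + a) 0 (rev cs) = 0.
  by rewrite foldl_rev -[RHS]hE; elim: (cs) => //= b s ->.
pose W (x : Q) := integral x /\ ~ exists2 y, integral y & x * y = 1.
have W0 : W 0.
  by split; [exact: integral0 | move=> [y _] /eqP; rewrite mul0r eq_sym oner_eq0].
have WB x y : W x -> W y -> W (x - y).
  move=> [xI hx] [yI hy]; split; first exact: integral_sub.
  move=> [u uI hu]; have [|[w wI hw]|[w wI hw]] := @integral_local (x * u).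
  - exact: integral_mul.
  - by apply: hx; exists (u * w); [exact: integral_mul | rewrite mulrA].
  apply: hy; exists (- (u * w)); first by apply: integral_opp; exact: integral_mul.
  have e : 1 - x * u = - (y * u) by rewrite -hu mulrBl addrAC subrr add0r.
  by rewrite -hw e mulrN mulNr mulrA.
have csI x : x \in rev cs -> integral x by rewrite mem_rev => /mapP[c _ ->]; exact: integral_id.
have [y hy] := hj.
have jF : (j < size F')%N.
  rewrite ltnNge; apply/negP => h; move: hy; rewrite nth_default // mul0r => /eqP.
  by rewrite eq_sym oner_eq0.
have nWs : exists2 x, x \in (0 : Q) :: rev cs & ~ W x.
  exists (io F'`_j); first by rewrite inE mem_rev map_f ?orbT // mem_nth.
  by move=> [_]; apply; exists (io y); [exact: integral_id | rewrite -rmorphM hy rmorph1].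
have clo (q : {poly Q}) u : q \is monic -> (forall i, integral q`_i) -> root q u -> integral u.
  by move=> qm qI qu; apply: (integral_root_monic qm qu); exact/integral_poly.
have key := @val_ring_horner Q integral W (integral1 _) (@integral_sub _ _ _) (@integral_mul _ _ _) clo W0 WB z 0 (rev cs).
have nW b : integral b -> ~ W b -> exists2 u, integral u & b * u = 1.
  by move=> bI nWb; apply: contrapT => h; apply: nWb.
have [] := key (integral0 _) csI E nWs; move=> [a [b [aI bI /(nW _ bI)[u uI bu] e]]].
  by left; rewrite -[z]mulr1 -bu mulrA e; exact: integral_mul.
by right; rewrite -[z^-1]mulr1 -bu mulrA e; exact: integral_mul.
Qed.
End CompleteDVR.

(** * The ring of p-adic integers and its finite extensions *)

Section PadicRing.
Context (p : nat) (p_pr : prime p).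

Definition Zp : idomainType := Defs_padicZ__canonical__GRing_IntegralDomain p_pr.
Implicit Types x y z : Zp.
Local Notation pi := (p%:R : Zp).

Let p_gt0 n : (0 < p ^ n)%N. Proof. by rewrite expn_gt0 prime_gt0. Qed.

Lemma padic_valD x y n : padic_val (x + y) n = ((padic_val x n + padic_val y n) %% p ^ n)%N.
Proof. by []. Qed.
Lemma padic_valM x y n : padic_val (x * y) n = ((padic_val x n * padic_val y n) %% p ^ n)%N.
Proof. by []. Qed.
Lemma padic_val_nat m n : padic_val (m%:R : Zp) n = (m %% p ^ n)%N.
Proof.
elim: m => [//|m IH]; rewrite -addn1 natrD padic_valD IH modnDml.
by rewrite (_ : padic_val (1%:R : Zp) n = (1 %% p ^ n)%N) ?modnDmr.
Qed.
Lemma padic_val_lt x n : (padic_val x n < p ^ n)%N.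
Proof. by rewrite -padic_mod ltn_mod. Qed.
Lemma Zp_ext x y : (forall n, padic_val x n = padic_val y n) -> x = y.
Proof. by move=> h; apply: (@val_inj _ _ (padicZ p)); apply: funext. Qed.

Lemma padic_val_natX k n : padic_val (pi ^+ k) n = ((p ^ k) %% p ^ n)%N.
Proof. by rewrite -natrX padic_val_nat. Qed.

Lemma padic_dvdP x n : padic_val x n = 0%N <-> exists z, x = pi ^+ n * z.
Proof.
split=> [h|[z ->]]; last by rewrite padic_valM padic_val_natX modnn mul0n mod0n.
(* The approximation of the quotient modulo [p ^ m] is that of [x] modulo [p ^ (m + n)], divided by
   [p ^ n]. *)
have hf m : ((padic_val x (m.+1 + n) %/ p ^ n) = (padic_val x (m + n) %/ p ^ n) %[mod p ^ m])%N.
  rewrite !modn_divl -expnD padic_mod; congr (_ %/ _)%N.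
  by rewrite addSn -padicE.
exists (padic_mk hf : Zp); apply: Zp_ext => m.
rewrite padic_valM padic_val_natX /= modnMm mulnC divnK; last first.
  by rewrite /dvdn addnC padic_le h.
by rewrite padic_le.
Qed.

Lemma padic_congP n x y : pi_cong pi n x y <-> padic_val x n = padic_val y n.
Proof.
split=> [[z hz]|h].
  have /padic_dvdP h : exists z, x - y = pi ^+ n * z by exists z.
  have := congr1 (fun u : Zp => padic_val u n) (subrK y x).
  by rewrite padic_valD h add0n padic_mod => ->.
apply/padic_dvdP; have := congr1 (fun z : Zp => padic_val z n) (subrK y x).
move: (x - y) => z; rewrite padic_valD h => e; apply/eqP.
rewrite -(modn_small (padic_val_lt z n)) -(mod0n (p ^ n)).
by rewrite -(eqn_modDr (padic_val y n)) e add0n padic_mod.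
Qed.

Lemma Zp_complete (a : nat -> Zp) : (forall n, pi_cong pi n (a n.+1) (a n)) ->
  exists l, forall n, pi_cong pi n l (a n).
Proof.
move=> h; have hf n : (padic_val (a n.+1) n.+1 = padic_val (a n) n %[mod p ^ n])%N.
  by rewrite -padicE ((padic_congP _ _ _).1 (h n)) padic_mod.
by exists (padic_mk hf : Zp) => n; apply/padic_congP; rewrite /= padic_mod.
Qed.

Lemma Zp_separated x : (forall n, pi_cong pi n x 0) -> x = 0.
Proof. by move=> h; apply: Zp_ext => n; apply/padic_congP. Qed.

Lemma Zp_finite_quot n : exists (T : finType) (red : Zp -> T),
  forall x y, red x = red y -> pi_cong pi n x y.
Proof.
exists 'I_(p ^ n).-1.+1, (fun x => inord (padic_val x n)) => x y /(congr1 val) /=.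
rewrite !inordK ?prednK // ?padic_val_lt // => h.
exact/padic_congP.
Qed.

(** If [x] is prime to [p], Euler's theorem gives an inverse modulo each [p ^ n] as a power of [x];
    uniqueness of inverses makes these compatible. *)
Lemma Zp_unit_or_dvd x : (exists y, x = pi * y) \/ (exists y, x * y = 1).
Proof.
have [x0|x0] := eqVneq (padic_val x 1) 0%N.
  by left; move/padic_dvdP: x0; rewrite expr1.
right; have cop n : coprime (padic_val x n) (p ^ n).
  case: n => [|n]; first by rewrite expn0 coprimen1.
  rewrite coprime_pexpr // coprime_sym prime_coprime //.
  by apply: contra x0 => /eqP h; rewrite -(padic_le x 1 n) expn1 h.
pose f n := (padic_val x n ^ (totient (p ^ n)).-1)%N.
have fx n : (f n * padic_val x n = 1 %[mod p ^ n])%N.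
  by rewrite /f -expnSr prednK ?totient_gt0 // Euler_exp_totient.
have uniq m a u v : (u * a = 1 %[mod m] -> v * a = 1 %[mod m] -> u = v %[mod m])%N.
  move=> ua va; rewrite -[u in LHS]muln1 -modnMmr -va modnMmr mulnCA.
  by rewrite -modnMmr ua modnMmr muln1.
have hf n : (f n.+1 = f n %[mod p ^ n])%N.
  apply: (uniq _ (padic_val x n)) (fx n).
  rewrite -(padic_le x n 1) addn1 modnMmr.
  have := congr1 (fun k => k %% p ^ n)%N (fx n.+1).
  by rewrite !modn_dvdm // expnS dvdn_mull.
exists (padic_mk hf : Zp); apply: Zp_ext => n.
by rewrite padic_valM /= modnMmr mulnC fx.
Qed.

Lemma Zp_nat_neq0 m : (0 < m)%N -> (m%:R : Zp) != 0.
Proof.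
move=> m0; apply/eqP => h; have := padic_val_nat m m; rewrite h => e.
have e0 : padic_val (0 : Zp) m = 0%N by exact: mod0n.
have mp : (m < p ^ m)%N by rewrite ltn_expl ?prime_gt1.
have m00 : m = 0%N := etrans (esym (modn_small mp)) (etrans (esym e) e0).
by rewrite m00 in m0.
Qed.

Lemma Zp_pi_nunit : ~ exists y, pi * y = 1.
Proof.
move=> [y /(congr1 (fun x : Zp => padic_val x 1))].
rewrite padic_valM padic_val_nat expn1 modnn mul0n mod0n /= expn1 modn_small //.
exact: prime_gt1.
Qed.

Lemma fraction_numden (R : idomainType) (x : {ratio R}) :
  \pi_{fraction R}%qT x = tofrac (frac x).1 / tofrac (frac x).2.
Proof.
have h : tofrac (frac x).2 != 0 by rewrite tofrac_eq0; exact: denom_ratioP.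
apply: (mulIf h); rewrite mulfVK //; apply/eqP.
rewrite !piE /FracField.mulf /FracField.equivf !numden_Ratio ?oner_eq0 ?mulr1 ?denom_ratioP //.
by rewrite mulrC.
Qed.

Lemma frac_clear (R : idomainType) (f : {poly {fraction R}}) :
  exists d (r : {poly R}), d != 0 /\ tofrac d *: f = map_poly (@tofrac R) r.
Proof.
elim/poly_ind: f => [|f c [d [r [d0 IH]]]].
  by exists 1, 0; rewrite oner_eq0 scaler0 map_poly0.
have [a [b [b0 cE]]] : exists a b : R, b != 0 /\ c = tofrac a / tofrac b.
  elim/quotW: c => x; exists (frac x).1, (frac x).2; split; first exact: denom_ratioP.
  exact: fraction_numden.
exists (d * b), (b *: r * 'X + (d * a)%:P); split; first by rewrite mulf_neq0.
have XE : map_poly (@tofrac R) (b *: r * 'X) = tofrac b *: map_poly (@tofrac R) r * 'X.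
  by rewrite rmorphM /= map_polyX map_polyZ.
rewrite scalerDr rmorphD /= XE map_polyC /= -IH scalerA -scalerAl !tofracM (mulrC (tofrac b)).
congr (_ + _); rewrite -mul_polyC -polyCM cE; congr (_%:P).
have b1 : tofrac b != 0 by rewrite tofrac_eq0.
by rewrite mulrCA -mulrA divff // mulr1 mulrC.
Qed.

Context (Q : fieldExtType (padicQ p_pr)).
Definition padic_in : Zp -> Q := in_alg Q \o @tofrac Zp.
HB.instance Definition _ := GRing.RMorphism.on padic_in.

Lemma padic_in_inj : injective padic_in.
Proof. by move=> x y /(fmorph_inj (in_alg Q)) /eqP; rewrite tofrac_eq => /eqP. Qed.

Lemma padic_nat_neq0 m : (0 < m)%N -> (m%:R : Q) != 0.
Proof.
move=> m0; rewrite -(rmorph_nat padic_in) -(rmorph0 padic_in) (inj_eq padic_in_inj).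
exact: Zp_nat_neq0.
Qed.

Lemma padic_valuation_ring (z : Q) : padic_integers z \/ padic_integers z^-1.
Proof.
have /polyOver1P[f hf] := minPolyOver 1 z.
have [d [r [d0 hr]]] := frac_clear f.
have f0 : f != 0.
  by apply: contraNneq (monic_neq0 (monic_minPoly 1 z)) => f0; rewrite hf f0 map_poly0.
have d0' : tofrac d != 0 :> padicQ p_pr by rewrite tofrac_eq0.
apply: (@valuation_ring Zp p%:R Zp_complete Zp_separated Zp_finite_quot Zp_unit_or_dvd
  Zp_pi_nunit (Zp_nat_neq0 (prime_gt0 p_pr)) Q padic_in padic_in_inj z r).
  apply: contraNneq f0 => r0; move: hr; rewrite r0 map_poly0 => /eqP.
  by rewrite scaler_eq0 (negPf d0').
rewrite /padic_in map_poly_comp -hr map_polyZ rootZ ?fmorph_eq0 //.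
by rewrite -hf root_minPoly.
Qed.
End PadicRing.

(** * The coefficient ring modulo M *)

Section CoefficientRing.
Context (X : setting) (Y : coefficients X).
Local Notation r := (c_r Y).

Lemma emb_scalar_unit (z : s_Q X) (l m : s_R X) (mu : s_R X) : s_emb X mu = z%:A -> z != 0 ->
  l * mu = m * mu -> l = m.
Proof.
move=> hz z0 /(congr1 (s_emb X)); have [einj _ _ _] := s_order X.
by rewrite !rmorphM /= hz -!scalerAr !mulr1 => /(scalerI z0)/einj.
Qed.

Lemma pi_c_M : c_pi Y (c_M Y) = 0.
Proof. by apply/c_pi_ker; exists 1; rewrite mulr1. Qed.

Lemma nat_eq0_of_integral m : padic_integers (m%:R / c_M0 Y) -> m%:R = 0 :> r.
Proof.
have [einj eO _ _] := s_order X.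
move=> /eO[x hx]; rewrite -(rmorph_nat (c_pi Y)).
apply/c_pi_ker; exists x; apply: einj.
rewrite rmorphM /= hx c_M_emb rmorph_nat -scalerAl mul1r scalerA mulrC divfK ?c_M_neq0 //.
by rewrite scaler_nat.
Qed.

Lemma Mbar_eq0 : (c_Mbar Y)%:R = 0 :> r.
Proof. exact/nat_eq0_of_integral/c_Mbar_dvd. Qed.

(* [M] and the integer [m] are comparable for divisibility in the valuation
   ring [O], so that [r] behaves like [O / M O]. *)
Lemma annihilator_div (l : r) m : (forall mu : r, mu *+ m = 0 -> l * mu = 0) ->
  exists nu, l = nu *+ m.
Proof.
have [einj eO _ _] := s_order X.
have one0 : m%:R = 0 :> r -> (forall mu : r, mu *+ m = 0 -> l * mu = 0) -> exists nu, l = nu *+ m.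
  by move=> m0 h; exists 0; rewrite mul0rn -[LHS]mulr1 h.
have [m0|m0] := posnP m; first by apply: one0; rewrite m0.
move=> h; have mQ : m%:R != 0 :> s_Q X by exact: padic_nat_neq0.
have [zI|] := padic_valuation_ring (c_M0 Y / m%:R); last first.
  by rewrite invf_div => /nat_eq0_of_integral m00; exact: one0.
(* When [m] divides [M], the quotient [mu0] is killed by [m] in [r]. So [M] divides [x * mu0], and
   cancelling [mu0] shows that [m] divides [x]. *)
have [mu0 hmu] := eO _ zI; have [x hx] := c_pi_surj l.
have mM : mu0 *+ m = c_M Y.
  by apply: einj; rewrite rmorphMn /= hmu c_M_emb -scaler_nat scalerA mulrC divfK.
have : l * c_pi Y mu0 = 0 by apply: h; rewrite -rmorphMn /= mM pi_c_M.
rewrite -hx -rmorphM => /c_pi_ker[y hy]; exists (c_pi Y y); rewrite -rmorphMn; congr (c_pi Y _).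
apply: (emb_scalar_unit hmu); first by rewrite mulf_neq0 ?c_M_neq0 ?invr_eq0.
by rewrite hy -mM mulrnAl mulrC -mulrnAl.
Qed.
End CoefficientRing.

(** * Augmentation quotients and tensor products *)

Section SubquotientTheory.
Context {R : pzRingType} {V : lmodType R} (Z B : subm V).

Lemma cls_val (x : submod Z) : cls Z B (val x) = \pi_(quotm (subm_preim Z B))%qT x.
Proof. by rewrite /cls valKd. Qed.

Lemma cls_lin a x y : Z x -> Z y -> cls Z B (a *: x + y) = a *: cls Z B x + cls Z B y.
Proof.
move=> /(subm_predP Z) Zx /(subm_predP Z) Zy; pose x' := Submod Zx; pose y' := Submod Zy.
rewrite -[x]/(val x') -[y]/(val y') -linearP !cls_val quotm_piD; congr (_ + _).
exact/esym/quotm_scale_pi.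
Qed.

Lemma clsD x y : Z x -> Z y -> cls Z B (x + y) = cls Z B x + cls Z B y.
Proof. by move=> Zx Zy; have := cls_lin 1 Zx Zy; rewrite !scale1r. Qed.

Lemma clsB x y : Z x -> Z y -> cls Z B (x - y) = cls Z B x - cls Z B y.
Proof. by move=> Zx Zy; rewrite addrC -scaleN1r cls_lin // scaleN1r addrC. Qed.

Lemma cls0 : cls Z B 0 = 0.
Proof.
have Z0 := subm_0 Z; apply: (addrI (cls Z B 0)).
by rewrite -clsD // !addr0.
Qed.

Lemma cls_eqP x y : Z x -> Z y -> cls Z B x = cls Z B y <-> B (x - y).
Proof.
move=> /(subm_predP Z) Zx /(subm_predP Z) Zy; pose x' := Submod Zx; pose y' := Submod Zy.
rewrite -[x]/(val x') -[y]/(val y') !cls_val; split=> [/quotm_eqP|h]; last exact/quotm_eqP.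
by move=> h; rewrite -raddfB.
Qed.

Lemma rep_in (c : subquot Z B) : Z (rep c).
Proof. exact: elimT (subm_predP Z _) (valP _). Qed.

Lemma repK (c : subquot Z B) : cls Z B (rep c) = c.
Proof. by rewrite /rep cls_val; exact: (@reprK _ (quotm (subm_preim Z B))). Qed.

Lemma submN (S : subm V) x : S x -> S (- x).
Proof. by move=> Sx; have := subm_lin (-1) Sx (subm_0 S); rewrite addr0 scaleN1r. Qed.
Lemma submD (S : subm V) x y : S x -> S y -> S (x + y).
Proof. by move=> Sx Sy; have := subm_lin 1 Sx Sy; rewrite scale1r. Qed.
Lemma submB (S : subm V) x y : S x -> S y -> S (x - y).
Proof. by move=> Sx Sy; apply: submD => //; exact: submN. Qed.
Lemma submZ (S : subm V) a x : S x -> S (a *: x).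
Proof. by move=> Sx; have := subm_lin a Sx (subm_0 S); rewrite addr0. Qed.
Lemma subm_sum (S : subm V) (I : Type) (s : seq I) (P : pred I) (f : I -> V) :
  (forall i, P i -> S (f i)) -> S (\sum_(i <- s | P i) f i).
Proof. by move=> h; elim/big_ind: _ => //; [exact: subm_0 | exact: submD]. Qed.

Lemma cls_repB x : Z x -> B (rep (cls Z B x) - x).
Proof. by move=> Zx; apply/cls_eqP => //; [exact: rep_in | rewrite repK]. Qed.
End SubquotientTheory.

Section Augmentation.
Context (G : finZmodType).
Local Notation ZG := (gring int G).

Lemma gdeltaM (r : comPzRingType) (g h : G) : gdelta r g * gdelta r h = gdelta r (g + h).
Proof.
apply/ffunP => x; rewrite ffunE (bigD1 g) //= big1 => [|y /negPf yg].
  by rewrite !ffunE eqxx mul1r addr0 subr_eq addrC.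
by rewrite ffunE yg mul0r.
Qed.

Lemma gaug_gdelta (r : comPzRingType) (g : G) : gaug (gdelta r g) = 1.
Proof.
rewrite /gaug (bigD1 g) //= big1 => [|y /negPf yg]; first by rewrite ffunE eqxx addr0.
by rewrite ffunE yg.
Qed.

Lemma gaugB (r : comPzRingType) (x y : gring r G) : gaug (x - y) = gaug x - gaug y.
Proof. by rewrite /gaug -sumrB; apply: eq_bigr => g _; rewrite !ffunE. Qed.

Lemma aug_gdeltaB (g h : G) : augideal G (gdelta int g - gdelta int h).
Proof. by rewrite /= gaugB !gaug_gdelta subrr. Qed.
Hint Resolve aug_gdeltaB : core.

(** The defect of additivity is the product of [g - 1] and [h - 1], an element of the square of the
    ideal. *)
Lemma rho_augD (g h : G) : rho_aug (g + h) = rho_aug g + rho_aug h.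
Proof.
rewrite /rho_aug /augcls -clsD //; apply/cls_eqP => //; first exact: submD.
exists [:: (gdelta int g - gdelta int 0, gdelta int h - gdelta int 0)].
  by move=> y; rewrite inE => /eqP ->; split; exact: aug_gdeltaB.
rewrite big_seq1 /= mulrBl !mulrBr !gdeltaM !addr0 !add0r.
by rewrite opprD !opprB !addrA subrK.
Qed.

Fact rho_aug_zmod : zmod_morphism (@rho_aug G).
Proof. by move=> x y; apply/eqP; rewrite eq_sym subr_eq -rho_augD subrK. Qed.
HB.instance Definition _ := GRing.isZmodMorphism.Build G (augquot G) (@rho_aug G) rho_aug_zmod.

Lemma gring_sum (r : comPzRingType) (z : gring r G) : z = \sum_g (z g : r) *: gdelta r g.
Proof.
apply/ffunP => x; rewrite sum_ffunE (bigD1 x) //= big1 => [|y /negPf yx].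
  by rewrite !ffunE eqxx addr0 /GRing.scale /= mulr1.
by rewrite !ffunE eq_sym yx scaler0.
Qed.

Lemma aug_sum (z : ZG) : gaug z = 0 -> z = \sum_g (z g : int) *: (gdelta int g - gdelta int 0).
Proof.
move=> z0; under eq_bigr => g _ do rewrite scalerBr.
rewrite sumrB -gring_sum -scaler_suml [X in X *: _](_ : _ = 0) ?scale0r ?subr0 //.
Qed.

(** By additivity, an integral combination of the [g - 1] has the class of one group element, the
    same combination formed in [G]. *)
Lemma rho_aug_surj (j : augquot G) : exists h, j = rho_aug h.
Proof.
have z0 := rep_in j; exists (\sum_g g *~ (rep j g : int)).
rewrite -[LHS]repK {1}(aug_sum z0) raddf_sum /=.
have aux (s : seq G) : cls (augideal G) (augsq G)
    (\sum_(g <- s) (rep j g : int) *: (gdelta int g - gdelta int 0)) =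
    \sum_(g <- s) rho_aug (g *~ rep j g).
  elim: s => [|g s IH]; first by rewrite !big_nil cls0.
  rewrite !big_cons cls_lin // ?IH; last by apply: subm_sum => i _; exact: submZ.
  congr (_ + _); rewrite raddfMz.
  by rewrite -[X in _ = X]scaler_int; congr (_ *: _); rewrite intz.
exact: aux.
Qed.

Section Functional.
Context (W : zmodType) (T : G -> W) (TD : forall x y, T (x + y) = T x + T y).

Definition gfun (z : ZG) : W := \sum_g T g *~ (z g : int).
Fact gfunB : zmod_morphism gfun.
Proof. move=> x y; by rewrite /gfun -sumrB; apply: eq_bigr => g _; rewrite !ffunE mulrzBr. Qed.
HB.instance Definition _ := GRing.isZmodMorphism.Build ZG W gfun gfunB.

Lemma gfun_delta g : gfun (gdelta int g) = T g.
Proof.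
rewrite /gfun (bigD1 g) //= big1 => [|y /negPf yg]; first by rewrite ffunE eqxx addr0 mulr1z.
by rewrite ffunE yg mulr0z.
Qed.

(** The linear extension of [T] to Z[G] is a derivation over the augmentation; this is why it kills
    the square of the augmentation ideal and descends to [augfun]. *)
Lemma gfunM x y : gfun (x * y) = gfun x *~ gaug y + gfun y *~ gaug x.
Proof.
rewrite {1}(gring_sum x) mulr_suml raddf_sum /=.
transitivity (\sum_g \sum_h (T g + T h) *~ (x g * y h : int)).
  apply: eq_bigr => g _; rewrite {1}(gring_sum y) mulr_sumr raddf_sum /=.
  apply: eq_bigr => h _; rewrite -gscaleAl mulrC -gscaleAl gdeltaM scalerA.
  rewrite -[_ * _]intz scaler_int raddfMz /= gfun_delta addrC TD.
  by rewrite intz.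
under eq_bigr => g _ do (under eq_bigr => h _ do rewrite mulrzDl; rewrite big_split /=).
rewrite big_split /=; congr (_ + _).
  rewrite /gfun /gaug mulrz_suml; apply: eq_bigr => g _; rewrite -mulrz_sumr -mulrzA; congr (_ *~ _).
  by rewrite mulr_sumr.
rewrite exchange_big /= /gfun /gaug mulrz_suml; apply: eq_bigr => g _.
rewrite -mulrz_sumr -mulrzA; congr (_ *~ _).
by rewrite mulr_sumr; apply: eq_bigr => h _; rewrite mulrC.
Qed.

Lemma gfun_augsq x : augsq G x -> gfun x = 0.
Proof.
move=> [s hs ->]; rewrite raddf_sum /= big_seq big1 // => y /hs[h1 h2].
by rewrite gfunM h1 h2 !mulr0z addr0.
Qed.

Lemma gfun_rep_cls x : augideal G x -> gfun (rep (augcls x)) = gfun x.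
Proof. by move=> x0; apply/eqP; rewrite -subr_eq0 -raddfB /= gfun_augsq //; exact: cls_repB. Qed.

Definition augfun (j : augquot G) : W := gfun (rep j).
Fact augfunB : zmod_morphism augfun.
Proof.
move=> i j; have zi := rep_in i; have zj := rep_in j; rewrite /augfun -raddfB /= -[in RHS]gfun_rep_cls; last exact: submB.
by rewrite /augcls clsB // !repK.
Qed.
HB.instance Definition _ := GRing.isZmodMorphism.Build (augquot G) W augfun augfunB.
Lemma augfun_rho g : augfun (rho_aug g) = T g.
Proof.
rewrite /augfun gfun_rep_cls // raddfB /= !gfun_delta.
have -> : T 0 = 0 by apply: (addrI (T 0)); rewrite -TD !addr0.
by rewrite subr0.
Qed.
End Functional.
End Augmentation.
#[global] Hint Resolve aug_gdeltaB : core.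

Lemma gaug_gpush (G H : finZmodType) (f : G -> H) (z : gring int G) : gaug (gpush f z) = gaug z.
Proof.
rewrite /gpush {2}(gring_sum z); elim/big_rec2: _ => [|g x y _ IH].
  by rewrite !aug_0.
by rewrite !gaugD !gaug_gdelta IH.
Qed.

Lemma augfun_push (G H : finZmodType) (W : zmodType) (f : G -> H) (T : H -> W) (j : augquot G) :
  (forall x y, T (x + y) = T x + T y) ->
  augfun T (augpush f j) = gfun (T \o f) (rep j).
Proof.
move=> TD; rewrite /augfun /augpush gfun_rep_cls //; last first.
  by rewrite /= gaug_gpush; exact: (rep_in j).
rewrite /gpush raddf_sum /=; apply: eq_bigr => g _.
by rewrite -[X in X *: _]intz scaler_int raddfMz /= gfun_delta.
Qed.

Section TensorTheory.
Context (U V W : zmodType).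
Implicit Types (u : U) (v : V).

Lemma tmkDl u u' v : tmk (u + u') v = tmk u v + tmk u' v.
Proof. exact: (tmk_biadditive U V).1. Qed.
Lemma tmkDr u v v' : tmk u (v + v') = tmk u v + tmk u v'.
Proof. exact: (tmk_biadditive U V).2. Qed.
Lemma tmk0l v : tmk (0 : U) v = 0.
Proof. by apply: (addrI (tmk 0 v)); rewrite -tmkDl !addr0. Qed.
Lemma tmk0r u : tmk u (0 : V) = 0.
Proof. by apply: (addrI (tmk u 0)); rewrite -tmkDr !addr0. Qed.
Lemma tmkMnl u v k : tmk (u *+ k) v = tmk u v *+ k.
Proof. by elim: k => [|k IH]; rewrite ?mulr0n ?tmk0l // !mulrS tmkDl IH. Qed.
Lemma tmkMnr u v k : tmk u (v *+ k) = tmk u v *+ k.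
Proof. by elim: k => [|k IH]; rewrite ?mulr0n ?tmk0r // !mulrS tmkDr IH. Qed.

Lemma tens_repr (x : tens U V) : exists s : seq (U * V), x = \sum_(u <- s) tmk u.1 u.2.
Proof.
elim/tens_ind: x => s; exists s; elim: s => [|[u v] s IH]; first by rewrite big_nil.
by rewrite big_cons -IH /=; apply: esym; exact: tadd_pi.
Qed.

Context (f : U -> V -> W) (f_bi : biadditive f).
Fact tlift_zmod : zmod_morphism (tlift f).
Proof.
by move=> x y; apply/eqP; rewrite eq_sym subr_eq -tlift_additive // subrK.
Qed.
Lemma tlift0 : tlift f 0 = 0.
Proof. by apply: (addrI (tlift f 0)); rewrite -tlift_additive // !addr0. Qed.
Lemma tlift_tmk u v : tlift f (tmk u v) = f u v.
Proof. by rewrite tlift_pi // /teval big_seq1. Qed.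
Lemma tlift_sum (I : Type) (s : seq I) (g : I -> tens U V) :
  tlift f (\sum_(i <- s) g i) = \sum_(i <- s) tlift f (g i).
Proof.
by elim: s => [|i s IH]; rewrite ?big_nil ?tlift0 // !big_cons tlift_additive // IH.
Qed.
End TensorTheory.

(** * Homomorphisms separate the points of a tensor product *)

Section Separation.
Context (r : comPzRingType) (V : lmodType r).
Context (ann : forall (l : V) m, (forall mu : r, mu *+ m = 0 -> mu *: l = 0) ->
  exists nu, l = nu *+ m).
Context (H : finZmodType).
Import GroupScope FinRing.Theory.
Local Open Scope ring_scope.

(** Induction on a decomposition into cyclic groups. The coefficient [Lam] at the generator [x] is
    killed by every value [mu] that a homomorphism can take at [x], that is by every [mu]
    annihilated by the order of [x]. So [ann] makes [Lam] a multiple of this order, and [tmk Lam x]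
    vanishes. *)
Lemma tens_separated_dprod (b : seq H) (G : {group H}) :
  \big[dprod/1%g]_(x <- b) <[x]>%g = G -> forall s : seq (V * H),
  (forall u, u \in s -> u.2 \in G) ->
  (forall T : H -> r, (forall x y, x \in G -> y \in G -> T (x + y) = T x + T y) ->
    \sum_(u <- s) T u.2 *: u.1 = 0) ->
  \sum_(u <- s) tmk u.1 u.2 = 0.
Proof.
elim: b G => [|x b IH] G.
  rewrite big_nil => G1 s sG _; rewrite big_seq big1 // => u /sG.
  by rewrite -G1 => /set1P ->; rewrite tmk0r.
rewrite big_cons => /[dup] GE /dprodP[[C K CE KE] CK cCK tCK] s sG sT.
rewrite KE in GE CK cCK tCK IH; clear CE.
have KC : K \in [complements to <[x]> in G].
  by apply/complP; rewrite tCK.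
have KG : K \subset G by rewrite -CK mulG_subr.
have CG : <[x]> <| G.
  by have /dprodW := GE; have [+ _] := dprod_normal2 GE.
pose d := divgr <[x]> K; pose m := remgr <[x]> K.
have dD : {in G &, {morph d : y z / y + z}} by exact: divgrM.
have mD : {in G &, {morph m : y z / y + z}} by exact: remgrM.
have /choice[e he] (g : H) : exists k, g \in G -> d g = x *+ k.
  have [gG|gG] := boolP (g \in G); last by exists 0%N.
  have /cycleP[k hk] : d g \in <[x]> by rewrite mem_divgr // CK.
  by exists k => _; rewrite hk zmodXgE.
have gE g : g \in G -> g = x *+ e g + m g.
  by move=> gG; rewrite -he //; exact: divgr_eq.
pose Lam := \sum_(u <- s) u.1 *+ e u.2.
have ordx : x *+ #[x]%g = 0 by rewrite -zmodXgE expg_order.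
have sumE : \sum_(u <- s) tmk u.1 u.2 = tmk Lam x + \sum_(u <- s) tmk u.1 (m u.2).
  have -> : tmk Lam x = \sum_(u <- s) tmk u.1 (x *+ e u.2).
    rewrite /Lam; elim: (s) => [|u t IHt]; first by rewrite !big_nil tmk0l.
    by rewrite !big_cons tmkDl IHt tmkMnl tmkMnr.
  rewrite -big_split /= big_seq [RHS]big_seq; apply: eq_bigr => u /sG uG.
  by rewrite -tmkDr -gE.
have LamE : exists nu, Lam = nu *+ #[x]%g.
  apply: ann => mu mu0.
  have muE k l : x *+ k = x *+ l -> mu *+ k = mu *+ l.
    rewrite -!zmodXgE => /eqP; rewrite eq_expg_mod_order => /eqP kl.
    have muM j : mu *+ j = mu *+ (j %% #[x]%g).
      by rewrite {1}(divn_eq j #[x]%g) mulrnDr mulnC mulrnA mu0 mul0rn add0r.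
    by rewrite muM kl -muM.
  rewrite scaler_sumr -[RHS](sT (fun g => mu *+ e g)).
    by apply: eq_bigr => u _; rewrite -scalerMnr scalerMnl.
  move=> y z yG zG; rewrite -mulrnDr; apply: muE; rewrite mulrnDr -!he //.
    by rewrite dD.
  exact: groupM.
rewrite sumE; have [nu ->] := LamE; rewrite tmkMnl -tmkMnr ordx tmk0r add0r.
have := IH K erefl [seq (u.1, m u.2) | u <- s].
rewrite !big_map /=; apply.
  by move=> u /mapP[w /sG wG ->] /=; rewrite mem_remgr // CK.
move=> T TD; rewrite big_map /=; apply: (sT (T \o m)) => y z yG zG /=.
by rewrite mD // TD // mem_remgr // CK.
Qed.

Lemma tens_separated (x : tens V H) :
  (forall T : H -> r, (forall y z, T (y + z) = T y + T z) ->
    tlift (fun v h => T h *: v) x = 0) -> x = 0.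
Proof.
have [s ->] := tens_repr x => hT.
have abG : abelian [set: H]%G by apply/centsP => y _ z _; exact: addrC.
have [b bE _] := abelian_structure abG.
apply: (tens_separated_dprod bE) => [u _|T TD]; first exact: finset.in_setT.
have TD' y z : T (y + z) = T y + T z by apply: TD; exact: finset.in_setT.
have bi : biadditive (fun (v : V) h => T h *: v).
  by split=> *; rewrite ?scalerDr ?TD' ?scalerDl.
rewrite -[RHS](hT T TD') tlift_sum //.
by apply: eq_bigr => u _; rewrite tlift_tmk.
Qed.
End Separation.

(** * Local cohomology *)

Lemma dual_scale (R : comPzRingType) (V : lmodType R) (b : dual V) a x :
  val (a *: b) x = a * val b x.
Proof. by rewrite linearZ. Qed.

Lemma dual_add (R : comPzRingType) (V : lmodType R) (b b' : dual V) x :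
  val (b + b') x = val b x + val b' x.
Proof. by rewrite raddfD. Qed.

Lemma submod_valD (R : comPzRingType) (V : lmodType R) (S : subm V) (x y : submod S) :
  val (x + y) = val x + val y.
Proof. exact: raddfD. Qed.

Section LocalCohomology.
Context (p k : nat) (p_pr : prime p) (p_odd : odd p).
Context (R : comPzRingType) (pk0 : (p ^ k)%:R = 0 :> R).
Context (D I : set gal) (Fr : gal).
Context (D1 : D 1%g) (DM : forall s t, D s -> D t -> D (s * t)%g).
Context (DV : forall s, D s -> D s^-1%g) (ID : forall s, I s -> D s) (DFr : D Fr).
Context (Dind : forall (P : gal -> Prop) (L : seq algC),
  (forall j, P (Fr ^+ j)%g) ->
  (forall s h, D s -> D h -> fixes L h -> P s -> P (s * h)%g) ->
  (forall s i, D s -> I i -> P s -> P (s * i)%g) -> forall s, D s -> P s).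
Context (unr : forall (phi : gal -> gal -> R) (L : seq algC),
  (forall s t u, D s -> D t -> D u ->
    phi t u - phi (s * t)%g u + phi s (t * u)%g - phi s t = 0) ->
  (forall s t g, D s -> D t -> D g -> I g \/ fixes L g ->
    phi (s * g)%g t = phi s t /\ phi s (t * g)%g = phi s t) ->
  (forall s, D s -> phi s 1%g = 0 /\ phi 1%g s = 0) ->
  exists (g : gal -> R) (L' : seq algC),
    (forall s h, D s -> D h -> fixes L' h -> g (s * h)%g = g s) /\
    (forall s t, D s -> D t -> phi s t = g t - g (s * t)%g + g s)).

Lemma lmod_torsion (V : lmodType R) (v : V) : v *+ (p ^ k) = 0.
Proof. by rewrite -scaler_nat pk0 scale0r. Qed.

Lemma cont1_lconst (V : lmodType R) (f : gal -> V) : cont1 p D f ->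
  forall s, D s -> exists L, forall h, D h -> fixes L h -> f (s * h)%g = f s.
Proof.
move=> cf s Ds; have [L hL] := cf k s Ds; exists L => h Dh Lh.
have [y] := hL h Dh Lh; rewrite lmod_torsion => /eqP; rewrite subr_eq0.
by move/eqP.
Qed.

Lemma lconst_cont1 (V : zmodType) (f : gal -> V) (L : seq algC) :
  (forall s h, D s -> D h -> fixes L h -> f (s * h)%g = f s) -> cont1 p D f.
Proof.
by move=> h n s Ds; exists L => g Dg Lg; exists 0; rewrite h // subrr mul0rn.
Qed.

Lemma lconst_cont2 (V : zmodType) (f : gal -> gal -> V) (L : seq algC) :
  (forall s t h l, D s -> D t -> D h -> D l -> fixes L h -> fixes L l ->
    f (s * h)%g (t * l)%g = f s t) -> cont2 p D f.
Proof.
move=> h n s t Ds Dt; exists L => g g' Dg Dg' Lg Lg'; exists 0.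
by rewrite h // subrr mul0rn.
Qed.

Context (c : gal -> R) (c1 : forall s, D s -> c s = 1).
Local Notation R1 := (twist c).

Lemma act1 s (x : R1) : D s -> gm_act R1 s x = x.
Proof. by move=> Ds; rewrite /= c1 // mul1r. Qed.

Section Bihom.
Implicit Types F : gal -> gal -> R1.

(** Biadditive functions trivial on an open subgroup. They are cocycles because [D] acts trivially
    on [R1], and vanishing of their classes is easy to test. *)
Definition bihom F : Prop :=
  [/\ forall s s' t, D s -> D s' -> D t -> F (s * s')%g t = F s t + F s' t,
      forall s t t', D s -> D t -> D t' -> F s (t * t')%g = F s t + F s t' &
      exists L, forall s h, D s -> D h -> fixes L h -> F s h = 0 /\ F h s = 0].

Lemma bihom_Z2 F : bihom F -> Z2 p R1 D F.
Proof.
move=> [Fl Fr' [L hL]]; split.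
  apply: (@lconst_cont2 _ _ L) => s t h l Ds Dt Dh Dl Lh Ll.
  rewrite Fl ?Fr' //; last exact: DM.
  by rewrite (hL s l Ds Dl Ll).1 (hL l h Dl Dh Lh).2 (hL t h Dt Dh Lh).2 !addr0.
move=> s t u Ds Dt Du; rewrite /cob2 act1 // Fl // Fr' //.
have aux (a b d : R) : a - (b + a) + (d + b) - d = 0 by ring.
exact: aux.
Qed.

Lemma cob1_B2 (g : gal -> R1) F (L : seq algC) :
  (forall s h, D s -> D h -> fixes L h -> g (s * h)%g = g s) ->
  (forall s t, D s -> D t -> F s t = g t - g (s * t)%g + g s) -> B2 p R1 D F.
Proof.
move=> gL h; exists g; first exact: lconst_cont1 gL.
by move=> s t Ds Dt; rewrite h // /cob1 act1.
Qed.

Lemma cls2_eq0 F : Z2 p R1 D F -> B2 p R1 D F -> cls2 p D F = 0.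
Proof.
move=> FZ FB; rewrite -(cls0 (Z2 p R1 D) (B2 p R1 D)).
by apply/(cls_eqP (B2 p R1 D) FZ (subm_0 (Z2 p R1 D))); rewrite subr0.
Qed.

Lemma bihom_lin a F G : bihom F -> bihom G -> bihom (a *: F + G).
Proof.
move=> [F1 F2 [L FL]] [G1 G2 [L' GL]]; split.
- move=> s s' t Ds Ds' Dt; change (a *: F (s * s')%g t + G (s * s')%g t =
    (a *: F s t + G s t) + (a *: F s' t + G s' t)).
  by rewrite F1 // G1 // scalerDr addrACA.
- move=> s t t' Ds Dt Dt'; change (a *: F s (t * t')%g + G s (t * t')%g =
    (a *: F s t + G s t) + (a *: F s t' + G s t')).
  by rewrite F2 // G2 // scalerDr addrACA.
exists (L ++ L') => s h Ds Dh /fixes_cat[Lh L'h].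
change (a *: F s h + G s h = 0 /\ a *: F h s + G h s = 0).
by have [-> ->] := FL s h Ds Dh Lh; have [-> ->] := GL s h Ds Dh L'h; rewrite scaler0 addr0.
Qed.

Lemma bihom_flip F : bihom F -> bihom (fun s t => F t s).
Proof.
move=> [F1 F2 [L FL]]; split; [by move=> *; apply: F2 | by move=> *; apply: F1 |].
by exists L => s h Ds Dh Lh; have [] := FL s h Ds Dh Lh.
Qed.

(** Antisymmetry of the cup product: the sum is the coboundary of [- F s s]. *)
Lemma bihom_swap F : bihom F -> cls2 p D F + cls2 p D (fun s t => F t s : R1) = 0.
Proof.
move=> FB; have [F1 F2 [L FL]] := FB; have FZ := bihom_Z2 FB.
have GB := bihom_flip FB; have GZ := bihom_Z2 GB; rewrite -[LHS]clsD //.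
apply: cls2_eq0; first exact: submD.
apply: (@cob1_B2 (fun s => - F s s) _ L).
  move=> s h Ds Dh Lh; rewrite F1 ?F2 //; last exact: DM.
  by rewrite (FL s h Ds Dh Lh).1 (FL s h Ds Dh Lh).2 (FL h h Dh Dh Lh).1 !addr0.
move=> s t Ds Dt; change (F s t + F t s = - F t t - (- F (s * t)%g (s * t)%g) + - F s s).
rewrite F1 ?F2 //; last exact: DM.
have aux (x y z w : R) : x + y = - w - (- (z + x + (y + w))) + - z by ring.
exact: aux.
Qed.

Lemma p_cancel (V : lmodType R) (v : V) (m : nat) : ~~ (p %| m)%N -> v *+ m = 0 -> v = 0.
Proof.
move=> pm h; have cop : coprime m (p ^ k) by rewrite coprime_sym coprimeXl // prime_coprime.
have red a b : (a = b %[mod p ^ k])%N -> v *+ a = v *+ b.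
  have redm n : v *+ n = v *+ (n %% p ^ k).
    by rewrite {1}(divn_eq n (p ^ k)) mulrnDr mulrnA lmod_torsion add0r.
  by move=> ab; rewrite redm ab -redm.
rewrite -[v]mulr1n -(red _ _ (Euler_exp_totient cop)) -(prednK (_ : 0 < totient (p ^ k))%N).
  by rewrite expnS mulrnA h mul0rn.
by rewrite totient_gt0 expn_gt0 prime_gt0.
Qed.

(** By [bihom_swap] a symmetric class is killed by 2, which is cancellable on [p]-power torsion for
    odd [p]. *)
Lemma bihom_sym0 F : bihom F -> (forall s t, D s -> D t -> F s t = F t s) -> cls2 p D F = 0.
Proof.
move=> FB Fsym; apply: (@p_cancel _ _ 2); first by rewrite dvdn_prime2 //; case: eqP p_odd => // ->.
rewrite mulr2n -[RHS](bihom_swap FB); congr (_ + _).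
apply/(cls_eqP _ (bihom_Z2 FB) (bihom_Z2 (bihom_flip FB))).
apply: (@cob1_B2 0 _ [::]) => [//|s t Ds Dt].
by change (F s t - F t s = 0 - 0 + 0); rewrite Fsym // !subrr addr0.
Qed.

Lemma unram_B2 F (L : seq algC) :
  (forall s t u, D s -> D t -> D u ->
    F t u - F (s * t)%g u + F s (t * u)%g - F s t = 0) ->
  (forall s t g, D s -> D t -> D g -> I g \/ fixes L g ->
    F (s * g)%g t = F s t /\ F s (t * g)%g = F s t) ->
  (forall s, D s -> F s 1%g = 0 /\ F 1%g s = 0) -> B2 p R1 D F.
Proof.
move=> h1 h2 h3; have [g [L' [gL gE]]] := unr h1 h2 h3.
exact: (@cob1_B2 g _ L').
Qed.

Lemma bihom_unr0 F : bihom F -> (forall s i, D s -> I i -> F s i = 0 /\ F i s = 0) ->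
  cls2 p D F = 0.
Proof.
move=> FB FI; apply: cls2_eq0 (bihom_Z2 FB) _; have [F1 F2 [L FL]] := FB.
have FLI s h : D s -> D h -> I h \/ fixes L h -> F s h = 0 /\ F h s = 0.
  by move=> Ds Dh [/(FI s)|/(FL s h)]; apply.
apply: (@unram_B2 F L).
- move=> s t u Ds Dt Du; have := (bihom_Z2 FB).2 s t u Ds Dt Du.
  by rewrite /cob2 act1.
- move=> s t g Ds Dt Dg /FLI hg; rewrite F1 // F2 //.
  by rewrite (hg s Ds Dg).1 (hg t Dt Dg).2 !addr0.
move=> s Ds; apply: FLI => //; right=> x _.
by rewrite -[RHS]gal_oneE.
Qed.
End Bihom.

Lemma unram_hom_eq (V : zmodType) (f g : gal -> V) (L : seq algC) :
  (forall s t, D s -> D t -> f (s * t)%g = f s + f t) ->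
  (forall s t, D s -> D t -> g (s * t)%g = g s + g t) ->
  (forall h, D h -> I h \/ fixes L h -> f h = 0 /\ g h = 0) ->
  f Fr = g Fr -> forall s, D s -> f s = g s.
Proof.
move=> fM gM h e; apply: (Dind (L := L)) => [j|s t Ds Dt Lt fg|s i Ds Ii fg].
- suff [] : f (Fr ^+ j)%g = g (Fr ^+ j)%g /\ D (Fr ^+ j)%g by [].
  elim: j => [|j [IH Dj]]; last by rewrite expgSr; split; [rewrite fM ?gM ?IH ?e | exact: DM].
  by split=> //; have [|-> ->] := h 1%g D1; first by right=> x _.
- by rewrite fM // gM // fg; have [-> ->] := h t Dt (or_intror Lt).
by rewrite fM ?gM ?fg //; try exact: ID; have [-> ->] := h i (ID Ii) (or_introl Ii).
Qed.

Context (A : gmod R) (A1 : forall a, gm_act A 1%g a = a).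
Context (AM : forall s t a, D s -> D t -> gm_act A (s * t)%g a = gm_act A s (gm_act A t a)).
Context (AI : forall i a, I i -> gm_act A i a = a).
Context (LA : seq algC) (AL : forall h a, D h -> fixes LA h -> gm_act A h a = a).
Local Notation B := (twisted_dual A c).

Lemma gm_actB (N : gmod R) s (x y : N) : gm_act N s (x - y) = gm_act N s x - gm_act N s y.
Proof. by rewrite addrC -scaleN1r gm_lin scaleN1r addrC. Qed.

Lemma evP (b : B) x a a' : val b (x *: a + a') = x * val b a + val b a'.
Proof. by have /subm_predP h := valP b; rewrite h. Qed.
Lemma evD (b : B) a a' : val b (a + a') = val b a + val b a'.
Proof. by have := evP b 1 a a'; rewrite scale1r mul1r. Qed.
Lemma ev0 (b : B) : val b 0 = 0.
Proof. by apply: (addrI (val b 0)); rewrite -evD !addr0. Qed.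
Lemma evZ (b : B) x a : val b (x *: a) = x * val b a.
Proof. by have := evP b x a 0; rewrite ev0 !addr0. Qed.
Lemma evB (b : B) a a' : val b (a - a') = val b a - val b a'.
Proof. by rewrite addrC -scaleN1r evP mulN1r addrC. Qed.

Lemma actVK s a : D s -> gm_act A s^-1%g (gm_act A s a) = a.
Proof. by move=> Ds; rewrite -AM ?mulVg //; exact: DV. Qed.
Lemma act_ev s (b : B) a : D s -> val (gm_act B s b) a = val b (gm_act A s^-1%g a).
Proof. by move=> Ds; rewrite /= c1 // mul1r. Qed.

Lemma A_fixed a : gm_act A Fr a = a -> forall s, D s -> gm_act A s a = a.
Proof.
move=> ha s Ds; suff [] : D s /\ gm_act A s a = a by [].
move: s Ds; apply: (Dind (L := LA)) => [j|s h Ds Dh Lh [_ IH]|s i Ds Ii [_ IH]].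
- elim: j => [|j [Dj IH]]; first by split=> //; exact: A1.
  by rewrite expgSr; split; [exact: DM | rewrite AM // ha].
- by split; [exact: DM | rewrite AM // (AL _ Dh Lh)].
by have Di := ID Ii; split; [exact: DM | rewrite AM // (AI _ Ii)].
Qed.

Lemma B_fixed_ev (b : B) : gm_act B Fr b = b ->
  forall s a, D s -> val b (gm_act A s a) = val b a.
Proof.
move=> hb s a Ds; have bF a' : val b (gm_act A Fr a') = val b a'.
  by rewrite -{1}hb act_ev // actVK.
suff [_ h] : D s /\ forall a, val b (gm_act A s a) = val b a by exact: h.
move: s Ds {a}; apply: (Dind (L := LA)) => [j|s h Ds Dh Lh [_ IH]|s i Ds Ii [_ IH]].
- elim: j => [|j [Dj IH]]; first by split=> // a'; rewrite A1.
  by rewrite expgSr; split=> [|a']; [exact: DM | rewrite AM // IH].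
- by split=> [|a']; [exact: DM | rewrite AM // (AL _ Dh Lh)].
by have Di := ID Ii; split=> [|a']; [exact: DM | rewrite AM // (AI _ Ii)].
Qed.

Lemma Z1M (N : gmod R) (J : set gal) f s t : Z1 p N D J f -> D s -> D t ->
  f (s * t)%g = f s + gm_act N s (f t).
Proof.
move=> [_ h _] Ds Dt; have := h s t Ds Dt.
by rewrite /cob1 addrAC => /eqP; rewrite subr_eq0 addrC => /eqP.
Qed.

Lemma Z1_fixes (V : gmod R) (J : set gal) f : (forall a, gm_act V 1%g a = a) -> Z1 p V D J f ->
  exists L, forall h, D h -> fixes L h -> f h = 0.
Proof.
move=> V1 fZ; have f1 : f 1%g = 0.
  by apply: (addrI (f 1%g)); rewrite -{1}(V1 (f 1%g)) addr0 addrC -(Z1M fZ) ?mul1g.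
have [fc _ _] := fZ; have [L hL] := cont1_lconst fc D1.
by exists L => h Dh Lh; rewrite -f1 -(hL h Dh Lh) mul1g.
Qed.

Lemma B1act (b : B) : gm_act B 1%g b = b.
Proof. by apply/val_inj/funext => a; rewrite act_ev // invg1 A1. Qed.

Definition pairing (f : gal -> B) (a : gal -> A) (s t : gal) : R1 :=
  val (f s) (gm_act A s (a t)).

Section Pairing.
Context (f : gal -> B) (a : gal -> A) (J J' : set gal).
Context (fZ : Z1 p B D J f) (aZ : Z1 p A D J' a).

Lemma pairing_cocycle s t u : D s -> D t -> D u ->
  pairing f a t u - pairing f a (s * t)%g u + pairing f a s (t * u)%g - pairing f a s t = 0.
Proof.
move=> Ds Dt Du; rewrite /pairing (Z1M fZ) // (Z1M aZ) // gm_actD evD AM //.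
rewrite [val (f s + _) _](_ : _ = val (f s) (gm_act A s (gm_act A t (a u)))
  + val (gm_act B s (f t)) (gm_act A s (gm_act A t (a u)))) //.
rewrite act_ev // actVK //.
have aux (x y z : R) : x - (y + x) + (z + y) - z = 0 by ring.
exact: aux.
Qed.

Lemma pairing_Z2 : Z2 p R1 D (pairing f a).
Proof.
split; last by move=> s t u Ds Dt Du; rewrite /cob2 act1 //; exact: pairing_cocycle.
move=> n s t Ds Dt; have [fc _ _] := fZ; have [ac _ _] := aZ.
have [L hL] := cont1_lconst fc Ds; have [L' hL'] := cont1_lconst ac Dt.
exists (L ++ L' ++ LA) => h l Dh Dl /fixes_cat[h1 /fixes_cat[h2 h3]] /fixes_cat[l1 /fixes_cat[l2 l3]].
by exists 0; rewrite /pairing hL // hL' // AM // (AL _ Dh h3) subrr mul0rn.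
Qed.
End Pairing.

Lemma pairing_cob_l (b : B) a J : Z1 p A D J a ->
  B2 p R1 D (pairing (fun s => gm_act B s b - b) a).
Proof.
move=> aZ; have [L hL] := Z1_fixes A1 aZ.
apply: (@cob1_B2 (fun s => val b (a s) : R1) _ L) => [s h Ds Dh Lh|s t Ds Dt].
  by rewrite (Z1M aZ) // (hL _ Dh Lh) gm_act0 addr0.
rewrite /pairing (Z1M aZ) // evD.
rewrite [val (gm_act B s b - b) _](_ : _ = val (gm_act B s b) (gm_act A s (a t)) -
  val b (gm_act A s (a t))) //.
rewrite act_ev // actVK //; have aux (x y z : R) : x - y = x - (z + y) + z by ring.
exact: aux.
Qed.

Lemma pairing_cob_r f (m : A) J : Z1 p B D J f ->
  B2 p R1 D (pairing f (fun s => gm_act A s m - m)).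
Proof.
move=> fZ; have [L hL] := Z1_fixes B1act fZ.
apply: (@cob1_B2 (fun s => - val (f s) (gm_act A s m) : R1) _ (L ++ LA)) => [s h Ds Dh|s t Ds Dt].
  move=> /fixes_cat[h1 h2]; rewrite AM // (AL _ Dh h2) (Z1M fZ) // (hL _ Dh h1) gm_act0.
  by rewrite addr0.
rewrite /pairing (Z1M fZ) // -scaleN1r gm_actD gm_actZ evD evZ AM //.
rewrite [val (f s + _) _](_ : _ = val (f s) (gm_act A s (gm_act A t m))
  + val (gm_act B s (f t)) (gm_act A s (gm_act A t m))) //.
rewrite act_ev // actVK //.
have aux (x y z : R) : x + -1 * y = - z - (- (x + z)) + - y by ring.
exact: aux.
Qed.

Definition cup (x : H1 p B D) (y : H1 p A D) : H2 p R1 D :=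
  cls2 p D (pairing (rep1 x) (rep1 y)).

Lemma pairing_lin x f g a : pairing (x *: f + g) a = x *: pairing f a + pairing g a.
Proof. by []. Qed.

Lemma B1_rep (N : gmod R) (f : gal -> N) : Z1 p N D set0 f -> B1 N D (rep1 (cls1 p D f) - f).
Proof. exact: cls_repB. Qed.

Lemma pairing_ext f g a b : (forall s, D s -> f s = g s) -> (forall s, D s -> a s = b s) ->
  B2 p R1 D (pairing f a - pairing g b).
Proof.
move=> fg ab; apply: (@cob1_B2 0 _ [::]) => [//|s t Ds Dt].
change (pairing f a s t - pairing g b s t = 0 - 0 + 0).
by rewrite /pairing fg // ab // !subrr addr0.
Qed.

Lemma cup_cls (f : gal -> B) (a : gal -> A) : Z1 p B D set0 f -> Z1 p A D set0 a ->
  cup (cls1 p D f) (cls1 p D a) = cls2 p D (pairing f a).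
Proof.
move=> fZ aZ; have gZ : Z1 p B D set0 (rep1 (cls1 p D f)) by exact: rep_in.
have bZ : Z1 p A D set0 (rep1 (cls1 p D a)) by exact: rep_in.
apply/(cls_eqP _ (pairing_Z2 gZ bZ) (pairing_Z2 fZ aZ)).
move: (rep1 _) gZ (B1_rep fZ) (rep1 _) bZ (B1_rep aZ) => g gZ [n hn] b bZ [m hm].
have -> : pairing g b - pairing f a = pairing (g - f) b + pairing f (b - a).
  apply/funext => s; apply/funext => t.
  change (val (g s) (gm_act A s (b t)) - val (f s) (gm_act A s (a t)) =
    val (g s - f s) (gm_act A s (b t)) + val (f s) (gm_act A s (b t - a t))).
  rewrite gm_actB evB.
  change (val (g s) (gm_act A s (b t)) - val (f s) (gm_act A s (a t)) =
    (val (g s) (gm_act A s (b t)) - val (f s) (gm_act A s (b t))) +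
    (val (f s) (gm_act A s (b t)) - val (f s) (gm_act A s (a t)))).
  by rewrite addrA subrK.
apply: submD.
  rewrite -[X in B2 _ _ _ X](subrK (pairing (fun s => gm_act B s n - n) b)); apply: submD.
    by apply: pairing_ext.
  exact: pairing_cob_l bZ.
rewrite -[X in B2 _ _ _ X](subrK (pairing f (fun s => gm_act A s m - m))); apply: submD.
  by apply: pairing_ext.
exact: pairing_cob_r fZ.
Qed.

Lemma cup_linl x (y y' : H1 p B D) (z : H1 p A D) : cup (x *: y + y') z = x *: cup y z + cup y' z.
Proof.
have yZ : Z1 p B D set0 (rep1 y) by exact: rep_in.
have yZ' : Z1 p B D set0 (rep1 y') by exact: rep_in.
have zZ : Z1 p A D set0 (rep1 z) by exact: rep_in.
rewrite -{1}(repK z) -{1}(repK y) -{1}(repK y') -[X in cup X _](cls_lin _ _ yZ yZ').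
rewrite cup_cls //; last exact: subm_lin.
by rewrite pairing_lin; exact: cls_lin (pairing_Z2 yZ zZ) (pairing_Z2 yZ' zZ).
Qed.

(** The pairing of two unramified cocycles is invariant under inertia in both variables, so [unr]
    provides a coboundary. *)
Lemma pairing_unr0 f a : Z1 p B D I f -> Z1 p A D I a -> cls2 p D (pairing f a) = 0.
Proof.
move=> fZ aZ; apply: cls2_eq0; first exact: (pairing_Z2 fZ aZ).
have [L hL] := Z1_fixes B1act fZ; have [L' hL'] := Z1_fixes A1 aZ.
have [_ _ fI] := fZ; have [_ _ aI] := aZ.
apply: (@unram_B2 _ (L ++ L' ++ LA)).
- by move=> *; exact: (pairing_cocycle fZ aZ).
- move=> s t g Ds Dt Dg hg.
  have [fg ag gA] : [/\ f g = 0, a g = 0 & forall m, gm_act A g m = m].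
    case: hg => [Ig|/fixes_cat[h1 /fixes_cat[h2 h3]]].
      by split; [exact: fI | exact: aI | move=> m; exact: AI].
    by split; [exact: hL | exact: hL' | move=> m; exact: AL].
  rewrite /pairing (Z1M fZ) // (Z1M aZ) // fg ag !gm_act0 !addr0 AM // gA.
  by [].
move=> s Ds; rewrite /pairing.
have -> : f 1%g = 0 by apply: hL.
have -> : a 1%g = 0 by apply: hL'.
by rewrite gm_act0 ev0.
Qed.

(* [Fr] agrees with an element of inertia modulo [J], and inertia acts trivially. *)
Section Transverse.
Context (J : set gal) (JD : forall s, J s -> D s).
Context (Jnormal : forall s h, D s -> J h -> J (s^-1 * h * s)%g).
Context (Jtot : exists2 i, I i & J (i^-1 * Fr)%g).
Context (t : gal -> B) (tZ : Z1 p B D J t).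

(** For [h] in the normal subgroup [J], where [t] vanishes, [t (h * s)] is on the one hand [h]
    applied to [t s], on the other hand [t (s * (s^-1 * h * s)) = t s]. So [J] fixes [t s], and [Fr]
    acts on it as inertia does. *)
Lemma transverse_fixed s : D s -> gm_act B Fr (t s) = t s.
Proof.
move=> Ds; have [_ _ tJ] := tZ.
have fixJ h : J h -> gm_act B h (t s) = t s.
  move=> Jh; have Dh := JD Jh; have Jh' := Jnormal Ds Jh.
  have := Z1M tZ Dh Ds; rewrite (tJ _ Jh) add0r => <-.
  rewrite -[(h * s)%g](_ : (s * (s^-1 * h * s))%g = _); last by rewrite !mulgA mulgV mul1g.
  by rewrite (Z1M tZ) //; [rewrite (tJ _ Jh') gm_act0 addr0 | exact: JD].
have [i Ii Ji] := Jtot; have Di := ID Ii; have Dj := JD Ji.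
apply/val_inj/funext => m; have him : gm_act A i^-1%g m = m by rewrite -{1}(AI m Ii) actVK.
rewrite act_ev // (_ : Fr^-1 = (i^-1 * Fr)^-1 * i^-1)%g; last by rewrite invMg invgK mulgK.
rewrite AM ?him; try exact: DV.
by rewrite -act_ev // fixJ.
Qed.
End Transverse.

(** * The operator Q(Fr) and the map v as a cup product *)

Section Comparison.
Context (m : nat) (qs : nat -> R).
Definition Qact (N : gmod R) (s : gal) (x : N) : N :=
  \sum_(i < m) qs i *: iter i (gm_act N s) x.
Context (CH : forall x : A, Qact Fr (gm_act A Fr x - x) = 0).
Let Q1 := \sum_(i < m) qs i.

Lemma iter_act_lin (N : gmod R) s i x (y z : N) :
  iter i (gm_act N s) (x *: y + z) = x *: iter i (gm_act N s) y + iter i (gm_act N s) z.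
Proof. by elim: i => //= i ->; rewrite gm_lin. Qed.

Lemma Qact_lin (N : gmod R) s x (y z : N) : Qact s (x *: y + z) = x *: Qact s y + Qact s z.
Proof.
rewrite /Qact scaler_sumr -big_split /=; apply: eq_bigr => i _.
by rewrite iter_act_lin scalerDr !scalerA mulrC.
Qed.

Lemma Qact_act x : Qact Fr (gm_act A Fr x) = gm_act A Fr (Qact Fr x).
Proof.
rewrite /Qact; elim/big_rec2: _ => [|i y z _ IH]; first by rewrite gm_act0.
by rewrite gm_lin -IH -iterSr.
Qed.

Lemma Qact_fixed x : gm_act A Fr (Qact Fr x) = Qact Fr x.
Proof.
apply/eqP; rewrite -subr_eq0 -Qact_act -[X in _ - X]scale1r -scaleNr addrC -Qact_lin.
by rewrite scaleN1r addrC CH.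
Qed.

Lemma ev_sum (b : B) (I0 : Type) (s : seq I0) (g : I0 -> A) :
  val b (\sum_(i <- s) g i) = \sum_(i <- s) val b (g i).
Proof. by elim: s => [|i s IH]; rewrite ?big_nil ?ev0 // !big_cons evD IH. Qed.

Lemma ev_scale (b : B) a x : val (a *: b) x = a * val b x.
Proof. exact: (@dual_scale R A b a x). Qed.

(** A form fixed by [Fr] does not distinguish [Fr] from 1, so it sees [Q(Fr)] as the scalar
    [Q(1)]. *)
Lemma ev_Qact_fixed (b : B) x : gm_act B Fr b = b -> val b (Qact Fr x) = Q1 * val b x.
Proof.
move=> hb; rewrite /Qact ev_sum mulr_suml; apply: eq_bigr => i _; rewrite evZ; congr (_ * _).
by elim: (i : nat) => //= j IH; rewrite B_fixed_ev.
Qed.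

(** The twist being trivial on [D], the action of [Fr^-1] on forms is the adjoint of that of [Fr];
    this explains [Q(Fr^-1)] in the finite-singular map. *)
Lemma ev_Qact_dual (b : B) x : val (Qact (N := B) Fr^-1%g b) x = val b (Qact Fr x).
Proof.
rewrite /Qact ev_sum.
have h (s : seq 'I_m) (g : 'I_m -> B) : val (\sum_(i <- s) g i) x = \sum_(i <- s) val (g i) x.
  by elim: s => [|i s IH]; rewrite ?big_nil // !big_cons -IH.
rewrite h; apply: eq_bigr => i _; rewrite evZ ev_scale; congr (_ * _); elim: (i : nat) x {h} => [//|j IH] x.
by rewrite iterS act_ev ?invgK ?IH; [rewrite -iterSr | exact: DV].
Qed.

Context (fA : {linear A -> R^o}) (fA_surj : forall y, exists x, fA x = y).
Context (fA_ker : forall x, fA x = 0 <-> exists y, x = gm_act A Fr y - y).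
Context (inv : {linear H2 p R1 D -> R^o}).
Local Notation AFr := (fixed A Fr).
Context (theta : {linear dual AFr -> R^o}) (theta_bij : bijective theta).
Context (v : H1 p B D -> R).
Context (vP : forall x, exists l : dual AFr, v x = theta l /\
  forall a : AFr, exists cc : gal -> A, [/\ Z1 p A D I cc, - Qact Fr (cc Fr) = val a &
    val l a = inv (cup x (cls1 p D cc))]).

Lemma unram_cob (d : gal -> A) y : Z1 p A D I d -> d Fr = gm_act A Fr y - y ->
  forall s, D s -> d s = gm_act A s y - y.
Proof.
move=> dZ e s Ds; have [M hM] := Z1_fixes A1 dZ; have [_ _ dI] := dZ.
have step u w : D u -> D w -> d u = gm_act A u y - y -> d w = gm_act A w y - y ->
    d (u * w)%g = gm_act A (u * w)%g y - y.
  by move=> Du Dw hu hw; rewrite (Z1M dZ) // hu hw AM // gm_actB addrC subrKA.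
suff [] : D s /\ d s = gm_act A s y - y by [].
move: s Ds; apply: (Dind (L := M ++ LA)) => [j|s h Ds Dh /fixes_cat[Mh Lh] [_ IH]|s i Ds Ii [_ IH]].
- elim: j => [|j [Dj IH]].
    by split=> //; rewrite expg0 A1 subrr; apply: hM.
  by rewrite expgSr; split; [exact: DM | exact: step].
- by split; [exact: DM | apply: step => //; rewrite (hM _ Dh Mh) (AL _ Dh Lh) subrr].
have Di := ID Ii; split; first exact: DM.
by apply: step => //; rewrite (dI _ Ii) (AI _ Ii) subrr.
Qed.

Lemma Z1_sub (N : gmod R) (J J' : set gal) f : (forall s, J s -> J' s) -> Z1 p N D J' f -> Z1 p N D J f.
Proof. by move=> JJ' [h1 h2 h3]; split=> // s /JJ'; exact: h3. Qed.
Lemma Z1_set0 (N : gmod R) (J : set gal) f : Z1 p N D J f -> Z1 p N D set0 f.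
Proof. exact: Z1_sub. Qed.

(** Replaces the cocycles that [vP] attaches to each class by a single [cc]. Since [fA] identifies
    [A / (Fr - 1)] with [R] and [vP] makes [- Q(Fr)] surjective onto the fixed part,
    [a0 = - Q(Fr) c0] generates this part. The scalar [eta] is the value at [a0] of the form that
    [theta] sends to 1; it is cancellable since a form vanishing at [a0] is 0. *)
Lemma comparison_data : exists (a0 : AFr) (eta : R) (cc : gal -> A),
  [/\ Z1 p A D I cc, - Qact Fr (cc Fr) = val a0, forall x, eta * x = 0 -> x = 0,
      forall l : dual AFr, val l a0 = theta l * eta &
      forall x, eta * v x = inv (cup x (cls1 p D cc))].
Proof.
have [c0 fc0] := fA_surj 1.
have aP : - Qact Fr c0 \in subm_pred (Subm (gm_act0 A Fr) (@fixed_lin _ A Fr)).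
  by apply/subm_predP; rewrite /= -scaleN1r gm_actZ Qact_fixed.
pose a0 : AFr := Submod aP.
have Q_f x : Qact Fr x = fA x *: Qact Fr c0.
  have [y hy] : exists y, x - fA x *: c0 = gm_act A Fr y - y.
    apply/fA_ker; rewrite addrC -scaleNr (linearP fA) fc0.
    by change (- (fA x : R) * 1 + fA x = 0 :> R); rewrite mulr1 addNr.
  rewrite -[x in LHS](subrK (fA x *: c0)) hy addrC Qact_lin.
  by rewrite CH addr0.
have [th' thK Kth] := theta_bij.
pose l0 := th' 1; have l0E (l : dual AFr) : l = theta l *: l0.
  by apply: (can_inj thK); rewrite (linearZ_LR theta) Kth; apply/esym/(mulr1 (theta l : R)).
have lZ (l : dual AFr) x (a : AFr) : val l (x *: a) = x * val l a.
  have /subm_predP h := valP l; have := h x a 0.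
  rewrite addr0 => ->; have l00 : val l 0 = 0.
    have h0 := h 1 0 0; rewrite !scale1r addr0 in h0.
    by apply: (addrI (val l 0)); rewrite -h0 addr0.
  by rewrite l00 addr0.
pose eta : R := val l0 a0.
(* The class 0 serves to extract from [vP] that every fixed [a] is [- Q(Fr)] of a value at [Fr]. *)
have [l' [_ hsurj]] := vP 0.
have aE (a : AFr) : exists mu, a = mu *: a0.
  have [cc [ccZ hcc _]] := hsurj a; exists (fA (cc Fr)); apply: val_inj => /=.
  by rewrite -hcc Q_f scalerN.
have etaN x : eta * x = 0 -> x = 0.
  move=> ex; have xl : x *: l0 = 0.
    apply/val_inj/funext => a; have [mu ->] := aE a.
    by rewrite dual_scale lZ mulrCA (mulrC x) -/eta ex mulr0.
  have := congr1 theta xl; rewrite (linearZ_LR theta) (raddf0 theta) Kth.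
  by move=> <-; apply/esym/(mulr1 x).
have lE (l : dual AFr) : val l a0 = theta l * eta by rewrite {1}(l0E l) dual_scale.
have [cc [ccZ hcc _]] := hsurj a0.
(* All cocycles admissible for [a0] have the same image under [fA] at [Fr], so two of them differ by
   a coboundary. *)
have fcc d : - Qact Fr d = val a0 -> fA d = 1.
  rewrite Q_f => h; apply/eqP; rewrite -subr_eq0; apply/eqP/etaN.
  have : (fA d - 1) *: a0 = 0.
    apply: val_inj => /=; rewrite scalerBl scale1r -[X in _ - X]/(val a0) -{1}h.
    by rewrite /= scalerN subrr.
  move=> e; have := lZ l0 (fA d - 1) a0; rewrite e -/eta mulrC => <-.
  have := lZ l0 0 a0; rewrite scale0r mul0r.
  by [].
exists a0, eta, cc; split=> // x.
have [l [-> hl]] := vP x; have [dd [ddZ hdd lE']] := hl a0.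
rewrite mulrC -lE lE'; congr (inv (cup x _)).
have [y hy] : exists y, dd Fr - cc Fr = gm_act A Fr y - y.
  by apply/fA_ker; rewrite raddfB /= !fcc // subrr.
apply/(cls_eqP _ (Z1_set0 ddZ) (Z1_set0 ccZ)); exists y => s Ds.
by apply: (@unram_cob (dd - cc)) => //; exact: submB.
Qed.

(** * The three cup products behind the identity *)

Section MainIdentity.
Context (Gq : finZmodType) (res : gal -> Gq).
Context (resM : forall s t, D s -> D t -> res (s * t)%g = res s + res t).
Context (res_fix : exists M, forall h, D h -> fixes M h -> res h = 0).
Context (res_surj : forall g, exists2 s, D s & res s = g).
Context (res_I : forall s, D s -> exists2 i, I i & res s = res i).
Context (res_cyc : exists g0 : Gq, forall g, exists a j, ~~ (p %| j)%N /\ g *+ j = g0 *+ a).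
Context (J : set gal) (JP : forall s, J s <-> D s /\ res s = 0).

(** On a cyclic group both homomorphisms are determined by their values at the generator, in which
    the product is symmetric. The multipliers [j] and [j'], prime to [p], are cancelled by
    [p_cancel]. *)
Lemma cyc_sym (l1 l2 : Gq -> R) : (forall x y, l1 (x + y) = l1 x + l1 y) ->
  (forall x y, l2 (x + y) = l2 x + l2 y) -> forall g g', l1 g * l2 g' = l1 g' * l2 g.
Proof.
move=> l1D l2D g g'; have [g0 hg0] := res_cyc.
have Mn (l : Gq -> R) : (forall x y, l (x + y) = l x + l y) -> forall x j, l (x *+ j) = l x *+ j.
  move=> lD x; elim=> [|j IH]; last by rewrite !mulrS lD IH.
  by rewrite !mulr0n; apply: (addrI (l 0)); rewrite -lD !addr0.
have [a [j [pj ej]]] := hg0 g; have [a' [j' [pj' ej']]] := hg0 g'.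
apply/eqP; rewrite -subr_eq0; apply/eqP.
apply: (@p_cancel R^o _ (j * j')); first by rewrite Euclid_dvdM // negb_or pj.
have e1 := congr1 l1 ej; have e1' := congr1 l1 ej'.
have e2 := congr1 l2 ej; have e2' := congr1 l2 ej'.
rewrite !Mn // in e1 e1' e2 e2'.
change ((l1 g * l2 g' - l1 g' * l2 g : R) *+ (j * j') = 0).
rewrite mulrnBl {1}mulrnA mulnC -mulrnAl e1 -mulrnAr e2'.
by rewrite mulrnA -mulrnAl e1' -mulrnAr e2 !mulrnAl !mulrnAr -!mulrnA mulnC subrr.
Qed.

Definition is_hom (l : gal -> R) : Prop :=
  (forall s t, D s -> D t -> l (s * t)%g = l s + l t) /\
  exists M, forall h, D h -> fixes M h -> l h = 0.

Lemma mul_bihom (l l' : gal -> R) : is_hom l -> is_hom l' -> bihom (fun s t => l s * l' t : R1).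
Proof.
move=> [lM [M hM]] [lM' [M' hM']]; split.
- by move=> s s' t Ds Ds' Dt; rewrite lM // mulrDl.
- by move=> s t t' Ds Dt Dt'; rewrite lM' // mulrDr.
exists (M ++ M') => s h Ds Dh /fixes_cat[Mh Mh']; rewrite (hM _ Dh Mh) (hM' _ Dh Mh').
by rewrite mulr0 mul0r.
Qed.

Lemma cls2_ext F G : bihom F -> bihom G -> (forall s t, D s -> D t -> F s t = G s t) ->
  cls2 (N := R1) p D F = cls2 p D G.
Proof.
move=> FB GB FG; apply/(cls_eqP _ (bihom_Z2 FB) (bihom_Z2 GB)).
apply: (@cob1_B2 0 _ [::]) => [//|s t Ds Dt].
by change (F s t - G s t = 0 - 0 + 0); rewrite FG // !subrr addr0.
Qed.

Lemma bihom_clsD F G : bihom F -> bihom G ->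
  cls2 (N := R1) p D (F + G) = cls2 p D F + cls2 p D G.
Proof. by move=> /bihom_Z2 FZ /bihom_Z2 GZ; exact: clsD. Qed.
Lemma bihom_clsZ a F : bihom F -> cls2 (N := R1) p D (a *: F) = a *: cls2 p D F.
Proof.
move=> /bihom_Z2 FZ; have := cls_lin (B2 p R1 D) a FZ (subm_0 _).
by rewrite cls0 !addr0.
Qed.
Lemma bihom0 : bihom (0 : gal -> gal -> R1).
Proof.
split=> [s s' t _ _ _|s t t' _ _ _|]; try by apply/esym; exact: addr0.
by exists [::].
Qed.
Lemma bihomZ a F : bihom F -> bihom (a *: F).
Proof. by move=> FB; have := bihom_lin a FB bihom0; rewrite addr0. Qed.

Lemma ev_hom (J' : set gal) (w : gal -> B) (a : AFr) : Z1 p B D J' w -> is_hom (fun s => val (w s) (val a)).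
Proof.
move=> wZ; have ha : gm_act A Fr (val a) = val a by exact: elimT (subm_predP _ _) (valP a).
split=> [s t Ds Dt|].
  rewrite (Z1M wZ) //.
  change (val (w s) (val a) + val (gm_act B s (w t)) (val a) = val (w s) (val a) + val (w t) (val a)).
  by rewrite act_ev // A_fixed //; exact: DV.
have [M hM] := Z1_fixes B1act wZ; exists M => h Dh Mh.
by rewrite (hM h Dh Mh).
Qed.

Lemma fixed_ev_hom (J' : set gal) (b : B) (w : gal -> A) : gm_act B Fr b = b -> Z1 p A D J' w ->
  is_hom (fun s => val b (w s)).
Proof.
move=> hb wZ; split=> [s t Ds Dt|]; first by rewrite (Z1M wZ) // evD B_fixed_ev.
have [M hM] := Z1_fixes A1 wZ; exists M => h Dh Mh.
by rewrite (hM h Dh Mh) ev0.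
Qed.

Lemma unram_eq (l l' : gal -> R) : is_hom l -> is_hom l' ->
  (forall i, I i -> l i = 0) -> (forall i, I i -> l' i = 0) -> l Fr = l' Fr ->
  forall s, D s -> l s = l' s.
Proof.
move=> [lM [M hM]] [lM' [M' hM']] lI lI'; apply: (unram_hom_eq (L := M ++ M')) => // h Dh [Ih|].
  by rewrite lI // lI'.
by move=> /fixes_cat[Mh Mh']; rewrite hM // hM'.
Qed.

Lemma hom_scale a (l : gal -> R) : is_hom l -> is_hom (fun s => a * l s).
Proof.
move=> [lM [M hM]]; split=> [s t Ds Dt|]; first by rewrite lM // mulrDr.
by exists M => h Dh Mh; rewrite hM // mulr0.
Qed.

Lemma hom_res (w : Gq -> R) : (forall x y, w (x + y) = w x + w y) -> is_hom (fun s => w (res s)).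
Proof.
move=> wD; split=> [s t Ds Dt|]; first by rewrite resM // wD.
have [M hM] := res_fix; exists M => h Dh Mh; rewrite (hM h Dh Mh).
by apply: (addrI (w 0)); rewrite -wD !addr0.
Qed.

Lemma J_trivial s h : D s -> D h -> res s = res h -> J (s^-1 * h)%g.
Proof.
move=> Ds Dh e; have Du : D (s^-1 * h)%g by apply: DM => //; exact: DV.
apply/JP; split=> //; apply: (addrI (res s)).
by rewrite -resM // mulKVg addr0.
Qed.

Section Identity.
Context (w : Gq -> R) (wD : forall x y, w (x + y) = w x + w y).
Context (u : gal -> R) (u_hom : is_hom u) (uI : forall i, I i -> u i = 0).
Context (z f t : gal -> B) (zZ : Z1 p B D set0 z) (fZ : Z1 p B D I f) (tZ : Z1 p B D J t).
Context (z_ft : cls1 p D z = cls1 p D f + cls1 p D t).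
Context (a0 : AFr) (eta : R) (cc : gal -> A) (ccZ : Z1 p A D I cc) (hcc : - Qact Fr (cc Fr) = val a0).
Context (vE : forall x, eta * v x = inv (cup x (cls1 p D cc))).
Definition ysum (r : seq (homZ Gq (fixed B Fr) * Gq)) : B := \sum_(k <- r) val (val k.1 k.2).
Context (y : seq (homZ Gq (fixed B Fr) * Gq)) (hy : ysum y = Qact Fr^-1%g (f Fr)).

Definition infl (h : homZ Gq (fixed B Fr)) (s : gal) : B := val (val h (res s)).

Let w_hom := hom_res wD.
Let f_hom := ev_hom a0 fZ.
Let t_hom := ev_hom a0 tZ.
Let z_hom := ev_hom a0 zZ.

Lemma homZD (h : homZ Gq (fixed B Fr)) x x' : val h (x + x') = val h x + val h x'.
Proof. by have /subm_predP := valP h; apply. Qed.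

Lemma infl_fixed h s : gm_act B Fr (infl h s) = infl h s.
Proof. exact: elimT (subm_predP _ _) (valP (val h (res s))). Qed.

Lemma infl_Z1 h : Z1 p B D set0 (infl h).
Proof.
have [M hM] := res_fix; have h0 : val h 0 = 0 by apply: (addrI (val h 0)); rewrite -homZD !addr0.
split=> // [|s s' Ds Ds'].
  apply: (@lconst_cont1 _ _ M) => s l Ds Dl Ml.
  by rewrite /infl resM // (hM l Dl Ml) addr0.
rewrite /cob1 [gm_act B s _](_ : _ = infl h s'); last first.
  apply/val_inj/funext => a; rewrite act_ev // B_fixed_ev ?infl_fixed //; exact: DV.
rewrite /infl resM // homZD.
change (val (val h (res s')) - (val (val h (res s)) + val (val h (res s'))) + val (val h (res s)) = 0).
by rewrite opprD addrCA addrN addr0 addNr.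
Qed.

(** Coboundaries vanish at [a0], which [D] fixes, so the equality of classes becomes an equality of
    functions. *)
Lemma z_ev s : D s -> val (z s) (val a0) = val (f s) (val a0) + val (t s) (val a0).
Proof.
move=> Ds; have fZ0 := Z1_set0 fZ; have tZ0 := Z1_set0 tZ.
have /(cls_eqP _ zZ (submD fZ0 tZ0))[b hb] : cls1 p D z = cls1 p D (f + t).
  by rewrite z_ft; apply/esym/clsD.
have ha : gm_act A Fr (val a0) = val a0 by exact: elimT (subm_predP _ _) (valP a0).
have e : val (z s - (f s + t s)) (val a0) = val (gm_act B s b - b) (val a0).
  by congr (val _ _); exact: hb.
have : val (z s) (val a0) - (val (f s) (val a0) + val (t s) (val a0)) =
   val (gm_act B s b) (val a0) - val b (val a0) by exact: e.
rewrite act_ev // A_fixed //; last exact: DV.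
by rewrite subrr => /eqP; rewrite subr_eq0 => /eqP.
Qed.

Lemma t_fixed s : D s -> gm_act B Fr (t s) = t s.
Proof.
apply: (@transverse_fixed J) => //.
- by move=> g /JP[].
- move=> g h Dg /JP[Dh h0]; have Dg' := DV Dg.
  have Dgh : D (g^-1 * h)%g by exact: DM.
  apply/JP; split; first exact: DM.
  by rewrite !resM // h0 addr0 -resM // mulVg; apply: (addrI (res 1%g)); rewrite -resM // mulg1 addr0.
by have [i Ii ei] := res_I DFr; exists i => //; apply: J_trivial => //; exact: ID.
Qed.

(** Evaluated at [a0], the transverse cocycle [t] is a homomorphism that factors through [Gq], as
    [w] does, and [cyc_sym] applies. *)
Lemma wt_symmetric s s' : D s -> D s' ->
  w (res s) * val (t s') (val a0) = w (res s') * val (t s) (val a0).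
Proof.
move=> Ds Ds'; have /choice[l hl] (g : Gq) : exists s, D s /\ res s = g.
  by have [g' Dg' eg] := res_surj g; exists g'.
have [_ _ tJ] := tZ; have [tM _] := t_hom.
have tE g g' : D g -> D g' -> res g = res g' -> val (t g) (val a0) = val (t g') (val a0).
  move=> Dg Dg' e; have Jg := J_trivial Dg Dg' e.
  have [Dj _] := (JP _).1 Jg.
  rewrite -{1}(mulKVg g g') tM // (tJ _ Jg).
  by rewrite [X in _ = _ + X](_ : _ = 0) ?addr0.
have tl g : D g -> val (t g) (val a0) = val (t (l (res g))) (val a0).
  by move=> Dg; have [Dl el] := hl (res g); apply: tE.
rewrite (tl s) // (tl s') //.
apply: (cyc_sym wD (l2 := fun g => val (t (l g)) (val a0))) => g g'.
have [Dl el] := hl g; have [Dl' el'] := hl g'; have [Dl2 el2] := hl (g + g').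
by rewrite -tM //; apply: tE => //; [exact: DM | rewrite resM // el el' el2].
Qed.

(** The sign of the last term comes from exchanging [u] and [t]; this puts it in the order in which
    [v] produces it. *)
Lemma bockstein_part :
  cls2 p D (fun s s' => (w (res s) + u s) * val (z s') (val a0) : R1) =
  cls2 p D (fun s s' => w (res s) * val (f s') (val a0) : R1) -
  cls2 p D (fun s s' => val (t s) (val a0) * u s' : R1).
Proof.
have wu_hom : is_hom (fun s => w (res s) + u s).
  have [wM [M hM]] := w_hom; have [uM [M' hM']] := u_hom; split=> [s s' Ds Ds'|].
    by rewrite wM // uM // addrACA.
  by exists (M ++ M') => h Dh /fixes_cat[Mh Mh']; rewrite hM // hM' // addr0.
have bwf := mul_bihom w_hom f_hom; have bwt := mul_bihom w_hom t_hom.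
have buf := mul_bihom u_hom f_hom; have but := mul_bihom u_hom t_hom.
have [_ _ fI] := fZ.
have wt0 := bihom_sym0 bwt wt_symmetric.
have uf0 : cls2 p D (fun s s' => u s * val (f s') (val a0) : R1) = 0.
  apply: bihom_unr0 => // s i Ds Ii; rewrite (uI Ii) (fI i Ii).
  by split; [exact: mulr0 | exact: mul0r].
have ut := bihom_swap but.
have bD F G : bihom F -> bihom G -> bihom (F + G).
  by move=> FB GB; have := bihom_lin 1 FB GB; rewrite scale1r.
have b1 := bD _ _ bwf bwt; have b2 := bD _ _ b1 buf.
transitivity (cls2 (N := R1) p D ((fun s s' => w (res s) * val (f s') (val a0) : R1) +
   (fun s s' => w (res s) * val (t s') (val a0) : R1) +
   (fun s s' => u s * val (f s') (val a0) : R1) + (fun s s' => u s * val (t s') (val a0) : R1))).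
  apply: cls2_ext; [exact: mul_bihom | exact: bD |].
  move=> s s' Ds Ds'; rewrite z_ev //.
  change ((w (res s) + u s) * (val (f s') (val a0) + val (t s') (val a0)) =
    w (res s) * val (f s') (val a0) + w (res s) * val (t s') (val a0) +
    u s * val (f s') (val a0) + u s * val (t s') (val a0)).
  by rewrite mulrDl !mulrDr !addrA.
rewrite (bihom_clsD b2 but) (bihom_clsD b1 buf) (bihom_clsD bwf bwt) wt0 uf0 !addr0; congr (_ + _); apply/eqP; rewrite -addr_eq0 -[X in _ == X]ut; apply/eqP.
congr (_ + _); apply: cls2_ext => //; [exact: mul_bihom | exact: bihom_flip |].
by move=> s s' _ _; exact: mulrC.
Qed.

(** By [cyc_sym], [w] and the homomorphism [k.1] exchange their arguments [k.2] and [res s], which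
    collects the sum into [ysum y], that is [Q(Fr^-1) (f Fr)]. Paired with [cc] this is an
    unramified homomorphism; at [Fr] it is [f Fr] evaluated at [Q(Fr) (cc Fr) = - a0], so everywhere
    it is minus [f] evaluated at [a0]. *)
Lemma finite_singular_part :
  \sum_(k <- y) w k.2 *: cls2 p D (pairing (infl k.1) cc) =
  - cls2 p D (fun s s' => w (res s) * val (f s') (val a0) : R1).
Proof.
have fixed_sum (r : seq (homZ Gq (fixed B Fr) * Gq)) :
    gm_act B Fr (ysum r) = ysum r.
  elim: r => [|e r IH]; first by rewrite /ysum big_nil gm_act0.
  rewrite /ysum big_cons -/(ysum r) gm_actD IH; congr (_ + _).
  exact: elimT (subm_predP _ _) (valP (val e.1 e.2)).
have bihom_y r : bihom (fun s s' => w (res s) * val (ysum r) (cc s') : R1).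
  exact: mul_bihom w_hom (fixed_ev_hom (fixed_sum r) ccZ).
have -> : \sum_(k <- y) w k.2 *: cls2 p D (pairing (infl k.1) cc) =
    cls2 p D (fun s s' => w (res s) * val (ysum y) (cc s') : R1).
  elim: (y) => [|[h g] r IH].
    rewrite /ysum !big_nil -(cls0 (Z2 p R1 D) (B2 p R1 D)); congr (cls2 _ _ _).
    by apply/funext => s; apply/funext => s'; apply/esym; exact: mulr0.
  rewrite big_cons IH /=.
  apply: etrans (esym (cls_lin _ (w g) (pairing_Z2 (infl_Z1 h) ccZ) (bihom_Z2 (bihom_y r)))) _.
  apply/(cls_eqP _ (subm_lin _ (pairing_Z2 (infl_Z1 h) ccZ) (bihom_Z2 (bihom_y r))) (bihom_Z2 (bihom_y _))).
  apply: (@cob1_B2 0 _ [::]) => [//|s s' Ds Ds'].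
  change (w g * pairing (infl h) cc s s' + w (res s) * val (ysum r) (cc s')
    - w (res s) * val (ysum ((h, g) :: r)) (cc s') = 0 - 0 + 0).
  rewrite subrr addr0 /ysum big_cons -/(ysum r).
  change (w g * pairing (infl h) cc s s' + w (res s) * val (ysum r) (cc s')
    - w (res s) * (val (val (val h g)) (cc s') + val (ysum r) (cc s')) = 0).
  rewrite mulrDr opprD addrACA subrr addr0 /pairing B_fixed_ev ?infl_fixed // /infl.
  apply/eqP; rewrite subr_eq0; apply/eqP.
  apply: (cyc_sym wD (l2 := fun g => val (val (val h g) : B) (cc s'))) => x x'.
  by rewrite homZD (@submod_valD R B) (@dual_add R A).
have fE s : D s -> val (ysum y) (cc s) = -1 * val (f s) (val a0).
  move: s; apply: unram_eq.
  - exact: fixed_ev_hom (fixed_sum y) ccZ.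
  - exact: hom_scale.
  - by have [_ _ cI] := ccZ => i Ii; rewrite (cI i Ii) ev0.
  - have [_ _ fI] := fZ => i Ii; rewrite (fI i Ii); exact: mulr0.
  by rewrite hy ev_Qact_dual -hcc mulN1r -scaleN1r evZ mulN1r opprK.
have bwf := mul_bihom w_hom f_hom.
rewrite -scaleN1r -bihom_clsZ //; apply: cls2_ext => //; first exact: (bihomZ (-1) bwf).
move=> s s' Ds Ds'; rewrite fE //.
by change (w (res s) * (-1 * val (f s') (val a0)) = -1 * (w (res s) * val (f s') (val a0))); rewrite mulrCA.
Qed.

(** Already an equality of functions on [D]. For fixed [s] both sides are unramified homomorphisms
    in the other variable, and they agree at [Fr]: since [Fr] fixes [t s], [Q1] times the value of
    [t s] at [cc Fr] is minus its value at [a0]. *)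
Lemma valuation_part :
  (- (Q1 * u Fr)) *: cls2 p D (pairing t cc) =
  cls2 p D (fun s s' => val (t s) (val a0) * u s' : R1).
Proof.
have btu := mul_bihom t_hom u_hom; have pZ := pairing_Z2 tZ ccZ.
have := cls_lin (B2 p R1 D) (- (Q1 * u Fr)) pZ (subm_0 _); rewrite cls0 !addr0 => <-.
apply/(cls_eqP _ (submZ _ pZ) (bihom_Z2 btu)).
apply: (@cob1_B2 0 _ [::]) => [//|s s' Ds Ds'].
change (- (Q1 * u Fr) * pairing t cc s s' - val (t s) (val a0) * u s' = 0 - 0 + 0).
rewrite subrr addr0; apply/eqP; rewrite subr_eq0; apply/eqP.
rewrite /pairing (B_fixed_ev (t_fixed Ds)) //.
move: s' Ds'; apply: (unram_eq (l := fun s' => - (Q1 * u Fr) * val (t s) (cc s'))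
  (l' := fun s' => val (t s) (val a0) * u s')).
- by apply: hom_scale; apply: fixed_ev_hom ccZ; exact: t_fixed.
- exact: hom_scale.
- by have [_ _ cI] := ccZ => i Ii; rewrite (cI i Ii) ev0 mulr0.
- by move=> i Ii; rewrite (uI Ii) mulr0.
rewrite -hcc -scaleN1r evZ (ev_Qact_fixed _ (t_fixed Ds)); move: (val _ _ : R) => x.
ring.
Qed.

Lemma local_identity :
  - inv (cls2 p D (fun s s' => (w (res s) + u s) * val (z s') (val a0) : R1)) =
  eta * (\sum_(k <- y) v (cls1 p D (infl k.1)) * w k.2 +
    v (cls1 p D f + cls1 p D t) * - (Q1 * u Fr)).
Proof.
have ccZ0 := Z1_set0 ccZ; have fZ0 := Z1_set0 fZ; have tZ0 := Z1_set0 tZ.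
(* The unramified part [f] drops out here, as its cup product with the unramified [cc] vanishes. *)
have e1 : eta * (v (cls1 p D f + cls1 p D t) * - (Q1 * u Fr)) =
    inv (cls2 p D (fun s s' => val (t s) (val a0) * u s' : R1)).
  rewrite mulrA vE -valuation_part (linearZ_LR inv) mulrC.
  have := cup_linl 1 (cls1 p D f) (cls1 p D t) (cls1 p D cc).
  rewrite !scale1r => ->; rewrite !cup_cls // pairing_unr0 // add0r.
  by [].
have e2 : eta * (\sum_(k <- y) v (cls1 p D (infl k.1)) * w k.2) =
    inv (\sum_(k <- y) w k.2 *: cls2 p D (pairing (infl k.1) cc)).
  rewrite (raddf_sum inv) mulr_sumr; apply: eq_bigr => e _.
  apply: etrans _ (esym (linearZ_LR inv _ _)); rewrite mulrA vE cup_cls //; last exact: infl_Z1.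
  exact: mulrC.
rewrite mulrDr e1 e2 finite_singular_part bockstein_part (raddfN inv) (raddfB inv).
by rewrite opprB addrC.
Qed.
End Identity.
End MainIdentity.
End Comparison.
End LocalCohomology.

(** * The Bockstein map *)

Lemma additive_mulz (U V : zmodType) (f : U -> V) : (forall x y, f (x + y) = f x + f y) ->
  forall x (m : int), f (x *~ m) = f x *~ m.
Proof.
move=> fD x; have f0 : f 0 = 0 by apply: (addrI (f 0)); rewrite -fD !addr0.
have fMn n : f (x *+ n) = f x *+ n.
  by elim: n => [|n IH]; rewrite ?mulr0n // !mulrS fD IH.
by case=> n; [exact: fMn | apply: (addIr (f (x *+ n.+1))); rewrite -fD addNr f0 fMn addNr].
Qed.

Lemma tlift_map (U V U' V' W : zmodType) (f : U' -> V' -> W) (g : U -> U') (h : V -> V') x :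
  biadditive f ->
  tlift f (tlift (fun u v => tmk (g u) (h v)) x) = tlift (fun u v => f (g u) (h v)) x.
Proof.
move=> fb; rewrite {2 3}/tlift /teval tlift_sum //; apply: eq_bigr => u _.
by rewrite tlift_tmk.
Qed.

(** * Functoriality of the second cohomology in the coefficients *)

Section CoefficientMap.
Context (p : nat) (R : comPzRingType) (D : set gal).
Context (N N' : gmod R) (f : N -> N') (fD : forall x y, f (x + y) = f x + f y).
Context (f_act : forall s x, D s -> f (gm_act N s x) = gm_act N' s (f x)).

Let f0 : f 0 = 0. Proof. by apply: (addrI (f 0)); rewrite -fD !addr0. Qed.
Let fN x : f (- x) = - f x. Proof. by apply: (addrI (f x)); rewrite -fD !addrN. Qed.
Let fMn x n : f (x *+ n) = f x *+ n.
Proof. by elim: n => [|n IH]; rewrite ?mulr0n // !mulrS fD IH. Qed.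

Lemma coef_Z2 y : Z2 p N D y -> Z2 p N' D (fun s t => f (y s t)).
Proof.
move=> [yc yZ]; split=> [n s t Ds Dt|s t u Ds Dt Du].
  have [L hL] := yc n s t Ds Dt; exists L => h l Dh Dl Lh Ll.
  by have [z hz] := hL h l Dh Dl Lh Ll; exists (f z); rewrite -fN -fD hz fMn.
by rewrite /cob2 -f_act // -!fN -!fD -/(cob2 y s t u) yZ.
Qed.

Lemma coef_B2 y : B2 p N D y -> B2 p N' D (fun s t => f (y s t)).
Proof.
move=> [g gc hg]; exists (fun s => f (g s)) => [n s Ds|s t Ds Dt].
  have [L hL] := gc n s Ds; exists L => h Dh Lh.
  by have [z hz] := hL h Dh Lh; exists (f z); rewrite -fN -fD hz fMn.
by rewrite hg // /cob1 -f_act // -!fN -!fD.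
Qed.

Lemma coef_cls2 y y' : Z2 p N D y -> Z2 p N D y' -> cls2 p D y = cls2 p D y' ->
  cls2 p D (fun s t => f (y s t)) = cls2 p D (fun s t => f (y' s t)).
Proof.
move=> yZ yZ' /(cls_eqP _ yZ yZ') /coef_B2 yB.
apply/(cls_eqP _ (coef_Z2 yZ) (coef_Z2 yZ')).
rewrite (_ : _ - _ = fun s t => f ((y - y') s t)) //; apply/funext => s; apply/funext => t.
by change (f (y s t) - f (y' s t) = f (y s t - y' s t)); rewrite -fN -fD.
Qed.

Lemma coef_rep2 y : Z2 p N D y ->
  cls2 p D (fun s t => f (rep2 (cls2 p D y) s t)) = cls2 p D (fun s t => f (y s t)).
Proof. by move=> yZ; apply: coef_cls2 => //; [exact: rep_in | exact: repK]. Qed.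

Lemma coef_rep2_sum (I : Type) (s : seq I) (c : I -> H2 p N D) :
  cls2 p D (fun s' t => f (rep2 (\sum_(i <- s) c i) s' t)) =
  \sum_(i <- s) cls2 p D (fun s' t => f (rep2 (c i) s' t)).
Proof.
elim: s => [|i s IH].
  rewrite !big_nil -(cls0 (Z2 p N D) (B2 p N D)) coef_rep2; last exact: subm_0.
  rewrite -(cls0 (Z2 p N' D) (B2 p N' D)); congr (cls2 _ _ _).
  by apply/funext => s; apply/funext => t; exact: f0.
have Z (x : H2 p N D) : Z2 p N D (rep2 x) by exact: rep_in.
rewrite !big_cons -IH; move: (\sum_(j <- s) c j) => x.
have -> : c i + x = cls2 p D (rep2 (c i) + rep2 x).
  by apply: etrans (esym (clsD _ (Z _) (Z _))); rewrite !repK.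
rewrite coef_rep2; last by apply: submD; exact: Z.
apply: etrans (clsD _ (coef_Z2 (Z _)) (coef_Z2 (Z _))).
congr (cls2 _ _ _); apply/funext => s'; apply/funext => t; exact: fD.
Qed.
End CoefficientMap.

Section Bockstein.
Context (p : nat) (R : comPzRingType) (D : set gal).
Context (c : gal -> R) (c1 : forall s, D s -> c s = 1).
Local Notation R1 := (twist c).
Context (A : gmod R) (a0 : A) (a0_fixed : forall s, D s -> gm_act A s^-1%g a0 = a0).
Local Notation B := (twisted_dual A c).
Context (G : finZmodType) (res : gal -> G).
Context (T : G -> R) (TD : forall x y, T (x + y) = T x + T y).
Local Notation J := (submod (augideal G)).
Context (ZD_D : forall (s : gal) (x y : gring int G),
  gdelta int (- res s) * (x + y) = gdelta int (- res s) * x + gdelta int (- res s) * y).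
Context (J_D : forall s (x y : J), gact (- res s) (x + y) = gact (- res s) x + gact (- res s) y).
Local Notation BZD := (tens_gmod B ZD_D).
Local Notation BJ := (tens_gmod B J_D).
Local Notation BJJ2 := (@tens_gmod R B (augquot G) (fun _ => id) (fun _ _ _ => erefl)).

Lemma act_ev_fixed s (b : B) : D s -> val (gm_act B s b) a0 = val b a0.
Proof. by move=> Ds; rewrite /= c1 // mul1r a0_fixed. Qed.

Lemma ev_biadditive (X : zmodType) (l : X -> R) : (forall x y, l (x + y) = l x + l y) ->
  biadditive (fun (b : B) x => val b a0 * l x : R1).
Proof.
move=> lD; split=> [b b' x|b x y]; last by rewrite lD; exact: mulrDr.
exact: mulrDl.
Qed.

Lemma gfunD x y : gfun T (x + y) = gfun T x + gfun T y. Proof. exact: raddfD. Qed.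
Lemma augfunD x y : augfun T (x + y) = augfun T x + augfun T y. Proof. exact: raddfD. Qed.

Definition ev_ZD : BZD -> R1 := tlift (fun (b : B) d => val b a0 * gfun T d).
Definition ev_J : BJ -> R1 := tlift (fun (b : B) (j : J) => val b a0 * gfun T (val j)).
Definition ev_JJ2 : BJJ2 -> R1 := tlift (fun (b : B) j => val b a0 * augfun T j).

Lemma ev_ZDD x y : ev_ZD (x + y) = ev_ZD x + ev_ZD y.
Proof. exact: tlift_additive (ev_biadditive gfunD). Qed.
Lemma gfun_valD (x y : J) : gfun T (val (x + y)) = gfun T (val x) + gfun T (val y).
Proof. exact: gfunD. Qed.
Lemma ev_JD x y : ev_J (x + y) = ev_J x + ev_J y.
Proof. exact: tlift_additive (ev_biadditive gfun_valD). Qed.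
Lemma ev_JJ2D x y : ev_JJ2 (x + y) = ev_JJ2 x + ev_JJ2 y.
Proof. exact: tlift_additive (ev_biadditive augfunD). Qed.

Lemma gfun_act s x : gfun T (gdelta int (- res s) * x) = gfun T x - T (res s) *~ gaug x.
Proof.
rewrite gfunM // gfun_delta gaug_gdelta mulr1z addrC; congr (_ + _).
have T0 : T 0 = 0 by apply: (addrI (T 0)); rewrite -TD !addr0.
have -> : T (- res s) = - T (res s) by apply: (addrI (T (res s))); rewrite -TD !addrN.
by rewrite mulNrz.
Qed.

Lemma ev_Jact s x : D s -> ev_J (gm_act BJ s x) = gm_act R1 s (ev_J x).
Proof.
move=> Ds; rewrite [RHS](_ : _ = ev_J x); last by rewrite /= c1 // mul1r.
rewrite [LHS](tlift_map _ _ _ (ev_biadditive gfun_valD)).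
apply: eq_bigr => u _; rewrite act_ev_fixed //; congr (_ * _).
by rewrite /= gfun_act [gaug _](elimT (subm_predP _ _) (valP u.2)) mulr0z subr0.
Qed.

Lemma ev_JJ2act s x : D s -> ev_JJ2 (gm_act BJJ2 s x) = gm_act R1 s (ev_JJ2 x).
Proof.
move=> Ds; rewrite [RHS](_ : _ = ev_JJ2 x); last by rewrite /= c1 // mul1r.
rewrite [LHS](tlift_map _ _ _ (ev_biadditive augfunD)).
by apply: eq_bigr => u _; rewrite act_ev_fixed.
Qed.

Definition aug_ev : BZD -> B := tlift (fun (b : B) (d : gring int G) => b *~ gaug d).

(** Evaluation at [a0] and [T] is not equivariant on [BZD], since [s] translates Z[G] by [- res s].
    The defect is the source of the cup product in the Bockstein map, and of its sign. *)
Lemma ev_ZDact s x : D s ->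
  ev_ZD (gm_act BZD s x) = ev_ZD x - T (res s) * val (aug_ev x) a0.
Proof.
move=> Ds; rewrite [LHS](tlift_map _ _ _ (ev_biadditive gfunD)).
rewrite /ev_ZD /aug_ev /tlift /teval.
elim: (repr x) => [|u t IH]; first by rewrite !big_nil /= mulr0 subr0.
rewrite !big_cons IH; set S := \sum_(i <- t) _; set S' := \sum_(i <- t) _.
rewrite [val (_ + S') a0](_ : _ = val (u.1 *~ gaug u.2) a0 + val S' a0) //.
have -> : val (u.1 *~ gaug u.2) a0 = val u.1 a0 *~ gaug u.2.
  exact: (@additive_mulz _ _ (fun b : B => val b a0 : R^o)).
rewrite act_ev_fixed // gfun_act.
have aux (x1 x2 x3 s1 s2 : R) (m : int) :
    x1 * (x2 - x3 *~ m) + (s1 - x3 * s2) = (x1 * x2 + s1) - x3 * (x1 *~ m + s2).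
  by rewrite -(mulrzr x3 m) -(mulrzr x1 m); ring.
exact: aux.
Qed.

(** The bounding cochain is [ev_ZD] applied to the lift [zt]: its coboundary differs from [ev_ZD] of
    the coboundary of [zt] by the defect in [ev_ZDact]. *)
Lemma bockstein_pairing (z : gal -> B) (zt : gal -> BZD) (y : gal -> gal -> BJ) :
  cont1 p D zt -> (forall s, D s -> aug_ev (zt s) = z s) ->
  (forall s t, D s -> D t -> tmapr (fun j : J => val j) (y s t) = cob1 zt s t) ->
  B2 p R1 D ((fun s t => ev_J (y s t)) + (fun s t => T (res s) * val (z t) a0)).
Proof.
move=> ztc hz hy; exists (fun s => ev_ZD (zt s)) => [n s Ds|s t Ds Dt].
  have [L hL] := ztc n s Ds; exists L => h Dh Lh; have [w hw] := hL h Dh Lh.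
  have ev_B u v : ev_ZD u - ev_ZD v = ev_ZD (u - v).
    by apply/eqP; rewrite subr_eq -ev_ZDD subrK.
  exists (ev_ZD w); rewrite ev_B hw.
  exact: (additive_mulz ev_ZDD w (p ^ n)%N).
change (ev_J (y s t) + T (res s) * val (z t) a0 =
  gm_act R1 s (ev_ZD (zt t)) - ev_ZD (zt (s * t)%g) + ev_ZD (zt s)).
have -> : ev_J (y s t) = ev_ZD (tmapr (fun j : J => val j) (y s t)).
  by rewrite [RHS](tlift_map _ _ _ (ev_biadditive gfunD)).
have ev_B u v : ev_ZD (u - v) = ev_ZD u - ev_ZD v.
  by apply/eqP; rewrite eq_sym subr_eq -ev_ZDD subrK.
rewrite hy // /cob1 ev_ZDD ev_B ev_ZDact // hz // [gm_act R1 s _](_ : _ = ev_ZD (zt t)).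
  have aux (x1 x2 x3 x4 : R) : x1 - x4 - x2 + x3 + x4 = x1 - x2 + x3 by ring.
  exact: aux.
by rewrite /= c1 // mul1r.
Qed.

(** Both sides are the images under [ev_JJ2] of the two sides of the hypothesis; on a pure tensor
    [augfun T j] comes out as a scalar. *)
Lemma bockstein_tens (cj : H2 p BJ D) (y : tens (H2 p B D) (augquot G)) :
  tlift (fun (cb : H2 p B D) j => cls2 p D (fun s t => tmk (rep2 cb s t) j : BJJ2)) y =
  cls2 p D (fun s t => tmapr (fun j : J => augcls (val j)) (rep2 cj s t) : BJJ2) ->
  tlift (fun (cb : H2 p B D) j => augfun T j *: cls2 p D (fun s t => val (rep2 cb s t : B) a0 : R1)) y =
  cls2 p D (fun s t => ev_J (rep2 cj s t)).
Proof.
move=> hy; have Z (N : gmod R) (x : H2 p N D) : Z2 p N D (rep2 x) by exact: rep_in.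
have evJE w : ev_JJ2 (tmapr (fun j : J => augcls (val j)) w) = ev_J w.
  rewrite [LHS](tlift_map _ _ _ (ev_biadditive augfunD)); apply: eq_bigr => u _.
  by rewrite /augfun gfun_rep_cls //; exact: elimT (subm_predP _ _) (valP u.2).
have clsD' (x x' : J) : augcls (val (x + x')) = augcls (val x) + augcls (val x').
  by apply: clsD; [exact: elimT (subm_predP _ _) (valP x) | exact: elimT (subm_predP _ _) (valP x')].
have tZ : Z2 p BJJ2 D (fun s t => tmapr (fun j : J => augcls (val j)) (rep2 cj s t) : BJJ2).
  apply: (@coef_Z2 p R D BJ BJJ2 (tmapr (fun j : J => augcls (val j)))) (Z _ _).
    move=> x x'; apply: tlift_additive; split=> *; first exact: tmkDl.
    by rewrite clsD' tmkDr.
  move=> s x Ds; rewrite [LHS]tlift_map; last first.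
    by split=> *; [exact: tmkDl | rewrite clsD' tmkDr].
  rewrite [RHS]tlift_map; last first.
    by split=> *; rewrite ?gm_actD ?tmkDl ?tmkDr.
  apply: eq_bigr => u _; congr (tmk _ _).
  have gJ : augideal G (gdelta int (- res s) * val u.2).
    by rewrite /= gaug_delta; exact: elimT (subm_predP _ _) (valP u.2).
  apply/cls_eqP; [exact: gJ | exact: elimT (subm_predP _ _) (valP u.2) |].
  exists [:: (gdelta int (- res s) - gdelta int 0, val u.2)].
    by move=> w; rewrite inE => /eqP ->; split; [exact: aug_gdeltaB | exact: elimT (subm_predP _ _) (valP u.2)].
  rewrite big_seq1 mulrBl; congr (_ - _); exact/esym/gmul1.
have evZ : forall y, Z2 p BJJ2 D y ->
    cls2 p D (fun s t => ev_JJ2 (rep2 (cls2 p D y) s t)) = cls2 p D (fun s t => ev_JJ2 (y s t)).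
  by move=> y' yZ; apply: (coef_rep2 ev_JJ2D) => // *; exact: ev_JJ2act.
have evS := @coef_rep2_sum p R D BJJ2 R1 ev_JJ2 ev_JJ2D ev_JJ2act.
have := congr1 (fun x => cls2 p D (fun s t => ev_JJ2 (rep2 x s t))) hy.
rewrite evZ // (_ : (fun s t => ev_JJ2 (tmapr _ _)) = (fun s t => ev_J (rep2 cj s t))); last first.
  by apply/funext => s; apply/funext => t; exact: evJE.
move=> <-; rewrite /tlift /teval evS; apply: eq_bigr => -[cb j] _ /=.
have bZ : Z2 p BJJ2 D (fun s t => tmk (rep2 cb s t) j : BJJ2).
  apply: (@coef_Z2 p R D B BJJ2 (fun b => tmk b j)) (Z _ _).
    by move=> x x'; exact: tmkDl.
  move=> s x Ds; rewrite [RHS]tlift_tmk //.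
  by split=> *; rewrite ?gm_actD ?tmkDl ?tmkDr.
rewrite evZ //.
have aZ : Z2 p R1 D (fun s t => val (rep2 cb s t : B) a0 : R1).
  apply: (@coef_Z2 p R D B R1 (fun b : B => val b a0 : R1)) (Z _ _) => // s x Ds.
  by rewrite act_ev_fixed // /= c1 // mul1r.
rewrite -[LHS]addr0 -(cls0 (Z2 p R1 D) (B2 p R1 D)).
apply: etrans (esym (cls_lin _ _ aZ (subm_0 _))) _; rewrite addr0; congr (cls _ _ _).
apply/funext => s; apply/funext => t; rewrite /ev_JJ2 tlift_tmk; last exact: (ev_biadditive augfunD).
exact: mulrC.
Qed.

Lemma ev_J_rep2 (y : gal -> gal -> BJ) : Z2 p BJ D y ->
  cls2 p D (fun s t => ev_J (rep2 (cls2 p D y) s t)) = cls2 p D (fun s t => ev_J (y s t)).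
Proof. by move=> yZ; apply: (coef_rep2 ev_JD) => // *; exact: ev_Jact. Qed.

Lemma ev_J_Z2 (y : gal -> gal -> BJ) : Z2 p BJ D y -> Z2 p R1 D (fun s t => ev_J (y s t)).
Proof. by move=> yZ; apply: (coef_Z2 ev_JD) => // *; exact: ev_Jact. Qed.
End Bockstein.

Section BocksteinIdentity.
Context (p : nat) (R : comPzRingType) (D : set gal) (c : gal -> R) (c1 : forall s, D s -> c s = 1).
Local Notation R1 := (twist c).
Context (A : gmod R) (Fr : gal).
Local Notation AFr := (fixed A Fr).
Context (AFr_inv : forall (a : AFr) s, D s -> gm_act A s^-1%g (val a) = val a).
Local Notation B := (twisted_dual A c).
Context (inv : {linear H2 p R1 D -> R^o}) (theta : {linear dual AFr -> R^o}).

(** The form attached to a class in [H2_dual], over the abstract [D] and [inv]. *)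
Definition H2_form (x : H2 p B D) (a : AFr) : R :=
  inv (cls2 p D (fun s t => val (rep2 x s t : B) (val a) : R1)).

Lemma ev_Z2 (y : gal -> gal -> B) (a : AFr) : Z2 p B D y ->
  Z2 p R1 D (fun s t => val (y s t : B) (val a) : R1).
Proof.
apply: (@coef_Z2 p R D B R1 (fun b : B => val b (val a) : R1)) => // s x Ds.
by rewrite (act_ev_fixed c1 (AFr_inv a)) // /= c1 // mul1r.
Qed.

Lemma H2_form_linear x : is_linear (V := AFr) (W := R^o) (H2_form x).
Proof.
have xZ : Z2 p B D (rep2 x) by exact: rep_in.
move=> b a1 a2; apply: etrans _ (linearP inv b _ _); congr (inv _).
apply: etrans _ (cls_lin _ b (ev_Z2 a1 xZ) (ev_Z2 a2 xZ)); congr (cls _ _ _).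
apply/funext => s; apply/funext => t.
by have /subm_predP h := valP (rep2 x s t : dual A); exact: (h b (val a1) (val a2)).
Qed.

Lemma H2_dualE x (a : AFr) : val (insubd (0 : dual AFr) (H2_form x)) a = H2_form x a.
Proof. by rewrite insubdK //; apply/subm_predP; exact: H2_form_linear. Qed.

Context (a0 : AFr) (eta : R) (theta_eta : forall l : dual AFr, val l a0 = theta l * eta).
Context (G : finZmodType) (res : gal -> G) (T : G -> R) (TD : forall x y, T (x + y) = T x + T y).
Local Notation J := (submod (augideal G)).
Context (ZD_D : forall (s : gal) (x y : gring int G),
  gdelta int (- res s) * (x + y) = gdelta int (- res s) * x + gdelta int (- res s) * y).
Context (J_D : forall s (x y : J), gact (- res s) (x + y) = gact (- res s) x + gact (- res s) y).
Local Notation BZD := (tens_gmod B ZD_D).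
Local Notation BJ := (tens_gmod B J_D).
Local Notation BJJ2 := (@tens_gmod R B (augquot G) (fun _ => id) (fun _ _ _ => erefl)).

(** Multiplication by [eta] turns [theta] of a form into its value at [a0], by [theta_eta]; there
    [bockstein_pairing] computes the class. *)
Lemma bockstein_identity (z : gal -> B) (zt : gal -> BZD) (y0 : gal -> gal -> BJ) (cj : H2 p BJ D)
    (y : tens (H2 p B D) (augquot G)) (l : gal -> R) :
  cont1 p D zt -> (forall s, D s -> aug_ev (zt s) = z s) ->
  Z2 p BJ D y0 -> cls2 p D y0 = cj ->
  (forall s t, D s -> D t -> tmapr (fun j : J => val j) (y0 s t) = cob1 zt s t) ->
  tlift (fun (cb : H2 p B D) j => cls2 p D (fun s t => tmk (rep2 cb s t) j : BJJ2)) y =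
    cls2 p D (fun s t => tmapr (fun j : J => augcls (val j)) (rep2 cj s t) : BJJ2) ->
  (forall s, D s -> T (res s) = l s) ->
  Z2 p R1 D (fun s t => l s * val (z t : B) (val a0) : R1) ->
  eta * tlift (fun (cb : H2 p B D) j => theta (insubd (0 : dual AFr) (H2_form cb)) * augfun T j) y =
  - inv (cls2 p D (fun s t => l s * val (z t : B) (val a0) : R1)).
Proof.
move=> ztc hz y0Z y0E y0c hy Tl lZ.
have -> : eta * tlift (fun (cb : H2 p B D) j => theta (insubd (0 : dual AFr) (H2_form cb)) * augfun T j) y =
    inv (tlift (fun (cb : H2 p B D) j =>
      augfun T j *: cls2 p D (fun s t => val (rep2 cb s t : B) (val a0) : R1)) y).
  rewrite /tlift /teval (raddf_sum inv) mulr_sumr; apply: eq_bigr => e _.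
  apply: etrans _ (esym (linearZ_LR inv _ _)).
  by rewrite mulrA (mulrC eta) -theta_eta H2_dualE mulrC.
rewrite (bockstein_tens c1 (AFr_inv a0) TD hy) -y0E ev_J_rep2 //; last exact: AFr_inv.
rewrite -(raddfN inv); congr (inv _); apply/eqP; rewrite -addr_eq0; apply/eqP.
have eZ := ev_J_Z2 c1 (AFr_inv a0) TD y0Z.
apply: etrans (esym (clsD _ eZ lZ)) _; rewrite -(cls0 (Z2 p R1 D) (B2 p R1 D)).
apply/(cls_eqP _ (submD eZ lZ) (subm_0 _)); rewrite subr0.
have [g gc hg] := bockstein_pairing c1 (AFr_inv a0) TD ztc hz y0c.
exists g => // s t Ds Dt; rewrite -hg //.
change (ev_J (val a0) T (y0 s t) + l s * val (z t) (val a0) =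
  ev_J (val a0) T (y0 s t) + T (res s) * val (z t) (val a0)).
by rewrite Tl.
Qed.
End BocksteinIdentity.

(** * Separation of the points of R (x) I / I^2 *)

Section AugmentationSeparation.
Context (X : setting) (Y : coefficients X) (H : finZmodType).
Local Notation R := (RGam Y).
Local Notation r := (c_r Y).

Lemma gring_annihilator_div (l : gring r (c_Gamma Y)) m :
  (forall mu : r, mu *+ m = 0 -> mu *: l = 0) -> exists nu, l = nu *+ m.
Proof.
move=> h; have /choice[nu hnu] (g : c_Gamma Y) : exists nu : r, l g = nu *+ m.
  apply: annihilator_div => mu /h /ffunP/(_ g); rewrite !ffunE => e.
  by rewrite mulrC.
exists [ffun g => nu g : r^o]; apply/ffunP => g.
have -> : ([ffun g => nu g : r^o] *+ m : gring r (c_Gamma Y)) g = nu g *+ m.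
  elim: m {hnu h} => [|m IH]; first by rewrite !mulr0n ffunE.
  by rewrite !mulrS !ffunE IH.
exact: hnu.
Qed.

Lemma r_to_RE (x : r) (v : R) : r_to_R x * v = (x *: (v : gring r (c_Gamma Y)) : R).
Proof. by rewrite /r_to_R -gscaleAl; congr (_ *: _); exact: gmul1. Qed.

Definition aug_pair (T : H -> R) (v : R^o) (j : augquot H) : R := v * augfun T j.

Lemma aug_pair_bi T : (forall y z, T (y + z) = T y + T z) -> biadditive (aug_pair T).
Proof.
move=> TD; split=> *; first by rewrite /aug_pair mulrDl.
by rewrite /aug_pair raddfD mulrDr.
Qed.

(** Every class in [I / I^2] is some [rho_aug g], so the tensor comes from one with [H] itself,
    where [tens_separated] applies over [r]; homomorphisms to [r] are then composed with
    [r_to_R]. *)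
Lemma aug_tens_separated (x : tens R^o (augquot H)) :
  (forall T : H -> R, (forall y z, T (y + z) = T y + T z) -> tlift (aug_pair T) x = 0) -> x = 0.
Proof.
move=> hT; have [s xE] := tens_repr x.
have /choice[h hh] (j : augquot H) : exists g, j = rho_aug g by exact: rho_aug_surj.
pose x' : tens (gring r (c_Gamma Y)) H := \sum_(u <- s) tmk (u.1 : gring r (c_Gamma Y)) (h u.2).
suff x0 : x' = 0.
  have bi : biadditive (fun (v : gring r (c_Gamma Y)) g => tmk (v : R^o) (rho_aug g)).
    by split=> *; [exact: tmkDl | rewrite rho_augD tmkDr].
  have := congr1 (tlift (fun (v : gring r (c_Gamma Y)) g => tmk (v : R^o) (rho_aug g))) x0.
  rewrite tlift0 // tlift_sum // => <-; rewrite xE; apply: eq_bigr => u _.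
  by rewrite tlift_tmk // -hh.
apply: (tens_separated gring_annihilator_div) => T TD.
pose T' g : R := r_to_R (T g).
have T'D g g' : T' (g + g') = T' g + T' g' by rewrite /T' TD /r_to_R scalerDl.
have bi : biadditive (fun (v : gring r (c_Gamma Y)) g => T g *: v).
  by split=> *; rewrite ?scalerDr ?TD ?scalerDl.
rewrite tlift_sum // -[RHS](hT T' T'D) xE tlift_sum; last exact: aug_pair_bi.
apply: eq_bigr => u _; rewrite !tlift_tmk //; last exact: aug_pair_bi.
by rewrite /aug_pair {2}(hh u.2) augfun_rho // mulrC r_to_RE.
Qed.
End AugmentationSeparation.

(** * The decomposition group at q *)

Lemma finite_ext_refl K : is_subfield K -> finite_ext K K.
Proof.
move=> sfK; have [K1 _ KM _] := sfK; split=> //; exists 1%N; exists (fun=> 1); split=> // x Kx.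
exists [ffun=> x]; split=> [|c [hc ->]].
  by split=> [i|]; rewrite ?ffunE // big_ord1 ffunE mulr1.
by apply/ffunP => i; rewrite ffunE big_ord1 mulr1 (ord1 i).
Qed.

Lemma residue_card_uniq K W n m : place W -> is_subfield K ->
  residue_card K (W `&` K) n -> residue_card K (W `&` K) m -> n = m.
Proof.
move=> pW sfK; have [_ KB _ _] := sfK.
suff aux a b : residue_card K (W `&` K) a -> residue_card K (W `&` K) b -> (a <= b)%N.
  by move=> hn hm; apply/eqP; rewrite eqn_leq !aux.
move=> [r [rI hr]] [r' [rI' hr']].
have /choice[f hf] (i : 'I_a) : exists j, (W `&` K) (r i - r' j).
  by have [j [hj _]] := hr' _ (rI i); exists j.
rewrite -[X in (X <= _)%N]card_ord -[X in (_ <= X)%N]card_ord.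
apply: (@leq_card _ _ f) => i j fij.
have h : (W `&` K) (r i - r j).
  have [Ki _] := rI i; have [Kj _] := rI j; split; last exact: KB.
  have [h1 _] := hf i; have [h2 _] := hf j; apply: place_sub h1 _ => //.
  by rewrite fij; apply: place_sym.
have [l [_ hl]] := hr _ (rI i); rewrite -(hl j h) (hl i) //.
by rewrite subrr; split; [exact: place0 | rewrite -(subrr (r i)); have [Ki _] := rI i; exact: KB].
Qed.

Section Quotients.
Context (S : set gal) (SM : forall s t, S s -> S t -> S (s * t)%g).
Context (SV : forall s, S s -> S s^-1%g) (F : set algC) (G : zmodType) (f : gal -> G).
Context (fQ : is_quotient S (galf F) f).

Lemma quotient_eqP s t : S s -> S t -> f s = f t <-> forall x, F x -> s x = t x.
Proof.
move=> Ss St; have [fM _ fK] := fQ.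
have Su : S (s^-1 * t)%g by apply: SM => //; exact: SV.
have e : f t = f s + f (s^-1 * t)%g by rewrite -fM // mulKVg.
split=> [fst x Fx|h].
  have /fK-/(_ Su) : f (s^-1 * t)%g = 0 by apply: (addrI (f s)); rewrite -e fst addr0.
  by move=> /(_ x Fx); rewrite gal_mulE => e'; rewrite -{1}e' gal_invVK.
rewrite e (fK _ Su).2 ?addr0 // => x Fx.
by rewrite gal_mulE -h // gal_invK.
Qed.
End Quotients.

Section Setting.
Context (X : setting) (Y : coefficients X).
Context (KK_E_n : forall n, squarefree_N Y n -> E_n Y n `<=` s_KK X).
Context (E_K1 : K1 X `<=` c_E Y).
Context (n : set (set algC)) (n_N : squarefree_N Y n) (q : set algC) (q_n : n q).
Local Notation p := (s_p X).
Local Notation K := (s_K X).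
Local Notation W := (s_above X K q).
Local Notation D := (D_at X q).
Local Notation I := (I_at X q).

Lemma setting_subfield : is_subfield K. Proof. by have [] := s_number_field X. Qed.
Lemma setting_num_gen : num_gen K. Proof. exact/number_field_num_gen/s_number_field. Qed.
Local Notation sfK := setting_subfield.
Local Notation gK := setting_num_gen.

Lemma q_prime_P : primes_P Y q. Proof. by have [_] := n_N; apply. Qed.
Lemma q_prime : prime_of K q. Proof. by have [] := q_prime_P. Qed.

Lemma above_place : place W.
Proof. by have [] := s_aboveP (finite_ext_refl sfK) q_prime. Qed.
Lemma above_contract : W `&` K = q.
Proof. by have [] := s_aboveP (finite_ext_refl sfK) q_prime. Qed.
Local Notation pW := above_place.

Lemma above_p : ~ W p%:R.
Proof.
move=> Wp; have [qP qS _ _ _] := q_prime_P; apply: qS; apply: s_S_p => //.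
rewrite -above_contract; split=> //; apply: subfield_Crat sfK _; exact: rpred_nat.
Qed.

Lemma D_E_M : D `<=` galf (E_M Y).
Proof. by have [_ _ _ h _] := q_prime_P; exact: h pW above_contract. Qed.

Lemma D_E : D `<=` galf (c_E Y).
Proof. by move=> s /D_E_M h x Ex; apply: h => L _ SL; apply: SL; do 2 left; left. Qed.

Lemma K_E : K `<=` c_E Y. Proof. by have [[]] := c_E_Omega Y. Qed.

Lemma ray_facts q' : prime_of K q' -> [/\ finite_ext K (c_ray Y q'), abelian_ext K (c_ray Y q') &
  forall v, prime_of K v -> v <> q' -> unramified K (c_ray Y q') v].
Proof. by move=> /(c_rayP Y)[]. Qed.

Lemma n_prime q' : n q' -> prime_of K q'.
Proof. by have [_ h] := n_N => /h[]. Qed.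

Lemma K_ray_c_ray q' : n q' -> K_ray Y q' `<=` c_ray Y q'.
Proof.
move=> /n_prime/ray_facts[fH aH _]; exact: (max_pext_sub (s_prime X) sfK gK fH aH).
Qed.

Lemma K_ray_stable s x : galf K s -> K_ray Y q x -> K_ray Y q (s x).
Proof.
have [fH aH _] := ray_facts q_prime.
exact: (max_pext_stable (s_prime X) sfK gK fH aH).
Qed.

Lemma K_ray_E_n q' : n q' -> K_ray Y q' `<=` E_n Y n.
Proof.
move=> nq x Kx L sL SL; apply: SL; right=> L' sL' SL'; apply: SL'; right.
by exists q'.
Qed.

(** [K(q)] lies in [E(n)], hence in [s_KK], where archimedean places split; the definition of the
    Hilbert class field asks for this splitting. *)
Lemma ray_arch : arch_splits K (K_ray Y q).
Proof.
move=> g s hs x Kx; apply: (@s_KK_arch X g s hs).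
by apply: (KK_E_n n_N); exact: K_ray_E_n Kx.
Qed.

Lemma E_n_fix m s : galf (c_E Y) s -> (forall q', m q' -> galf (K_ray Y q') s) -> galf (E_n Y m) s.
Proof.
move=> sE sm x; apply: field_gen_fix => y [Ey|]; first exact: sE.
apply: field_gen_fix => z [Kz|[q' mq' Kz]]; first by apply/sE/K_E.
exact: sm Kz.
Qed.

Lemma E_n_eq s t : galf (c_E Y) s -> galf (c_E Y) t ->
  (forall x, E_n Y (n `\ q) x -> s x = t x) -> (forall x, K_ray Y q x -> s x = t x) ->
  forall x, E_n Y n x -> s x = t x.
Proof.
move=> sE tE h1 h2 x nx; have u z : (t^-1 * s)%g z = z -> s z = t z.
  by rewrite gal_mulE => e; rewrite -{2}e gal_invVK.
have uu z : s z = t z -> (t^-1 * s)%g z = z by move=> e; rewrite gal_mulE e gal_invK.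
apply: u; move: x nx; apply: E_n_fix => [|q' nq' x Kx].
  by apply: galf_mul => //; exact: galf_inv.
apply: uu; have [e|ne] := pselect (q' = q); first by apply: h2; rewrite -e.
apply: h1 => L sL SL; apply: SL; right=> L' sL' SL'; apply: SL'; right.
by exists q'.
Qed.

(** Inertia at [q] is trivial on [E], where [q] splits completely, and on [K(q')] for every other
    [q'] in [n], which is unramified at [q]. Hence [u] below is unramified. *)
Lemma I_E_nq i : I i -> galf (E_n Y (n `\ q)) i.
Proof.
move=> Ii; apply: E_n_fix => [|q' [nq' ne] x Kx]; first exact/D_E/inertia_decomp.
have [_ _ h] := ray_facts (n_prime nq').
apply: (h q q_prime _ W pW above_contract i Ii); first by move=> e; apply: ne.
exact: K_ray_c_ray Kx.
Qed.

Lemma c_E_num_gen : num_gen (c_E Y).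
Proof. by have [fE _] := c_E_Omega Y; exact: finite_ext_num_gen gK fE. Qed.

Lemma E_fixes : exists L, forall h, fixes L h -> galf (c_E Y) h.
Proof. exact: num_gen_fix c_E_num_gen. Qed.

Lemma K_ray_fixes q' : n q' -> exists L, forall h, fixes L h -> galf (K_ray Y q') h.
Proof.
move=> nq'; have [fH aH _] := ray_facts (n_prime nq').
by apply: num_gen_fix; apply: num_gen_sub (K_ray_c_ray nq'); exact: finite_ext_num_gen gK fH.
Qed.

Lemma E_n_fixes : exists L, forall h, fixes L h -> galf (c_E Y) h /\ forall q', n q' -> galf (K_ray Y q') h.
Proof.
have [L hL] := E_fixes; have [/finite_seqP[s sE] _] := n_N.
have /choice[f hf] q' : exists M, n q' -> forall h, fixes M h -> galf (K_ray Y q') h.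
  have [nq'|nq'] := pselect (n q'); last by exists [::].
  by have [M hM] := K_ray_fixes nq'; exists M.
exists (L ++ flatten [seq f q' | q' <- s]) => h /fixes_cat[/hL Eh hs]; split=> // q' nq'.
apply: hf => // x xq; apply: hs; apply/flattenP; exists (f q') => //.
by apply: map_f; have : [set` s] q' by rewrite -sE.
Qed.

Section LocalData.
Context (L : local_data Y n q).
Local Notation Fr := (l_Fr L).
Local Notation inclGq := (@l_inclGq _ _ _ _ L).
Local Notation inclHnq := (@l_inclHnq _ _ _ _ L).
Local Notation inclDq := (@l_inclDq _ _ _ _ L).

Lemma Fr_decomp : D Fr. Proof. by have [] := l_FrP L. Qed.
Lemma Fr_card : exists2 N, residue_card K (W `&` K) N & forall x, x \in Aint -> W (Fr x - x ^+ N).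
Proof. by have [] := l_FrP L. Qed.

Lemma resGqM s t : D s -> D t -> l_resGq L (s * t)%g = l_resGq L s + l_resGq L t.
Proof. by have [h _ _] := l_resGqP L; exact: h. Qed.
Lemma resGq_eqP s t : D s -> D t -> l_resGq L s = l_resGq L t <-> forall x, K_ray Y q x -> s x = t x.
Proof.
exact: (quotient_eqP (fun s t => @decomp_mul K W s t) (fun s => @decomp_inv K W s) (l_resGqP L)).
Qed.
Lemma resDqM s t : D s -> D t -> l_resDq L (s * t)%g = l_resDq L s + l_resDq L t.
Proof. by have [h _ _] := l_resDqP L; exact: h. Qed.
Local Notation GE := (galf (c_E Y)).
Lemma resHnM s t : GE s -> GE t -> l_resHn L (s * t)%g = l_resHn L s + l_resHn L t.
Proof. by have [h _ _] := l_resHnP L; exact: h. Qed.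
Lemma resHn_eqP s t : GE s -> GE t -> l_resHn L s = l_resHn L t <-> forall x, E_n Y n x -> s x = t x.
Proof. exact: (quotient_eqP (@galf_mul _) (@galf_inv _) (l_resHnP L)). Qed.
Lemma resHnqM s t : GE s -> GE t -> l_resHnq L (s * t)%g = l_resHnq L s + l_resHnq L t.
Proof. by have [h _ _] := l_resHnqP L; exact: h. Qed.
Lemma resHnq_eqP s t : GE s -> GE t ->
  l_resHnq L s = l_resHnq L t <-> forall x, E_n Y (n `\ q) x -> s x = t x.
Proof. exact: (quotient_eqP (@galf_mul _) (@galf_inv _) (l_resHnqP L)). Qed.

Lemma E_E_n m : c_E Y `<=` E_n Y m.
Proof. by move=> x Ex F _ SF; apply: SF; left. Qed.

Lemma resHn_ext s t : GE s -> GE t -> (forall x, E_n Y (n `\ q) x -> s x = t x) ->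
  (forall x, K_ray Y q x -> s x = t x) -> l_resHn L s = l_resHn L t.
Proof. by move=> sE tE h1 h2; apply/resHn_eqP => //; exact: E_n_eq. Qed.

Lemma inclGqD g g' : inclGq (g + g') = inclGq g + inclGq g'.
Proof.
have [s [t [sE <- Dt tg st]]] := (@l_inclGqP _ _ _ _ L) g.
have [s' [t' [sE' <- Dt' tg' st']]] := (@l_inclGqP _ _ _ _ L) g'.
have [s2 [t2 [sE2 <- Dt2 tg2 st2]]] := (@l_inclGqP _ _ _ _ L) (g + g').
have GEs u : galf (E_n Y (n `\ q)) u -> GE u by move=> h x /E_E_n/h.
have Dtt : D (t * t')%g by exact: decomp_mul.
rewrite -resHnM; try exact: GEs.
apply: resHn_ext; [exact: GEs | by apply: galf_mul; exact: GEs | |].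
  by move=> x Ex; rewrite gal_mulE sE2 // sE' // sE.
move=> x Kx; rewrite gal_mulE st2 // st' // st; last first.
  by apply: K_ray_stable => //; exact: decomp_galf Dt'.
by rewrite -gal_mulE; move: x Kx; apply/resGq_eqP => //; rewrite resGqM // tg tg'.
Qed.

Lemma inclHnqD h h' : inclHnq (h + h') = inclHnq h + inclHnq h'.
Proof.
have [s [sE sK sh <-]] := (@l_inclHnqP _ _ _ _ L) h.
have [s' [sE' sK' sh' <-]] := (@l_inclHnqP _ _ _ _ L) h'.
have [s2 [sE2 sK2 sh2 <-]] := (@l_inclHnqP _ _ _ _ L) (h + h').
rewrite -resHnM //; apply: resHn_ext => //; [exact: galf_mul | |].
  by apply/resHnq_eqP => //; [exact: galf_mul | rewrite resHnqM // sh sh'].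
by move=> x Kx; rewrite sK2 // gal_mulE sK' // sK.
Qed.

Lemma inclDqD d d' : inclDq (d + d') = inclDq d + inclDq d'.
Proof.
have [_ dS _] := l_resDqP L; have [s Ds <-] := dS d; have [t Dt <-] := dS d'.
rewrite -resDqM // !l_inclDqP //; last exact: decomp_mul.
by apply: resHnM; exact: D_E.
Qed.

(** An automorphism of E(n) over E is determined by its restrictions to E(n/q) and K(q), and each of
    the two inclusions is trivial on one of these fields. This splits [T] on [D] into [w] and
    [u]. *)
Lemma resHn_split s : D s ->
  l_resHn L s = inclGq (l_resGq L s) + inclHnq (l_resHnq L s).
Proof.
move=> Ds; have sE := D_E Ds.
have [s1 [t [sE1 <- Dt tg st]]] := (@l_inclGqP _ _ _ _ L) (l_resGq L s).
have [s2 [sE2 sK2 sh <-]] := (@l_inclHnqP _ _ _ _ L) (l_resHnq L s).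
have GE1 : GE s1 by move=> x /E_E_n/sE1.
rewrite addrC -resHnM //; apply: resHn_ext => //; first exact: galf_mul.
  by move=> x Ex; rewrite gal_mulE sE1 //; apply/esym; move: x Ex; apply/resHnq_eqP.
move=> x Kx; rewrite gal_mulE st //.
have -> : t x = s x by move: x Kx; apply/resGq_eqP.
by rewrite sK2 //; apply: K_ray_stable => //; exact: decomp_galf Ds.
Qed.

Lemma resHnq_inertia i : I i -> l_resHnq L i = 0.
Proof.
move=> Ii; have [_ _ h] := l_resHnqP L; apply/h; first exact/D_E/inertia_decomp.
exact: I_E_nq.
Qed.

Lemma resGq_fixes : exists M, forall h, D h -> fixes M h -> l_resGq L h = 0.
Proof.
have [M hM] := K_ray_fixes q_n; exists M => h Dh /hM hh.
by have [_ _ hK] := l_resGqP L; apply/hK.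
Qed.

Lemma resHnq_fixes : exists M, forall h, D h -> fixes M h -> l_resHnq L h = 0.
Proof.
have [M hM] := E_n_fixes; exists M => h Dh /hM[Eh hh].
have [_ _ hK] := l_resHnqP L; apply/hK; first exact: D_E.
by apply: E_n_fix => // q' [nq' _]; exact: hh.
Qed.

Lemma resGq_inertia s : D s -> exists2 i, I i & l_resGq L s = l_resGq L i.
Proof.
move=> Ds; have [fH aH unrH] := ray_facts q_prime.
apply: (total_ramification (s_prime X) sfK gK fH aH pW) (l_resGqP L) _ Ds.
- by move=> v hv; rewrite above_contract; exact: unrH.
- exact: ray_arch.
by move=> t x Dt hx; apply: (D_E Dt); exact: E_K1.
Qed.

Lemma Gq_cyclic : exists g0 : l_Gq L, forall g, exists a m, ~~ (p %| m)%N /\ g *+ m = g0 *+ a.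
Proof.
have [N hN hFr] := Fr_card; have N1 := residue_card_gt1 sfK pW hN.
have [gM gS gK'] := l_resGqP L.
apply: (@tame_cyclic K W pW N (ltnW N1) _ p (s_prime X) above_p _ (l_resGq L) (K_ray Y q)).
- exact: (residue_card_mem sfK pW hN).
- by move=> s t /inertia_decomp Ds /inertia_decomp Dt; exact: gM.
- by move=> s /inertia_decomp Ds; exact: gK'.
- by move=> s x /inertia_decomp/decomp_galf Gs; exact: K_ray_stable.
move=> g; have [s Ds <-] := gS g; have [i Ii ->] := resGq_inertia Ds.
by exists i.
Qed.
End LocalData.
End Setting.

(** * The action of the decomposition group on the coefficients *)

Section CoefficientAction.
Context (X : setting) (Y : coefficients X).
Context (n : set (set algC)) (n_N : squarefree_N Y n) (q : set algC) (q_n : n q).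
Context (L : local_data Y n q).
Local Notation p := (s_p X).
Local Notation K := (s_K X).
Local Notation W := (s_above X K q).
Local Notation D := (D_at X q).
Local Notation I := (I_at X q).
Local Notation R := (RGam Y).
Local Notation A := (A_mod Y).
Local Notation Fr := (l_Fr L).
Local Notation pW := (above_place n_N q_n).
Local Notation sfK := (setting_subfield X).
Local Notation gK := (setting_num_gen X).

Lemma RGam_torsion : exists k, (p ^ k)%:R = 0 :> R.
Proof.
have [k hk] := c_Mbar_pow Y; exists k; rewrite -hk.
have -> : (c_Mbar Y)%:R = (c_Mbar Y)%:R *: (1 : gring (c_r Y) (c_Gamma Y)) :> R.
  by rewrite scaler_nat.
by rewrite Mbar_eq0 scale0r.
Qed.

Fact r_to_R_zmod : zmod_morphism (@r_to_R X Y).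
Proof. by move=> x y; rewrite /r_to_R scalerBl. Qed.
Fact r_to_R_monoid : monoid_morphism (@r_to_R X Y).
Proof.
split=> [|x y]; first by rewrite /r_to_R scale1r.
by rewrite r_to_RE /r_to_R scalerA.
Qed.
HB.instance Definition _ := GRing.isZmodMorphism.Build (c_r Y) R (@r_to_R X Y) r_to_R_zmod.
HB.instance Definition _ := GRing.isMonoidMorphism.Build (c_r Y) R (@r_to_R X Y) r_to_R_monoid.
HB.instance Definition _ := GRing.RMorphism.copy (@RR_to_R X Y) (@r_to_R X Y \o c_pi Y).

Lemma Mbar_torsion (y : s_R X) : c_pi Y (y *+ c_Mbar Y) = 0.
Proof. by rewrite rmorphMn /= -mulr_natr Mbar_eq0 mulr0. Qed.

Lemma RR_Mbar (y : s_R X) : RR_to_R Y (y *+ c_Mbar Y) = 0.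
Proof. by rewrite /RR_to_R Mbar_torsion rmorph0. Qed.

(** [E_M] contains the roots of unity of order [c_Mbar Y] and [q] splits completely in it; so the
    cyclotomic character is 1 modulo [c_Mbar Y], which vanishes in [r]. *)
Lemma chi_D s : D s -> RR_to_R Y (s_chi X s) = 1.
Proof.
move=> Ds; have [k hk] := c_Mbar_pow Y.
have [a [ha [y hy]]] := @s_chi_cyclotomic X s k (decomp_galf Ds).
have M0 : (0 < p ^ k)%N by rewrite expn_gt0 prime_gt0 ?s_prime.
have [z hz] := C_prim_root_exists M0.
have sz : s z = z.
  apply: (D_E_M n_N q_n Ds) => F _ SF; apply: SF; left; left; right.
  by rewrite /= hk; exact: prim_expr_order.
have az : (a = 1 %[mod p ^ k])%N.
  by apply/eqP; rewrite -(eq_prim_root_expr hz) expr1 -ha ?sz //; exact: prim_expr_order.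
rewrite /RR_to_R hy rmorphD /= -hk Mbar_torsion addr0 rmorph_nat.
have -> : a%:R = (1%N)%:R :> c_r Y.
  have red b : b%:R = (b %% p ^ k)%:R :> c_r Y.
    by rewrite {1}(divn_eq b (p ^ k)) natrD natrM -{2}hk Mbar_eq0 mulr0 add0r.
  by rewrite red az -red.
by rewrite rmorph1.
Qed.

Lemma decomp_at1 : D 1%g. Proof. exact: decomp1. Qed.
Lemma resE_D s : D s -> c_resE Y s = 0.
Proof.
move=> Ds; have [_ _ h] := c_resEP Y; apply/(h _ (decomp_galf Ds)).
exact: (D_E n_N q_n Ds).
Qed.

Lemma A_act_D s (a : A) : D s -> gm_act A s a = map_mx (RR_to_R Y) (s_rho X s) *m a.
Proof. by move=> Ds; rewrite /= resE_D // oppr0 (_ : gdelta _ 0 = 1) // scale1r. Qed.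

Lemma A_act1 (a : A) : gm_act A 1%g a = a.
Proof. by rewrite A_act_D; [rewrite s_rho1 map_mx1 mul1mx | exact: decomp_at1]. Qed.

Lemma A_actM s t (a : A) : D s -> D t -> gm_act A (s * t)%g a = gm_act A s (gm_act A t a).
Proof.
move=> Ds Dt; have Dst : D (s * t)%g by exact: decomp_mul.
rewrite !A_act_D // s_rhoM; try by exact: (@decomp_galf K W).
by rewrite map_mxM mulmxA.
Qed.

Lemma A_act_inertia i (a : A) : I i -> gm_act A i a = a.
Proof.
move=> Ii; rewrite A_act_D; last exact: inertia_decomp Ii.
rewrite (@s_S_ram X q (q_prime n_N q_n) _ W pW (above_contract n_N q_n) i Ii) ?map_mx1 ?mul1mx //.
by have [] := q_prime_P n_N q_n.
Qed.

Lemma A_act_fixes : exists M, forall h (a : A), D h -> fixes M h -> gm_act A h a = a.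
Proof.
have [k hk] := c_Mbar_pow Y.
have [M hM] := @s_rho_cont X k 1%g (@galf1 K); exists M => h a Dh Mh.
have [y hy] := hM h (decomp_galf Dh) Mh.
rewrite A_act_D // -[RHS]mul1mx; congr (_ *m _).
move: hy; rewrite mul1g s_rho1 => /eqP; rewrite subr_eq => /eqP ->.
rewrite map_mxD map_mx1 -[RHS]add0r; congr (_ + _).
apply/matrixP => i j; rewrite !mxE (_ : (y *+ p ^ k) i j = y i j *+ p ^ k).
  by rewrite -hk; exact: RR_Mbar.
by elim: (p ^ k)%N => [|m IH]; rewrite ?mulr0n ?mulrS ?mxE // IH.
Qed.

(** Two Frobenius elements differ by inertia, which acts trivially on [A]. This reconciles the
    Frobenius chosen in [primes_P] with [l_Fr]. *)
Lemma frob_act s (a : A) : is_frob K W s -> gm_act A s a = gm_act A Fr a.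
Proof.
move=> [Ds [N hN hs]]; have [N' hN' hF] := Fr_card L; have DF := Fr_decomp L.
have NN' : N' = N := residue_card_uniq pW sfK hN' hN.
have Ii : I (Fr^-1 * s)%g.
  split=> [|x xA]; first by apply: decomp_mul => //; exact: decomp_inv.
  apply/(decompP _ DF); rewrite gal_mulE rmorphB /= gal_invVK.
  apply: (place_sub pW (hs x xA)); apply: (place_sym pW).
  by rewrite -NN'; exact: hF.
rewrite -{1}(mulKVg Fr s) A_actM //; last exact: inertia_decomp Ii.
by rewrite (A_act_inertia _ Ii).
Qed.

Lemma Fr_coker : exists f : {linear A -> R^o}, (forall y, exists x, f x = y) /\
  forall x, f x = 0 <-> exists y, x = gm_act A Fr y - y.
Proof.
have [_ _ _ _ [s [f [hs fs fK]]]] := q_prime_P n_N q_n.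
have e : gm_act A s = gm_act A Fr by apply: funext => y; exact: frob_act.
by rewrite e in fK; exists f.
Qed.

Lemma D_ind (P : gal -> Prop) (M : seq algC) :
  (forall j, P (Fr ^+ j)%g) ->
  (forall s h, D s -> D h -> fixes M h -> P s -> P (s * h)%g) ->
  (forall s i, D s -> I i -> P s -> P (s * i)%g) -> forall s, D s -> P s.
Proof.
have [N hN hF] := Fr_card L => h1 h2 h3 s Ds.
exact: (decomp_ind sfK pW (Fr_decomp L) hN hF h1 h2 h3 Ds).
Qed.

Lemma D_unr (phi : gal -> gal -> R) (M : seq algC) :
  (forall s t u, D s -> D t -> D u ->
    phi t u - phi (s * t)%g u + phi s (t * u)%g - phi s t = 0) ->
  (forall s t g, D s -> D t -> D g -> I g \/ fixes M g ->
    phi (s * g)%g t = phi s t /\ phi s (t * g)%g = phi s t) ->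
  (forall s, D s -> phi s 1%g = 0 /\ phi 1%g s = 0) ->
  exists (g : gal -> R) (L' : seq algC),
    (forall s h, D s -> D h -> fixes L' h -> g (s * h)%g = g s) /\
    (forall s t, D s -> D t -> phi s t = g t - g (s * t)%g + g s).
Proof.
have [N hN hF] := Fr_card L; have [k hk] := RGam_torsion.
apply: (unramified_coboundary sfK pW (Fr_decomp L) hN hF (P := (p ^ k)%N)).
  by rewrite expn_gt0 prime_gt0 ?s_prime.
by move=> v; rewrite -mulr_natr hk mulr0.
Qed.
End CoefficientAction.

(* The coefficients [N_i] of the adjugate of [1 - X psi] satisfy
   [N_i - N_(i-1) psi = P_i], so that [sum P_i phi^i] telescopes when [psi phi = 1]. *)
Lemma det_inverse_root (S : comNzRingType) d (psi phi : 'M[S]_d) : psi *m phi = 1%:M ->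
  let P := \det (1%:M - 'X *: map_mx polyC psi) in
  \sum_(i < size P) P`_i *: iter i (mulmx phi) 1%:M = 0.
Proof.
move=> pp P; pose M : 'M[{poly S}]_d := 1%:M - 'X *: map_mx polyC psi.
pose N i : 'M[S]_d := \matrix_(a, b) ((\adj M) a b)`_i.
pose w i : 'M[S]_d := iter i (mulmx phi) 1%:M.
have NE i : (P`_i)%:M = N i - (if i is j.+1 then N j *m psi else 0).
  have := mul_adj_mx M; rewrite -/P => /matrixP h; apply/matrixP => a b.
  have := congr1 (fun f : {poly S} => f`_i) (h a b).
  rewrite /M mulmxBr mulmx1 -scalemxAr !mxE coefB coefXM coefMn => e.
  rewrite -e; congr (_ - _); case: i {e} => [|i] /=; first by rewrite mxE.
  by rewrite !mxE coef_sum; apply: eq_bigr => c _; rewrite !mxE coefMC.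
have psiw i : psi *m w i.+1 = w i by rewrite /w iterS mulmxA pp mul1mx.
have tele m : \sum_(i < m.+1) P`_i *: w i = N m *m w m.
  elim: m => [|m IH].
    by rewrite big_ord1 -mul_scalar_mx NE subr0.
  by rewrite big_ord_recr IH /= -mul_scalar_mx NE mulmxBl -mulmxA psiw addrC subrK.
(* An index beyond the degrees of [P] and of all entries of the adjugate, where the telescoped sum
   is 0. *)
pose s := maxn (size P) (\max_a \max_b size ((\adj M) a b)).
have := tele s; rewrite (_ : N s = 0); last first.
  apply/matrixP => a b; rewrite [LHS]mxE [RHS]mxE nth_default // /s leq_max; apply/orP; right.
  have h1 := @leq_bigmax _ (fun b => size ((\adj M) a b)) b.
  have h2 := @leq_bigmax _ (fun a => \max_b size ((\adj M) a b)) a.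
  exact: leq_trans h1 h2.
rewrite mul0mx => tot; rewrite -[RHS]tot.
rewrite (big_ord_widen s.+1 (fun i => P`_i *: w i)); last by rewrite leqW // leq_maxl.
rewrite big_mkcond; apply: eq_bigr => i _; case: ifP => // /negbT; rewrite -leqNgt => h.
by rewrite nth_default // scale0r.
Qed.

(** * The polynomials P and Q evaluated at Frobenius *)

Section CayleyHamilton.
Context (X : setting) (Y : coefficients X) (n : set (set algC)) (q : set algC).
Context (n_N : squarefree_N Y n) (q_n : n q) (L : local_data Y n q).
Local Notation K := (s_K X).
Local Notation D := (D_at X q).
Local Notation R := (RGam Y).
Local Notation A := (A_mod Y).
Local Notation Fr := (l_Fr L).
Local Notation P := (P_poly X Fr).
Local Notation qs := (fun i => RR_to_R Y (l_Q L)`_i).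
Local Notation pis := (fun i => RR_to_R Y P`_i).

Lemma Q_P_coef i : pis i = (if i is j.+1 then qs j else 0) - qs i.
Proof.
have [y hy] := l_QP L i.
have : RR_to_R Y ((('X - 1) * l_Q L - P)`_i) = 0.
  by rewrite hy /RR_to_R rmorphM pi_c_M mul0r rmorph0.
rewrite coefB mulrBl mul1r coefB coefXM !rmorphB => /eqP; rewrite subr_eq0 => /eqP <-.
by case: i {hy} => [|i] //=; rewrite rmorph0.
Qed.

(** The Cayley-Hamilton theorem in reversed form: [P] is the determinant of [1 - X Fr^-1], so it is
    killed by substituting [Fr] for X. *)
Lemma P_root (x : A) : \sum_(i < size P) pis i *: iter i (gm_act A Fr) x = 0.
Proof.
have DF := Fr_decomp L; have GF := decomp_galf DF.
have pp : s_rho X Fr^-1%g *m s_rho X Fr = 1%:M.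
  by rewrite -s_rhoM ?mulVg ?s_rho1 //; exact: galf_inv.
have h := det_inverse_root pp; rewrite -/P in h.
have itE i : iter i (gm_act A Fr) x = map_mx (RR_to_R Y) (iter i (mulmx (s_rho X Fr)) 1%:M) *m x.
  elim: i => [|i IH]; first by rewrite /= map_mx1 mul1mx.
  by rewrite !iterS map_mxM -mulmxA -IH (A_act_D n_N q_n).
have := congr1 (fun m => map_mx (RR_to_R Y) m *m x) h; rewrite /= map_mx0 mul0mx.
have sumE (r : seq 'I_(size P)) : map_mx (RR_to_R Y) (\sum_(i <- r) P`_i *: iter i (mulmx (s_rho X Fr)) 1%:M) *m x
    = \sum_(i <- r) pis i *: iter i (gm_act A Fr) x.
  elim: r => [|i r IH]; first by rewrite !big_nil map_mx0 mul0mx.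
  by rewrite !big_cons map_mxD mulmxDl IH map_mxZ itE -scalemxAl.
by rewrite sumE.
Qed.

(** Summation by parts turns [(X - 1) Q = P] into an identity for an arbitrary sequence [w]. The
    iterates of [Fr] give the vanishing of [Q(Fr)] on coboundaries, and [w i = i] gives
    [Q(1) = P'(1)]. *)
Lemma sum_Abel (V : lmodType R) (w : nat -> V) :
  \sum_(i < size (l_Q L)) qs i *: (w i.+1 - w i) = \sum_(i < size P) pis i *: w i.
Proof.
pose s := maxn (size P) (size (l_Q L)).
have wid (f : {poly s_R X}) (g : nat -> V) : (size f <= s.+1)%N ->
    \sum_(i < size f) RR_to_R Y f`_i *: g i = \sum_(i < s.+1) RR_to_R Y f`_i *: g i.
  move=> fs; rewrite (big_ord_widen s.+1 (fun i => RR_to_R Y f`_i *: g i)) // big_mkcond.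
  apply: eq_bigr => i _; case: ifP => // /negbT; rewrite -leqNgt => h.
  by rewrite nth_default // rmorph0 scale0r.
rewrite (wid _ (fun i => w i.+1 - w i)) ?leqW ?leq_maxr // (wid _ w) ?leqW ?leq_maxl //.
have qs0 : qs s = 0 by rewrite nth_default ?rmorph0 // leq_maxr.
suff tele m : \sum_(i < m.+1) pis i *: w i =
    \sum_(i < m.+1) qs i *: (w i.+1 - w i) - qs m *: w m.+1.
  by rewrite tele qs0 scale0r subr0.
elim: m => [|m IH]; first by rewrite !big_ord1 Q_P_coef sub0r scalerBr scaleNr addrAC subrr add0r.
rewrite big_ord_recr [in RHS]big_ord_recr IH /= Q_P_coef /= scalerBl scalerBr.
move: (\sum_(i < m.+1) _) => S; rewrite addrA subrK -addrA; congr (_ + _).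
by rewrite addrAC subrr add0r.
Qed.

Lemma Q_act_cob (x : A) : Q_act L (N := A) Fr (gm_act A Fr x - x) = 0.
Proof.
rewrite -[RHS](P_root x) -(sum_Abel (fun i => iter i (gm_act A Fr) x)).
apply: eq_bigr => i _; congr (_ *: _).
by rewrite addrC -scaleN1r iter_act_lin scaleN1r addrC -iterSr.
Qed.

Lemma Q_sum : \sum_(i < size (l_Q L)) qs i = \sum_(i < size P) pis i * i%:R.
Proof.
have := @sum_Abel R^o (fun i => i%:R).
rewrite -[X in _ = X]/(\sum_(i < size P) pis i * i%:R) => <-.
apply: eq_bigr => i _; rewrite -natr1 addrC addKr.
exact/esym/mulr1.
Qed.
End CayleyHamilton.

(** * Comparison of the two sides *)

Section AugmentationPairings.
Context (X : setting) (Y : coefficients X) (n : set (set algC)) (q : set algC).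
Context (n_N : squarefree_N Y n) (q_n : n q) (L : local_data Y n q).
Local Notation R := (RGam Y).
Local Notation inclGq := (@l_inclGq _ _ _ _ L).
Local Notation inclHnq := (@l_inclHnq _ _ _ _ L).
Local Notation inclDq := (@l_inclDq _ _ _ _ L).
Local Notation Fr := (l_Fr L).
Local Notation P := (P_poly X Fr).

Section Push.
Context (G H : finZmodType) (incl : G -> H) (inclD : forall x y, incl (x + y) = incl x + incl y).
Context (T : H -> R) (TD : forall x y, T (x + y) = T x + T y).
Lemma comp_incl x y : (T \o incl) (x + y) = (T \o incl) x + (T \o incl) y.
Proof. by rewrite /= inclD TD. Qed.

Lemma aug_pair_push (U : zmodType) (g : U -> R^o) (z : tens U (augquot G)) :
  (forall x y, g (x + y) = g x + g y) ->
  tlift (fun u j => aug_pair T (g u) j) (tmapr (augpush incl) z) =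
  tlift (fun u j => aug_pair (T \o incl) (g u) j) z.
Proof.
move=> gD; have bi : biadditive (fun u j => aug_pair T (g u) j).
  by have [h1 h2] := aug_pair_bi TD; split=> *; rewrite ?gD ?h1 ?h2.
rewrite /tmapr tlift_map //; congr (tlift _ _).
by apply/funext => u; apply/funext => j; rewrite /aug_pair augfun_push.
Qed.
End Push.

Lemma rho_q_pair (T : l_Hn L -> R) (y : tens R^o (l_Gq L)) : (forall x y, T (x + y) = T x + T y) ->
  tlift (aug_pair T) (rho_q y) = tlift (fun v g => v * T (inclGq g)) y.
Proof.
move=> TD; have T'D := comp_incl (inclGqD n_N q_n (L := L)) TD.
rewrite /rho_q (@aug_pair_push _ _ inclGq T TD R^o id) //.
rewrite /tmapr tlift_map; last exact: aug_pair_bi T'D.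
by congr (tlift _ _); apply/funext => u; apply/funext => g; rewrite /aug_pair augfun_rho.
Qed.

Lemma bockstein_pair (T : l_Hn L -> R) (U : zmodType) (g : U -> R^o) (y : tens U (augquot (l_Dq L))) :
  (forall x y, T (x + y) = T x + T y) ->
  tlift (aug_pair T) (tmapr (augpush inclDq) (tmapl g y)) =
  tlift (fun u j => g u * augfun (T \o inclDq) j) y.
Proof.
move=> TD; have T'D := comp_incl (inclDqD n_N q_n (L := L)) TD.
rewrite (@aug_pair_push _ _ inclDq T TD R^o id) //.
by rewrite /tmapl tlift_map //; exact: aug_pair_bi.
Qed.

Lemma gdeltaX (r : comPzRingType) (G : finZmodType) (h : G) i : gdelta r h ^+ i = gdelta r (h *+ i).
Proof. by elim: i => [//|i IH]; rewrite exprS IH gdeltaM mulrS. Qed.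

(** [T] is additive, so the power [i] of [Fr^-1] contributes [- i] times the value at [Fr]; the
    weighted sum of the coefficients of [P] is then [- P'(1)] times this value. *)
Lemma P_Fr_pair (T : l_Hn L -> R) (v : R) : (forall x y, T (x + y) = T x + T y) ->
  tlift (aug_pair T) (mul_P_Fr L v) =
  v * - ((\sum_(i < size P) RR_to_R Y P`_i * i%:R) * T (inclHnq (l_resHnq L Fr))).
Proof.
move=> TD; have T'D := comp_incl (inclHnqD (L := L)) TD; set T' := T \o inclHnq in T'D.
pose F (z : gring (c_r Y) (l_Hnq L)) : R := \sum_g r_to_R (z g : c_r Y) * T' g.
have step : tlift (aug_pair T) (tmapl (fun c => r_to_R c : R^o) (P_Fr_aug L)) = F (P_Fr L).
  rewrite /tmapl tlift_map; last exact: aug_pair_bi.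
  rewrite /P_Fr_aug (@aug_pair_push _ _ inclHnq T TD (c_r Y)^o (fun c => r_to_R c : R^o)); last first.
    by move=> a b; rewrite raddfD.
  have bi : biadditive (fun (u : (c_r Y)^o) j => aug_pair T' (r_to_R u : R^o) j).
    by have [h1 h2] := aug_pair_bi T'D; split=> *; rewrite ?raddfD /= ?h1 ?h2.
  rewrite /tmapr tlift_map //.
  have bi2 : biadditive (fun (u : (c_r Y)^o) (j : submod (augideal (l_Hnq L))) =>
      aug_pair T' (r_to_R u : R^o) (augcls (val j))).
    have [h1 h2] := bi; split=> [*|u j j']; first exact: h1.
    rewrite -h2; congr (aug_pair _ _ _); apply: clsD.
      exact: elimT (subm_predP _ _) (valP j).
    exact: elimT (subm_predP _ _) (valP j').
  rewrite /to_aug tlift_sum //; apply: eq_bigr => g _; rewrite tlift_tmk //.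
  rewrite insubdK; last by apply/subm_predP; exact: aug_gdeltaB.
  by rewrite /aug_pair augfun_rho.
have FD a z z' : F (a *: z + z') = r_to_R a * F z + F z'.
  rewrite /F mulr_sumr -big_split /=; apply: eq_bigr => g _.
  have -> : (a *: z + z') g = (a * (z g : c_r Y) + (z' g : c_r Y) : c_r Y) by rewrite !ffunE.
  by rewrite rmorphD rmorphM mulrDl mulrA.
have Fdelta g : F (gdelta (c_r Y) g) = T' g.
  rewrite /F (bigD1 g) //= big1 => [|g' /negPf gg']; first by rewrite ffunE eqxx rmorph1 mul1r addr0.
  by rewrite ffunE gg' rmorph0 mul0r.
have F0 : F 0 = 0 by rewrite /F big1 // => g _; rewrite ffunE rmorph0 mul0r.
rewrite /mul_P_Fr (@tlift_scale _ _ _ R^o _ v _ (aug_pair_bi TD)); last first.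
  by move=> a b; apply/esym; exact: mulrA.
rewrite step; congr (_ * _); rewrite /P_Fr mulr_suml -sumrN.
elim/big_rec2: _ => [//|i z1 z2 _ IH]; rewrite FD IH gdeltaX Fdelta; congr (_ + _).
have T'N h i' : T' (- h *+ i') = - (i'%:R * T' h).
  have T'0 : T' 0 = 0 by apply: (addrI (T' 0)); rewrite -T'D !addr0.
  have T'V : T' (- h) = - T' h by apply: (addrI (T' h)); rewrite -T'D !addrN.
  elim: i' => [|i' IH']; first by rewrite mulr0n T'0 mul0r oppr0.
  by rewrite mulrS T'D IH' T'V -natr1 mulrDl mul1r opprD addrC.
by rewrite T'N mulrN mulrA.
Qed.
End AugmentationPairings.

Section Assembly.
Context (X : setting) (Y : coefficients X).
Context (KK_E_n : forall n, squarefree_N Y n -> E_n Y n `<=` s_KK X) (E_K1 : K1 X `<=` c_E Y).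
Context (n : set (set algC)) (n_N : squarefree_N Y n) (q : set algC) (q_n : n q).
Context (L : local_data Y n q).
Local Notation p := (s_p X).
Local Notation K := (s_K X).
Local Notation D := (D_at X q).
Local Notation I := (I_at X q).
Local Notation R := (RGam Y).
Local Notation A := (A_mod Y).
Local Notation B := (A_dual1 Y).
Local Notation Fr := (l_Fr L).
Local Notation AFr := (fixed A Fr).
Local Notation chi := (RR_to_R Y \o s_chi X).

Lemma chi1 s : D s -> chi s = 1. Proof. by move=> Ds; exact: (chi_D n_N q_n Ds). Qed.
Lemma decomp_atM s t : D s -> D t -> D (s * t)%g. Proof. exact: decomp_mul. Qed.
Lemma decomp_atV s : D s -> D s^-1%g. Proof. exact: decomp_inv. Qed.
Lemma inertia_decomp_at s : I s -> D s. Proof. exact: inertia_decomp. Qed.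

Lemma AFr_fixed (a : AFr) s : D s -> gm_act A s^-1%g (val a) = val a.
Proof.
move=> Ds; have [M hM] := A_act_fixes n_N q_n.
have ha : gm_act A Fr (val a) = val a by exact: elimT (subm_predP _ _) (valP a).
apply: (A_fixed (decomp_at1 X q) decomp_atM inertia_decomp_at (Fr_decomp L) (D_ind n_N q_n (L := L)) (A_act1 n_N q_n)
  (A_actM n_N q_n) (A_act_inertia n_N q_n) hM ha).
exact: decomp_atV.
Qed.

(** [bockstein_identity] computes [eta] times the left side and [local_identity] [eta] times the
    right side, both as the invariant of the same cocycle up to sign; [eta] is then cancelled. *)
Lemma pairing_identity (v : H1 p B D -> R) (vP : is_v_loc L v)
    (x : H1 p B D) (f t : gal -> B) (y : tens (homZ (l_Gq L) (fixed B Fr)) (l_Gq L))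
    (cj : H2 p (B_J L) D) (yb : tens (H2 p B D) (augquot (l_Dq L)))
    (T : l_Hn L -> R) (TD : forall g h, T (g + h) = T g + T h) :
  Z1 p B D I f -> Z1 p B D (D `&` galf (K_ray Y q)) t -> x = cls1 p D f + cls1 p D t ->
  tlift (fun h g => val (val h g)) y = Q_act L (Fr^-1)%g (f Fr) ->
  connecting (@J_to_ZD _ _ _ _ L) (@ZD_to_B _ _ _ _ L) x cj -> H2_tens yb = J_to_JJ2 cj ->
  tlift (fun c j => H2_to_R L c * augfun (T \o @l_inclDq _ _ _ _ L) j) yb =
  tlift (fun h g => v (infl_Gq h) * T (@l_inclGq _ _ _ _ L g)) y +
  v x * - ((\sum_(i < size (P_poly X Fr)) RR_to_R Y (P_poly X Fr)`_i * i%:R) *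
    T (@l_inclHnq _ _ _ _ L (l_resHnq L Fr))).
Proof.
move=> fZ tZ xE hy [z [zt [y0 [[zZ z_x] [ztc hz] [y0Z y0E] y0c]]]] hb.
have [k pk0] := RGam_torsion Y; have [M hM] := A_act_fixes n_N q_n.
have [fA [fA_surj fA_ker]] := Fr_coker n_N q_n L.
pose qs i := RR_to_R Y (l_Q L)`_i.
have [a0 [eta [cc [ccZ hcc etaN lE vE]]]] :=
  comparison_data (qs := qs) pk0 (decomp_at1 X q) decomp_atM inertia_decomp_at (Fr_decomp L) (D_ind n_N q_n (L := L))
  (A_act1 n_N q_n) (A_actM n_N q_n) (A_act_inertia n_N q_n) hM (Q_act_cob n_N q_n L)
  fA_surj fA_ker (l_theta_bij L) vP.
pose w := T \o @l_inclGq _ _ _ _ L; pose u s := T (@l_inclHnq _ _ _ _ L (l_resHnq L s)).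
have wD : forall g h, w (g + h) = w g + w h.
  by move=> g h; rewrite /w /= (inclGqD n_N q_n) TD.
have T0 : T 0 = 0 by apply: (addrI (T 0)); rewrite -TD !addr0.
have incl0 : @l_inclHnq _ _ _ _ L 0 = 0.
  by apply: (addrI (@l_inclHnq _ _ _ _ L 0)); rewrite -inclHnqD !addr0.
have u_hom : is_hom D u.
  split=> [s s' Ds Ds'|].
    by rewrite /u resHnqM ?inclHnqD ?TD //; exact: (D_E n_N q_n).
  have [M' hM'] := resHnq_fixes n_N q_n L; exists M' => h Dh Mh.
  by rewrite /u (hM' h Dh Mh) incl0 T0.
have uI i : I i -> u i = 0 by move=> Ii; rewrite /u (resHnq_inertia n_N q_n) // incl0 T0.
have resM := resGqM L.
have res_surj g : exists2 s, D s & l_resGq L s = g by have [_ h _] := l_resGqP L; exact: h.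
have JP s : (D `&` galf (K_ray Y q)) s <-> D s /\ l_resGq L s = 0.
  by have [_ _ h] := l_resGqP L; split=> -[Ds hs]; split=> //; apply/h.
have z_ft : cls1 p D z = cls1 p D f + cls1 p D t by rewrite z_x xE.
have ident := local_identity (s_prime X) (s_odd X) pk0 (decomp_at1 X q) decomp_atM decomp_atV inertia_decomp_at (Fr_decomp L)
  (D_ind n_N q_n (L := L)) (D_unr n_N q_n L) chi1 (A_act1 n_N q_n) (A_actM n_N q_n)
  (A_act_inertia n_N q_n) hM resM (resGq_fixes n_N q_n L) res_surj
  (resGq_inertia KK_E_n E_K1 n_N q_n L) (Gq_cyclic KK_E_n E_K1 n_N q_n L) JP wD u_hom uI
  zZ fZ tZ z_ft ccZ hcc vE hy.
apply/eqP; rewrite -subr_eq0; apply/eqP/etaN; rewrite mulrBr; apply/eqP; rewrite subr_eq0; apply/eqP.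
have T'D := comp_incl (inclDqD n_N q_n (L := L)) TD.
have Tl s : D s -> (T \o @l_inclDq _ _ _ _ L) (l_resDq L s) = w (l_resGq L s) + u s.
  move=> Ds; rewrite /comp l_inclDqP //.
  by have e := resHn_split n_N q_n L Ds; rewrite e TD.
have wu_hom : is_hom D (fun s => w (l_resGq L s) + u s).
  have [wM [M1 hM1]] := hom_res resM (resGq_fixes n_N q_n L) wD; have [uM [M2 hM2]] := u_hom.
  split=> [s s' Ds Ds'|]; first by rewrite wM // uM // addrACA.
  exists (M1 ++ M2) => h Dh /fixes_cat[Mh1 Mh2].
  by rewrite (hM1 h Dh Mh1) (hM2 h Dh Mh2) addr0.
have z_hom := ev_hom pk0 (decomp_at1 X q) decomp_atM decomp_atV inertia_decomp_at (Fr_decomp L) (D_ind n_N q_n (L := L)) chi1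
  (A_act1 n_N q_n) (A_actM n_N q_n) (A_act_inertia n_N q_n) hM a0 zZ.
have lZ := bihom_Z2 p decomp_atM chi1 (mul_bihom chi wu_hom z_hom).
apply: etrans (bockstein_identity chi1 AFr_fixed (l_inv L) lE T'D ztc hz y0Z y0E y0c hb Tl lZ) _.
rewrite -(Q_sum L) /tlift /teval xE; exact: ident.
Qed.
End Assembly.

Theorem theorem4p23 (X : setting) (Y : coefficients X) (r_T : nat)
  (r_T_gt0 : (1 <= r_T)%N)
  (YK_free : free_of_rank (YK X) r_T)
  (H1_free : forall F, Omega X F ->
     free_over (O_in_R X) (H1Sigma X (Tdual1 X) F (S_of X F)))
  (H0_zero : forall F, Omega X F -> H0Sigma X (Tdual1 X) F = [set 0])
  (KK_E_n : forall n, squarefree_N Y n -> E_n Y n `<=` s_KK X)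
  (E_K1 : K1 X `<=` c_E Y)
  (P_nonempty : primes_P Y !=set0)
  (n : set (set algC)) (n_N : squarefree_N Y n) (q : set algC) (q_n : n q)
  (L : local_data Y n q)
  (v : H1 (s_p X) (A_dual1 Y) (D_at X q) -> RGam Y) (vP : is_v_loc L v)
  (phi_fs : H1 (s_p X) (A_dual1 Y) (galf (s_K X)) -> tens (RGam Y)^o (l_Gq L))
  (phi_fsP : is_phi_fs v phi_fs)
  (phi : H1Sigma X (A_dual1 Y) (s_K X) (s_S X `|` n) ->
         tens (RGam Y)^o (augquot (l_Hn L)))
  (phiP : is_bockstein phi) :
  forall x : H1Sigma X (A_dual1 Y) (s_K X) (s_S X `|` n),
    phi x = rho_q (phi_fs (fibre_to_H1 x)) + mul_P_Fr L (v_q v (fibre_to_H1 x)).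
Proof.
move=> x; apply/eqP; rewrite -subr_eq0; apply/eqP/aug_tens_separated => T TD.
have bi := aug_pair_bi TD; rewrite (tlift_zmod bi); apply/eqP; rewrite subr_eq0; apply/eqP.
have [cj [yb [hc hb ->]]] := phiP x.
have [f [t [y [fZ tZ xE hy ->]]]] := phi_fsP (fibre_to_H1 x).
rewrite (bockstein_pair n_N q_n) // tlift_additive // P_Fr_pair // (rho_q_pair n_N q_n) //.
rewrite /tmapl tlift_map; last first.
  by split=> *; rewrite ?mulrDl // (inclGqD n_N q_n) TD mulrDr.
exact: (pairing_identity KK_E_n E_K1 n_N q_n vP TD fZ tZ xE hy hc hb).
Qed.
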